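(* Let $n\geq 1$, $m>0$ and $s>1/2$. Let $a\in C^\infty(\mathbb{R}^n)$ be real-valued, let $a_m\in C^\infty(\mathbb{R}^n\setminus\{0\})$ be real-valued and positively homogeneous of order $m$, i.e. $a_m(\lambda\xi)=\lambda^m a_m(\xi)$ for all $\lambda>0$, $\xi\neq0$, and assume: (1) $\nabla a(\xi)\neq0$ for all $\xi\in\mathbb{R}^n$, and $\nabla a_m(\xi)\neq 0$ for all $\xi\in\mathbb{R}^n\setminus\{0\}$; (2) for every multi-index $\alpha$ there is a constant $C_\alpha$ such that $|\partial^\alpha(a(\xi)-a_m(\xi))|\leq C_\alpha|\xi|^{m-1-|\alpha|}$ for all $|\xi|\geq1$. Then there is a constant $C>0$ such that, for all $f$ with $\langle x\rangle^{s}f\in L^2(\mathbb{R}_t\times\mathbb{R}^n_x)$, $$\left\|\langle x\rangle^{-s}\langle D_x\rangle^{m-1}\int_0^t e^{i(t-\tau)a(D_x)}f(\tau,x)\,d\tau\right\|_{L^2(\mathbb{R}_t\times\mathbb{R}^n_x)}\leq C\left\|\langle x\rangle^{s} f(t,x)\right\|_{L^2(\mathbb{R}_t\times\mathbb{R}^n_x)}.$$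
   Context: Notation: $\langle x\rangle=(1+|x|^2)^{1/2}$. For a function $b(\xi)$ on $\mathbb{R}^n$, $b(D_x)$ denotes the Fourier multiplier with symbol $b$, i.e. $\mathcal F_x[b(D_x)g](\xi)=b(\xi)\,\mathcal F_x g(\xi)$ where $\mathcal F_x$ is the Fourier transform in $x$; $D_{x_j}=-i\partial_{x_j}$. Thus $\langle D_x\rangle^{m-1}$ has symbol $(1+|\xi|^2)^{(m-1)/2}$ and $e^{ita(D_x)}$ has symbol $e^{ita(\xi)}$. The variable $t$ ranges over all of $\mathbb{R}$ (both signs). The function $u(t,x)=-i\int_0^t e^{i(t-\tau)a(D_x)}f(\tau,x)\,d\tau$ is the solution of $(i\partial_t+a(D_x))u=f$, $u(0,\cdot)=0$. The function $a_m$ is called the principal part of $a$. The constant $C$ may depend on $n,m,s,a$ but not on $f$. *)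

(* Defs.v *)
From HB Require Import structures.
From mathcomp Require Import all_boot all_order all_algebra.
From mathcomp Require Import all_classical all_reals all_analysis.
From mathcomp Require Import complex.

Set Implicit Arguments.
Unset Strict Implicit.
Unset Printing Implicit Defensive.

Import Order.TTheory GRing.Theory Num.Theory.
Import numFieldNormedType.Exports.

Local Open Scope classical_set_scope.
Local Open Scope ring_scope.

(* 'rV[R]_n carries the product sigma-algebra, generated by the coordinates,
    like the library's n.-tuple. *)
Section rV_measurable.
Context {R : realType} (n : nat).

Definition rV_coord (i : 'I_n) (x : 'rV[R]_n) : R := x ord0 i.

HB.instance Definition _ := @isMeasurable.Build
  (measure_tuple_display default_measure_display) 'rV[R]_n
  (g_sigma_preimage rV_coord)
  (@sigma_algebra0 _ setT _) (@sigma_algebraC _ _)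
  (@sigma_algebra_bigcup _ setT _).

Lemma measurable_rV_coord (i : 'I_n) : measurable_fun [set: 'rV[R]_n] (rV_coord i).
Proof.
move=> _ Y mY; rewrite setTI; apply: sub_sigma_algebra => /=.
rewrite -bigcup_seq/=; exists i => /=; first by rewrite mem_index_enum.
by exists Y => //; rewrite setTI.
Qed.

Lemma measurable_fun_rV d (T : measurableType d) (f : T -> 'rV[R]_n) :
  (forall i, measurable_fun [set: T] (rV_coord i \o f)) ->
  measurable_fun [set: T] f.
Proof.
move=> mf _ Y; rewrite setTI.
pose G := [set A | measurable (f @^-1` A)].
have sG : sigma_algebra [set: 'rV[R]_n] G.
  split; rewrite /G /=.
  - by rewrite preimage_set0.
  - by move=> A mA; rewrite setTD preimage_setC; exact: measurableC.
  - by move=> F mF; rewrite preimage_bigcup; exact: bigcupT_measurable.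
move=> /(_ G); apply; split => // A; rewrite -bigcup_seq/= => -[i _ [B mB <-]].
by rewrite /G /= setTI -[X in measurable X]setTI -comp_preimage; exact: mf.
Qed.

End rV_measurable.

Section lebesgue_rV.
Context {R : realType}.

Let R1 := measurableTypeR R.

Definition rV_cons n (p : R1 * 'rV[R]_n) : 'rV[R]_n.+1 :=
  (row_mx (const_mx p.1 : 'rV_1) p.2 : 'rV_(1 + n)).

Definition rV_uncons n (x : 'rV[R]_n.+1) : R1 * 'rV[R]_n :=
  (x ord0 ord0, \row_j x ord0 (lift ord0 j)).

Lemma rV_consK n : cancel (@rV_cons n) (@rV_uncons n).
Proof.
move=> [r x]; rewrite /rV_cons /rV_uncons /=; congr pair.
  have E : (ord0 : 'I_n.+1) = lshift n (ord0 : 'I_1) by exact: val_inj.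
  by rewrite [X in fun_of_matrix _ _ X]E (@row_mxEl _ 1 1 n) mxE.
apply/rowP => j; rewrite mxE.
have E : lift ord0 j = rshift 1 j by exact: val_inj.
by rewrite [X in fun_of_matrix _ _ X]E (@row_mxEr _ 1 1 n).
Qed.

Lemma measurable_rV_cons n : measurable_fun [set: R1 * 'rV[R]_n] (@rV_cons n).
Proof.
apply: measurable_fun_rV => i; case: (split_ordP (i : 'I_(1 + n))) => j ->.
  rewrite (_ : _ \o _ = (fun r : R1 => (r : R)) \o fst); last first.
    by apply/funext => p; rewrite /rV_coord /= (@row_mxEl _ 1 1 n) mxE.
  exact: (measurableT_comp (@measurable_id _ R1 setT)).
rewrite (_ : _ \o _ = rV_coord j \o snd); last first.
  by apply/funext => p; rewrite /rV_coord /= (@row_mxEr _ 1 1 n).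
exact: (measurableT_comp (measurable_rV_coord j)).
Qed.

Lemma measurable_rV_uncons n : measurable_fun [set: 'rV[R]_n.+1] (@rV_uncons n).
Proof.
apply: measurable_fun_pair; first exact: measurable_rV_coord.
apply: measurable_fun_rV => i.
rewrite (_ : _ \o _ = rV_coord (lift ord0 i)); last first.
  by apply/funext => p; rewrite /rV_coord /= mxE.
exact: measurable_rV_coord.
Qed.

Section step.
Local Open Scope ereal_scope.
Variables (n : nat) (mu : {sigma_finite_measure set 'rV[R]_n -> \bar R}).

Definition lebesgue_cons : set 'rV[R]_n.+1 -> \bar R :=
  pushforward (lebesgue_measure \x mu) (@rV_cons n).

Let cons0 : lebesgue_cons set0 = 0.
Proof. by rewrite /lebesgue_cons /pushforward preimage_set0 measure0. Qed.

Let cons_ge0 A : 0 <= lebesgue_cons A.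
Proof. exact: (measure_ge0 (lebesgue_measure \x mu)). Qed.

Let cons_sigma_additive : semi_sigma_additive lebesgue_cons.
Proof.
move=> F mF tF mUF; rewrite /lebesgue_cons /pushforward preimage_bigcup.
have mcons A : measurable A -> measurable (@rV_cons n @^-1` A).
  by move=> mA; rewrite -[X in measurable X]setTI; exact: measurable_rV_cons.
apply: measure_semi_sigma_additive.
- by move=> k; exact: mcons.
- apply/trivIsetP => /= i j _ _ ij; rewrite -preimage_setI.
  by move/trivIsetP : tF => /(_ _ _ _ _ ij) ->//; rewrite preimage_set0.
- by rewrite -preimage_bigcup; exact: mcons.
Qed.

HB.instance Definition _ := isMeasure.Build _ _ _ lebesgue_cons
  cons0 cons_ge0 cons_sigma_additive.

Let cons_sigma_finite : sigma_finite setT lebesgue_cons.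
Proof.
have /sigma_finiteP[F [TF ndF Foo]] := sigma_finiteT (@lebesgue_measure R).
have /sigma_finiteP[G [TG ndG Goo]] := sigma_finiteT mu.
exists (fun k => @rV_uncons n @^-1` (F k `*` G k)).
  rewrite -preimage_bigcup -[LHS](preimage_setT (@rV_uncons n)); congr preimage.
  rewrite -setXTT TF TG predeqE => -[x y]; split; last first.
    by move=> [k _ []/= ? ?]; split; exists k.
  move=> [/= [k _ Fkx] [l _ Gly]]; exists (maxn k l) => //; split.
  - by move: x Fkx; exact/subsetPset/ndF/leq_maxl.
  - by move: y Gly; exact/subsetPset/ndG/leq_maxr.
move=> k; have [mF Fk] := Foo k; have [mG Gk] := Goo k; split.
  by rewrite -[X in measurable X]setTI; apply: measurable_rV_uncons => //;
    exact: measurableX.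
rewrite /lebesgue_cons /pushforward -comp_preimage.
rewrite (_ : _ \o _ = id); last by apply/funext => p; exact: rV_consK.
by rewrite preimage_id product_measure1E// lte_mul_pinfty// ge0_fin_numE.
Qed.

HB.instance Definition _ := Measure_isSigmaFinite.Build _ _ _ lebesgue_cons
  cons_sigma_finite.

End step.

Fixpoint lebesgue_rV n : {sigma_finite_measure set 'rV[R]_n -> \bar R} :=
  match n with
  | 0 => \d_(0 : 'rV[R]_0)
  | n'.+1 => lebesgue_cons (lebesgue_rV n')
  end.

Lemma lebesgue_rV_box n (A : 'I_n -> set R) : (forall i, measurable (A i)) ->
  lebesgue_rV n [set x | forall i, A i (x ord0 i)] =
  (\prod_(i < n) lebesgue_measure (A i : set (measurableTypeR R)))%E.
Proof.
elim: n A => [|n IH] A mA /=.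
  rewrite big_ord0 diracE mem_set//=.
  by case.
rewrite big_ord_recl -(IH (fun i => A (lift ord0 i)))// -product_measure1E//.
- rewrite /lebesgue_cons /pushforward; congr product_measure1.
  apply/seteqP; split => -[r x] /=.
    move=> Ax; split.
      by have := Ax ord0; have := congr1 fst (rV_consK (r, x)) => /= ->.
    move=> i; have := Ax (lift ord0 i).
    by have /rowP/(_ i) := congr1 snd (rV_consK (r, x)); rewrite /= mxE => ->.
  move=> [Ar Ax] i; case: (unliftP ord0 i) => [j|] ->.
    by have /rowP/(_ j) := congr1 snd (rV_consK (r, x)); rewrite /= mxE => ->.
  by have := congr1 fst (rV_consK (r, x)) => /= ->.
- exact: mA.
- set B := (X in measurable X).
  have -> : B = \bigcap_(i in [set: 'I_n]) (rV_coord i @^-1` A (lift ord0 i)).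
    by apply/seteqP; split => x Bx i => [_|]; exact: Bx.
  apply: fin_bigcap_measurable => // i _.
  by rewrite -[X in measurable X]setTI; exact: measurable_rV_coord.
Qed.

End lebesgue_rV.

Section calculus.
Context {R : realType} {n : nat}.
Implicit Types (x y : 'rV[R]_n) (f : 'rV[R]_n -> R).

Definition dotp x y : R := \sum_(j < n) x ord0 j * y ord0 j.

(* The library's `|x| on 'rV[R]_n is the sup norm. *)
Definition enorm x : R := Num.sqrt (dotp x x).

Definition japanese x : R := Num.sqrt (1 + enorm x ^+ 2).

Definition evec (j : 'I_n) : 'rV[R]_n := delta_mx ord0 j.

Definition gradient f x : 'rV[R]_n := \row_j 'D_(evec j) f x.

Definition pderivs (l : seq 'I_n) f : 'rV[R]_n -> R :=
  foldr (fun j g => 'D_(evec j) g) f l.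

Definition smooth_on (U : set 'rV[R]_n) f : Prop :=
  forall (l : seq 'I_n) x, U x ->
    {for x, continuous (pderivs l f)} /\
    forall j, derivable (pderivs l f) x (evec j).

Definition multi_index := {ffun 'I_n -> nat}.

Definition mi_size (al : multi_index) : nat := (\sum_(j < n) al j)%N.

Definition mi_deriv (al : multi_index) f : 'rV[R]_n -> R :=
  pderivs (flatten [seq nseq (al j) j | j <- enum 'I_n]) f.

Definition monomial (al : multi_index) x : R := \prod_(j < n) x ord0 j ^+ al j.

Definition rschwartz f : Prop :=
  smooth_on setT f /\
  forall al be : multi_index, exists M : R,
    forall x, `|monomial al x * mi_deriv be f x| <= M.

Definition schwartz (phi : 'rV[R]_n -> R[i]) : Prop :=
  rschwartz (fun x => complex.Re (phi x)) /\
  rschwartz (fun x => complex.Im (phi x)).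

End calculus.

Section complex_integration.
Context {R : realType}.
Local Open Scope complex_scope.

Definition cintegral d (T : measurableType d) (mu : {measure set T -> \bar R})
    (D : set T) (F : T -> R[i]) : R[i] :=
  (\int[mu]_(x in D) complex.Re (F x)) +i* (\int[mu]_(x in D) complex.Im (F x)).

Definition cintegral0 (t : R) (F : R -> R[i]) : R[i] :=
  if 0 <= t then cintegral lebesgue_measure `[0, t] F
  else - cintegral lebesgue_measure `[t, 0] F.

Definition L2norm d (T : measurableType d) (mu : {measure set T -> \bar R})
    (F : T -> R[i]) : \bar R :=
  ('N[mu]_2%:E [(fun x => (Normc.normc (F x))%:E)])%E.

Definition in_L2 d (T : measurableType d) (mu : {measure set T -> \bar R})
    (F : T -> R[i]) : Prop :=
  [/\ measurable_fun setT (fun x => complex.Re (F x)),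
      measurable_fun setT (fun x => complex.Im (F x)) &
      (L2norm mu F < +oo)%E].

Definition expi (theta : R) : R[i] := cos theta +i* sin theta.

End complex_integration.

Section distributions.
Context {R : realType} {n : nat}.
Local Open Scope complex_scope.
Local Notation Rn := 'rV[R]_n.

(* With this convention -i d/dx_j has symbol xi_j. *)
Definition fourier (phi : Rn -> R[i]) (xi : Rn) : R[i] :=
  cintegral (lebesgue_rV n) setT (fun x => expi (- dotp x xi) * phi x).

Definition inv_fourier (phi : Rn -> R[i]) (x : Rn) : R[i] :=
  (((2 * pi) ^- n)%:C : R[i]) *
  cintegral (lebesgue_rV n) setT (fun xi => expi (dotp x xi) * phi xi).

(* A tempered distribution is given by its values on Schwartz functions; its
   values on other functions are irrelevant, see dist_eq. *)
Definition tdist := (Rn -> R[i]) -> R[i].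

Definition dist_eq (S T : tdist) : Prop := forall phi, schwartz phi -> S phi = T phi.

Definition dist_of_fun (g : Rn -> R[i]) : tdist :=
  fun phi => cintegral (lebesgue_rV n) setT (fun x => g x * phi x).

Definition dist_fourier (T : tdist) : tdist := fun phi => T (fourier phi).

Definition dist_inv_fourier (T : tdist) : tdist := fun phi => T (inv_fourier phi).

Definition dist_mul (b : Rn -> R[i]) (T : tdist) : tdist :=
  fun phi => T (fun xi => b xi * phi xi).

(* The distribution b(D_x) T, whose Fourier transform is b times that of T. *)
Definition multiplier (b : Rn -> R[i]) (T : tdist) : tdist :=
  dist_inv_fourier (dist_mul b (dist_fourier T)).

Definition dist_integral0 (t : R) (T : R -> tdist) : tdist :=
  fun phi => cintegral0 t (fun tau => T tau phi).

(* The integral over tau from 0 to t of e^{i(t-tau)a(D_x)} f(tau, .), taken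
   weakly: in L^2(R^n) it coincides with the Bochner integral. *)
Definition duhamel (a : Rn -> R) (f : R * Rn -> R[i]) (t : R) : tdist :=
  dist_integral0 t (fun tau =>
    multiplier (fun xi => expi ((t - tau) * a xi))
      (dist_of_fun (fun x => f (tau, x)))).

Definition bessel (r : R) (T : tdist) : tdist :=
  multiplier (fun xi => (japanese xi `^ r)%:C) T.

Definition weight (r : R) (F : R * Rn -> R[i]) : R * Rn -> R[i] :=
  fun z => (japanese z.2 `^ r)%:C * F z.

Definition spacetime_measure : {measure set (measurableTypeR R * Rn) -> \bar R} :=
  (lebesgue_measure \x lebesgue_rV n)%E.

End distributions.

(* Main.v *)
(* Split frequency space into pieces on which some |d_j a| is comparable to <xi>^(m-1).
   On such a piece, taking d_j a as new density on the lines parallel to e_j turns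
   exp(i t a) into a translation group, and Plancherel in t bounds the bilinear form of
   <D>^(m-1) exp(i (t - tau) a) by one-dimensional norms in x_j that are controlled by
   <x>^s because s > 1/2. The variable coefficients cost only Lipschitz commutators, and
   the whole estimate is run on the Fourier side with the explicit pair
   (1 + e|X|) exp(-e|X|) <-> 4 e^3 / (e^2 + r^2)^2.
   Duality bounds the solutions for truncated data uniformly. A weak limit of them is
   obtained as the strong limit of near-minimal elements of decreasing convex sets. *)
Require Import Defs.
From HB Require Import structures.
From mathcomp Require Import all_boot all_order all_algebra.
From mathcomp Require Import all_classical all_reals all_analysis.
From mathcomp Require Import measurable_realfun complex ring lra.

Set Implicit Arguments.
Unset Strict Implicit.
Unset Printing Implicit Defensive.

Import Order.TTheory GRing.Theory Num.Theory.
Import numFieldNormedType.Exports.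

Local Open Scope classical_set_scope.
Local Open Scope ring_scope.

(** On a line a function is measured by its energies at the dyadic scales [e_ i], with weights
    [rho ^+ i]. Three constraints fix [rho]: [2 < rho] makes the dual weight [om] integrable, which
    pays for the integral over translations; [rho < 4] makes the norm stable under Lipschitz
    multipliers, so that the cutoffs and the factor 1 / |q| can be moved onto the data;
    [rho * theta < 1] lets the spatial weight control the norm. The kernel pair is chosen
    accordingly: its Fourier image decays like r^-4, so that its second moment is finite, unlike
    that of the Poisson kernel. The image is also positive, so that Bessel's inequality and an
    inequality form of Parseval's identity follow, for any phase, from a single use of Fubini's
    theorem. The symbol bounds give mixed second derivatives only with indices in increasing order,
    and the frequency cutoffs are arranged so that only these occur. Finally <xi>^(m-1) varies by
    unbounded factors, so the localization to short intervals is a continuous average over their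
    centres, and the value of the weight at the centre becomes the speed of translation. *)

Notation normc := Normc.normc.
Notation cRe := complex.Re.
Notation cIm := complex.Im.
Notation measT := (measurable_fun setT).
Notation mcomp := measurableT_comp.
Notation mEFin := measurable_EFinP.
Notation mfunM := measurable_funM.
Notation mfunB := measurable_funB.
Notation mfunD := measurable_funD.
Notation mfst := measurable_fst.
Notation msnd := measurable_snd.
Notation mpair := measurable_fun_pair.
Notation mpair1 := measurable_pair1.
Notation mpair2 := measurable_pair2.
Notation contm := continuous_measurable_fun.
Notation eqint := eq_integral.
Notation intg_ge0 := integral_ge0.
Notation mfuneM := measurable_funeM.
Notation mindic := measurable_indic.
Notation mfunX := measurable_funX.
Notation mcst := measurable_cst.
Notation mcoord := measurable_rV_coord.

(** * Complex numbers through the squared modulus *)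

Section sqn.
Context {R : realType}.
Implicit Types z w : R[i].
Local Open Scope complex_scope.

Definition sqn z : R := cRe z ^+ 2 + cIm z ^+ 2.

Lemma sqn_ge0 z : 0 <= sqn z.
Proof. by rewrite addr_ge0 ?sqr_ge0. Qed.

Lemma normc_sqrt z : normc z = Num.sqrt (sqn z).
Proof. by case: z. Qed.

Lemma nc_ge0 z : 0 <= normc z.
Proof. by rewrite normc_sqrt sqrtr_ge0. Qed.

Lemma normc_sqrE z : normc z ^+ 2 = sqn z.
Proof. by rewrite normc_sqrt sqr_sqrtr ?sqn_ge0. Qed.

Lemma sqnM z w : sqn (z * w) = sqn z * sqn w.
Proof. by case: z => a b; case: w => c d; rewrite /sqn /=; ring. Qed.

Lemma sqn0 : sqn 0 = 0.
Proof. by rewrite /sqn /= expr0n addr0. Qed.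

Lemma sqnN z : sqn (- z) = sqn z.
Proof. by case: z => a b; rewrite /sqn /=; ring. Qed.

Lemma sqn_conj z : sqn (conjc z) = sqn z.
Proof. by case: z => a b; rewrite /sqn /=; ring. Qed.

Lemma normc_conj z : normc (conjc z) = normc z.
Proof. by rewrite !normc_sqrt sqn_conj. Qed.

Lemma sqn_real (x : R) : sqn x%:C = x ^+ 2.
Proof. by rewrite /sqn /= expr0n addr0. Qed.

Lemma normc_real (x : R) : normc x%:C = `|x|.
Proof. by rewrite normc_sqrt sqn_real sqrtr_sqr. Qed.

Lemma sqnD_le z w : sqn (z + w) <= 2 * sqn z + 2 * sqn w.
Proof.
case: z => a b; case: w => c d; rewrite /sqn /=.
by have := sqr_ge0 (a - c); have := sqr_ge0 (b - d); nra.
Qed.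

Lemma sqnB_le z w : sqn (z - w) <= 2 * sqn z + 2 * sqn w.
Proof. by rewrite -(sqnN w); exact: sqnD_le. Qed.

Lemma mulc_conj z : z * (conjc z) = (sqn z)%:C.
Proof. by case: z => a b; rewrite /sqn; simpc; congr (_ +i* _); ring. Qed.

Lemma normcM_le z w : normc (z * w) <= 2^-1 * (sqn z + sqn w).
Proof.
rewrite Normc.normcM -!normc_sqrE.
by have := sqr_ge0 (normc z - normc w); nra.
Qed.

Lemma sqn_expi (x : R) : sqn (expi x) = 1.
Proof. by rewrite /sqn /= cos2Dsin2. Qed.

Lemma normc_expi (x : R) : normc (expi x) = 1.
Proof. by rewrite normc_sqrt sqn_expi sqrtr1. Qed.

Lemma expiD (x y : R) : expi (x + y) = expi x * expi y.
Proof. by rewrite /expi sinD cosD; simpc; congr (_ +i* _); ring. Qed.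

Lemma expi0 : expi (0 : R) = 1.
Proof. by rewrite /expi cos0 sin0. Qed.

Lemma conj_expi (x : R) : (conjc (expi x)) = expi (- x).
Proof. by rewrite /expi cosN sinN. Qed.

Lemma conjcM z w : conjc (z * w) = conjc z * conjc w.
Proof. exact: rmorphM. Qed.

Lemma conjcB z w : conjc (z - w) = conjc z - conjc w.
Proof. exact: rmorphB. Qed.

Lemma creM (x y : R) : (x * y)%:C = x%:C * y%:C.
Proof. exact: rmorphM. Qed.

Lemma creD (x y : R) : (x + y)%:C = x%:C + y%:C.
Proof. exact: rmorphD. Qed.

Lemma creB (x y : R) : (x - y)%:C = x%:C - y%:C.
Proof. exact: rmorphB. Qed.

Lemma normRe z : `|cRe z| <= normc z.
Proof.
by rewrite normc_sqrt -sqrtr_sqr ler_sqrt ?sqn_ge0// /sqn lerDl sqr_ge0.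
Qed.

Lemma normIm z : `|cIm z| <= normc z.
Proof.
by rewrite normc_sqrt -sqrtr_sqr ler_sqrt ?sqn_ge0// /sqn lerDr sqr_ge0.
Qed.

Lemma normc_ReIm z : normc z <= `|cRe z| + `|cIm z|.
Proof.
rewrite normc_sqrt -[leRHS]ger0_norm ?addr_ge0// -sqrtr_sqr.
rewrite ler_sqrt ?sqr_ge0// /sqn -[_ ^+ 2]real_normK ?num_real//.
rewrite -[cIm z ^+ 2]real_normK ?num_real//.
by have := normr_ge0 (cRe z); have := normr_ge0 (cIm z); nra.
Qed.

Lemma cReM z w : cRe (z * w) =
  cRe z * cRe w - cIm z * cIm w.
Proof. by case: z => a b; case: w => c d. Qed.

Lemma cImM z w : cIm (z * w) =
  cRe z * cIm w + cIm z * cRe w.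
Proof. by case: z => a b; case: w => c d. Qed.

Lemma cReD z w : cRe (z + w) = cRe z + cRe w.
Proof. by case: z => a b; case: w => c d. Qed.

Lemma cImD z w : cIm (z + w) = cIm z + cIm w.
Proof. by case: z => a b; case: w => c d. Qed.

Lemma cReN z : cRe (- z) = - cRe z.
Proof. by case: z. Qed.

Lemma cImN z : cIm (- z) = - cIm z.
Proof. by case: z. Qed.

Lemma cReJ z : cRe ((conjc z)) = cRe z.
Proof. by case: z. Qed.

Lemma cImJ z : cIm ((conjc z)) = - cIm z.
Proof. by case: z. Qed.

Lemma normc_rot z : exists2 w, normc w = 1 & w * z = (normc z)%:C.
Proof.
have [->|z0] := eqVneq z 0.
  by exists 1; rewrite ?Normc.normc1 // mulr0 Normc.normc0.
have nz : normc z != 0 by apply: contra_neq z0 => /Normc.eq0_normc.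
exists ((conjc z) / (normc z)%:C).
  by rewrite Normc.normcM Normc.normcV normc_conj normc_real ger0_norm ?nc_ge0// mulfV.
rewrite mulrAC mulrC [(conjc z) * z]mulrC mulc_conj -normc_sqrE.
by rewrite -fmorphV -rmorphM expr2 mulrA mulVf// mul1r.
Qed.

End sqn.

(** * Complex-valued integrals and Fubini's theorem *)

Section cint.
Context {R : realType}.
Local Open Scope complex_scope.

Definition cmeas d (T : measurableType d) (F : T -> R[i]) :=
  measT (fun x => cRe (F x)) /\
  measT (fun x => cIm (F x)).

Definition cint d (T : measurableType d) (mu : {measure set T -> \bar R})
  (F : T -> R[i]) := cintegral mu setT F.

Definition cintg d (T : measurableType d) (mu : {measure set T -> \bar R})
  (F : T -> R[i]) :=
  mu.-integrable setT (EFin \o (fun x => cRe (F x))) /\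
  mu.-integrable setT (EFin \o (fun x => cIm (F x))).

Section one.
Context d (T : measurableType d) (mu : {measure set T -> \bar R}).
Implicit Types F G : T -> R[i].

Lemma cmeasD F G : cmeas F -> cmeas G -> cmeas (fun x => F x + G x).
Proof.
move=> [F1 F2] [G1 G2]; split.
- under eq_fun do rewrite cReD; exact: mfunD.
- under eq_fun do rewrite cImD; exact: mfunD.
Qed.

Lemma cmeasN F : cmeas F -> cmeas (fun x => - F x).
Proof.
move=> [F1 F2]; split.
- under eq_fun do rewrite cReN; exact: mcomp.
- under eq_fun do rewrite cImN; exact: mcomp.
Qed.

Lemma cmeasB F G : cmeas F -> cmeas G -> cmeas (fun x => F x - G x).
Proof. by move=> mF mG; apply: cmeasD => //; exact: cmeasN. Qed.

Lemma cmeasM F G : cmeas F -> cmeas G -> cmeas (fun x => F x * G x).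
Proof.
move=> [F1 F2] [G1 G2]; split.
- under eq_fun do rewrite cReM; apply: mfunB; exact: mfunM.
- under eq_fun do rewrite cImM; apply: mfunD; exact: mfunM.
Qed.

Lemma cmeas_conj F : cmeas F -> cmeas (fun x => (conjc (F x))).
Proof.
move=> [F1 F2]; split.
- by under eq_fun do rewrite cReJ.
- under eq_fun do rewrite cImJ; exact: mcomp.
Qed.

Lemma cmeas_cst (z : R[i]) : cmeas (fun _ : T => z).
Proof. by split; exact: mcst. Qed.

Lemma cmeas_real (f : T -> R) : measT f -> cmeas (fun x => (f x)%:C).
Proof. by move=> mf; split => //=; exact: mcst. Qed.

Lemma cmeas_expi (f : T -> R) :
  measT f -> cmeas (fun x => expi (f x)).
Proof.
move=> mf; split => /=.
- by apply: mcomp mf; apply: contm; exact: continuous_cos.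
- by apply: mcomp mf; apply: contm; exact: continuous_sin.
Qed.

Lemma msqn F : cmeas F -> measT (fun x => sqn (F x)).
Proof.
by move=> [F1 F2]; apply: mfunD; apply: mfunX.
Qed.

Lemma mnormc F :
  cmeas F -> measT (fun x => normc (F x)).
Proof.
move=> mF; under eq_fun do rewrite normc_sqrt.
apply: (mcomp (f := @Num.sqrt R)); last exact: msqn.
by apply: contm; exact: sqrt_continuous.
Qed.

Lemma cintg_meas F : cintg mu F -> cmeas F.
Proof.
by move=> [/measurable_int/mEFin F1 /measurable_int/mEFin F2]; split.
Qed.

Lemma cintgP F : cintg mu F <->
  cmeas F /\ (\int[mu]_x (normc (F x))%:E < +oo)%E.
Proof.
split=> [iF|[mF FF]].
  have mF := cintg_meas iF; split => //.
  have [/integrableP[m1 F1] /integrableP[m2 F2]] := iF.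
  apply: (@le_lt_trans _ _ (\int[mu]_x ((`|cRe (F x)|)%:E
     + (`|cIm (F x)|)%:E))%E).
    apply: ge0_le_integral => //.
    - by move=> x _; rewrite lee_fin nc_ge0.
    - by apply/mEFin; exact: mnormc.
    - by apply: emeasurable_funD; apply: mcomp => //=;
        apply: mcomp => //; case: mF.
    - by move=> x _; rewrite -EFinD lee_fin normc_ReIm.
  rewrite ge0_integralD//=.
  - by rewrite lte_add_pinfty.
  - by apply: mcomp => //=; apply: mcomp => //; case: mF.
  - by apply: mcomp => //=; apply: mcomp => //; case: mF.
have I : mu.-integrable setT (EFin \o (fun x => normc (F x))).
  apply/integrableP; split; first by apply/mEFin; exact: mnormc.
  by under eqint do rewrite /= ger0_norm ?nc_ge0//.
split; apply: le_integrable I => //.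
- by apply/mEFin; case: mF.
- by move=> x _ /=; rewrite lee_fin [leRHS]ger0_norm ?nc_ge0 ?normRe.
- by apply/mEFin; case: mF.
- by move=> x _ /=; rewrite lee_fin [leRHS]ger0_norm ?nc_ge0 ?normIm.
Qed.

Lemma le_cintg F (G : T -> R) : cmeas F ->
  mu.-integrable setT (EFin \o G) ->
  (forall x, normc (F x) <= G x) -> cintg mu F.
Proof.
move=> mF iG FG; apply/cintgP; split=> //.
have /integrableP[mG] := iG; apply: le_lt_trans.
apply: ge0_le_integral => //=.
- by move=> x _; rewrite lee_fin nc_ge0.
- by apply/mEFin; exact: mnormc.
- by apply/mEFin; apply: mcomp => //; exact/mEFin.
- by move=> x _; rewrite lee_fin (le_trans (FG x))// ler_norm.
Qed.

Lemma cintg_normc F : cintg mu F ->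
  mu.-integrable setT (EFin \o (fun x => normc (F x))).
Proof.
move=> /cintgP[mF FF]; apply/integrableP; split.
  by apply/mEFin; exact: mnormc.
by under eqint do rewrite /= ger0_norm ?nc_ge0//.
Qed.

Lemma le_cintg2 F G : cmeas F -> cintg mu G ->
  (forall x, normc (F x) <= normc (G x)) -> cintg mu F.
Proof. by move=> mF /cintg_normc iG; exact: le_cintg. Qed.

Lemma cintgD F G :
  cintg mu F -> cintg mu G -> cintg mu (fun x => F x + G x).
Proof.
move=> [F1 F2] [G1 G2]; split.
- under eq_fun do rewrite cReD; exact: (integrableD measurableT F1 G1).
- under eq_fun do rewrite cImD; exact: (integrableD measurableT F2 G2).
Qed.

Lemma cintgM (h : T -> R[i]) F (C : R) : cmeas h ->
  (forall x, normc (h x) <= C) -> cintg mu F ->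
  cintg mu (fun x => h x * F x).
Proof.
move=> mh hC iF; have /cintgP[mF FF] := iF.
have C0 : 0 <= `|C| by [].
apply/cintgP; split; first exact: cmeasM.
apply: (@le_lt_trans _ _ (\int[mu]_x (`|C|%:E * (normc (F x))%:E))%E).
  apply: ge0_le_integral => //.
  - by move=> x _; rewrite lee_fin nc_ge0.
  - by apply/mEFin; apply: mnormc; exact: cmeasM.
  - by apply: mfuneM; apply/mEFin; exact: mnormc.
  - move=> x _; rewrite -EFinM lee_fin Normc.normcM ler_wpM2r ?nc_ge0//.
    by rewrite (le_trans (hC x))// ler_norm.
rewrite ge0_integralZl//.
- by rewrite lte_mul_pinfty// ?lee_fin.
- by apply/mEFin; exact: mnormc.
- by move=> x _; rewrite lee_fin nc_ge0.
Qed.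

Lemma cintgZl z F : cintg mu F -> cintg mu (fun x => z * F x).
Proof.
by apply: (@cintgM (fun=> z) _ (normc z)) => //; exact: cmeas_cst.
Qed.

Lemma cintgN F : cintg mu F -> cintg mu (fun x => - F x).
Proof. by move=> /(cintgZl (-1)); under eq_fun do rewrite mulN1r. Qed.

Lemma cintgB F G :
  cintg mu F -> cintg mu G -> cintg mu (fun x => F x - G x).
Proof. by move=> iF iG; apply: cintgD => //; exact: cintgN. Qed.

Lemma cintg_conj F : cintg mu F -> cintg mu (fun x => (conjc (F x))).
Proof.
move=> iF; apply: (le_cintg2 _ iF).
  by apply: cmeas_conj; exact: cintg_meas iF.
by move=> x; rewrite normc_conj.
Qed.

Lemma cintg_real (f : T -> R) :
  mu.-integrable setT (EFin \o f) -> cintg mu (fun x => (f x)%:C).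
Proof. by move=> If; split => //; exact: integrable0. Qed.

Lemma eq_cint F G : F =1 G -> cint mu F = cint mu G.
Proof. by move=> /funext ->. Qed.

Lemma cintD F G : cintg mu F -> cintg mu G ->
  cint mu (fun x => F x + G x) = cint mu F + cint mu G.
Proof.
move=> [F1 F2] [G1 G2]; rewrite /cint /cintegral; simpc; congr (_ +i* _).
- by under eq_Rintegral do rewrite cReD; rewrite RintegralD.
- by under eq_Rintegral do rewrite cImD; rewrite RintegralD.
Qed.

Lemma cintZl z F : cintg mu F ->
  cint mu (fun x => z * F x) = z * cint mu F.
Proof.
move=> [F1 F2]; case: z => a b; rewrite /cint /cintegral; simpc; congr (_ +i* _).
- under eq_Rintegral do rewrite cReM/=; rewrite RintegralB ?RintegralZl//.
  + exact: (integrableZl _ a F1).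
  + exact: (integrableZl _ b F2).
- under eq_Rintegral do rewrite cImM/=; rewrite RintegralD ?RintegralZl//.
  + exact: (integrableZl _ a F2).
  + exact: (integrableZl _ b F1).
Qed.

Lemma cintZr z F : cintg mu F ->
  cint mu (fun x => F x * z) = cint mu F * z.
Proof. by move=> iF; rewrite mulrC -cintZl//; apply: eq_cint => x; rewrite mulrC. Qed.

Lemma cintN F : cintg mu F -> cint mu (fun x => - F x) = - cint mu F.
Proof. by move=> iF; rewrite -mulN1r -cintZl//; apply: eq_cint => x; rewrite mulN1r. Qed.

Lemma cintB F G : cintg mu F -> cintg mu G ->
  cint mu (fun x => F x - G x) = cint mu F - cint mu G.
Proof. by move=> iF iG; rewrite cintD ?cintN//; exact: cintgN. Qed.

Lemma cint_conj F : cintg mu F -> cint mu (fun x => (conjc (F x))) = (conjc (cint mu F)).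
Proof.
move=> [F1 F2]; rewrite /cint /cintegral; simpc; congr (_ +i* _).
- by under eq_Rintegral do rewrite cReJ.
- under eq_Rintegral do rewrite cImJ -mulN1r; rewrite RintegralZl// ?mulN1r//.
Qed.

Lemma cint_real (f : T -> R) : cint mu (fun x => (f x)%:C) = (\int[mu]_x f x)%:C.
Proof. by rewrite /cint /cintegral /= Rintegral_cst// mul0r. Qed.

Lemma Re_cint F : cRe (cint mu F) = (\int[mu]_x cRe (F x))%R.
Proof. by []. Qed.

Lemma cint0 : cint mu (fun=> 0) = 0.
Proof. by rewrite (cint_real (fun=> 0)) Rintegral_cst// mul0r. Qed.

(** Rotating the integral onto the positive half-line makes its modulus the integral of a real part,
    to which the real inequality applies. *)
Lemma le_normc_cint F : cintg mu F ->
  ((normc (cint mu F))%:E <= \int[mu]_x (normc (F x))%:E)%E.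
Proof.
move=> iF; have [w w1 wz] := normc_rot (cint mu F).
have iwF := cintgZl w iF.
have := congr1 (@cRe R) wz; rewrite -cintZl// Re_cint /= => <-.
have [[wF1 _] [F1 _]] := (iwF, iF).
rewrite /Rintegral fineK; last exact: integrable_fin_num.
apply: (le_trans (lee_abs _)); apply: le_trans (le_abse_integral _ _ _) _ => //.
  by apply: measurable_int wF1.
apply: ge0_le_integral => //.
- by apply: mcomp => //; apply: measurable_int wF1.
- by apply/mEFin; apply: mnormc; exact: cintg_meas iF.
- move=> x _ /=; rewrite lee_fin; apply: (le_trans (normRe _)).
  by rewrite Normc.normcM w1 mul1r.
Qed.

End one.

Lemma cmeas_comp d1 d2 (T1 : measurableType d1) (T2 : measurableType d2)
  (F : T2 -> R[i]) (g : T1 -> T2) : cmeas F -> measT g ->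
  cmeas (fun x => F (g x)).
Proof.
by move=> [F1 F2] mg; split; [exact: (mcomp F1 mg)|exact: (mcomp F2 mg)].
Qed.

Section two.
Context d1 d2 (T1 : measurableType d1) (T2 : measurableType d2).
Variables (m1 : {sigma_finite_measure set T1 -> \bar R}).
Variables (m2 : {sigma_finite_measure set T2 -> \bar R}).

Lemma meas_Rintegral_param (F : T1 * T2 -> R) : measT F ->
  measT (fun x => \int[m2]_y F (x, y)).
Proof.
move=> mF; apply: (mcomp (fine_measurable measurableT)).
have mEF : measT (EFin \o F) by exact/mEFin.
rewrite (_ : (fun x => _) = (fubini_F m2 (EFin \o F)^\+ \- fubini_F m2 (EFin \o F)^\-)%E).
  by apply: emeasurable_funB; apply: measurable_fun_fubini_tonelli_F => //;
    [exact: measurable_funepos|exact: measurable_funeneg].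
apply/funext => x; rewrite integralE /=; congr (_ - _)%E; apply: eqint => y _.
all: by rewrite ?funeposE ?funenegE.
Qed.

Lemma cmeas_cint (F : T1 * T2 -> R[i]) : cmeas F ->
  cmeas (fun x => cint m2 (fun y => F (x, y))).
Proof. by move=> [F1 F2]; split; [exact: (meas_Rintegral_param F1)|exact: (meas_Rintegral_param F2)]. Qed.

Lemma cintg_tonelli (F : T1 * T2 -> R[i]) : cmeas F ->
  (\int[m1]_x \int[m2]_y (normc (F (x, y)))%:E < +oo)%E ->
  cintg (m1 \x m2)%E F.
Proof.
move=> mF FF; apply/cintgP; split => //.
rewrite fubini_tonelli1//; first by apply/mEFin; exact: mnormc.
by move=> x; rewrite lee_fin nc_ge0.
Qed.

(** On the slices that are not integrable the inner [Rintegral] may be a default value of [fine];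
    these slices form a null set, so the outer integral does not see them. *)
Lemma Rint_prod1 (F : T1 * T2 -> R) : (m1 \x m2)%E.-integrable setT (EFin \o F) ->
  \int[(m1 \x m2)%E]_z F z = \int[m1]_x \int[m2]_y F (x, y).
Proof.
move=> iF; rewrite /Rintegral; congr fine.
rewrite -(integral12_prod_meas1 iF); apply: ae_eq_integral => //.
- exact: (measurable_fubini_F iF).
- apply/mEFin; apply: meas_Rintegral_param.
  by apply/mEFin; exact: measurable_int iF.
- have := ae_integrable1 iF; apply: filterS => x ix _.
  by rewrite /= fineK//; apply: integrable_fin_num.
Qed.

Lemma Rint_prod2 (F : T1 * T2 -> R) : (m1 \x m2)%E.-integrable setT (EFin \o F) ->
  \int[(m1 \x m2)%E]_z F z = \int[m2]_y \int[m1]_x F (x, y).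
Proof.
move=> iF; rewrite /Rintegral; congr fine.
rewrite -(integral21_prod_meas1 iF); apply: ae_eq_integral => //.
- exact: (measurable_fubini_G iF).
- apply/mEFin.
  exact: (mcomp (fine_measurable measurableT) (measurable_fubini_G iF)).
- have := ae_integrable2 iF; apply: filterS => x ix _.
  by rewrite /= fineK//; apply: integrable_fin_num.
Qed.

Lemma cint_prod1 (F : T1 * T2 -> R[i]) : cintg (m1 \x m2)%E F ->
  cint (m1 \x m2)%E F = cint m1 (fun x => cint m2 (fun y => F (x, y))).
Proof. by move=> [F1 F2]; rewrite /cint /cintegral /= !Rint_prod1. Qed.

Lemma cint_prod2 (F : T1 * T2 -> R[i]) : cintg (m1 \x m2)%E F ->
  cint (m1 \x m2)%E F = cint m2 (fun y => cint m1 (fun x => F (x, y))).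
Proof. by move=> [F1 F2]; rewrite /cint /cintegral /= !Rint_prod2. Qed.

Lemma cint_Fubini (F : T1 * T2 -> R[i]) : cintg (m1 \x m2)%E F ->
  cint m1 (fun x => cint m2 (fun y => F (x, y))) =
  cint m2 (fun y => cint m1 (fun x => F (x, y))).
Proof. by move=> iF; rewrite -cint_prod1// cint_prod2. Qed.

Lemma cintg_cint1 (F : T1 * T2 -> R[i]) : cintg (m1 \x m2)%E F ->
  cintg m1 (fun x => cint m2 (fun y => F (x, y))).
Proof.
move=> iF; have /cintgP[mF FF] := iF; apply/cintgP; split.
  exact: cmeas_cint.
apply: le_lt_trans FF; rewrite fubini_tonelli1//; first last.
- by move=> x; rewrite lee_fin nc_ge0.
- by apply/mEFin; exact: mnormc.
apply: ae_ge0_le_integral => //.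
- by move=> x _; rewrite lee_fin nc_ge0.
- by apply/mEFin; apply: mnormc; exact: cmeas_cint.
- by move=> x _; apply: intg_ge0 => y _; rewrite lee_fin nc_ge0.
- apply: (@measurable_fun_fubini_tonelli_F _ _ _ _ _ m2
    (fun z => (normc (F z))%:E)).
    by apply/mEFin; exact: mnormc.
  by move=> x; rewrite lee_fin nc_ge0.
have [F1 F2] := iF.
have := ae_integrable1 F1; have := ae_integrable1 F2.
apply: filterS2 => x x1 x2 _; exact: le_normc_cint.
Qed.

Lemma cintg_mulX (u : T1 -> R[i]) (v : T2 -> R[i]) :
  cintg m1 u -> cintg m2 v ->
  cintg (m1 \x m2)%E (fun z => u z.1 * v z.2).
Proof.
move=> /cintgP[mu iu] /cintgP[mv iv]; apply: cintg_tonelli.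
  by apply: cmeasM; [exact: (cmeas_comp mu)|exact: (cmeas_comp mv)].
have E x : (\int[m2]_y (normc (u x * v y))%:E =
    (normc (u x))%:E * \int[m2]_y (normc (v y))%:E)%E.
  under eqint do rewrite Normc.normcM EFinM.
  rewrite ge0_integralZl//.
  - by apply/mEFin; exact: mnormc.
  - by move=> y _; rewrite lee_fin nc_ge0.
  - by rewrite lee_fin nc_ge0.
under eqint do rewrite /= E.
rewrite ge0_integralZr//.
- by rewrite lte_mul_pinfty// ?intg_ge0// ?ge0_fin_numE ?intg_ge0 //; move=> x _;
    rewrite lee_fin nc_ge0.
- by apply/mEFin; exact: mnormc.
- by move=> x _; rewrite lee_fin nc_ge0.
- by apply: intg_ge0 => x _; rewrite lee_fin nc_ge0.
Qed.

Lemma cint_mulX (u : T1 -> R[i]) (v : T2 -> R[i]) :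
  cintg m1 u -> cintg m2 v ->
  cint (m1 \x m2)%E (fun z => u z.1 * v z.2) = cint m1 u * cint m2 v.
Proof.
move=> iu iv; rewrite cint_prod1; last exact: cintg_mulX.
rewrite -cintZr//; apply: eq_cint => x /=.
by rewrite cintZl.
Qed.

(* The library's sigma-finite instance on [m1 \x m2] is shadowed by the one for
   subprobabilities, hence the alias. *)
Definition sprod : set (T1 * T2) -> \bar R := (m1 \x m2)%E.

HB.instance Definition _ := Measure.copy sprod (m1 \x m2)%E.

Let sprod_sigma_finite : sigma_finite setT sprod.
Proof.
have /sigma_finiteP[F [TF ndF Foo]] := sigma_finiteT m1.
have /sigma_finiteP[G [TG ndG Goo]] := sigma_finiteT m2.
exists (fun k => F k `*` G k).
  apply/seteqP; split => // -[x y] _.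
  have [k _ Fk] : (\bigcup_k F k) x by rewrite -TF.
  have [l _ Gl] : (\bigcup_k G k) y by rewrite -TG.
  exists (maxn k l) => //; split.
  - by move: x Fk; exact/subsetPset/ndF/leq_maxl.
  - by move: y Gl; exact/subsetPset/ndG/leq_maxr.
move=> k; have [mF Fk] := Foo k; have [mG Gk] := Goo k; split.
  exact: measurableX.
by rewrite /sprod product_measure1E// lte_mul_pinfty// ge0_fin_numE.
Qed.

HB.instance Definition _ := Measure_isSigmaFinite.Build _ _ _ sprod sprod_sigma_finite.

End two.
End cint.

(** * Affine changes of variable on the line *)

Section change.
Context {R : realType}.
Local Notation R1 := (measurableTypeR R).
Local Notation leb := (@lebesgue_measure R).
Local Open Scope ereal_scope.

Lemma ge0_integral_image d1 d2 (X : measurableType d1) (Y : measurableType d2)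
  (phi : X -> Y) (mu : {measure set X -> \bar R}) (nu : {measure set Y -> \bar R})
  (f : Y -> \bar R) : measT phi ->
  (forall A, measurable A -> nu A = mu (phi @^-1` A)) ->
  measT f -> (forall y, 0 <= f y) ->
  \int[nu]_y f y = \int[mu]_x f (phi x).
Proof.
move=> mphi H mf f0.
rewrite (eq_measure_integral
  (measure_function_pushforward__canonical__measure_function_Measure mu mphi)); last first.
  by move=> A mA _; rewrite H.
by rewrite ge0_integral_pushforward.
Qed.

Lemma meas_affine (c b : R) : measT (fun x : R1 => (c * x + b)%R : R1).
Proof.
by apply: mfunD => //; exact: mfunM.
Qed.

(** The image under the affine map of |c| times Lebesgue measure agrees with Lebesgue measure on
    half-open intervals, hence everywhere. For c < 0 the preimage of such an interval is half-open
    on the other side, with the same length. *)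
Lemma ge0_integral_affine (c b : R) (f : R -> \bar R) : c != 0%R ->
  measT f -> (forall y, 0 <= f y) ->
  `|c|%:E * \int[leb]_x f (c * x + b)%R = \int[leb]_x f x.
Proof.
move=> c0 mf f0; pose k := NngNum (normr_ge0 c).
rewrite (@ge0_integral_image _ _ _ _ (fun x : R1 => (c * x + b)%R : R1)
   (mscale k leb) leb f)//; last 2 first.
- exact: meas_affine.
- apply: (@lebesgue_measure_unique _
    (measure_function_pushforward__canonical__measure_function_Measure
      (mscale k leb) (meas_affine c b))) => X [[x1 x2] _ <-] /=.
  rewrite lebesgue_measure_itv/= /mscale /pushforward/=.
  have [c1|c1|/eqP] := ltgtP c 0%R; last by rewrite (negbTE c0).
  - rewrite (_ : _ @^-1` _ = `[(x2 - b) / c, (x1 - b) / c[%classic)%R; last first.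
      apply/seteqP; split => x /=; rewrite !in_itv/=.
        move=> /andP[h1 h2]; apply/andP; split.
          by rewrite ler_ndivrMr//; lra.
        by rewrite ltr_ndivlMr//; lra.
      move=> /andP[]; rewrite ler_ndivrMr// ltr_ndivlMr// => h1 h2.
      by apply/andP; split; lra.
    rewrite lebesgue_measure_itv/= !lte_fin ltr_ndivrMr// mulfVK// ltrD2r.
    case: ifPn => [_|]; last by rewrite mule0.
    rewrite -!EFinD -EFinM; congr EFin; rewrite ltr0_norm//.
    by field.
  - rewrite (_ : _ @^-1` _ = `](x1 - b) / c, (x2 - b) / c]%classic)%R; last first.
      apply/seteqP; split => x /=; rewrite !in_itv/=.
        move=> /andP[h1 h2]; apply/andP; split.
          by rewrite ltr_pdivrMr//; lra.
        by rewrite ler_pdivlMr//; lra.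
      move=> /andP[]; rewrite ltr_pdivrMr// ler_pdivlMr// => h1 h2.
      by apply/andP; split; lra.
    rewrite lebesgue_measure_itv/= !lte_fin ltr_pdivrMr// mulfVK// ltrD2r.
    case: ifPn => [_|]; last by rewrite mule0.
    rewrite -!EFinD -EFinM; congr EFin; rewrite gtr0_norm//.
    by field.
rewrite ge0_integral_mscale//.
exact: (mcomp mf (meas_affine _ _)).
Qed.

Lemma ge0_integral_shift (b : R) (f : R -> \bar R) :
  measT f -> (forall y, 0 <= f y) ->
  \int[leb]_x f (x + b)%R = \int[leb]_x f x.
Proof.
move=> mf f0; rewrite -(@ge0_integral_affine 1%R b f) ?oner_neq0// normr1 mul1e.
by under [RHS]eqint do rewrite mul1r.
Qed.

Lemma ge0_integral_opp (f : R -> \bar R) :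
  measT f -> (forall y, 0 <= f y) ->
  \int[leb]_x f (- x)%R = \int[leb]_x f x.
Proof.
move=> mf f0; rewrite -(@ge0_integral_affine (-1)%R 0%R f) ?oppr_eq0 ?oner_neq0//.
by rewrite normrN normr1 mul1e; under [RHS]eqint do rewrite addr0 mulN1r.
Qed.

End change.

(** * Slicing Lebesgue measure on R^n along any coordinate *)

Section slices.
Context {R : realType}.
Local Notation R1 := (measurableTypeR R).
Local Notation leb := (@lebesgue_measure R).

(** The generalization of [rV_cons] to coordinate [j]: the maps [r |-> ins j (r, y)] parametrize the
    lines parallel to e_j, on which the estimates are run. *)
Definition ins n (j : 'I_n.+1) (p : R1 * 'rV[R]_n) : 'rV[R]_n.+1 :=
  \row_k oapp (fun l => p.2 ord0 l) p.1 (unlift j k).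

Lemma insE n (j : 'I_n.+1) p : ins j p ord0 j = p.1.
Proof. by rewrite mxE unlift_none. Qed.

Lemma ins_lift n (j : 'I_n.+1) p l : ins j p ord0 (lift j l) = p.2 ord0 l.
Proof. by rewrite mxE liftK. Qed.

Lemma insP n (j : 'I_n.+1) (x : 'rV[R]_n.+1) :
  ins j (x ord0 j, \row_l x ord0 (lift j l)) = x.
Proof.
apply/rowP => k; case: (unliftP j k) => [l|] ->; last by rewrite insE.
by rewrite ins_lift mxE.
Qed.

Lemma ins_add n (j : 'I_n.+1) r h (y : 'rV[R]_n) :
  ins j (r + h, y) = ins j (r, y) + h *: evec j.
Proof.
apply/rowP => k; rewrite !mxE eqxx /=; case: (unliftP j k) => [l|] ->.
  by rewrite /= eq_sym (negbTE (neq_lift _ _)) mulr0 addr0.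
by rewrite /= eqxx mulr1.
Qed.

Lemma meas_ins n (j : 'I_n.+1) : measT (@ins n j).
Proof.
apply: measurable_fun_rV => k; case: (unliftP j k) => [l|] ->.
  rewrite (_ : _ \o _ = rV_coord l \o snd); last first.
    by apply/funext => p; rewrite /rV_coord /= ins_lift.
  exact: (mcomp (mcoord l)).
rewrite (_ : _ \o _ = (fun r : R1 => (r : R)) \o fst); last first.
  by apply/funext => p; rewrite /rV_coord /= insE.
exact: (mcomp (@measurable_id _ R1 setT)).
Qed.

Definition box n (A : 'I_n -> set R) : set 'rV[R]_n := [set x | forall i, A i (x ord0 i)].

Lemma meas_box n (A : 'I_n -> set R) : (forall i, measurable (A i)) ->
  measurable (box A).
Proof.
move=> mA; have -> : box A = \bigcap_(i in [set: 'I_n]) (rV_coord i @^-1` A i).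
  by apply/seteqP; split => x Bx i => [_|]; exact: Bx.
apply: fin_bigcap_measurable => // i _.
by rewrite -[X in measurable X]setTI; exact: mcoord.
Qed.

Definition boxes n : set (set 'rV[R]_n) :=
  [set B | exists2 A : 'I_n -> set R, (forall i, measurable (A i)) & B = box A].

Lemma boxes_gen n : @measurable _ 'rV[R]_n = <<s @boxes n >>.
Proof.
apply/seteqP; split; last first.
  apply: smallest_sub; first exact: sigma_algebra_measurable.
  by move=> B [A mA ->]; exact: meas_box.
apply: smallest_sub; first exact: smallest_sigma_algebra.
move=> B; rewrite -bigcup_seq /= => -[i _ [C mC <-]].
apply: sub_sigma_algebra; exists (fun k => if k == i then C else setT).
  by move=> k; case: ifP.
rewrite setTI; apply/seteqP; split => x /=.
  by move=> Cx k; case: eqP => // ->.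
by move=> /(_ i); rewrite eqxx.
Qed.

Lemma rV_measure_unique n (m1 m2 : {measure set 'rV[R]_n -> \bar R}) :
  (forall A : 'I_n -> set R, (forall i, measurable (A i)) -> m1 (box A) = m2 (box A)) ->
  (forall k : nat, (m1 (box (fun=> `](- k%:R)%R, k%:R%R[%classic)) < +oo)%E) ->
  forall A, measurable A -> m1 A = m2 A.
Proof.
move=> H Hf; apply: (measure_unique (@boxes n)
  (fun k : nat => box (fun=> `](- k%:R)%R, k%:R%R[%classic))) => //.
- exact: boxes_gen.
- move=> _ _ [A mA ->] [B mB ->]; exists (fun i => A i `&` B i).
    by move=> i; exact: measurableI.
  apply/seteqP; split => x /=; first by move=> [Ax Bx] i; split.
  by move=> ABx; split => i; case: (ABx i).
- by move=> k; exists (fun=> `](- k%:R)%R, k%:R%R[%classic).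
- apply/seteqP; split => // x _.
  have [k hk] : exists k : nat, forall i, `|x ord0 i| < k%:R.
    exists (\max_(i < n) (Num.trunc `|x ord0 i|).+1)%N => i.
    apply: (lt_le_trans (Num.Theory.truncnS_gt _)).
    by rewrite ler_nat (leq_bigmax i).
  by exists k => // i /=; rewrite in_itv /= -ltr_norml.
- by move=> _ [A mA ->]; exact: H.
Qed.

(** [lebesgue_rV] is built by peeling off coordinate 0. Both sides give a box the product of its
    side lengths, and boxes determine the measure, so any other coordinate may be peeled off
    instead. *)
Lemma lebesgue_rV_ins n (j : 'I_n.+1) (A : set 'rV[R]_n.+1) : measurable A ->
  lebesgue_rV n.+1 A = (leb \x lebesgue_rV n)%E (@ins n j @^-1` A).
Proof.
move: A; apply: (rV_measure_unique
  (m2 := measure_function_pushforward__canonical__measure_function_Measure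
    (leb \x lebesgue_rV n)%E (meas_ins j))) => [A mA|k].
  transitivity (\prod_(i < n.+1) lebesgue_measure (A i : set R1))%E.
    exact: (lebesgue_rV_box mA).
  rewrite /= /pushforward.
  rewrite (_ : _ @^-1` _ = A j `*` box (fun l => A (lift j l))); last first.
    apply/seteqP; split => -[r y] /=.
      move=> h; split; first by have := h j; rewrite insE.
      by move=> l; have := h (lift j l); rewrite ins_lift.
    move=> [h1 h2] k; case: (unliftP j k) => [l|] ->.
      by rewrite ins_lift; exact: h2.
    by rewrite insE.
  rewrite product_measure1E//; last exact: meas_box.
  have -> : lebesgue_rV n (box (fun l => A (lift j l))) =
    (\prod_(l < n) lebesgue_measure (A (lift j l) : set R1))%E.
    exact: lebesgue_rV_box.
  rewrite (bigD1_ord j)//=.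
  exact: (mA j).
pose A : 'I_n.+1 -> set R := fun=> `](- k%:R)%R, k%:R%R[%classic.
have mA i : measurable (A i) by exact: measurable_itv.
apply: (@le_lt_trans _ _ (\prod_(i < n.+1) lebesgue_measure (A i : set R1))%E).
  by rewrite -(lebesgue_rV_box mA).
rewrite /A.
under eq_bigr do rewrite lebesgue_measure_itv/=.
rewrite ltey_eq; apply/orP; left; apply: (big_ind (fun x : \bar R => x \is a fin_num)) => //.
  exact: fin_numM.
by move=> i _; case: ifP.
Qed.

Local Open Scope ereal_scope.

Lemma ge0_integral_rV n (j : 'I_n.+1) (f : 'rV[R]_n.+1 -> \bar R) :
  measT f -> (forall x, 0 <= f x) ->
  \int[lebesgue_rV n.+1]_x f x = \int[lebesgue_rV n]_y \int[leb]_r f (ins j (r, y)).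
Proof.
move=> mf f0; rewrite (ge0_integral_image (meas_ins j) (lebesgue_rV_ins j) mf f0).
rewrite fubini_tonelli2//=.
exact: (mcomp mf (meas_ins j)).
Qed.

Lemma ge0_integral_rV' n (j : 'I_n.+1) (f : 'rV[R]_n.+1 -> \bar R) :
  measT f -> (forall x, 0 <= f x) ->
  \int[lebesgue_rV n.+1]_x f x = \int[leb]_r \int[lebesgue_rV n]_y f (ins j (r, y)).
Proof.
move=> mf f0; rewrite (ge0_integral_image (meas_ins j) (lebesgue_rV_ins j) mf f0).
rewrite fubini_tonelli1//=.
exact: (mcomp mf (meas_ins j)).
Qed.

Lemma Rintegral_rV n (j : 'I_n.+1) (f : 'rV[R]_n.+1 -> R) :
  measT f ->
  (\int[lebesgue_rV n.+1]_x f x)%R = (\int[leb \x lebesgue_rV n]_p f (ins j p))%R.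
Proof.
move=> mf; rewrite /Rintegral; congr fine; rewrite integralE [RHS]integralE.
have mEf : measT (EFin \o f) by exact/mEFin.
congr (_ - _).
- rewrite (ge0_integral_image (meas_ins j) (lebesgue_rV_ins j) (measurable_funepos mEf))//.
  by apply: eqint => p _; rewrite ?funeposE ?funenegE.
- rewrite (ge0_integral_image (meas_ins j) (lebesgue_rV_ins j) (measurable_funeneg mEf))//.
  by apply: eqint => p _; rewrite ?funeposE ?funenegE.
Qed.

Lemma cintg_rV n (j : 'I_n.+1) (f : 'rV[R]_n.+1 -> R[i]) :
  cintg (lebesgue_rV n.+1) f ->
  cintg (leb \x lebesgue_rV n) (fun p => f (ins j p)).
Proof.
move=> /cintgP[mf If]; apply/cintgP; split.
  exact: (cmeas_comp mf (meas_ins j)).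
rewrite (ge0_integral_image (meas_ins j) (lebesgue_rV_ins j)) in If => //.
  by apply/mEFin; exact: mnormc.
by move=> y; rewrite lee_fin nc_ge0.
Qed.

Lemma cint_rV n (j : 'I_n.+1) (f : 'rV[R]_n.+1 -> R[i]) :
  cintg (lebesgue_rV n.+1) f ->
  cint (lebesgue_rV n.+1) f =
  cint (lebesgue_rV n) (fun y => cint leb (fun r => f (ins j (r, y)))).
Proof.
move=> cf; have [mf1 mf2] := cintg_meas cf.
rewrite -(cint_prod2 (cintg_rV j cf)) /cint /cintegral.
by rewrite (Rintegral_rV j mf1) (Rintegral_rV j mf2).
Qed.

Lemma ge0_integral_prod n (p : 'I_n -> R -> R) :
  (forall i, measT (p i)) -> (forall i x, (0 <= p i x)%R) ->
  \int[lebesgue_rV n]_x (\prod_(i < n) p i (x ord0 i))%:E =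
  \prod_(i < n) \int[leb]_r (p i r)%:E.
Proof.
elim: n p => [|n IH] p mp p0.
  rewrite big_ord0; under eqint do rewrite big_ord0.
  by rewrite integral_cst//= diracE mem_set// mul1e.
have mP m (q : 'I_m -> R -> R) : (forall i, measT (q i)) ->
    measT (fun x : 'rV[R]_m => (\prod_(i < m) q i (x ord0 i))%R).
  move=> mq; apply: measurable_prod => i _.
  exact: (mcomp (mq i) (mcoord i)).
rewrite (@ge0_integral_rV _ ord0); last 2 first.
- by apply/mEFin; exact: mP.
- by move=> x; rewrite lee_fin; apply: prodr_ge0.
have E y r : (\prod_(i < n.+1) p i (ins ord0 (r, y) ord0 i) =
   p ord0 r * \prod_(i < n) p (lift ord0 i) (y ord0 i))%R.
  by rewrite big_ord_recl insE; congr (_ * _)%R; apply: eq_bigr => i _; rewrite ins_lift.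
under eqint do under eqint do rewrite E EFinM.
under eqint.
  move=> y _; rewrite ge0_integralZr//; last 3 first.
  - by apply/mEFin; exact: mp.
  - by move=> x _; rewrite lee_fin.
  - by rewrite lee_fin prodr_ge0.
  over.
rewrite ge0_integralZl//; last 3 first.
- apply/mEFin; exact: (mP n (fun i => p (lift ord0 i)) (fun i => mp _)).
- by move=> x _; rewrite lee_fin prodr_ge0.
- by apply: intg_ge0 => x _; rewrite lee_fin.
by rewrite big_ord_recl -(IH (fun i => p (lift ord0 i))).
Qed.

Lemma cint_prod n (p : 'I_n -> R -> R[i]) :
  (forall i, cintg leb (p i)) ->
  cintg (lebesgue_rV n) (fun x => \prod_(i < n) p i (x ord0 i))%R /\
  cint (lebesgue_rV n) (fun x => \prod_(i < n) p i (x ord0 i))%R =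
  (\prod_(i < n) cint leb (p i))%R.
Proof.
elim: n p => [|n IH] p ip.
  rewrite big_ord0; under eq_fun do rewrite big_ord0; split.
    apply/cintgP; split; first exact: cmeas_cst.
    by rewrite Normc.normc1 integral_cst//= diracE mem_set// mul1e ltry.
  rewrite (cint_real _ (fun=> 1%R)) Rintegral_cst//=. by rewrite indicT mul1r.
have [I1 I2] := IH _ (fun i => ip (lift ord0 i)).
have E q : (\prod_(i < n.+1) p i (ins ord0 q ord0 i) =
   p ord0 q.1 * \prod_(i < n) p (lift ord0 i) (q.2 ord0 i))%R.
  by rewrite big_ord_recl insE; congr (_ * _)%R; apply: eq_bigr => i _; rewrite ins_lift.
have mP m (q : 'I_m -> R -> R[i]) : (forall i, cmeas (q i)) ->
    cmeas (fun x : 'rV[R]_m => (\prod_(i < m) q i (x ord0 i))%R).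
  move=> mq; elim: m q mq => [|m IHm] q mq.
    by under eq_fun do rewrite big_ord0; exact: cmeas_cst.
  under eq_fun do rewrite big_ord_recl.
  apply: cmeasM; first exact: (cmeas_comp (mq _) (mcoord _)).
  rewrite (_ : (fun x => _) = (fun y : 'rV[R]_m => \prod_(i < m) q (lift ord0 i) (y ord0 i))%R \o
     (fun x : 'rV[R]_m.+1 => \row_l x ord0 (lift ord0 l))).
    apply: (cmeas_comp (IHm (fun i => q (lift ord0 i)) (fun i => mq _))).
    apply: measurable_fun_rV => i.
    rewrite (_ : _ \o _ = rV_coord (lift ord0 i)); first exact: mcoord.
    by apply/funext => x; rewrite /rV_coord /= mxE.
  by apply/funext => x /=; apply: eq_bigr => i _; rewrite mxE.
have iP : cintg (lebesgue_rV n.+1) (fun x => \prod_(i < n.+1) p i (x ord0 i))%R.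
  apply/cintgP; split; first by apply: mP => i; exact: cintg_meas (ip i).
  rewrite (ge0_integral_image (meas_ins ord0) (lebesgue_rV_ins ord0)).
  - under eqint do rewrite E.
    by have /cintgP[] := cintg_mulX (ip ord0) I1.
  - by apply/mEFin; apply: mnormc; apply: mP => i;
      exact: cintg_meas (ip i).
  - by move=> x; rewrite lee_fin nc_ge0.
split => //; rewrite (cint_rV ord0 iP) -(cint_prod2 (cintg_rV ord0 iP)).
under eq_fun do rewrite E.
by rewrite (cint_mulX (ip ord0) I1) I2 big_ord_recl.
Qed.

End slices.

(** * Derivative rules and the fundamental theorem of calculus *)

Section derivation.
Context {R : realType}.
Implicit Types (f g : R -> R) (x a b : R).

Lemma derD f g x a b : is_derive x 1 f a -> is_derive x 1 g b ->
  is_derive x 1 (fun t => f t + g t) (a + b).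
Proof. by move=> ? ?; exact: is_deriveD. Qed.

Lemma derN f x a : is_derive x 1 f a -> is_derive x 1 (fun t => - f t) (- a).
Proof. by move=> ?; exact: is_deriveN. Qed.

Lemma derM f g x a b : is_derive x 1 f a -> is_derive x 1 g b ->
  is_derive x 1 (fun t => f t * g t) (f x * b + g x * a).
Proof. by move=> ? ?; exact: is_deriveM. Qed.

Lemma der_cst (c x : R) : is_derive x 1 (fun=> c) 0.
Proof. exact: is_derive_cst. Qed.

Lemma der_id (x : R) : is_derive x 1 (fun t => t) 1.
Proof. exact: is_derive_id. Qed.

Lemma derX f x a n : is_derive x 1 f a ->
  is_derive x 1 (fun t => f t ^+ n.+1) (n.+1%:R * f x ^+ n * a).
Proof.
elim: n => [|n IH] df.
  have E : (fun t => f t ^+ 1) = f by apply/funext => t; rewrite expr1.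
  by rewrite E expr0 !mul1r.
have := derM df (IH df); rewrite (_ : (fun t => f t * f t ^+ n.+1) = fun t => f t ^+ n.+2).
  by congr (is_derive _ _ _ _); rewrite -[in RHS]natr1 exprS; ring.
by apply/funext => t; rewrite -exprS.
Qed.

Lemma der_comp f g x a b : is_derive (g x) 1 f a -> is_derive x 1 g b ->
  is_derive x 1 (fun t => f (g t)) (a * b).
Proof. by move=> ? ?; exact: is_derive1_comp. Qed.

Lemma der_expR f x a : is_derive x 1 f a ->
  is_derive x 1 (fun t => expR (f t)) (expR (f x) * a).
Proof. by move=> df; apply: (der_comp (is_derive_expR _) df). Qed.

Lemma der_cos f x a : is_derive x 1 f a ->
  is_derive x 1 (fun t => cos (f t)) (- sin (f x) * a).
Proof. by move=> df; apply: (der_comp (is_derive_cos _) df). Qed.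

Lemma der_sin f x a : is_derive x 1 f a ->
  is_derive x 1 (fun t => sin (f t)) (cos (f x) * a).
Proof. by move=> df; apply: (der_comp (is_derive_sin _) df). Qed.

Lemma der_atan f x a : is_derive x 1 f a ->
  is_derive x 1 (fun t => atan (f t)) ((1 + f x ^+ 2)^-1 * a).
Proof. by move=> df; apply: (der_comp (is_derive1_atan _) df). Qed.

Lemma derV f x a : f x != 0 -> is_derive x 1 f a ->
  is_derive x 1 (fun t => (f t)^-1) (- f x ^- 2 * a).
Proof. by move=> fx df; exact: is_deriveV. Qed.

Lemma der_eq f x a b : is_derive x 1 f a -> a = b -> is_derive x 1 f b.
Proof. by move=> df <-. Qed.

Lemma der_derivable f x a : is_derive x 1 f a -> derivable f x 1.
Proof. by case. Qed.

Lemma der_val f x a : is_derive x 1 f a -> derive1 f x = a.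
Proof. by rewrite derive1E; case. Qed.

Lemma der_cont f x a : is_derive x 1 f a -> {for x, continuous f}.
Proof.
by move=> df; apply: differentiable_continuous; apply/derivable1_diffP; case: df.
Qed.

End derivation.

Ltac der1 := lazymatch goal with
  | |- is_derive _ _ (fun _ => ?c) _ => exact: der_cst
  | |- is_derive _ _ (fun t => t) _ => exact: der_id
  | |- is_derive _ _ (fun t => @GRing.add _ (@?f t) (@?g t)) _ => eapply (@derD _ f g)
  | |- is_derive _ _ (fun t => @GRing.mul _ (@?f t) (@?g t)) _ => eapply (@derM _ f g)
  | |- is_derive _ _ (fun t => @GRing.opp _ (@?f t)) _ => eapply (@derN _ f)
  | |- is_derive _ _ (fun t => @GRing.inv _ (@?f t)) _ => eapply (@derV _ f)
  | |- is_derive _ _ (fun t => @GRing.exp _ (@?f t) _) _ => eapply (@derX _ f)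
  | |- is_derive _ _ (fun t => expR (@?f t)) _ => eapply (@der_expR _ f)
  | |- is_derive _ _ (fun t => cos (@?f t)) _ => eapply (@der_cos _ f)
  | |- is_derive _ _ (fun t => sin (@?f t)) _ => eapply (@der_sin _ f)
  | |- is_derive _ _ (fun t => atan (@?f t)) _ => eapply (@der_atan _ f)
  | |- is_derive _ _ _ _ => eassumption
  end.
Ltac der := repeat der1.

Section FTC.
Context {R : realType}.
Local Notation leb := (@lebesgue_measure R).
Implicit Types x : R.

Lemma FTC_y (f F : R -> R) (l : R) : (forall x, 0 <= x -> 0 <= f x) ->
  continuous f -> (forall x : R, is_derive x 1 F (f x)) ->
  F x @[x --> +oo] --> l ->
  (\int[leb]_(x in `[0%R, +oo[) (f x)%:E = (l - F 0%R)%:E)%E.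
Proof.
move=> f0 cf dF Fl; rewrite (@ge0_continuous_FTC2y _ f F 0 l)//.
- exact: continuous_subspaceT.
- by apply: cvg_at_right_filter; exact: der_cont (dF 0).
- by move=> x _; exact: der_val (dF x).
Qed.

(** The half-line version on each half; the left one is reflected, and [t |-> - F (- t)] is an
    antiderivative of the reflected integrand. *)
Lemma FTC_T (f F : R -> R) (l l' : R) : (forall x, 0 <= f x) ->
  continuous f -> (forall x : R, is_derive x 1 F (f x)) ->
  F x @[x --> +oo] --> l -> F x @[x --> -oo] --> l' ->
  (\int[leb]_x (f x)%:E = (l - l')%:E)%E.
Proof.
move=> f0 cf dF Fl Fl'.
have mf : measT f by exact: contm.
rewrite -(setUv [set x : R | 0 <= x]%R) ge0_integral_setU//=; last 5 first.
- by rewrite -set_itvcy.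
- by apply: measurableC; rewrite -set_itvcy.
- by apply/mEFin; rewrite setUv.
- by move=> x _; rewrite lee_fin.
- exact/disj_setPCl.
rewrite -set_itvcy (FTC_y (fun x _ => f0 x) cf dF Fl) setCitvr.
rewrite integral_itv_bndo_bndc; last exact/mEFin/measurable_funTS.
rewrite -[in X in (_ + X)%E]oppr0 ge0_integration_by_substitutionNy//; last first.
  exact: continuous_subspaceT.
have dF' x : is_derive x 1 (fun t => - F (- t)) (f (- x)).
  apply: (der_eq (derN (der_comp (dF (- x)) (derN (der_id x))))).
  by rewrite mulrN1 opprK.
rewrite (_ : (\int[leb]_(x in `[0%R, +oo[) ((f \o -%R) x)%:E)%E = (- l' - - F (- 0))%:E)%R.
  rewrite -EFinD; congr EFin; rewrite oppr0; ring.
apply: (@FTC_y (fun x => f (- x)) (fun t => - F (- t))) => //.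
- by move=> x; apply: continuous_comp; [exact: opp_continuous|exact: cf].
- by apply: cvgN; apply/cvgNy_compNP.
Qed.

Lemma Rintegral_opp (f : R -> R) : measT f ->
  (\int[leb]_x f (- x) = \int[leb]_x f x)%R.
Proof.
move=> mf; rewrite /Rintegral; congr fine; rewrite integralE [RHS]integralE.
have mEf : measT (EFin \o f) by exact/mEFin.
congr (_ - _)%E.
- rewrite -(ge0_integral_opp (measurable_funepos mEf))//.
  by apply: eqint => x _; rewrite !funeposE.
- rewrite -(ge0_integral_opp (measurable_funeneg mEf))//.
  by apply: eqint => x _; rewrite !funenegE.
Qed.

Lemma Rintegral_odd (f : R -> R) : measT f ->
  (forall x, f (- x) = - f x) -> leb.-integrable setT (EFin \o f) ->
  (\int[leb]_x f x = 0)%R.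
Proof.
move=> mf of_ If; have := Rintegral_opp mf.
under eq_Rintegral do rewrite of_ -mulN1r.
by rewrite RintegralZl//; lra.
Qed.

End FTC.

(** * The explicit kernel pair and its integrals *)

Section kernels.
Context {R : realType}.
Local Notation leb := (@lebesgue_measure R).
Implicit Types x : R.
Implicit Types e r : R.

(** [Pk e] is the Fourier transform of [Ek e] (see [FT_Ek]), and [Qk e] is the Poisson kernel, the
    transform of exp(-e|x|). The factor [1 + e * |x|] removes the corner of the exponential at 0;
    thanks to it [Pk] decays like r^-4 and has a finite second moment, which [Qk] has not. *)
Definition Ek e x : R := (1 + e * `|x|) * expR (- (e * `|x|)).
Definition Pk e r : R := 4 * e ^+ 3 / (e ^+ 2 + r ^+ 2) ^+ 2.
Definition Qk e r : R := 2 * e / (e ^+ 2 + r ^+ 2).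

Lemma den_gt0 e r : 0 < e -> 0 < e ^+ 2 + r ^+ 2.
Proof. by move=> e0; rewrite ltr_wpDr ?sqr_ge0 ?exprn_gt0. Qed.

Lemma Pk_ge0 e r : 0 < e -> 0 <= Pk e r.
Proof. by move=> e0; rewrite /Pk divr_ge0 ?sqr_ge0// mulr_ge0// exprn_ge0// ltW. Qed.

Lemma Qk_ge0 e r : 0 < e -> 0 <= Qk e r.
Proof. by move=> e0; rewrite /Qk divr_ge0 ?mulr_ge0 ?ltW// den_gt0. Qed.

Lemma PkN e r : Pk e (- r) = Pk e r. Proof. by rewrite /Pk sqrrN. Qed.

(** The second moment of [Pk] is of size e^2. This gain is what controls Lipschitz multipliers in
    [mult_osc] and small arguments in [scale_bound]. *)
Lemma Pk_sqr e r : 0 < e -> r ^+ 2 * Pk e r <= 2 * e ^+ 2 * Qk e r.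
Proof.
move=> e0; have D := den_gt0 r e0.
rewrite /Pk /Qk !mulrA ler_pdivrMr ?exprn_gt0//.
rewrite expr2 mulrA mulfVK ?gt_eqF//.
have h : 0 <= 4 * e ^+ 3 * e ^+ 2 by rewrite !mulr_ge0 ?exprn_ge0 ?ltW.
by nra.
Qed.

(** The first moment of [Pk] is of size e, the rate of approximation used for Fourier inversion. *)
Lemma Pk_abs e r : 0 < e -> `|r| * Pk e r <= e * Qk e r.
Proof.
move=> e0; have D := den_gt0 r e0.
rewrite /Pk /Qk !mulrA ler_pdivrMr ?exprn_gt0//.
rewrite expr2 mulrA mulfVK ?gt_eqF//.
have h : 2 * (e * `|r|) <= e ^+ 2 + r ^+ 2.
  by rewrite -(real_normK (num_real r)); have := sqr_ge0 (e - `|r|); nra.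
have := ler_wpM2l (ltW (exprn_gt0 2 e0)) h; nra.
Qed.

(** For a function [be] that contracts distances by no more than [c], the kernel at [be x - be y]
    may be replaced by the kernel at [x - y], with a constant independent of the scale [e]. *)
Lemma Pk_scale e c r s : 0 < e -> 0 < c -> c <= 1 -> c * `|r| <= `|s| ->
  Pk e s <= c ^- 4 * Pk e r.
Proof.
move=> e0 c0 c1 h; have D := den_gt0 r e0; have D' := den_gt0 s e0.
have h2 : c ^+ 2 * r ^+ 2 <= s ^+ 2.
  rewrite -(real_normK (num_real s)) -(real_normK (num_real r)) -exprMn.
  by rewrite ler_pXn2r ?nnegrE ?mulr_ge0// ltW.
have h3 : c ^+ 2 * (e ^+ 2 + r ^+ 2) <= e ^+ 2 + s ^+ 2.
  have : c ^+ 2 * e ^+ 2 <= e ^+ 2 by rewrite ler_piMl ?sqr_ge0// exprn_ile1// ltW.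
  by lra.
rewrite /Pk [leRHS]mulrCA; apply: ler_wpM2l; first by rewrite mulr_ge0 ?exprn_ge0 ?ltW.
rewrite -invfM lef_pV2 ?posrE ?mulr_gt0 ?exprn_gt0//.
rewrite (_ : c ^+ 4 * _ = (c ^+ 2 * (e ^+ 2 + r ^+ 2)) ^+ 2); last by ring.
by rewrite ler_pXn2r ?nnegrE ?(ltW D')// mulr_ge0 ?sqr_ge0 ?(ltW D).
Qed.

Lemma Ek_ge0 e x : 0 < e -> 0 <= Ek e x.
Proof. by move=> e0; rewrite mulr_ge0 ?expR_ge0// addr_ge0// mulr_ge0// ltW. Qed.

Lemma Ek_le1 e x : 0 < e -> Ek e x <= 1.
Proof.
move=> e0; rewrite /Ek expRN ler_pdivrMr ?expR_gt0// mul1r; exact: expR_ge1Dx.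
Qed.

(** From (1 + t/2)^2 <= exp t the value is at most (1 + t) / (1 + t/2)^2, which is 8/9 at t = 1 and
    decreases afterwards. *)
Lemma Ek_lower e x : 0 < e -> 1 <= e * `|x| -> 9^-1 <= 1 - Ek e x.
Proof.
move=> e0; set t := e * `|x| => t1.
have h1 : (1 + t / 2) ^+ 2 <= expR t.
  rewrite {2}(_ : t = 2%:R * (t / 2)); last by field.
  rewrite expRM_natl ler_pXn2r ?nnegrE ?expR_ge0 ?expR_ge1Dx//.
  by rewrite addr_ge0// divr_ge0//; lra.
suff : Ek e x <= 8 / 9 by lra.
rewrite /Ek -/t expRN ler_pdivrMr ?expR_gt0//; nra.
Qed.

Lemma continuous_abs_comp (f : R -> R) : continuous f -> continuous (fun x : R => f `|x|).
Proof.
by move=> cf x; apply: (@continuous_comp _ _ _ (fun x : R => `|x|) f);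
  [exact: norm_continuous|exact: cf].
Qed.

Lemma der_continuous (f g : R -> R) : (forall x : R, is_derive x 1 f (g x)) -> continuous f.
Proof. by move=> df x; exact: der_cont (df x). Qed.

Lemma Ek_continuous e : continuous (Ek e).
Proof.
apply: (continuous_abs_comp (f := fun y => (1 + e * y) * expR (- (e * y)))).
eapply der_continuous => x; der.
Qed.

Lemma meas_Ek e : measT (Ek e).
Proof. by apply: contm; exact: Ek_continuous. Qed.

Lemma Pk_continuous e : 0 < e -> continuous (Pk e).
Proof.
move=> e0; rewrite /Pk; eapply der_continuous => x; der.
by rewrite sqrf_eq0 gt_eqF ?den_gt0.
Qed.

Lemma Qk_continuous e : 0 < e -> continuous (Qk e).
Proof.
move=> e0; rewrite /Qk; eapply der_continuous => x; der.
by rewrite gt_eqF ?den_gt0.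
Qed.

Lemma meas_Pk e : 0 < e -> measT (Pk e).
Proof. by move=> e0; apply: contm; exact: Pk_continuous. Qed.

Lemma meas_Qk e : 0 < e -> measT (Qk e).
Proof. by move=> e0; apply: contm; exact: Qk_continuous. Qed.

Lemma decay_cvg0 (F : R -> R) (C : R) :
  (forall x, 1 <= x -> `|F x| <= C / x) -> F x @[x --> +oo] --> 0.
Proof.
move=> H; apply/cvgr0Pnorm_lt => eps eps0.
near=> x; have x1 : 1 <= x by near: x; apply: nbhs_pinfty_ge; exact: num_real.
have x0 : 0 < x by lra.
apply: (le_lt_trans (H _ x1)); rewrite ltr_pdivrMr// mulrC -ltr_pdivrMr//.
by near: x; apply: nbhs_pinfty_gt; exact: num_real.
Unshelve. all: by end_near. Qed.

Lemma cvg_odd_Ny (F : R -> R) (l : R) : (forall x, F (- x) = - F x) ->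
  F x @[x --> +oo] --> l -> F x @[x --> -oo] --> - l.
Proof.
move=> oF Fl; apply/cvgNy_compNP; rewrite (_ : F \o -%R = fun x => - F x).
  exact: cvgN.
by apply/funext => x; exact: oF.
Qed.

Definition Pprim e r : R := 2 * atan (e^-1 * r) + 2 * e * r * (e ^+ 2 + r ^+ 2)^-1.

Lemma atan_cvg e : 0 < e -> 2 * atan (e^-1 * r) @[r --> +oo] --> (pi : R).
Proof.
move=> e0; have -> : (pi : R) = 2 * (pi / 2) by rewrite mulrCA divff// mulr1.
apply: cvgM; first exact: cvg_cst.
apply: (cvg_comp (fun r : R => e^-1 * r) (@atan R)); last exact: cvgy_atan.
by apply: gt0_cvgMry => //; rewrite invr_gt0.
Qed.

Lemma Pprim_cvg e : 0 < e -> Pprim e r @[r --> +oo] --> (pi : R).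
Proof.
move=> e0; rewrite -[X in _ --> X]addr0; apply: cvgD; first exact: atan_cvg.
apply: (@decay_cvg0 _ (2 * e)) => x x1.
have D := den_gt0 x e0.
rewrite ger0_norm; last by rewrite mulr_ge0 ?invr_ge0 ?ltW// !mulr_gt0//; lra.
rewrite ler_pdivrMr// [leRHS]mulrAC ler_pdivlMr; last by lra.
have h : 0 <= 2 * e * e ^+ 2 by rewrite !mulr_ge0 ?sqr_ge0 ?ltW.
by nra.
Qed.

Lemma Pprim_odd e r : Pprim e (- r) = - Pprim e r.
Proof. by rewrite /Pprim mulrN atanN sqrrN; ring. Qed.

Lemma der_Pprim e r : 0 < e -> is_derive r 1 (Pprim e) (Pk e r).
Proof.
move=> e0; have D := den_gt0 r e0; have D0 := lt0r_neq0 D.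
have D1 : 1 + (e^-1 * r) ^+ 2 = e ^- 2 * (e ^+ 2 + r ^+ 2) by field; rewrite gt_eqF.
rewrite /Pprim; eapply der_eq; first by der; exact: D0.
rewrite D1 /Pk; field; rewrite D0 /=.
by rewrite (gt_eqF e0).
Qed.

(** Taken against the density [be'], the kernel in the variable [be] has mass [2 * pi] wherever it
    is centred. This is why the derivative of the phase is the right density on a line. The
    substitution is done by the antiderivative [Pprim e (be x - b)]. *)
Lemma int_Pk e b (be p : R -> R) : 0 < e -> continuous p -> (forall x, 0 <= p x) ->
  (forall x : R, is_derive x 1 be (p x)) ->
  be x @[x --> +oo] --> +oo -> be x @[x --> -oo] --> -oo ->
  (\int[leb]_x (Pk e (be x - b) * p x)%:E = (2 * pi)%:E)%E.
Proof.
move=> e0 cp p0 dbe bey beNy.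
have cbe : continuous be by move=> x; exact: der_cont (dbe x).
have -> : (2 : R) * pi = pi - - pi by ring.
apply: (@FTC_T _ (fun x => Pk e (be x - b) * p x) (fun x => Pprim e (be x - b)) pi (- pi)).
- by move=> x; rewrite mulr_ge0 ?Pk_ge0.
- move=> x; apply: (@continuousM _ _ (fun x => Pk e (be x - b)) p); last exact: cp.
  apply: (@continuous_comp _ _ _ (fun x => be x - b) (Pk e)); last exact: Pk_continuous.
  by apply: (@continuousB _ _ _ be (cst b)); [exact: cbe|exact: cst_continuous].
- move=> x; have d1 := derD (dbe x) (der_cst (- b) x).
  have d2 := @der_comp _ (Pprim e) (fun t => be t - b) x _ _ (der_Pprim (be x - b) e0) d1.
  by apply: (der_eq d2); rewrite addr0.
- apply: (cvg_comp (fun x => be x - b) (Pprim e)); last exact: Pprim_cvg.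
  exact: (cvg_comp be (fun y => y - b) bey (@cvg_addrr _ (- b))).
- apply: (cvg_comp (fun x => be x - b) (Pprim e)); last first.
    by apply: cvg_odd_Ny; [exact: Pprim_odd|exact: Pprim_cvg].
  exact: (cvg_comp be (fun y => y - b) beNy (@cvg_addrr_Ny _ (- b))).
Qed.

Lemma int_Qk e : 0 < e -> (\int[leb]_x (Qk e x)%:E = (2 * pi)%:E)%E.
Proof.
move=> e0; have -> : (2 : R) * pi = pi - - pi by ring.
apply: (@FTC_T _ (Qk e) (fun r => 2 * atan (e^-1 * r)) pi (- pi)).
- by move=> x; exact: Qk_ge0.
- exact: Qk_continuous.
- move=> x; have D := den_gt0 x e0; have D0 := lt0r_neq0 D.
  have D1 : 1 + (e^-1 * x) ^+ 2 = e ^- 2 * (e ^+ 2 + x ^+ 2) by field; rewrite gt_eqF.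
  eapply der_eq; first by der.
  by rewrite D1 /Qk; field; rewrite D0 /= (gt_eqF e0).
- exact: atan_cvg.
- by apply: cvg_odd_Ny; [move=> x; rewrite mulrN atanN mulrN|exact: atan_cvg].
Qed.

Lemma int_Pk1 e b : 0 < e -> (\int[leb]_x (Pk e (x - b))%:E = (2 * pi)%:E)%E.
Proof.
move=> e0; rewrite -(@int_Pk e b id (fun=> 1) e0)//.
- by apply: eqint => x _; rewrite mulr1.
- exact: cst_continuous.
Qed.

Definition Gprim e x : R := - ((2 * e^-1 + x) * expR (- (e * x))).

Lemma der_Gprim e x : 0 < e ->
  is_derive x 1 (Gprim e) ((1 + e * x) * expR (- (e * x))).
Proof.
move=> e0; rewrite /Gprim; eapply der_eq; first by der.
by field; rewrite gt_eqF.
Qed.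

(** The real part of the elementary antiderivative of (1 + e x) exp(-(e - i r) x), with 1/(e - i r)
    and its square written out. *)
Definition Hprim e r x : R := - (expR (- (e * x)) *
  (cos (r * x) * ((1 + e * x) * (e / (e ^+ 2 + r ^+ 2))
     + e * (e ^+ 2 - r ^+ 2) / (e ^+ 2 + r ^+ 2) ^+ 2)
   - sin (r * x) * ((1 + e * x) * (r / (e ^+ 2 + r ^+ 2))
     + 2 * e ^+ 2 * r / (e ^+ 2 + r ^+ 2) ^+ 2))).

Lemma der_Hprim e r x : 0 < e ->
  is_derive x 1 (Hprim e r) ((1 + e * x) * expR (- (e * x)) * cos (r * x)).
Proof.
move=> e0; have D := lt0r_neq0 (den_gt0 r e0).
rewrite /Hprim; eapply der_eq; first by der.
by field.
Qed.

Lemma Ek_decay e x : 0 < e -> 0 < x -> (1 + e * x) * expR (- (e * x)) <= 4 / e / x.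
Proof.
move=> e0 x0; have t0 : 0 < e * x by rewrite mulr_gt0.
have h1 : (1 + e * x / 2) ^+ 2 <= expR (e * x).
  rewrite {2}(_ : e * x = 2%:R * (e * x / 2)); last by field.
  rewrite expRM_natl ler_pXn2r ?nnegrE ?expR_ge0 ?expR_ge1Dx//.
  by rewrite addr_ge0// divr_ge0// ltW.
rewrite expRN ler_pdivrMr ?expR_gt0// -mulrA -invfM mulrAC ler_pdivlMr//.
by set t := e * x in t0 h1 *; nra.
Qed.

Lemma Gprim_cvg e : 0 < e -> Gprim e x @[x --> +oo] --> 0.
Proof.
move=> e0; apply: (@decay_cvg0 _ (2 / e * (4 / e))) => x x1.
have x0 : 0 < x by lra.
rewrite /Gprim normrN ger0_norm; last first.
  by rewrite mulr_ge0 ?expR_ge0// addr_ge0 ?mulr_ge0 ?invr_ge0 ?ltW.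
rewrite -[leRHS]mulrA; apply: le_trans (ler_wpM2l _ (Ek_decay e0 x0)); last first.
  by rewrite divr_ge0// ltW.
rewrite mulrA; apply: ler_wpM2r; first exact: expR_ge0.
rewrite mulrDr mulr1 lerD2l mulrA mulfVK ?gt_eqF//; lra.
Qed.

Lemma Hprim_cvg e r : 0 < e -> Hprim e r x @[x --> +oo] --> 0.
Proof.
move=> e0; set D := e ^+ 2 + r ^+ 2.
have D0 : 0 < D by exact: den_gt0.
pose A := `|e / D| + `|e * (e ^+ 2 - r ^+ 2) / D ^+ 2|
        + (`|r / D| + `|2 * e ^+ 2 * r / D ^+ 2|).
apply: (@decay_cvg0 _ (A * (4 / e))) => x x1.
have x0 : 0 < x by lra.
have t0 : 0 <= e * x by rewrite mulr_ge0 ?ltW.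
rewrite /Hprim normrN normrM ger0_norm ?expR_ge0// -/D.
rewrite -[leRHS]mulrA; apply: le_trans (ler_wpM2l _ (Ek_decay e0 x0)); last first.
  by rewrite !addr_ge0.
rewrite [leLHS]mulrC [leRHS]mulrA; apply: ler_wpM2r; first exact: expR_ge0.
have bound (c u v : R) : `|c| <= 1 -> `|c * ((1 + e * x) * u + v)| <= (`|u| + `|v|) * (1 + e * x).
  move=> c1; rewrite normrM; apply: (le_trans (ler_wpM2r _ c1)) => //.
  rewrite mul1r; apply: (le_trans (ler_normD _ _)); rewrite normrM mulrDl.
  rewrite (ger0_norm (_ : 0 <= 1 + e * x)) ?addr_ge0// [(1 + _) * _]mulrC lerD2l.
  by rewrite mulrDr mulr1 lerDl mulr_ge0.
apply: (le_trans (ler_normB _ _)); rewrite /A [leRHS]mulrDl; apply: lerD; apply: bound.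
- by rewrite ler_norml cos_geN1 cos_le1.
- by rewrite ler_norml sin_geN1 sin_le1.
Qed.

Lemma int_even_y (f F : R -> R) l : (forall x, 0 <= x -> 0 <= f x) ->
  continuous f -> (forall x : R, is_derive x 1 F (f x)) ->
  F x @[x --> +oo] --> l ->
  (\int[leb]_x (f `|x|)%:E = (2 * (l - F 0%R))%:E)%E.
Proof.
move=> f0 cf dF Fl; rewrite ge0_symfun_integralT.
- rewrite EFinM -set_itvcy; congr (_ * _)%E; rewrite -(FTC_y f0 cf dF Fl).
  apply: eqint => x; rewrite inE /= in_itv /= andbT => x0.
  by rewrite ger0_norm.
- by move=> x; exact: f0.
- exact: continuous_abs_comp.
- by move=> x /=; rewrite normrN.
Qed.

Lemma int_Ek e : 0 < e -> (\int[leb]_x (Ek e x)%:E = (Pk e 0)%:E)%E.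
Proof.
move=> e0.
have -> : Pk e 0 = 2 * (0 - Gprim e 0).
  by rewrite /Gprim /Pk mulr0 oppr0 expR0 expr0n /= addr0; field; rewrite gt_eqF.
apply: (@int_even_y (fun y => (1 + e * y) * expR (- (e * y))) (Gprim e) 0).
- by move=> x x0; rewrite mulr_ge0 ?expR_ge0// addr_ge0// mulr_ge0// ltW.
- eapply der_continuous => x; der.
- by move=> x; exact: der_Gprim.
- exact: Gprim_cvg.
Qed.

Lemma Ek_integrable e : 0 < e -> leb.-integrable setT (EFin \o Ek e).
Proof.
move=> e0; apply/integrableP; split; first by apply/mEFin; exact: meas_Ek.
under eqint do rewrite /= ger0_norm ?Ek_ge0//.
by rewrite int_Ek// ltry.
Qed.

(** The summand 1 keeps the integrand nonnegative, as the half-line theorem requires; [FT_Ek]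
    subtracts it again. *)
Lemma int_Ek_cos1 e r : 0 < e ->
  (\int[leb]_x (Ek e x * (1 + cos (r * x)))%:E = (Pk e 0 + Pk e r)%:E)%E.
Proof.
move=> e0; have D := den_gt0 r e0.
have -> : Pk e 0 + Pk e r = 2 * (0 - (Gprim e 0 + Hprim e r 0)).
  rewrite /Gprim /Hprim /Pk !mulr0 oppr0 expR0 cos0 sin0 expr0n /= addr0.
  by field; rewrite !gt_eqF.
have := @int_even_y (fun y => (1 + e * y) * expR (- (e * y)) * (1 + cos (r * y)))
  (fun y => Gprim e y + Hprim e r y) 0.
under eqint.
  move=> x _; rewrite (_ : cos (r * `|x|) = cos (r * x)); last first.
    by case: (ger0P x) => // _; rewrite mulrN cosN.
  over.
apply.
- move=> x x0; apply: mulr_ge0; last by have := cos_geN1 (r * x); lra.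
  by rewrite mulr_ge0 ?expR_ge0// addr_ge0// mulr_ge0// ltW.
- eapply der_continuous => x; der.
- move=> x; apply: (der_eq (derD (der_Gprim x e0) (der_Hprim r x e0))).
  by rewrite mulrDr mulr1.
- by rewrite -[X in _ --> X]addr0; apply: cvgD; [exact: Gprim_cvg|exact: Hprim_cvg].
Qed.

Lemma Ek_expi_integrable e r : 0 < e ->
  cintg leb (fun x => expi (x * r) * (Ek e x)%:C%C).
Proof.
move=> e0; apply: (@cintgM _ _ _ _ _ _ 1).
- by apply: cmeas_expi; exact: mfunM.
- by move=> x; rewrite normc_expi.
- by apply: cintg_real; exact: Ek_integrable.
Qed.

Lemma FT_Ek e r : 0 < e ->
  cint leb (fun x => expi (x * r) * (Ek e x)%:C%C) = (Pk e r)%:C%C.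
Proof.
move=> e0; have [I1 I2] := Ek_expi_integrable r e0.
rewrite /cint /cintegral; congr Complex.
- transitivity ((\int[leb]_x (Ek e x * (1 + cos (r * x))) - \int[leb]_x (Ek e x))%R).
    rewrite -RintegralB//.
    - apply: eq_Rintegral => x _. by rewrite cReM /= [x * r]mulrC; ring.
    - apply/integrableP; split.
        apply/mEFin; apply: mfunM; first exact: meas_Ek.
        apply: mfunD => //; apply: contm.
        eapply der_continuous => x; der.
      under eqint => x _.
        rewrite /= ger0_norm; last first.
          by rewrite mulr_ge0 ?Ek_ge0//; have := cos_geN1 (r * x); lra.
        over.
      by rewrite int_Ek_cos1// ltry.
    - exact: Ek_integrable.
  by rewrite /Rintegral int_Ek_cos1// int_Ek//=; lra.
- apply: Rintegral_odd => //.
    by apply/mEFin; exact: measurable_int I2.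
  by move=> x; rewrite !cImM /= mulNr sinN /Ek normrN; ring.
Qed.

End kernels.

Section fatou_le.
Context {R : realType} d (T : measurableType d) (mu : {measure set T -> \bar R}).
Local Open Scope ereal_scope.

Lemma fatou_le (f : nat -> T -> \bar R) (g : T -> \bar R) (C : \bar R) :
  (forall i, measT (f i)) -> (forall i x, 0 <= f i x) ->
  (forall x, f ^~ x @ \oo --> g x) -> (forall i, \int[mu]_x f i x <= C) ->
  \int[mu]_x g x <= C.
Proof.
move=> mf f0 fg fC.
have -> : \int[mu]_x g x = \int[mu]_x limn_einf (f ^~ x).
  by apply: eqint => x _; rewrite (cvg_limn_einf_sup (fg x)).1.
apply: le_trans; first by apply: fatou => // i x _; exact: f0.
rewrite limn_einf_lim; apply: lime_le; first exact: is_cvg_einfs.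
apply: nearW => i; apply: le_trans (fC i).
by apply: ereal_inf_lbound; exists i => /=.
Qed.

Lemma RintE (f : T -> R) :
  mu.-integrable setT (EFin \o f) -> \int[mu]_x (f x)%:E = (\int[mu]_x f x)%R%:E.
Proof. by move=> If; rewrite fineK//; exact: integrable_fin_num. Qed.
End fatou_le.

(** * Bessel and Parseval inequalities for a general phase *)

Section FT.
Context {R : realType} d1 d2 (T1 : measurableType d1) (T2 : measurableType d2).
Variables (mu : {sigma_finite_measure set T1 -> \bar R}).
Variables (nu : {sigma_finite_measure set T2 -> \bar R}).
Variables (ph : T2 * T1 -> R) (mph : measT ph).
Local Notation mumu := (sprod mu mu).
Local Open Scope complex_scope.
Implicit Types (w v u : T1 -> R[i]).

(** Phase and measures stay abstract because the theory is used twice: with the phase [X * be x] on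
    a line and the density [p = be'], and with the inner product of R^n and the density 1. *)
Definition FT w X := cint mu (fun xi => expi (ph (X, xi)) * w xi).

Lemma FT_integrable w X : cintg mu w ->
  cintg mu (fun xi => expi (ph (X, xi)) * w xi).
Proof.
move=> iw; apply: (@cintgM _ _ _ _ _ _ 1) => //.
- apply: cmeas_expi; exact: (mcomp mph (mpair1 X)).
- by move=> x; rewrite normc_expi.
Qed.

Lemma cmeas_FT w : cmeas w -> cmeas (FT w).
Proof.
move=> mw; apply: (cmeas_cint mu (F := fun z => expi (ph z) * w z.2)).
by apply: cmeasM; [exact: cmeas_expi|exact: (cmeas_comp mw)].
Qed.

Section one_kernel.
Variables (E : T2 -> R) (P : T1 -> T1 -> R).
Hypotheses (mE : measT E) (E0 : forall X, 0 <= E X).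
Hypothesis (IE : nu.-integrable setT (EFin \o E)).
Hypothesis HK : forall xi zeta,
  cint nu (fun X => expi (ph (X, xi) - ph (X, zeta)) * (E X)%:C) = (P xi zeta)%:C.

Let IE' : (\int[nu]_X (E X)%:E < +oo)%E.
Proof.
have /integrableP[_] := IE; congr (_ < _)%E.
by apply: eqint => X _; rewrite /= ger0_norm.
Qed.

(** Fubini's theorem in (X, xi, zeta); the [X]-integral is evaluated by [HK], which turns the cutoff
    [E] into the kernel [P]. *)
Lemma FT_pair w v : cintg mu w -> cintg mu v ->
  cintg (mu \x mu)%E (fun q => w q.1 * (conjc (v q.2)) * (P q.1 q.2)%:C) /\
  cintg nu (fun X => FT w X * (conjc (FT v X)) * (E X)%:C) /\
  cint nu (fun X => FT w X * (conjc (FT v X)) * (E X)%:C) =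
  cint (mu \x mu)%E (fun q => w q.1 * (conjc (v q.2)) * (P q.1 q.2)%:C).
Proof.
move=> iw iv; have iv' := cintg_conj iv.
pose h (z : T2 * (T1 * T1)) := expi (ph (z.1, z.2.1) - ph (z.1, z.2.2)).
pose F (z : T2 * (T1 * T1)) := h z * ((E z.1)%:C * (w z.2.1 * (conjc (v z.2.2)))).
have iF : cintg (nu \x mumu)%E F.
  apply: (@cintgM _ _ _ _ _ _ 1).
  - apply: cmeas_expi; apply: mfunB; apply: (mcomp mph);
      by apply: mpair => //; exact: mcomp.
  - by move=> z; rewrite normc_expi.
  - apply: (@cintg_mulX _ _ _ _ _ nu mumu (fun X => (E X)%:C)
      (fun q => w q.1 * (conjc (v q.2)))).
      exact: cintg_real.
    exact: (cintg_mulX iw iv').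
have E1 X : cint (mu \x mu)%E (fun q => F (X, q)) = FT w X * (conjc (FT v X)) * (E X)%:C.
  rewrite /FT -(cint_conj (FT_integrable X iv)).
  rewrite -(cint_mulX (FT_integrable X iw) (cintg_conj (FT_integrable X iv))).
  rewrite -cintZr.
    apply: eq_cint => q; rewrite /F /h /= conjcM conj_expi expiD /=; ring.
  exact: (cintg_mulX (FT_integrable X iw) (cintg_conj (FT_integrable X iv))).
have E2 q : cint nu (fun X => F (X, q)) = w q.1 * (conjc (v q.2)) * (P q.1 q.2)%:C.
  rewrite -HK -cintZl.
    apply: eq_cint => X; rewrite /F /h /=; ring.
  apply: (@cintgM _ _ _ _ _ _ 1); last exact: cintg_real.
    apply: cmeas_expi; apply: mfunB;
      exact: (mcomp mph (mpair2 _)).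
  by move=> X; rewrite normc_expi.
split; [|split].
- have := iF; move=> /cintgP[mF FF]; apply/cintgP; split.
    have := @cmeas_cint _ _ _ _ _ nu (fun z => F (z.2, z.1)).
    rewrite (_ : (fun x => _) = (fun q => w q.1 * (conjc (v q.2)) * (P q.1 q.2)%:C)).
      apply; apply: (cmeas_comp mF); exact: measurable_swap.
    by apply/funext => q; exact: E2.
  apply: le_lt_trans FF; rewrite [X in (_ <= X)%E]fubini_tonelli2//; first last.
  + by move=> x; rewrite lee_fin nc_ge0.
  + by apply/mEFin; exact: (mnormc mF).
  apply: ge0_le_integral => //.
  + by move=> x _; rewrite lee_fin nc_ge0.
  + apply/mEFin; apply: mnormc.
    have := @cmeas_cint _ _ _ _ _ nu (fun z => F (z.2, z.1)).
    rewrite (_ : (fun x => _) = (fun q => w q.1 * (conjc (v q.2)) * (P q.1 q.2)%:C)).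
      apply; apply: (cmeas_comp mF); exact: measurable_swap.
    by apply/funext => q; exact: E2.
  + apply: (@measurable_fun_fubini_tonelli_G _ _ _ _ _ nu
      (fun z => (normc (F z))%:E)).
      by apply/mEFin; exact: (mnormc mF).
    by move=> x; rewrite lee_fin nc_ge0.
  + move=> q _; rewrite -E2; apply: le_normc_cint.
    apply/cintgP; split; first exact: (cmeas_comp mF (mpair2 _)).
    rewrite (_ : (fun X => _) = (fun X => (normc (w q.1 * (conjc (v q.2))))%:E * (E X)%:E)%E).
      rewrite ge0_integralZl//.
      * by rewrite lte_mul_pinfty// lee_fin nc_ge0.
      * exact/mEFin.
      * by move=> X _; rewrite lee_fin.
      * by rewrite lee_fin nc_ge0.
    apply/funext => X; rewrite /F /h -EFinM; congr EFin.
    by rewrite !Normc.normcM normc_expi mul1r normc_real ger0_norm// mulrC.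
- have := cintg_cint1 iF.
  by rewrite (_ : (fun x => _) = (fun X => FT w X * (conjc (FT v X)) * (E X)%:C))//;
    apply/funext => X; exact: E1.
- transitivity (cint nu (fun X => cint mumu (fun q => F (X, q)))).
    by apply: eq_cint => X; rewrite -E1.
  by rewrite (cint_Fubini iF); apply: eq_cint => q; exact: E2.
Qed.

Variables (p : T1 -> R) (c : R).
Hypotheses (mp : measT p) (p0 : forall xi, 0 <= p xi) (c0 : 0 <= c).
Hypotheses (P0 : forall xi zeta, 0 <= P xi zeta)
  (Psym : forall xi zeta, P xi zeta = P zeta xi)
  (mP : measT (fun q => P q.1 q.2)).
Hypothesis IP : forall xi, (\int[mu]_zeta (P xi zeta * p zeta)%:E = c%:E)%E.

Definition L2p u := cintg mu (fun xi => u xi * (p xi)%:C) /\ cmeas u /\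
  (\int[mu]_xi (sqn (u xi) * p xi)%:E < +oo)%E.

Let K (q : T1 * T1) := P q.1 q.2 * p q.1 * p q.2.
Let mK : measT K.
Proof.
by apply: mfunM; [apply: mfunM => //|]; exact: mcomp.
Qed.
Let K0 q : 0 <= K q. Proof. by rewrite !mulr_ge0. Qed.

Lemma intK1 (f : T1 -> R) : measT f -> (forall x, 0 <= f x) ->
  (\int[mu \x mu]_q (f q.1 * K q)%:E = c%:E * \int[mu]_x (f x * p x)%:E)%E.
Proof.
move=> mf f0; rewrite fubini_tonelli1//=; last 2 first.
- by apply/mEFin; apply: mfunM => //; exact: mcomp.
- by move=> q; rewrite lee_fin mulr_ge0.
rewrite -ge0_integralZl//; last 2 first.
- by apply/mEFin; exact: mfunM.
- by move=> x _; rewrite lee_fin mulr_ge0.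
apply: eqint => x _; rewrite /fubini_F -(IP x) muleC -ge0_integralZl//=.
- by apply: eqint => y _; rewrite -EFinM /K /=; congr EFin; ring.
- apply/mEFin; apply: mfunM => //.
  exact: (mcomp mP (mpair1 x)).
- by move=> y _; rewrite lee_fin mulr_ge0.
- by rewrite lee_fin mulr_ge0.
Qed.

Lemma intK2 (f : T1 -> R) : measT f -> (forall x, 0 <= f x) ->
  (\int[mu \x mu]_q (f q.2 * K q)%:E = c%:E * \int[mu]_x (f x * p x)%:E)%E.
Proof.
move=> mf f0; rewrite -(intK1 mf f0).
have m1 : measT (fun q => (f q.1 * K q)%:E).
  by apply/mEFin; apply: mfunM => //; exact: mcomp.
have m2 : measT (fun q => (f q.2 * K q)%:E).
  by apply/mEFin; apply: mfunM => //; exact: mcomp.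
have h1 q : (0 <= (f q.1 * K q)%:E)%E by rewrite lee_fin mulr_ge0.
have h2 q : (0 <= (f q.2 * K q)%:E)%E by rewrite lee_fin mulr_ge0.
rewrite [LHS](@fubini_tonelli1 _ _ _ _ _ mu mu _ m2 h2) [RHS](@fubini_tonelli2 _ _ _ _ _ mu mu _ m1 h1).
apply: eqint => x _; apply: eqint => y _.
by rewrite /K /= Psym; congr EFin; ring.
Qed.

Lemma L2p_mul u v : L2p u -> L2p v -> cintg mu (fun xi => u xi * (conjc (v xi)) * (p xi)%:C).
Proof.
move=> [_ [mu1 Iu]] [_ [mv Iv]]; apply/cintgP; split.
  by apply: cmeasM; [apply: cmeasM => //; exact: cmeas_conj|exact: cmeas_real].
apply: (@le_lt_trans _ _ (\int[mu]_x ((sqn (u x) * p x)%:E + (sqn (v x) * p x)%:E))%E).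
  apply: ge0_le_integral => //.
  - by move=> x _; rewrite lee_fin nc_ge0.
  - apply/mEFin; apply: mnormc.
    by apply: cmeasM; [apply: cmeasM => //; exact: cmeas_conj|exact: cmeas_real].
  - by apply/mEFin; apply: mfunD; apply: mfunM => //;
      exact: msqn.
  - move=> x _; rewrite -EFinD lee_fin Normc.normcM normc_real ger0_norm// -mulrDl.
    apply: ler_wpM2r => //; apply: (le_trans (normcM_le _ _)); rewrite sqn_conj.
    by have := sqn_ge0 (u x); have := sqn_ge0 (v x); lra.
rewrite ge0_integralD//.
- by rewrite lte_add_pinfty.
- by move=> x _; rewrite lee_fin mulr_ge0 ?sqn_ge0.
- by apply/mEFin; apply: mfunM => //; exact: msqn.
- by move=> x _; rewrite lee_fin mulr_ge0 ?sqn_ge0.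
- by apply/mEFin; apply: mfunM => //; exact: msqn.
Qed.

(** The products are dominated by |u|^2 K and |v|^2 K, whose integrals the marginals of [K] reduce
    to weighted L2 norms. *)
Let prodI u v (s1 s2 : T1 * T1 -> T1) : (s1 = fst \/ s1 = snd) -> (s2 = fst \/ s2 = snd) ->
  L2p u -> L2p v -> cintg (mu \x mu)%E (fun q => u (s1 q) * (conjc (v (s2 q))) * (K q)%:C).
Proof.
move=> h1 h2 [_ [mu1 Iu]] [_ [mv Iv]].
have ms (s : T1 * T1 -> T1) : (s = fst \/ s = snd) -> measT s.
  by move=> [] ->.
have mm : cmeas (fun q => u (s1 q) * (conjc (v (s2 q))) * (K q)%:C).
  apply: cmeasM; last exact: cmeas_real.
  apply: cmeasM; first exact: (cmeas_comp mu1 (ms _ h1)).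
  by apply: cmeas_conj; exact: (cmeas_comp mv (ms _ h2)).
have b w s : (s = fst \/ s = snd) -> cmeas w -> (\int[mu]_xi (sqn (w xi) * p xi)%:E < +oo)%E ->
    (\int[mu \x mu]_q (sqn (w (s q)) * K q)%:E < +oo)%E.
  move=> [] -> mw Iw.
    rewrite (intK1 (msqn mw))//; last by move=> x; exact: sqn_ge0.
    by rewrite lte_mul_pinfty.
  rewrite (intK2 (msqn mw))//; last by move=> x; exact: sqn_ge0.
  by rewrite lte_mul_pinfty.
apply/cintgP; split => //.
apply: (@le_lt_trans _ _ (\int[mu \x mu]_q
  ((sqn (u (s1 q)) * K q)%:E + (sqn (v (s2 q)) * K q)%:E))%E).
  apply: ge0_le_integral => //.
  - by move=> x _; rewrite lee_fin nc_ge0.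
  - by apply/mEFin; exact: mnormc.
  - apply/mEFin; apply: mfunD; apply: mfunM => //;
      apply: msqn.
    + exact: (cmeas_comp mu1 (ms _ h1)).
    + exact: (cmeas_comp mv (ms _ h2)).
  - move=> x _; rewrite -EFinD lee_fin Normc.normcM normc_real ger0_norm// -mulrDl.
    apply: ler_wpM2r => //; apply: (le_trans (normcM_le _ _)); rewrite sqn_conj.
    by have := sqn_ge0 (u (s1 x)); have := sqn_ge0 (v (s2 x)); lra.
rewrite ge0_integralD//.
- by rewrite lte_add_pinfty// b.
- by move=> x _; rewrite lee_fin mulr_ge0 ?sqn_ge0.
- apply/mEFin; apply: mfunM => //; apply: msqn.
  exact: (cmeas_comp mu1 (ms _ h1)).
- by move=> x _; rewrite lee_fin mulr_ge0 ?sqn_ge0.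
- apply/mEFin; apply: mfunM => //; apply: msqn.
  exact: (cmeas_comp mv (ms _ h2)).
Qed.

Let KE q : K q = P q.1 q.2 * p q.1 * p q.2. Proof. by []. Qed.

Let diag u v : L2p u -> L2p v ->
  cint (mu \x mu)%E (fun q => u q.1 * (conjc (v q.1)) * (K q)%:C) =
  c%:C * cint mu (fun xi => u xi * (conjc (v xi)) * (p xi)%:C).
Proof.
move=> Lu Lv; rewrite cint_prod1; last exact: (prodI (or_introl erefl) (or_introl erefl)).
rewrite -cintZl; last exact: L2p_mul.
apply: eq_cint => x /=.
have IPR : (\int[mu]_y (P x y * p y))%R = c by rewrite /Rintegral IP.
rewrite -IPR -cint_real -cintZr.
  by apply: eq_cint => y; rewrite KE /= !creM /=; ring.
apply: cintg_real; apply/integrableP; split.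
  apply/mEFin; apply: mfunM => //.
  exact: (mcomp mP (mpair1 x)).
under eqint do rewrite /= ger0_norm ?mulr_ge0//.
by rewrite IP ltry.
Qed.

Let swapI (F : T1 * T1 -> R[i]) : cintg (mu \x mu)%E F ->
  cintg (mu \x mu)%E (fun q => F (q.2, q.1)) ->
  cint (mu \x mu)%E (fun q => F (q.2, q.1)) = cint (mu \x mu)%E F.
Proof. by move=> iF iF'; rewrite cint_prod2// cint_prod1. Qed.

(** By symmetry of [K], the off-diagonal product u(xi) conj(v(zeta)) may be replaced by half of u
    conj(v) at xi plus u conj(v) at zeta minus the product of the differences. The marginals of [K]
    being [c * p], the first two terms give the weighted L2 product, and the last one an energy of
    differences. *)
Lemma FT_ident u v : L2p u -> L2p v ->
  cintg (mu \x mu)%E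
    (fun q => (u q.1 - u q.2) * (conjc (v q.1 - v q.2)) * (P q.1 q.2 * p q.1 * p q.2)%:C) /\
  cint nu (fun X => FT (fun xi => u xi * (p xi)%:C) X *
     (conjc (FT (fun xi => v xi * (p xi)%:C) X)) * (E X)%:C) =
  c%:C * cint mu (fun xi => u xi * (conjc (v xi)) * (p xi)%:C)
  - (2^-1)%:C * cint (mu \x mu)%E
    (fun q => (u q.1 - u q.2) * (conjc (v q.1 - v q.2)) * (P q.1 q.2 * p q.1 * p q.2)%:C).
Proof.
move=> Lu Lv.
have I11 := prodI (or_introl erefl) (or_introl erefl) Lu Lv.
have I12 := prodI (or_introl erefl) (or_intror erefl) Lu Lv.
have I21 := prodI (or_intror erefl) (or_introl erefl) Lu Lv.
have I22 := prodI (or_intror erefl) (or_intror erefl) Lu Lv.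
have ED q : (u q.1 - u q.2) * (conjc (v q.1 - v q.2)) * (P q.1 q.2 * p q.1 * p q.2)%:C =
  (u q.1 * (conjc (v q.1)) * (K q)%:C + u q.2 * (conjc (v q.2)) * (K q)%:C)
  - (u q.1 * (conjc (v q.2)) * (K q)%:C + u q.2 * (conjc (v q.1)) * (K q)%:C).
  by rewrite -KE conjcB /=; ring.
have [_ [_ ->]] := FT_pair Lu.1 Lv.1.
have -> : cint (mu \x mu)%E (fun q => u q.1 * (p q.1)%:C * (conjc (v q.2 * (p q.2)%:C)) *
    (P q.1 q.2)%:C) = cint (mu \x mu)%E (fun q => u q.1 * (conjc (v q.2)) * (K q)%:C).
  by apply: eq_cint => q; rewrite KE !creM conjcM conjc_real; ring.
under eq_fun do rewrite ED.
split.
  by apply: cintgB; exact: cintgD.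
rewrite cintB; [|exact: cintgD..].
rewrite !cintD// (diag Lu Lv).
have swp q : K (q.2, q.1) = K q by rewrite /K /= Psym; ring.
have -> : cint (mu \x mu)%E (fun q => u q.2 * (conjc (v q.2)) * (K q)%:C) =
    c%:C * cint mu (fun xi => u xi * (conjc (v xi)) * (p xi)%:C).
  rewrite -(diag Lu Lv) -swapI//.
    by apply: eq_cint => q; rewrite /= swp.
  by under eq_fun do rewrite /= swp.
have -> : cint (mu \x mu)%E (fun q => u q.2 * (conjc (v q.1)) * (K q)%:C) =
    cint (mu \x mu)%E (fun q => u q.1 * (conjc (v q.2)) * (K q)%:C).
  rewrite -[RHS]swapI//.
    by apply: eq_cint => q; rewrite /= swp.
  by under eq_fun do rewrite /= swp.
set a := _ * cint mu _; set b := cint _ _.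
have h : (2^-1)%:C + (2^-1)%:C = 1 :> R[i].
  by have hh : 2^-1 + 2^-1 = 1 :> R; [field|rewrite -creD hh].
transitivity (a - ((2^-1)%:C + (2^-1)%:C) * (a - b)); first by rewrite h; ring.
ring.
Qed.

Lemma FT_quad u : L2p u ->
  (\int[nu]_X (sqn (FT (fun xi => u xi * (p xi)%:C)%R X) * E X)%:E
   + (2^-1)%:E * \int[mu \x mu]_q (sqn (u q.1 - u q.2)%R * (P q.1 q.2 * p q.1 * p q.2))%:E
   = c%:E * \int[mu]_xi (sqn (u xi) * p xi)%:E)%E.
Proof.
move=> Lu; have [I1 H] := FT_ident Lu Lu.
have [_ [I2 _]] := FT_pair Lu.1 Lu.1.
have I3 := L2p_mul Lu Lu.
set w := fun xi => u xi * (p xi)%:C in H I2 *.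
have E1 : (fun X => FT w X * conjc (FT w X) * (E X)%:C) =
    (fun X => (sqn (FT w X) * E X)%:C).
  by apply/funext => X; rewrite mulc_conj -creM.
have E2 : (fun q : T1 * T1 => (u q.1 - u q.2) * conjc (u q.1 - u q.2) *
    (P q.1 q.2 * p q.1 * p q.2)%:C) =
    (fun q => (sqn (u q.1 - u q.2) * (P q.1 q.2 * p q.1 * p q.2))%:C).
  by apply/funext => X; rewrite mulc_conj -creM.
have E3 : (fun x => u x * conjc (u x) * (p x)%:C) = (fun x => (sqn (u x) * p x)%:C).
  by apply/funext => X; rewrite mulc_conj -creM.
rewrite E1 in H I2; rewrite E2 in H I1; rewrite E3 in H I3.
rewrite (RintE I1.1) (RintE I2.1) (RintE I3.1) -!EFinM -EFinD; congr EFin.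
move: H; rewrite !cint_real -!creM -creB => -[] /= ->; ring.
Qed.
End one_kernel.

Section kernels.
Variables (E : nat -> T2 -> R) (P : nat -> T1 -> T1 -> R).
Hypotheses (mE : forall i, measT (E i)) (E0 : forall i X, 0 <= E i X)
  (E1 : forall i X, E i X <= 1) (IE : forall i, nu.-integrable setT (EFin \o E i)).
Hypothesis HK : forall i xi zeta,
  cint nu (fun X => expi (ph (X, xi) - ph (X, zeta)) * (E i X)%:C) = (P i xi zeta)%:C.
Variables (p : T1 -> R) (c : R).
Hypotheses (mp : measT p) (p0 : forall xi, 0 <= p xi) (c0 : 0 <= c).
Hypotheses (P0 : forall i xi zeta, 0 <= P i xi zeta)
  (Psym : forall i xi zeta, P i xi zeta = P i zeta xi)
  (mP : forall i, measT (fun q => P i q.1 q.2)).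
Hypothesis IP : forall i xi, (\int[mu]_zeta (P i xi zeta * p zeta)%:E = c%:E)%E.
Hypothesis E_lim : forall X, E i X @[i --> \oo] --> (1 : R).
Local Open Scope ereal_scope.

Let FTp u := FT (fun xi => (u xi * (p xi)%:C)%R).
Let S u := \int[mu]_xi (sqn (u xi) * p xi)%:E.

Definition dir i u :=
  \int[mu \x mu]_q (sqn (u q.1 - u q.2)%R * (P i q.1 q.2 * p q.1 * p q.2))%:E.

Let S_ge0 u : 0 <= S u.
Proof. by apply: intg_ge0 => x _; rewrite lee_fin mulr_ge0 ?sqn_ge0. Qed.

Let dir_ge0 i u : 0 <= dir i u.
Proof. by apply: intg_ge0 => x _; rewrite lee_fin !mulr_ge0 ?sqn_ge0. Qed.

Let quad i u : L2p p u ->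
  \int[nu]_X (sqn (FTp u X) * E i X)%:E + (2^-1)%:E * dir i u = c%:E * S u.
Proof. exact: (FT_quad (mE i) (E0 i) (IE i) (HK i) mp p0 c0 (P0 i) (Psym i) (mP i) (IP i)). Qed.

Let mFTp u : L2p p u -> cmeas (FTp u).
Proof.
by move=> [iu [mu1 _]]; apply: cmeas_FT; apply: cmeasM => //; exact: cmeas_real.
Qed.

(** The energy in [FT_quad] is nonnegative, so the transform cut off by any [E i] obeys the bound;
    Fatou's lemma removes the cutoff. *)
Lemma FT_bessel u : L2p p u ->
  \int[nu]_X (sqn (FTp u X))%:E <= c%:E * \int[mu]_xi (sqn (u xi) * p xi)%:E.
Proof.
move=> Lu; apply: (@fatou_le _ _ _ _ (fun i X => (sqn (FTp u X) * E i X)%:E)).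
- move=> i; apply/mEFin; apply: mfunM => //.
  by apply: msqn; exact: mFTp.
- by move=> i X; rewrite lee_fin mulr_ge0 ?sqn_ge0.
- move=> X; apply: cvg_EFin; first by apply: nearW.
  rewrite -[X in _ --> X]mulr1; apply: cvgM; first exact: cvg_cst.
  exact: E_lim.
- by move=> i; rewrite -/(S u) -(quad i Lu) leeDl// mule_ge0// lee_fin.
Qed.

(** In [FT_bessel] the left side splits into the integrals against [E i] and [1 - E i]. Subtracting
    the identity [FT_quad] cancels the first, which is finite: the part of the transform at large
    [X] is paid for by the energy at scale [i]. *)
Lemma FT_dir i u : L2p p u ->
  \int[nu]_X (sqn (FTp u X) * (1 - E i X))%:E <= (2^-1)%:E * dir i u.
Proof.
move=> Lu; have Sfin : c%:E * S u < +oo by rewrite lte_mul_pinfty// Lu.2.2.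
pose A := \int[nu]_X (sqn (FTp u X) * E i X)%:E.
have A0 : 0 <= A by apply: intg_ge0 => X _; rewrite lee_fin mulr_ge0 ?sqn_ge0.
have Afin : A \is a fin_num.
  rewrite ge0_fin_numE//; apply: le_lt_trans Sfin.
  by rewrite -(quad i Lu) leeDl// mule_ge0// lee_fin.
rewrite -(leeD2rE _ _ Afin) addeC [leRHS]addeC quad//.
apply: le_trans (FT_bessel Lu).
rewrite /A -ge0_integralD//.
- by under eqint do rewrite -EFinD -mulrDr addrC subrK mulr1.
- by move=> X _; rewrite lee_fin mulr_ge0 ?sqn_ge0.
- apply/mEFin; apply: mfunM => //.
  by apply: msqn; exact: mFTp.
- by move=> X _; rewrite lee_fin mulr_ge0 ?sqn_ge0// subr_ge0.
- apply/mEFin; apply: mfunM; last exact: mfunB.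
  by apply: msqn; exact: mFTp.
Qed.

Lemma dir_le i u : L2p p u -> dir i u <= (2 * c)%:E * S u.
Proof.
move=> Lu; rewrite EFinM -muleA -(quad i Lu) ge0_muleDr//.
- rewrite muleA -EFinM mulfV ?pnatr_eq0// mul1e leeDr// mule_ge0//.
  by apply: intg_ge0 => X _; rewrite lee_fin mulr_ge0 ?sqn_ge0.
- by apply: intg_ge0 => X _; rewrite lee_fin mulr_ge0 ?sqn_ge0.
- by rewrite mule_ge0// lee_fin.
Qed.

(** The polarized identity is used at a scale where the energy of [u] is negligible. The mixed
    energy is then small by Young's inequality, because the energy of [v] is bounded uniformly in
    the scale by [dir_le]. *)
Lemma FT_parseval u v : L2p p u -> L2p p v ->
  (forall eps : R, (0 < eps)%R -> exists i, dir i u <= eps%:E) ->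
  (c * normc (cint mu (fun xi => u xi * conjc (v xi) * (p xi)%:C)%R))%:E <=
  \int[nu]_X (normc (FTp u X) * normc (FTp v X))%:E.
Proof.
move=> Lu Lv Hu; apply/lee_addgt0Pr => eps eps0.
have Sv : S v \is a fin_num by rewrite ge0_fin_numE// Lv.2.2.
pose s := fine (S v).
have s0 : (0 <= s)%R by rewrite fine_ge0.
(* Parameter of Young's inequality: [kap] times the bound [2 * c * s] for the energy of [v] is at
   most [eps]. *)
pose kap := (eps / (1 + 2 * c * s))%R.
have kap0 : (0 < kap)%R.
  by rewrite divr_gt0// ltr_wpDr// !mulr_ge0.
have kapE : kap = (eps / (1 + 2 * c * s))%R by [].
clearbody kap.
have [i hi] := Hu (eps * kap)%R (mulr_gt0 eps0 kap0).
have [I1 H] := FT_ident (mE i) (E0 i) (IE i) (HK i) mp p0 c0 (P0 i) (Psym i) (mP i) (IP i) Lu Lv.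
have [_ [I2 _]] := FT_pair (mE i) (E0 i) (IE i) (HK i) Lu.1 Lv.1.
rewrite -/(FTp u) -/(FTp v) in H I2.
pose w (q : T1 * T1) := ((u q.1 - u q.2) * conjc (v q.1 - v q.2) *
  (P i q.1 q.2 * p q.1 * p q.2)%:C)%R.
rewrite -/w in H I1.
pose I := cint mu (fun xi => u xi * conjc (v xi) * (p xi)%:C)%R.
rewrite -/I in H *.
have -> : (c * normc I)%R = normc (c%:C * I)%R.
  by rewrite Normc.normcM normc_real ger0_norm.
have -> : (c%:C * I = cint nu (fun X => FTp u X * conjc (FTp v X) * (E i X)%:C) +
     (2^-1)%:C * cint (mu \x mu)%E w)%R by rewrite H; ring.
apply: (@le_trans _ _ ((normc (cint nu (fun X => FTp u X * conjc (FTp v X) * (E i X)%:C)%R))%:E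
   + (2^-1)%:E * (normc (cint (mu \x mu)%E w))%:E)).
  rewrite -EFinM -EFinD lee_fin; apply: (le_trans (le_normcD _ _)).
  by rewrite Normc.normcM normc_real ger0_norm.
apply: leeD.
  apply: (le_trans (le_normc_cint I2)); apply: ge0_le_integral => //.
  - by move=> X _; rewrite lee_fin nc_ge0.
  - apply/mEFin; apply: mnormc; exact: cintg_meas I2.
  - by apply/mEFin; apply: mfunM; apply: mnormc; exact: mFTp.
  - move=> X _; rewrite lee_fin !Normc.normcM normc_conj normc_real ger0_norm//.
    by rewrite ler_piMr// mulr_ge0 ?nc_ge0.
have dv : dir i v <= (2 * c * s)%:E by rewrite EFinM fineK//; exact: dir_le.
have K0 q : (0 <= P i q.1 q.2 * p q.1 * p q.2)%R by rewrite !mulr_ge0.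
have mK : measT (fun q : T1 * T1 => P i q.1 q.2 * p q.1 * p q.2)%R.
  by apply: mfunM; [apply: mfunM => //|]; exact: mcomp.
have mD f : L2p p f -> measT (fun q : T1 * T1 => sqn (f q.1 - f q.2)%R *
    (P i q.1 q.2 * p q.1 * p q.2))%R.
  move=> [_ [mf _]]; apply: mfunM => //; apply: msqn.
  by apply: cmeasB; exact: (cmeas_comp mf).
have step : (normc (cint (mu \x mu)%E w))%:E <=
    (2^-1 / kap)%:E * dir i u + (2^-1 * kap)%:E * dir i v.
  apply: (le_trans (le_normc_cint I1)).
  rewrite -!ge0_integralZl//; first last.
  - by rewrite lee_fin mulr_ge0// invr_ge0 ltW.
  - by move=> q _; rewrite lee_fin mulr_ge0 ?sqn_ge0.
  - by apply/mEFin; exact: mD.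
  - by rewrite lee_fin mulr_ge0// ltW.
  - by move=> q _; rewrite lee_fin mulr_ge0 ?sqn_ge0.
  - by apply/mEFin; exact: mD.
  rewrite -ge0_integralD//; first last.
  - by apply: mfuneM; apply/mEFin; exact: mD.
  - move=> q _; rewrite -EFinM lee_fin; apply: mulr_ge0; last by rewrite mulr_ge0 ?sqn_ge0.
    by rewrite mulr_ge0 ?invr_ge0// ltW.
  - by apply: mfuneM; apply/mEFin; exact: mD.
  - move=> q _; rewrite -EFinM lee_fin; apply: mulr_ge0; last by rewrite mulr_ge0 ?sqn_ge0.
    by rewrite mulr_ge0 ?invr_ge0// ltW.
  apply: ge0_le_integral => //.
  - by move=> X _; rewrite lee_fin nc_ge0.
  - apply/mEFin; apply: mnormc; exact: cintg_meas I1.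
  - by apply: emeasurable_funD; apply: mfuneM; apply/mEFin; exact: mD.
  - move=> q _; rewrite -!EFinM -EFinD lee_fin /w !Normc.normcM normc_conj normc_real.
    rewrite ger0_norm//; have := K0 q; move: (_ * _ * p q.2)%R => k k0.
    rewrite !mulrA -mulrDl; apply: ler_wpM2r => //.
    rewrite -!normc_sqrE; set x := normc _; set y := normc _.
    have : (0 <= (x / kap - y) ^+ 2 * kap)%R by rewrite mulr_ge0 ?sqr_ge0 ?ltW.
    rewrite (_ : (_ ^+ 2 * kap = x ^+ 2 / kap - 2 * (x * y) + kap * y ^+ 2)%R); first by lra.
    by field; rewrite gt_eqF.
apply: (le_trans (lee_wpmul2l _ step)); first by rewrite lee_fin.
apply: (@le_trans _ _ (2^-1 * (2^-1 / kap * (eps * kap) + 2^-1 * kap * (2 * c * s)))%R%:E).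
  rewrite [leRHS]EFinM [in leRHS]EFinD [in leRHS](EFinM (2^-1 / kap)) [in leRHS](EFinM (2^-1 * kap)).
  apply: lee_wpmul2l; first by rewrite lee_fin.
  by apply: leeD; apply: lee_wpmul2l => //; rewrite lee_fin mulr_ge0// ?invr_ge0 ltW.
rewrite lee_fin.
have -> : (2^-1 / kap * (eps * kap) = 2^-1 * eps)%R by field; rewrite gt_eqF.
have : (kap * (2 * c * s) <= eps)%R.
  have cs : (0 <= 2 * c * s)%R by rewrite !mulr_ge0.
  by rewrite kapE mulrAC ler_pdivrMr ?ltr_wpDr// ler_wpM2l ?(ltW eps0)// lerDr.
by lra.
Qed.

End kernels.
End FT.

(** * Dyadic scales and the integrable weight *)

Section geometric.
Context {R : realType}.
Local Open Scope ereal_scope.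

Lemma nneseries_le (f : nat -> \bar R) (C : \bar R) : (forall i, 0 <= f i) ->
  (forall n, \sum_(0 <= i < n) f i <= C) -> \sum_(i <oo) f i <= C.
Proof.
move=> f0 H; apply: lime_le; first by apply: is_cvg_nneseries => *; exact: f0.
exact: nearW.
Qed.

Lemma nneseries_term (f : nat -> \bar R) i : (forall i, 0 <= f i) ->
  f i <= \sum_(i <oo) f i.
Proof.
move=> f0; apply: (@le_trans _ _ (\sum_(0 <= k < i.+1) f k)).
  by rewrite big_nat_recr//= leeDr// sume_ge0.
by apply: nneseries_lim_ge => *; exact: f0.
Qed.

End geometric.

Section weight.
Context {R : realType}.
Local Notation leb := (@lebesgue_measure R).

Definition e_ (i : nat) : R := 2^-1 ^+ i.

Lemma e_gt0 i : 0 < e_ i. Proof. by rewrite exprn_gt0. Qed.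

Lemma Ek_lim (X : R) : Ek (e_ i) X @[i --> \oo] --> (1 : R).
Proof.
have c : continuous (fun t : R => (1 + t) * expR (- t)).
  by eapply der_continuous => x; der.
have := c 0; rewrite /continuous_at addr0 oppr0 expR0 mulr1 => c0.
apply: (cvg_comp (fun i => e_ i * `|X|) (fun t : R => (1 + t) * expR (- t))); last exact: c0.
rewrite -(mul0r `|X|); apply: cvgM; last exact: cvg_cst.
by apply: cvg_expr; rewrite ger0_norm//; lra.
Qed.

Lemma dyadic_shell (X : R) : `|X| < 1 \/ exists i, 2 ^+ i <= `|X| < 2 ^+ i.+1.
Proof.
have [k hk] : exists k : nat, `|X| < 2 ^+ k.
  exists (Num.trunc `|X|).+1; apply: (lt_trans (truncnS_gt _)).
  by rewrite -natrX ltr_nat ltn_expl.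
elim: k hk => [|k IH] hk; first by left; rewrite expr0 in hk.
have [h|h] := ltP `|X| (2 ^+ k); first exact: IH.
by right; exists k; rewrite h.
Qed.

Definition cell (i : nat) : set R := `](- 2 ^+ i)%R, (2 ^+ i)%R[%classic.

Variable rho : R.
Hypothesis rho2 : 2 < rho.

Let rho0 : 0 < rho. Proof. by have := rho2; lra. Qed.

(** Comparable to <X>^(-log_2 rho): of size rho^-i where |X| is about 2^i. It is therefore
    integrable exactly because [rho] exceeds 2. *)
Definition omE (X : R) : \bar R :=
  (\sum_(i <oo) (rho ^- i * \1_(cell i) X)%:E)%E.

Definition om X : R := fine (omE X).

Let term_ge0 i X : (0 <= (rho ^- i * \1_(cell i) X)%:E)%E.
Proof. by rewrite lee_fin mulr_ge0// invr_ge0 exprn_ge0// ltW. Qed.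

Lemma geometric_lty (z : R) : 0 <= z -> z < 1 -> (\sum_(i <oo) (z ^+ i)%:E < +oo)%E.
Proof.
move=> z0 z1; apply: (@le_lt_trans _ _ ((1 - z)^-1)%:E); last exact: ltry.
apply: nneseries_le => [i|n]; first by rewrite lee_fin exprn_ge0.
rewrite sumEFin lee_fin -[leRHS]mul1r ler_pdivlMr ?subr_gt0//.
rewrite big_mkord mulrC -opprB mulNr -subrX1 opprB.
by rewrite gerBl exprn_ge0.
Qed.

Lemma omE_lty X : (omE X < +oo)%E.
Proof.
apply: (@le_lt_trans _ _ (\sum_(i <oo) (rho^-1 ^+ i)%:E)%E); last first.
  by apply: geometric_lty; rewrite ?invr_ge0 ?(ltW rho0)// invf_lt1//; have := rho2; lra.
apply: lee_nneseries => [i _ _|i _]; first exact: term_ge0.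
rewrite lee_fin exprVn ler_piMr ?invr_ge0 ?exprn_ge0 ?(ltW rho0)//.
Qed.

Lemma omEE X : (om X)%:E = omE X.
Proof.
rewrite /om fineK// ge0_fin_numE ?omE_lty//.
by apply: nneseries_ge0 => *; exact: term_ge0.
Qed.

Lemma om_ge X i : `|X| < 2 ^+ i -> rho ^- i <= om X.
Proof.
move=> hX; rewrite -lee_fin omEE; apply: le_trans (nneseries_term i _); last first.
  by move=> k; exact: term_ge0.
by rewrite lee_fin indicE mem_set ?mulr1// /cell /= in_itv /= -ltr_norml.
Qed.

Lemma om_gt0 X : 0 < om X.
Proof.
have [h|[i /andP[_ h]]] := dyadic_shell X.
  by apply: lt_le_trans (@om_ge X 0 _); rewrite ?expr0// invr1.
by apply: lt_le_trans (om_ge h); rewrite invr_gt0 exprn_gt0.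
Qed.

Lemma meas_om : measT om.
Proof.
apply: (mcomp (fine_measurable measurableT)).
apply: ge0_emeasurable_sum => [i x _|i _]; first by move=> _; exact: term_ge0.
by apply/mEFin; apply: mfunM => //; apply: mindic; exact: measurable_itv.
Qed.

Lemma meas_om_inv : measT (fun X => (om X)^-1).
Proof.
under eq_fun do rewrite -powR_inv1 ?(ltW (om_gt0 _))//.
exact: (mcomp (measurable_powR _) meas_om).
Qed.

Lemma int_om_lty : (\int[leb]_X (om X)%:E < +oo)%E.
Proof.
under eqint do rewrite omEE.
rewrite integral_nneseries//; first last.
- by move=> i; apply/mEFin; apply: mfunM => //;
    apply: mindic; exact: measurable_itv.
apply: (@le_lt_trans _ _ (\sum_(i <oo) (2%:E * ((2 / rho) ^+ i)%:E))%E).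
  apply: lee_nneseries => [i _ _|i _].
    by apply: intg_ge0 => x _; exact: term_ge0.
  under eqint do rewrite EFinM.
  rewrite ge0_integralZl//; last 2 first.
  - by apply/mEFin; apply: mindic; exact: measurable_itv.
  - by rewrite lee_fin invr_ge0 exprn_ge0// ltW.
  rewrite integral_indic// ?setIT; last exact: measurable_itv.
  have p2 : (0 : R) < 2 ^+ i by rewrite exprn_gt0.
  have L : lebesgue_measure (cell i : set (measurableTypeR R)) = (2 * 2 ^+ i)%:E.
    rewrite lebesgue_measure_itv/= lte_fin ifT; last by lra.
    by rewrite -EFinB; congr EFin; ring.
  rewrite [X in (_ * X <= _)%E]L -!EFinM lee_fin expr_div_n.
  by rewrite mulrCA [rho ^- i * _]mulrC.
rewrite nneseriesZl//; last by move=> i _; rewrite lee_fin exprn_ge0// divr_ge0// ltW.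
rewrite lte_mul_pinfty//; apply: geometric_lty; first by rewrite divr_ge0// ltW.
by rewrite ltr_pdivrMr// mul1r.
Qed.

(* Weighting |g|^2 by 1/om costs no more than the dyadic weight
   1 + sum_i rho^i (1 - E_i), of which a single term already suffices. *)
Lemma om_weight (X g : R) : 0 <= g ->
  ((g / om X)%:E <= (9 * rho)%:E *
    (g%:E + \sum_(i <oo) (rho ^+ i * (g * (1 - Ek (e_ i) X)))%:E))%E.
Proof.
move=> g0.
have t0 i : (0 <= (rho ^+ i * (g * (1 - Ek (e_ i) X)))%:E)%E.
  by rewrite lee_fin !mulr_ge0 ?exprn_ge0 ?(ltW rho0)// subr_ge0 Ek_le1// e_gt0.
have s0 : (0 <= \sum_(i <oo) (rho ^+ i * (g * (1 - Ek (e_ i) X)))%:E)%E.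
  by apply: nneseries_ge0 => *; exact: t0.
have [h|[i /andP[h1 h2]]] := dyadic_shell X.
  apply: (@le_trans _ _ ((9 * rho)%:E * g%:E)%E).
    rewrite -EFinM lee_fin mulrC; apply: ler_wpM2r => //.
    apply: (@le_trans _ _ 1); last by have := rho2; lra.
    by rewrite invf_le1 ?om_gt0//; have := @om_ge X 0; rewrite !expr0 invr1; apply.
  apply: lee_wpmul2l; first by rewrite lee_fin mulr_ge0// ltW.
  by rewrite leeDl.
apply: (@le_trans _ _ ((9 * rho)%:E * (rho ^+ i * (g * (1 - Ek (e_ i) X)))%:E)%E).
  rewrite -EFinM lee_fin ler_pdivrMr ?om_gt0//.
  have w1 : rho ^- i.+1 <= om X by exact: om_ge.
  have w2 : 9^-1 <= 1 - Ek (e_ i) X.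
    apply: Ek_lower; first exact: e_gt0.
    by rewrite /e_ exprVn mulrC ler_pdivlMr ?exprn_gt0// mul1r.
  rewrite [leLHS](_ : _ = 9 * rho * (rho ^+ i * (g * 9^-1)) * rho ^- i.+1).
    apply: ler_pM => //.
    - by rewrite !mulr_ge0 ?exprn_ge0 ?(ltW rho0).
    - by rewrite invr_ge0 exprn_ge0// ltW.
    - do 3! (apply: ler_wpM2l; first by rewrite ?mulr_ge0 ?exprn_ge0 ?(ltW rho0)).
      by [].
  by rewrite exprS; field; rewrite expf_neq0 gt_eqF.
apply: lee_wpmul2l; first by rewrite lee_fin mulr_ge0// ltW.
by rewrite (le_trans (nneseries_term i t0))// leeDr// lee_fin.
Qed.

End weight.

(** * Tonelli's theorem and integration over translations *)

Section swap.
Context {R : realType} d1 d2 (T1 : measurableType d1) (T2 : measurableType d2).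
Variables (m1 : {sigma_finite_measure set T1 -> \bar R}).
Variables (m2 : {sigma_finite_measure set T2 -> \bar R}).
Local Open Scope ereal_scope.

Lemma ge0_swap (F : T1 -> T2 -> R) :
  measT (fun z => F z.1 z.2) -> (forall x y, (0 <= F x y)%R) ->
  \int[m1]_x \int[m2]_y (F x y)%:E = \int[m2]_y \int[m1]_x (F x y)%:E.
Proof.
move=> mF F0; have mEF : measT (fun z => (F z.1 z.2)%:E) by exact/mEFin.
have h z : 0 <= (F z.1 z.2)%:E by rewrite lee_fin.
exact: (@fubini_tonelli _ _ _ _ _ m1 m2 _ mEF h).
Qed.

Lemma ge0_swapE (F : T1 -> T2 -> \bar R) :
  measT (fun z => F z.1 z.2) -> (forall x y, 0 <= F x y) ->
  \int[m1]_x \int[m2]_y F x y = \int[m2]_y \int[m1]_x F x y.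
Proof. by move=> mF F0; exact: (@fubini_tonelli _ _ _ _ _ m1 m2 (fun z => F z.1 z.2)). Qed.

Lemma mintp (F : T1 -> T2 -> \bar R) :
  measT (fun z => F z.1 z.2) -> (forall x y, 0 <= F x y) ->
  measT (fun x => \int[m2]_y F x y).
Proof.
move=> mF F0.
exact: (@measurable_fun_fubini_tonelli_F _ _ _ _ _ m2 (fun z => F z.1 z.2)).
Qed.

Lemma ge0_prod_int (F : T1 -> T2 -> \bar R) :
  measT (fun z => F z.1 z.2) -> (forall x y, 0 <= F x y) ->
  \int[m1 \x m2]_z F z.1 z.2 = \int[m1]_x \int[m2]_y F x y.
Proof. by move=> mF F0; exact: (@fubini_tonelli1 _ _ _ _ _ m1 m2 (fun z => F z.1 z.2)). Qed.

End swap.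

Lemma ae_mono {R : realType} d (T : measurableType d) (mu : {measure set T -> \bar R})
  (P Q : T -> Prop) : {ae mu, forall x, P x} -> (forall x, P x -> Q x) ->
  {ae mu, forall x, Q x}.
Proof. by move=> aeP PQ; apply: filterS aeP. Qed.

Lemma ge0_ae_lty {R : realType} d (T : measurableType d) (mu : {measure set T -> \bar R})
  (f : T -> \bar R) : measT f -> (forall x, 0 <= f x)%E ->
  (\int[mu]_x f x < +oo)%E -> {ae mu, forall x, (f x < +oo)%E}.
Proof.
move=> mf f0 If; have : mu.-integrable setT f.
  apply/integrableP; split => //.
  by rewrite (eqint f) => // x _; rewrite gee0_abs.
move=> /(integrable_ae measurableT); apply: filterS => x /(_ I).
by rewrite ge0_fin_numE.
Qed.

Lemma le_mul_pinfty {R : realType} (C : R) (L x y : \bar R) : 0 < C ->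
  (0 <= x)%E -> (0 <= y)%E -> (+oo <= x)%E \/ (+oo <= y)%E -> (L <= C%:E * (x + y))%E.
Proof.
move=> C0 x0 y0 H; have -> : (x + y = +oo)%E; last by rewrite gt0_muley ?lte_fin// leey.
apply/eqP; rewrite -leye_eq; case: H => h; apply: (le_trans h).
  by rewrite leeDl.
by rewrite leeDr.
Qed.

Lemma ge0_split3 {R : realType} (x y z X Y s : \bar R) :
  x = (z * X)%E -> y = (z * Y)%E -> (0 <= X)%E -> (0 <= Y)%E -> s = (x + y)%E ->
  s = (z * (X + Y))%E.
Proof. by move=> -> -> X0 Y0 ->; rewrite ge0_muleDr. Qed.

Section transport.
Context {R : realType}.
Local Notation leb := (@lebesgue_measure R).
Variables (A : R) (A0 : A != 0) (w : R -> R) (mw : measT w)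
  (w0 : forall x, 0 <= w x) (f : R * R -> R) (mf : measT f)
  (f0 : forall z, 0 <= f z).
Local Open Scope ereal_scope.

Let mg : measT (fun z : (R * R) * R => (z.2 - (z.1.1 - z.1.2) * A)%R).
Proof.
apply: mfunB => //; apply: mfunM => //; apply: mfunB.
  exact: (mcomp mfst mfst).
exact: (mcomp msnd mfst).
Qed.

Let mwA (c : R) (s : R) : measT (fun t => w (s * t + c)%R).
Proof. exact: (mcomp mw (meas_affine s c)). Qed.

Let affine_w (s c : R) : `|s|%R = `|A|%R ->
  \int[leb]_t (`|A| * w (s * t + c))%:E = \int[leb]_x (w x)%:E.
Proof.
move=> sA; have s0 : s != 0%R by rewrite -normr_eq0 sA normr_eq0.
under eqint do rewrite EFinM.
rewrite ge0_integralZl//; first last.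
- by move=> x _; rewrite lee_fin.
- by apply/mEFin; exact: mwA.
rewrite -sA (@ge0_integral_affine _ s c (fun x => (w x)%:E))//.
  exact/mEFin.
Qed.

(** The integral over [t] is taken first: |A| is the Jacobian of [t |-> X - (t - tau) * A], and [w]
    integrates out whatever [X] and [tau] are. *)
Lemma transport1 :
  \int[leb]_t \int[leb]_tau \int[leb]_X (`|A| * (f (tau, X) * w (X - (t - tau) * A)%R))%:E =
  (\int[leb]_x (w x)%:E) * \int[leb]_tau \int[leb]_X (f (tau, X))%:E.
Proof.
pose G (z : (R * R) * R) := (`|A| * (f (z.1.2, z.2) * w (z.2 - (z.1.1 - z.1.2) * A)))%R.
have mG : measT G.
  apply: mfunM => //; apply: mfunM; last exact: mcomp.
  apply: mcomp => //; apply: mpair => //.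
  exact: (mcomp msnd mfst).
have G0 z : (0 <= G z)%R by rewrite !mulr_ge0.
rewrite (@ge0_swapE _ _ _ _ _ leb leb
  (fun t tau => \int[leb]_X (G ((t, tau), X))%:E)); first last.
- by move=> x y; apply: intg_ge0 => X _; rewrite lee_fin.
- apply: (@mintp _ _ _ _ _ leb (fun z X => (G (z, X))%:E)).
    by apply/mEFin; apply: (mcomp mG); apply: mpair.
  by move=> x y; rewrite lee_fin.
have mf1 tau : measT (fun X => f (tau, X)).
  exact: (mcomp mf (mpair1 tau)).
rewrite -ge0_integralZl//; first last.
- by apply: intg_ge0 => x _; rewrite lee_fin.
- by move=> tau _; apply: intg_ge0 => X _; rewrite lee_fin.
- apply: (@mintp _ _ _ _ _ leb (fun tau X => (f (tau, X))%:E)).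
    by apply/mEFin; apply: (mcomp mf); apply: mpair.
  by move=> x y; rewrite lee_fin.
apply: eqint => tau _.
rewrite (@ge0_swap _ _ _ _ _ leb leb (fun t X => G ((t, tau), X))); first last.
- by [].
- apply: (mcomp mG); apply: mpair => //.
  by apply: mpair => //; exact: mfst.
rewrite -ge0_integralZl//; first last.
- by apply: intg_ge0 => x _; rewrite lee_fin.
- by move=> X _; rewrite lee_fin.
- by apply/mEFin; exact: mf1.
apply: eqint => X _; rewrite -(@affine_w (- A)%R (X + tau * A)%R) ?normrN// muleC.
rewrite -ge0_integralZl//; first last.
- by rewrite lee_fin.
- by move=> t _; rewrite lee_fin mulr_ge0.
- by apply/mEFin; apply: mfunM => //; exact: mwA.
apply: eqint => t _; rewrite -EFinM /G /=; congr EFin.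
by rewrite (_ : (- A * t + (X + tau * A) = X - (t - tau) * A)%R); ring.
Qed.

(** Here the point where [f] is evaluated moves with [tau]. It is shifted back first, which moves
    the translation onto [w], and the integral over [tau] then removes [w]. *)
Lemma transport2 :
  \int[leb]_t \int[leb]_tau \int[leb]_X (`|A| * (f (t, (X - (t - tau) * A)%R) * w X))%:E =
  (\int[leb]_x (w x)%:E) * \int[leb]_tau \int[leb]_X (f (tau, X))%:E.
Proof.
have mf1 tau : measT (fun X => f (tau, X)).
  exact: (mcomp mf (mpair1 tau)).
rewrite -ge0_integralZl//; first last.
- by apply: intg_ge0 => x _; rewrite lee_fin.
- by move=> tau _; apply: intg_ge0 => X _; rewrite lee_fin.
- apply: (@mintp _ _ _ _ _ leb (fun tau X => (f (tau, X))%:E)).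
    by apply/mEFin; apply: (mcomp mf); apply: mpair.
  by move=> x y; rewrite lee_fin.
apply: eqint => t _.
transitivity (\int[leb]_tau \int[leb]_Y (`|A| * (f (t, Y) * w (Y + (t - tau) * A)))%:E).
  apply: eqint => tau _.
  rewrite -(@ge0_integral_shift _ (- ((t - tau) * A))%R
     (fun Y => (`|A| * (f (t, Y) * w (Y + (t - tau) * A)))%:E)).
  - by apply: eqint => X _; rewrite subrK.
  - apply/mEFin; apply: mfunM => //; apply: mfunM => //.
    by apply: (mcomp mw); exact: mfunD.
  - by move=> y; rewrite lee_fin !mulr_ge0.
rewrite (@ge0_swap _ _ _ _ _ leb leb
  (fun tau Y => `|A| * (f (t, Y) * w (Y + (t - tau) * A))))%R; first last.
- by move=> x y; rewrite !mulr_ge0.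
- apply: mfunM => //; apply: mfunM.
    by apply: (mcomp mf); apply: mpair.
  apply: (mcomp mw); apply: mfunD => //.
  by apply: mfunM => //; apply: mfunB.
rewrite -ge0_integralZl//; first last.
- by apply: intg_ge0 => x _; rewrite lee_fin.
- by move=> X _; rewrite lee_fin.
- by apply/mEFin; exact: mf1.
apply: eqint => X _; rewrite -(@affine_w (- A)%R (X + t * A)%R) ?normrN// muleC.
rewrite -ge0_integralZl//; first last.
- by rewrite lee_fin.
- by move=> s _; rewrite lee_fin mulr_ge0.
- by apply/mEFin; apply: mfunM => //; exact: mwA.
apply: eqint => s _; rewrite -EFinM /=; congr EFin.
by rewrite (_ : (- A * s + (X + t * A) = X + (t - s) * A)%R); ring.
Qed.

End transport.

(** * The one-dimensional estimate for a fixed phase *)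

Section core.
Context {R : realType}.
Local Notation leb := (@lebesgue_measure R).
Variables (rho cl cu : R).
Hypotheses (rho2 : 2 < rho) (cl0 : 0 < cl) (cl1 : cl <= 1) (cu0 : 0 < cu).
Local Open Scope complex_scope.

Definition osc (i : nat) (u : R -> R[i]) : \bar R :=
  (\int[leb \x leb]_q (sqn (u q.1 - u q.2)%R * Pk (e_ i) (q.1 - q.2))%:E)%E.

(** For 2 < rho < 4 this is equivalent to the square of a Sobolev norm of order (log_2 rho) / 2,
    between 1/2 and 1. It is written with differences of [u] so that changes of variable and
    multiplications act on it directly. *)
Definition N1 (u : R -> R[i]) : \bar R :=
  (\int[leb]_x (sqn (u x))%:E + \sum_(i <oo) (rho ^+ i)%:E * osc i u)%E.

Let rho0 : 0 < rho. Proof. by have := rho2; lra. Qed.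

Lemma osc_ge0 i u : (0 <= osc i u)%E.
Proof. by apply: intg_ge0 => q _; rewrite lee_fin mulr_ge0 ?sqn_ge0 ?Pk_ge0 ?e_gt0. Qed.

Let rosc_ge0 i u : (0 <= (rho ^+ i)%:E * osc i u)%E.
Proof. by rewrite mule_ge0 ?osc_ge0// lee_fin exprn_ge0// ltW. Qed.

Lemma N1_ge0 u : (0 <= N1 u)%E.
Proof.
apply: adde_ge0; first by apply: intg_ge0 => x _; rewrite lee_fin sqn_ge0.
by apply: nneseries_ge0 => *; exact: rosc_ge0.
Qed.

Section phase.
Variables (be p : R -> R).
Hypotheses (dbe : forall x : R, is_derive x 1 be (p x)) (cp : continuous p)
  (pl : forall x, cl <= p x) (pu : forall x, p x <= cu).

Let p0 x : 0 <= p x. Proof. by apply: le_trans (pl x); exact: ltW. Qed.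

Let mp : measT p. Proof. exact: contm. Qed.

Let cbe : continuous be. Proof. by move=> x; exact: der_cont (dbe x). Qed.

Let mbe : measT be. Proof. exact: contm. Qed.

Lemma phase_incr x y : x <= y -> cl * (y - x) <= be y - be x.
Proof.
rewrite le_eqVlt => /predU1P[->|xy]; first by rewrite !subrr mulr0.
have [z _ ->] := @MVT R be p x y xy (fun z _ => dbe z) (continuous_subspaceT cbe).
by apply: ler_wpM2r => //; rewrite subr_ge0 ltW.
Qed.

Lemma phase_lip x y : cl * `|x - y| <= `|be x - be y|.
Proof.
wlog xy : x y / x <= y.
  move=> H; have [/H//|/ltW/H] := leP x y.
  by rewrite (distrC y) (distrC (be y)).
rewrite distrC (distrC (be x)) ger0_norm ?subr_ge0// (le_trans (phase_incr xy))//.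
exact: ler_norm.
Qed.

Lemma phase_cvgy : be x @[x --> +oo] --> +oo.
Proof.
apply/cvgryPge => M; near=> x.
have x0 : 0 <= x by near: x; apply: nbhs_pinfty_ge; exact: num_real.
have := phase_incr x0; rewrite subr0 => h.
have : M - be 0 <= cl * x.
  rewrite -ler_pdivrMl//; near: x; apply: nbhs_pinfty_ge; exact: num_real.
by lra.
Unshelve. all: by end_near. Qed.

Lemma phase_cvgNy : be x @[x --> -oo] --> -oo.
Proof.
apply/cvgrNyPle => M; near=> x.
have x0 : x <= 0 by near: x; apply: nbhs_ninfty_le; exact: num_real.
have := phase_incr x0; rewrite sub0r => h.
have : cl * x <= M - be 0.
  rewrite -ler_pdivlMl//; near: x; apply: nbhs_ninfty_le; exact: num_real.
by lra.
Unshelve. all: by end_near. Qed.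

Let ph (z : R * R) := z.1 * be z.2.
Let mph : measT ph.
Proof. by apply: mfunM => //; exact: mcomp. Qed.
Let P i x y := Pk (e_ i) (be x - be y).
Let HK i (x y : R) : cint leb (fun X => expi (ph (X, x) - ph (X, y)) * (Ek (e_ i) X)%:C) = (P i x y)%:C.
Proof.
rewrite -FT_Ek ?e_gt0//; apply: eq_cint => X; congr (expi _ * _).
by rewrite /ph /= mulrBr.
Qed.
Let P0 i x y : 0 <= P i x y. Proof. exact/Pk_ge0/e_gt0. Qed.
Let Psym i x y : P i x y = P i y x. Proof. by rewrite /P -PkN opprB. Qed.
Let mP i : measT (fun q => P i q.1 q.2).
Proof.
apply: (mcomp (meas_Pk (e_gt0 i))).
by apply: mfunB; exact: mcomp.
Qed.
Let IP i x : (\int[leb]_y (P i x y * p y)%:E = (2 * pi)%:E)%E.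
Proof.
rewrite -(@int_Pk R (e_ i) (be x) be p (e_gt0 i) cp p0 dbe phase_cvgy phase_cvgNy).
by apply: eqint => y _; rewrite Psym.
Qed.
Let pi20 : 0 <= 2 * pi :> R. Proof. by rewrite mulr_ge0// pi_ge0. Qed.

Definition FTb (u : R -> R[i]) := FT leb ph (fun x => u x * (p x)%:C).

(** The lower bound for [p] allows [Pk_scale] to straighten the phase in the kernel; the upper bound
    removes the two densities. *)
Let dir_osc i u : cmeas u ->
  (dir leb P p i u <= (cl ^- 4 * cu ^+ 2)%:E * osc i u)%E.
Proof.
move=> mu1; have k0 : 0 <= cl ^- 4 by rewrite invr_ge0 exprn_ge0// ltW.
have mD : measT (fun q : R * R => sqn (u q.1 - u q.2)).
  by apply: msqn; apply: cmeasB; exact: (cmeas_comp mu1).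
have mPk : measT (fun q : R * R => Pk (e_ i) (q.1 - q.2)).
  apply: (mcomp (meas_Pk (e_gt0 i))).
  exact: (mfunB mfst msnd).
rewrite /osc -ge0_integralZl//; first last.
- by rewrite lee_fin mulr_ge0 ?sqr_ge0.
- by move=> q _; rewrite lee_fin mulr_ge0 ?sqn_ge0 ?Pk_ge0 ?e_gt0.
- by apply/mEFin; exact: mfunM.
apply: ge0_le_integral => //.
- move=> q _; rewrite lee_fin mulr_ge0 ?sqn_ge0//.
  by apply: mulr_ge0 => //; apply: mulr_ge0.
- apply/mEFin; apply: mfunM => //.
  apply: mfunM; last exact: mcomp.
  by apply: mfunM; [exact: mP|exact: mcomp].
- by apply: mfuneM; apply/mEFin; exact: mfunM.
move=> q _; rewrite -EFinM lee_fin [leRHS]mulrCA; apply: ler_wpM2l; first exact: sqn_ge0.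
rewrite -mulrA (_ : _ * _ * Pk _ _ = cl ^- 4 * Pk (e_ i) (q.1 - q.2) * (cu ^+ 2)); last by ring.
apply: ler_pM; [exact: P0|by apply: mulr_ge0| |by rewrite expr2; apply: ler_pM].
by apply: Pk_scale; rewrite ?e_gt0// phase_lip.
Qed.

Let L2p_N1 u : cintg leb u -> (N1 u < +oo)%E -> L2p leb p u.
Proof.
move=> iu Nu; split; [|split].
- have -> : (fun x => u x * (p x)%:C) = (fun x => (p x)%:C * u x).
    by apply/funext => x; rewrite mulrC.
  apply: (@cintgM _ _ (measurableTypeR R) leb (fun x => (p x)%:C) u cu) => //.
  by move=> x; rewrite normc_real ger0_norm.
- exact: cintg_meas iu.
have mu1 := cintg_meas iu.
apply: (@le_lt_trans _ _ (cu%:E * \int[leb]_x (sqn (u x))%:E)%E).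
  rewrite -ge0_integralZl//; first last.
  - by rewrite lee_fin ltW.
  - by move=> x _; rewrite lee_fin sqn_ge0.
  - by apply/mEFin; exact: msqn.
  apply: ge0_le_integral => //.
  - by move=> x _; rewrite lee_fin mulr_ge0 ?sqn_ge0.
  - by apply/mEFin; apply: mfunM => //; exact: msqn.
  - by apply: mfuneM; apply/mEFin; exact: msqn.
  - by move=> x _; rewrite -EFinM lee_fin mulrC ler_wpM2r ?sqn_ge0.
rewrite lte_mul_pinfty// ?lee_fin ?(ltW cu0)//; apply: le_lt_trans Nu.
by rewrite leeDl//; apply: nneseries_ge0 => *; exact: rosc_ge0.
Qed.

Definition Cft : R := 9 * rho * (2 * pi * cu + cl ^- 4 * cu ^+ 2).

(** [om_weight] splits 1 / om into a constant and the terms rho^i (1 - E_i). Bessel's inequality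
    bounds the first contribution by the L2 norm, [FT_dir] and [dir_osc] bound the others by the
    energies in [N1]. *)
Lemma FT_N1 u : cintg leb u -> (N1 u < +oo)%E ->
  (\int[leb]_X (sqn (FTb u X) / om rho X)%:E <= Cft%:E * N1 u)%E.
Proof.
move=> iu Nu; have mu1 := cintg_meas iu.
have Lu := L2p_N1 iu Nu.
have mF : cmeas (FTb u).
  by apply: cmeas_FT => //; apply: cmeasM => //; exact: cmeas_real.
have k0 : 0 <= cl ^- 4 * cu ^+ 2 by rewrite mulr_ge0 ?sqr_ge0// invr_ge0 exprn_ge0// ltW.
have mS : measT (fun X => sqn (FTb u X)) by exact: msqn.
have s0 X : 0 <= sqn (FTb u X) by exact: sqn_ge0.
have t0 i X : (0 <= (rho ^+ i * (sqn (FTb u X) * (1 - Ek (e_ i) X)))%:E)%E.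
  by rewrite lee_fin !mulr_ge0 ?exprn_ge0 ?(ltW rho0)// subr_ge0 Ek_le1// e_gt0.
have mt i : measT (fun X => (rho ^+ i * (sqn (FTb u X) * (1 - Ek (e_ i) X)))%:E).
  apply/mEFin; apply: mfunM => //; apply: mfunM => //.
  by apply: mfunB => //; exact: meas_Ek.
have mts : measT (fun X => \sum_(i <oo) (rho ^+ i * (sqn (FTb u X) * (1 - Ek (e_ i) X)))%:E)%E.
  by apply: ge0_emeasurable_sum => [i X _ _|i _]; [exact: t0|exact: mt].
apply: (@le_trans _ _ (\int[leb]_X ((9 * rho)%:E * ((sqn (FTb u X))%:E
   + \sum_(i <oo) (rho ^+ i * (sqn (FTb u X) * (1 - Ek (e_ i) X)))%:E)))%E).
  apply: ge0_le_integral => //.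
  - by move=> X _; rewrite lee_fin divr_ge0// ltW// om_gt0.
  - apply/mEFin; apply: mfunM => //; exact: meas_om_inv.
  - by apply: mfuneM; apply: emeasurable_funD => //; exact/mEFin.
  - by move=> X _; exact: om_weight.
rewrite ge0_integralZl//; first last.
- by rewrite lee_fin mulr_ge0// ltW.
- by move=> X _; rewrite adde_ge0// ?lee_fin//; apply: nneseries_ge0 => *; exact: t0.
- by apply: emeasurable_funD => //; exact/mEFin.
rewrite /Cft [in leRHS]EFinM -muleA; apply: lee_wpmul2l; first by rewrite lee_fin mulr_ge0// ltW.
rewrite ge0_integralD//; first last.
- by move=> X _; apply: nneseries_ge0 => *; exact: t0.
- exact/mEFin.
- by move=> X _; rewrite lee_fin.
have i0 : (0 <= \int[leb]_x (sqn (u x))%:E)%E.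
  by apply: intg_ge0 => x _; rewrite lee_fin sqn_ge0.
have o0 : (0 <= \sum_(i <oo) (rho ^+ i)%:E * osc i u)%E.
  by apply: nneseries_ge0 => *; exact: rosc_ge0.
have pcu0 : 0 <= 2 * pi * cu by rewrite mulr_ge0// ltW.
rewrite /N1 ge0_muleDr//; apply: leeD.
  apply: (@le_trans _ _ ((2 * pi * cu)%:E * \int[leb]_x (sqn (u x))%:E)%E); last first.
    by apply: lee_wpmul2r => //; rewrite lee_fin lerDl.
  apply: le_trans (@FT_bessel R _ _ (measurableTypeR R) (measurableTypeR R) leb leb ph mph
    (fun i => Ek (e_ i)) P (fun i => meas_Ek (e_ i))
    (fun i X => Ek_ge0 X (e_gt0 i)) (fun i => Ek_integrable (e_gt0 i)) HK p (2 * pi) mp p0 pi20 P0 Psym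
    mP IP (@Ek_lim R) u Lu) _.
  rewrite [in leRHS]EFinM -muleA; apply: lee_wpmul2l; first by rewrite lee_fin.
  rewrite -ge0_integralZl//; first last.
  - by rewrite lee_fin ltW.
  - by move=> x _; rewrite lee_fin sqn_ge0.
  - by apply/mEFin; exact: msqn.
  apply: ge0_le_integral => //.
  - by move=> x _; rewrite lee_fin mulr_ge0 ?sqn_ge0.
  - by apply/mEFin; apply: mfunM => //; exact: msqn.
  - by apply: mfuneM; apply/mEFin; exact: msqn.
  - by move=> x _; rewrite -EFinM lee_fin mulrC ler_wpM2r ?sqn_ge0.
rewrite integral_nneseries//.
rewrite -nneseriesZl//.
apply: lee_nneseries => [i _ _|i _].
  by apply: intg_ge0 => X _; exact: t0.
under eqint do rewrite EFinM.
rewrite ge0_integralZl//; first last.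
- by rewrite lee_fin exprn_ge0// ltW.
- by move=> X _; rewrite lee_fin mulr_ge0// subr_ge0 Ek_le1// e_gt0.
- apply/mEFin; apply: mfunM => //.
  by apply: mfunB => //; exact: meas_Ek.
rewrite muleCA; apply: lee_wpmul2l; first by rewrite lee_fin exprn_ge0// ltW.
apply: le_trans (@FT_dir R _ _ (measurableTypeR R) (measurableTypeR R) leb leb ph mph
    (fun i => Ek (e_ i)) P (fun i => meas_Ek (e_ i))
    (fun i X => Ek_ge0 X (e_gt0 i)) (fun i X => Ek_le1 X (e_gt0 i))
    (fun i => Ek_integrable (e_gt0 i)) HK p (2 * pi) mp p0 pi20 P0 Psym
    mP IP (@Ek_lim R) i u Lu) _.
apply: (@le_trans _ _ (dir leb P p i u)).
  rewrite -[leRHS]mul1e; apply: lee_wpmul2r; last by rewrite lee_fin; lra.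
  apply: intg_ge0 => q _; rewrite lee_fin mulr_ge0 ?sqn_ge0//.
  by apply: mulr_ge0 => //; apply: mulr_ge0.
apply: (le_trans (dir_osc i mu1)); apply: lee_wpmul2r; first exact: osc_ge0.
by rewrite lee_fin lerDr.
Qed.

(** Each term of the series in [N1] is at most [N1], so the energy at scale [i] is O(rho^-i). *)
Let dir_to0 u : cintg leb u -> (N1 u < +oo)%E ->
  forall eps : R, 0 < eps -> exists i, (dir leb P p i u <= eps%:E)%E.
Proof.
move=> iu Nu eps eps0; have mu1 := cintg_meas iu.
have Nf : N1 u \is a fin_num by rewrite ge0_fin_numE// N1_ge0.
pose K := cl ^- 4 * cu ^+ 2 * fine (N1 u).
have k0 : 0 <= cl ^- 4 * cu ^+ 2 by rewrite mulr_ge0 ?sqr_ge0// invr_ge0 exprn_ge0// ltW.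
have K0 : 0 <= K by rewrite mulr_ge0// fine_ge0 ?N1_ge0.
have [i hi] : exists i, K / eps <= rho ^+ i.
  exists (Num.trunc (K / eps)).+1; apply: (le_trans (ltW (truncnS_gt _))).
  apply: (@le_trans _ _ (2 ^+ (Num.trunc (K / eps)).+1)).
    by rewrite -natrX ler_nat ltnW// ltn_expl.
  by rewrite lerXn2r ?nnegrE ?(ltW rho0)// ltW.
exists i; apply: (le_trans (dir_osc i mu1)).
have ri : 0 < rho ^+ i by rewrite exprn_gt0.
have o1 : ((rho ^+ i)%:E * osc i u <= N1 u)%E.
  apply: (le_trans (nneseries_term i (fun i => rosc_ge0 i u))).
  by rewrite leeDr//; apply: intg_ge0 => x _; rewrite lee_fin sqn_ge0.
have o2 : (osc i u <= (fine (N1 u) / rho ^+ i)%:E)%E.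
  rewrite -(@lee_pmul2l _ (rho ^+ i)%:E) ?lte_fin// -EFinM mulrCA mulfV ?gt_eqF// mulr1.
  by rewrite fineK.
apply: (le_trans (lee_wpmul2l _ o2)); first by rewrite lee_fin.
rewrite -EFinM lee_fin mulrA -/K ler_pdivrMr// mulrC -ler_pdivrMr//.
Qed.

(** In the variable [be], the oscillating factor translates the transform by [th]. It is moved onto
    [v] before Parseval's inequality is applied, whose constant [2 * pi] is dropped because it
    exceeds 1. *)
Lemma phase_pairing (th : R) u v : cintg leb u -> cintg leb v ->
  (N1 u < +oo)%E -> (N1 v < +oo)%E ->
  ((normc (cint leb (fun x => expi (th * be x) * u x * conjc (v x) * (p x)%:C)))%:E
   <= \int[leb]_X (normc (FTb u X) * normc (FTb v (X - th)))%:E)%E.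
Proof.
move=> iu iv Nu Nv.
have Lu := L2p_N1 iu Nu; have Lv := L2p_N1 iv Nv.
pose v' x := expi (- th * be x) * v x.
have me : cmeas (fun x => expi (- th * be x)) by apply: cmeas_expi; exact: mfunM.
have Lv' : L2p leb p v'.
  split; [|split].
  - under eq_fun do rewrite /v' -mulrA.
    apply: (@cintgM _ _ _ _ _ _ 1) => //; last exact: Lv.1.
    by move=> x; rewrite normc_expi.
  - by apply: cmeasM => //; exact: Lv.2.1.
  - by under eqint do rewrite sqnM sqn_expi mul1r; exact: Lv.2.2.
have := @FT_parseval R _ _ (measurableTypeR R) (measurableTypeR R) leb leb ph mph
    (fun i => Ek (e_ i)) P (fun i => meas_Ek (e_ i))
    (fun i X => Ek_ge0 X (e_gt0 i)) (fun i X => Ek_le1 X (e_gt0 i))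
    (fun i => Ek_integrable (e_gt0 i)) HK p (2 * pi) mp p0 pi20 P0 Psym
    mP IP u v' Lu Lv' (dir_to0 iu Nu).
have E1 X : FT leb ph (fun x => v' x * (p x)%:C) X = FTb v (X - th).
  apply: eq_cint => x; rewrite /v' /ph /= -!mulrA mulrA -expiD; congr (expi _ * _); ring.
move=> H; have -> : (\int[leb]_X (normc (FTb u X) * normc (FTb v (X - th)))%:E =
  \int[leb]_X (normc (FTb u X) * normc (FT leb ph (fun x => v' x * (p x)%:C)%R X))%:E)%E.
  by apply: eqint => X _; rewrite E1.
apply: le_trans H; rewrite lee_fin.
rewrite (_ : (fun x => u x * conjc (v' x) * (p x)%:C) =
    (fun x => expi (th * be x) * u x * conjc (v x) * (p x)%:C)); last first.
  by apply/funext => x; rewrite /v' conjcM conj_expi mulNr opprK; ring.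
rewrite -[leLHS]mul1r; apply: ler_wpM2r; first exact: nc_ge0.
by have := pi_ge2 R; lra.
Qed.

End phase.

Lemma Cft_ge0 : 0 <= Cft.
Proof.
apply: mulr_ge0; first by rewrite mulr_ge0// ltW.
apply: addr_ge0; first by rewrite mulr_ge0 ?mulr_ge0 ?pi_ge0// ltW.
by rewrite mulr_ge0 ?sqr_ge0// invr_ge0 exprn_ge0// ltW.
Qed.

Definition Ccore : R := (Cft + 1) * (1 + fine (\int[leb]_x (om rho x)%:E)).

Lemma Ccore_gt0 : 0 < Ccore.
Proof.
have C0 := Cft_ge0.
have f0 : 0 <= fine (\int[leb]_x (om rho x)%:E)%E.
  by apply: fine_ge0; apply: intg_ge0 => x _; rewrite lee_fin ltW// om_gt0.
by apply: mulr_gt0; lra.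
Qed.

Lemma meas_osc (d : measure_display) (T : measurableType d) (U : T * R -> R[i]) i :
  cmeas U -> measT (fun t => osc i (fun x => U (t, x))).
Proof.
move=> mU.
apply: (@mintp _ _ _ _ _ (sprod leb leb) (fun t q =>
  (sqn (U (t, q.1) - U (t, q.2))%R * Pk (e_ i) (q.1 - q.2))%:E)).
  apply/mEFin; apply: mfunM.
    apply: msqn; apply: cmeasB; apply: (cmeas_comp mU);
      apply: mpair => //; exact: (mcomp _ msnd).
  apply: (mcomp (meas_Pk (e_gt0 i))).
  by apply: mfunB; exact: (mcomp _ msnd).
by move=> x y; rewrite lee_fin mulr_ge0 ?sqn_ge0 ?Pk_ge0 ?e_gt0.
Qed.

Lemma meas_N1 (d : measure_display) (T : measurableType d) (U : T * R -> R[i]) :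
  cmeas U -> measT (fun t => N1 (fun x => U (t, x))).
Proof.
move=> mU; apply: emeasurable_funD.
  apply: (@mintp _ _ _ _ _ leb (fun t x => (sqn (U (t, x)))%:E)).
    apply/mEFin; apply: msqn; apply: (cmeas_comp mU).
    exact: mpair.
  by move=> x y; rewrite lee_fin sqn_ge0.
apply: ge0_emeasurable_sum => [i x _ _|i _]; first exact: rosc_ge0.
by apply: mfuneM; exact: meas_osc.
Qed.

(** For almost all pairs of times the pairing is at most the integral of a product of two
    transforms, one of them translated by [(t - tau) * A]. Young's inequality with ratio om(Y) /
    om(X) turns the product into squares divided by [om], each times a translate of [om].
    Integration over the times removes that translate by the transport lemmas, and [FT_N1] bounds
    what remains. *)
Lemma core (be p : R -> R) (A : R) (U V : R * R -> R[i]) :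
  (forall x : R, is_derive x 1 be (p x)) -> continuous p ->
  (forall x, cl <= p x) -> (forall x, p x <= cu) -> A != 0 ->
  cmeas U -> cmeas V -> (forall t, cintg leb (fun x => U (t, x))) ->
  (forall t, cintg leb (fun x => V (t, x))) ->
  (\int[leb]_t \int[leb]_tau (`|A| * normc (cint leb (fun x =>
      expi ((t - tau) * A * be x) * U (tau, x) * conjc (V (t, x)) * (p x)%:C)%R))%:E
   <= Ccore%:E * (\int[leb]_t N1 (fun x => U (t, x)) + \int[leb]_t N1 (fun x => V (t, x))))%E.
Proof.
move=> dbe cp pl pu A0 mU mV iU iV.
have C0 := Ccore_gt0.
have N0 (W : R * R -> R[i]) : (0 <= \int[leb]_t N1 (fun x => W (t, x)))%E.
  by apply: intg_ge0 => t _; exact: N1_ge0.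
(* An infinite norm makes the right-hand side infinite since [Ccore] is positive. Finite time
   integrals make both norms finite at almost every time. *)
have [UF|UF] := ltP (\int[leb]_t N1 (fun x => U (t, x)))%E +oo%E; last first.
  exact (le_mul_pinfty _ C0 (N0 U) (N0 V) (or_introl UF)).
have [VF|VF] := ltP (\int[leb]_t N1 (fun x => V (t, x)))%E +oo%E; last first.
  exact (le_mul_pinfty _ C0 (N0 U) (N0 V) (or_intror VF)).
have aeN (W : R * R -> R[i]) : cmeas W -> (\int[leb]_t N1 (fun x => W (t, x)) < +oo)%E ->
    {ae leb, forall t, (N1 (fun x => W (t, x)) < +oo)%E}.
  move=> mW; apply: ge0_ae_lty; first exact: meas_N1.
  by move=> t; exact: N1_ge0.
have mp : measT p by exact: contm.
have mbe : measT be.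
  by apply: contm => x; exact: der_cont (dbe x).
have mFT (W : R * R -> R[i]) : cmeas W ->
    cmeas (fun z : R * R => FTb be p (fun x => W (z.1, x)) z.2).
  move=> mW; apply: (@cmeas_cint _ _ _ _ _ leb (fun z : (R * R) * R =>
    expi (z.1.2 * be z.2) * (W (z.1.1, z.2) * (p z.2)%:C))).
  have m11 : measT (fun z : (R * R) * R => z.1.1).
    exact: (mcomp mfst mfst).
  have m12 : measT (fun z : (R * R) * R => z.1.2).
    exact: (mcomp msnd mfst).
  apply: cmeasM.
    by apply: cmeas_expi; apply: mfunM => //; exact: mcomp.
  apply: cmeasM; last by apply: cmeas_real; exact: mcomp.
  by apply: (cmeas_comp mW); exact: mpair.
pose a z := normc (FTb be p (fun x => U (z.1, x)) z.2).
pose b z := normc (FTb be p (fun x => V (z.1, x)) z.2).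
have ma : measT a by apply: mnormc; exact: mFT.
have mb : measT b by apply: mnormc; exact: mFT.
have a0 z : 0 <= a z by exact: nc_ge0.
have b0 z : 0 <= b z by exact: nc_ge0.
have mom := meas_om rho2; have momV := meas_om_inv rho2.
have om0 x : 0 < om rho x := om_gt0 rho2 x.
have omV0 x : 0 <= (om rho x)^-1 by rewrite invr_ge0 ltW.
pose fa z := a z ^+ 2 / om rho z.2.
pose fb z := b z ^+ 2 / om rho z.2.
have mfa : measT fa.
  by apply: mfunM; [exact: mfunX|exact: (mcomp momV)].
have mfb : measT fb.
  by apply: mfunM; [exact: mfunX|exact: (mcomp momV)].
have fa0 z : 0 <= fa z by rewrite mulr_ge0 ?sqr_ge0.
have fb0 z : 0 <= fb z by rewrite mulr_ge0 ?sqr_ge0.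
pose Ga t tau X := `|A| * (fa (tau, X) * om rho (X - (t - tau) * A)).
pose Gb t tau X := `|A| * (fb (t, X - (t - tau) * A) * om rho X).
have m11 : measT (fun z : (R * R) * R => z.1.1).
  exact: (mcomp mfst mfst).
have m12 : measT (fun z : (R * R) * R => z.1.2).
  exact: (mcomp msnd mfst).
have msh : measT (fun z : (R * R) * R => z.2 - (z.1.1 - z.1.2) * A).
  apply: mfunB => //; apply: mfunM => //; exact: mfunB.
have mGa : measT (fun z : (R * R) * R => Ga z.1.1 z.1.2 z.2).
  apply: mfunM => //; apply: mfunM; last exact: mcomp.
  by apply: mcomp => //; exact: mpair.
have mGb : measT (fun z : (R * R) * R => Gb z.1.1 z.1.2 z.2).
  apply: mfunM => //; apply: mfunM; last exact: mcomp.
  by apply: mcomp => //; exact: mpair.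
have Ga0 t tau X : 0 <= Ga t tau X by rewrite !mulr_ge0// ltW.
have Gb0 t tau X : 0 <= Gb t tau X by rewrite !mulr_ge0// ltW.
pose G t tau X := Ga t tau X + Gb t tau X.
have mG : measT (fun z : (R * R) * R => G z.1.1 z.1.2 z.2).
  exact: mfunD.
have G0 t tau X : 0 <= G t tau X by rewrite addr_ge0.
have mIX (H : R -> R -> R -> R) : measT (fun z : (R * R) * R => H z.1.1 z.1.2 z.2) ->
    (forall t tau X, 0 <= H t tau X) ->
    measT (fun z : R * R => \int[leb]_X (H z.1 z.2 X)%:E)%E.
  move=> mH H0; apply: (@mintp _ _ _ _ _ leb (fun (z : R * R) X => (H z.1 z.2 X)%:E)).
    exact/mEFin.
  by move=> x y; rewrite lee_fin.
have mIt (H : R -> R -> R -> R) : measT (fun z : (R * R) * R => H z.1.1 z.1.2 z.2) ->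
    (forall t tau X, 0 <= H t tau X) ->
    measT (fun t : R => \int[leb]_tau \int[leb]_X (H t tau X)%:E)%E.
  move=> mH H0; apply: (@mintp _ _ _ _ _ leb (fun t tau => \int[leb]_X (H t tau X)%:E)%E).
    exact: mIX.
  by move=> x y; apply: intg_ge0 => X _; rewrite lee_fin.
pose I (t tau : R) : R[i] := cint leb (fun x =>
  expi ((t - tau) * A * be x) * U (tau, x) * conjc (V (t, x)) * (p x)%:C).
pose L (t tau : R) : R := `|A| * normc (I t tau).
change (\int[leb]_t \int[leb]_tau (L t tau)%:E <= Ccore%:E *
  (\int[leb]_t N1 (fun x => U (t, x)) + \int[leb]_t N1 (fun x => V (t, x))))%E.
have mI : cmeas (fun z : R * R => I z.1 z.2).
  apply: (@cmeas_cint _ _ _ _ _ leb (fun z : (R * R) * R =>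
    expi ((z.1.1 - z.1.2) * A * be z.2) * U (z.1.2, z.2) * conjc (V (z.1.1, z.2)) * (p z.2)%:C)).
  apply: cmeasM; last by apply: cmeas_real; exact: mcomp.
  apply: cmeasM; last first.
    by apply: cmeas_conj; apply: (cmeas_comp mV); exact: mpair.
  apply: cmeasM; last by apply: (cmeas_comp mU); exact: mpair.
  apply: cmeas_expi; apply: mfunM; last exact: mcomp.
  by apply: mfunM => //; exact: mfunB.
have L0 t tau : 0 <= L t tau by rewrite mulr_ge0 ?nc_ge0.
have mL : measT (fun z : R * R => (L z.1 z.2)%:E).
  apply/mEFin; apply: mfunM; first exact: mcst.
  exact: mnormc.
apply: (@le_trans _ _ (\int[leb]_t \int[leb]_tau \int[leb]_X (G t tau X)%:E)%E).
  apply: ae_ge0_le_integral => //.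
  - by move=> t _; apply: intg_ge0 => tau _; rewrite lee_fin.
  - apply: (@mintp _ _ _ _ _ leb (fun t tau => (L t tau)%:E)) => //.
  - by move=> t _; apply: intg_ge0 => tau _; apply: intg_ge0 => X _; rewrite lee_fin.
  - exact: (mIt G mG G0).
  apply: (ae_mono (aeN _ mV VF)) => t Vt _.
  apply: ae_ge0_le_integral => //.
  - by move=> tau _; rewrite lee_fin.
  - exact: (mcomp mL (mpair1 t)).
  - by move=> tau _; apply: intg_ge0 => X _; rewrite lee_fin.
  - exact: (mcomp (mIX _ mG G0) (mpair1 t)).
  apply: (ae_mono (aeN _ mU UF)) => tau Ut _.
  have H : ((normc (I t tau))%:E <= \int[leb]_X (a (tau, X) * b (t, X - (t - tau) * A))%:E)%E.
    exact: (phase_pairing dbe cp pl pu ((t - tau) * A) (iU tau) (iV t) Ut Vt).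
  have nA : (0 <= `|A|%:E)%E by rewrite lee_fin.
  rewrite /L EFinM; apply: (le_trans (lee_wpmul2l nA H)).
  rewrite -ge0_integralZl//; first last.
  + by move=> X _; rewrite lee_fin mulr_ge0 ?nc_ge0.
  + apply/mEFin; apply: mfunM.
      exact: (mcomp ma (mpair1 tau)).
    apply: (mcomp (f := fun X => b (t, X))).
      exact: (mcomp mb (mpair1 t)).
    exact: mfunB.
  apply: ge0_le_integral => //.
  + by move=> X _; rewrite -EFinM lee_fin !mulr_ge0 ?nc_ge0.
  + apply: mfuneM; apply/mEFin; apply: mfunM.
      exact: (mcomp ma (mpair1 tau)).
    apply: (mcomp (f := fun X => b (t, X))).
      exact: (mcomp mb (mpair1 t)).
    exact: mfunB.
  + apply/mEFin; exact: (mcomp mG (mpair1 (t, tau))).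
  move=> X _; rewrite -EFinM lee_fin /G /Ga /Gb -mulrDr; apply: ler_wpM2l => //.
  (* The inequality is x y <= x^2 o2 / o1 + y^2 o1 / o2, where [o1] and [o2] are the weights at [X]
     and at the translated point [Y]. *)
  rewrite /fa /fb /=; set Y := X - _.
  have oX := om0 X; have oY := om0 Y.
  have x0 := a0 (tau, X); have y0 := b0 (t, Y).
  move: (a (tau, X)) (b (t, Y)) (om rho X) (om rho Y) oX oY x0 y0 => x y o1 o2 o10 o20 x0 y0.
  have sq := sqr_ge0 (x * o2 - y * o1).
  have oo : 0 < o1 * o2 by exact: mulr_gt0.
  have xy : 0 <= x * y * (o1 * o2) by apply: mulr_ge0; [exact: mulr_ge0|exact: ltW].
  rewrite -subr_ge0 (_ : _ - _ = ((x * o2 - y * o1) ^+ 2 + x * y * (o1 * o2)) / (o1 * o2)).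
    by apply: divr_ge0; [exact: addr_ge0|exact: ltW].
  by field; rewrite !gt_eqF.
have TA : (\int[leb]_t \int[leb]_tau \int[leb]_X (Ga t tau X)%:E =
   (\int[leb]_x (om rho x)%:E) * \int[leb]_tau \int[leb]_X (fa (tau, X))%:E)%E.
  exact (transport1 A0 mom (fun x => ltW (om0 x)) mfa fa0).
have TB : (\int[leb]_t \int[leb]_tau \int[leb]_X (Gb t tau X)%:E =
   (\int[leb]_x (om rho x)%:E) * \int[leb]_tau \int[leb]_X (fb (tau, X))%:E)%E.
  exact (transport2 A0 mom (fun x => ltW (om0 x)) mfb fb0).
have ES : (\int[leb]_t \int[leb]_tau \int[leb]_X (G t tau X)%:E =
   \int[leb]_t \int[leb]_tau \int[leb]_X (Ga t tau X)%:E +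
   \int[leb]_t \int[leb]_tau \int[leb]_X (Gb t tau X)%:E)%E.
  rewrite -ge0_integralD//; first last.
  - exact: (mIt Gb).
  - by move=> t _; apply: intg_ge0 => tau _; apply: intg_ge0 => X _; rewrite lee_fin; exact: Gb0.
  - exact: (mIt Ga).
  - by move=> t _; apply: intg_ge0 => tau _; apply: intg_ge0 => X _; rewrite lee_fin; exact: Ga0.
  apply: eqint => t _; rewrite -ge0_integralD//; first last.
  - exact: (mcomp (mIX Gb mGb Gb0) (mpair1 t)).
  - by move=> tau _; apply: intg_ge0 => X _; rewrite lee_fin; exact: Gb0.
  - exact: (mcomp (mIX Ga mGa Ga0) (mpair1 t)).
  - by move=> tau _; apply: intg_ge0 => X _; rewrite lee_fin; exact: Ga0.
  apply: eqint => tau _; rewrite -ge0_integralD//; first last.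
  - by apply/mEFin; exact: (mcomp mGb (mpair1 (t, tau))).
  - by move=> X _; rewrite lee_fin; exact: Gb0.
  - by apply/mEFin; exact: (mcomp mGa (mpair1 (t, tau))).
  - by move=> X _; rewrite lee_fin; exact: Ga0.
have IGE : (\int[leb]_t \int[leb]_tau \int[leb]_X (G t tau X)%:E =
   (\int[leb]_x (om rho x)%:E) * (\int[leb]_tau \int[leb]_X (fa (tau, X))%:E +
     \int[leb]_tau \int[leb]_X (fb (tau, X))%:E))%E.
  apply: (ge0_split3 TA TB _ _ ES).
  - by apply: intg_ge0 => t _; apply: intg_ge0 => X _; rewrite lee_fin.
  - by apply: intg_ge0 => t _; apply: intg_ge0 => X _; rewrite lee_fin.
rewrite IGE {IGE ES TA TB}.
have FN (W : R * R -> R[i]) (f : R * R -> R) : cmeas W -> (forall t, cintg leb (fun x => W (t, x))) ->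
    (\int[leb]_t N1 (fun x => W (t, x)) < +oo)%E ->
    measT f -> (forall z, 0 <= f z) ->
    (forall z, f z = normc (FTb be p (fun x => W (z.1, x)) z.2) ^+ 2 / om rho z.2) ->
    (\int[leb]_tau \int[leb]_X (f (tau, X))%:E <= (Cft + 1)%:E * \int[leb]_t N1 (fun x => W (t, x)))%E.
  move=> mW iW WF mf f0 fE.
  have C1 : 0 <= Cft + 1 by rewrite addr_ge0// Cft_ge0.
  rewrite -ge0_integralZl//; first last.
  - by move=> t _; exact: N1_ge0.
  - exact: meas_N1.
  apply: ae_ge0_le_integral => //.
  - by move=> t _; apply: intg_ge0 => X _; rewrite lee_fin.
  - apply: (@mintp _ _ _ _ _ leb (fun t X => (f (t, X))%:E)).
      by apply/mEFin; apply: (mcomp mf); exact: mpair.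
    by move=> x y; rewrite lee_fin.
  - by move=> t _; apply: mule_ge0; rewrite ?lee_fin// N1_ge0.
  - by apply: mfuneM; exact: meas_N1.
  apply: (ae_mono (aeN _ mW WF)) => t Wt _.
  under eqint do rewrite fE normc_sqrE.
  apply: le_trans (FT_N1 dbe cp pl pu (iW t) Wt) _.
  by apply: lee_wpmul2r; [exact: N1_ge0|rewrite lee_fin lerDl].
have om_fin : (\int[leb]_x (om rho x)%:E)%E \is a fin_num.
  rewrite ge0_fin_numE ?int_om_lty//.
  by apply: intg_ge0 => x _; rewrite lee_fin ltW.
have C1 : 0 <= Cft + 1 by rewrite addr_ge0// Cft_ge0.
apply: (@le_trans _ _ ((\int[leb]_x (om rho x)%:E) * ((Cft + 1)%:E *
  (\int[leb]_t N1 (fun x => U (t, x)) + \int[leb]_t N1 (fun x => V (t, x)))))%E).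
  apply: lee_wpmul2l; first by apply: intg_ge0 => x _; rewrite lee_fin ltW.
  rewrite ge0_muleDr//; apply: leeD.
    exact (FN U fa mU iU UF mfa fa0 (fun z => erefl)).
  exact (FN V fb mV iV VF mfb fb0 (fun z => erefl)).
rewrite /Ccore [in leRHS]EFinM muleA; apply: lee_wpmul2r; first exact: adde_ge0.
rewrite muleC; apply: lee_wpmul2l; first by rewrite lee_fin.
by rewrite EFinD fineK// leeDr.
Qed.

End core.

Section complex_extra.
Context {R : realType} d (T : measurableType d) (mu : {measure set T -> \bar R}).
Lemma le_normc_cint_meas (F : T -> R[i]) : cmeas F ->
  ((normc (cint mu F))%:E <= \int[mu]_x (normc (F x))%:E)%E.
Proof.
move=> mF; have [h|h] := ltP (\int[mu]_x (normc (F x))%:E)%E +oo%E.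
  by apply: le_normc_cint; apply/cintgP.
by apply: le_trans h; rewrite leey.
Qed.
End complex_extra.

(** * Continuity, piecewise linear cutoffs and antiderivatives *)

Section continuity.
Context {R : realType}.
Implicit Types f g : R -> R.

Lemma contD f g : continuous f -> continuous g -> continuous (fun x => f x + g x).
Proof. by move=> cf cg x; exact: cvgD (cf x) (cg x). Qed.

Lemma contN f : continuous f -> continuous (fun x => - f x).
Proof. by move=> cf x; exact: cvgN (cf x). Qed.

Lemma contM f g : continuous f -> continuous g -> continuous (fun x => f x * g x).
Proof. by move=> cf cg x; exact: cvgM (cf x) (cg x). Qed.

Lemma cont_cst (c : R) : continuous (fun _ : R => c).
Proof. by move=> x; exact: cvg_cst. Qed.

Lemma cont_id : continuous (fun x : R => x).
Proof. by move=> x; exact: cvg_id. Qed.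

Lemma cont_norm f : continuous f -> continuous (fun x => `|f x|).
Proof. by move=> cf x; exact: cvg_norm (cf x). Qed.

End continuity.

Ltac cont := repeat (lazymatch goal with
  | |- continuous (fun _ => ?c) => exact: cont_cst
  | |- continuous (fun t => t) => exact: cont_id
  | |- continuous (fun t => @GRing.add _ (@?f t) (@?g t)) => apply: (@contD _ f g)
  | |- continuous (fun t => @GRing.mul _ (@?f t) (@?g t)) => apply: (@contM _ f g)
  | |- continuous (fun t => @GRing.opp _ (@?f t)) => apply: (@contN _ f)
  | |- continuous (fun t => Num.norm (@?f t)) => apply: (@cont_norm _ f)
  end).

HB.lock Definition pos (R : realType) (x : R) : R := (x + `|x|) / 2.

Section pos.
Context {R : realType}.
Implicit Types (x y z d : R).

Lemma pos_ge0 x : 0 <= pos x.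
Proof. by rewrite pos.unlock; have := ler_norm (- x); rewrite normrN => h; lra. Qed.

Lemma pos_id x : 0 <= x -> pos x = x.
Proof. by move=> x0; rewrite pos.unlock ger0_norm//; field. Qed.

Lemma pos_0 x : x <= 0 -> pos x = 0.
Proof. by move=> x0; rewrite pos.unlock ler0_norm// subrr mul0r. Qed.

Lemma pos_lip x y : `|pos x - pos y| <= `|x - y|.
Proof.
rewrite pos.unlock -mulrBl normrM (@ger0_norm _ 2^-1)// ler_pdivrMr//.
rewrite (_ : _ - _ = (x - y) + (`|x| - `|y|)); last by ring.
have := ler_normD (x - y) (`|x| - `|y|); have := lerB_dist x y; have := lerB_dist y x.
have : `|(`|x| - `|y|)| <= `|x - y|.
  rewrite ler_norml lerB_dist andbT; have := lerB_dist y x; rewrite distrC => h; lra.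
by move=> h1 h2 h3 h4; lra.
Qed.

Lemma pos_cont (f : R -> R) : continuous f -> continuous (fun x : R => pos (f x)).
Proof. by move=> cf; rewrite pos.unlock; cont. Qed.

(** A tent of height and half-width [d] around [z], with slope 1 for every [d]. The integral of its
    square over the centre [z] does not depend on [x], which makes these squares a continuous
    partition of unity. *)
Definition chi d z x : R := pos (d - `|x - z|).

Lemma chi_ge0 d z x : 0 <= chi d z x. Proof. exact: pos_ge0. Qed.

Lemma chi_out d z x : d < `|x - z| -> chi d z x = 0.
Proof. by move=> h; apply: pos_0; lra. Qed.

Lemma chi_le d z x : 0 <= d -> chi d z x <= d.
Proof.
move=> d0; have n0 := normr_ge0 (x - z).
have [h|h] := leP `|x - z| d; last by rewrite chi_out.
by rewrite /chi pos_id; lra.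
Qed.

Lemma chi_lip d z x y : `|chi d z x - chi d z y| <= `|x - y|.
Proof.
apply: le_trans (pos_lip _ _) _.
rewrite (_ : _ - _ = `|y - z| - `|x - z|); last by ring.
rewrite (_ : x - y = - ((y - z) - (x - z))); last by ring.
rewrite normrN ler_norml lerB_dist andbT.
have := lerB_dist (x - z) (y - z); rewrite (distrC (x - z)) => h; lra.
Qed.

Lemma meas_pos : measT (@pos R).
Proof. by apply: contm; apply: pos_cont => x; exact: cvg_id. Qed.

Lemma meas_chi d : measT (fun q : R * R => chi d q.1 q.2).
Proof.
apply: (mcomp meas_pos); apply: mfunB => //.
by apply: mcomp => //; exact: mfunB.
Qed.

(** The projection of [x] onto the interval of radius [d] around [z], as a sum of ramps. *)
Definition clamp d z x : R := z - d + pos (x - z + d) - pos (x - z - d).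

Lemma clamp_id d z x : `|x - z| <= d -> clamp d z x = x.
Proof.
rewrite ler_norml => /andP[h1 h2]; rewrite /clamp pos_id; last by lra.
by rewrite pos_0; [ring|lra].
Qed.

Lemma clamp_in d z x : 0 <= d -> `|clamp d z x - z| <= d.
Proof.
move=> d0; rewrite /clamp ler_norml.
have [h1|h1] := leP 0 (x - z + d); have [h2|h2] := leP 0 (x - z - d).
- by rewrite !pos_id//; apply/andP; split; lra.
- by rewrite pos_id// (pos_0 (ltW h2)); apply/andP; split; lra.
- by exfalso; lra.
- by rewrite (pos_0 (ltW h1)) (pos_0 (ltW h2)); apply/andP; split; lra.
Qed.

Lemma clamp_cont d z : continuous (clamp d z).
Proof. by rewrite /clamp; cont; apply: pos_cont; cont. Qed.

(** Equal to 1 up to distance [d] from [z], to 0 from distance [2 * d] on, and linear between. *)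
Definition plateau d z x : R := pos (2 - `|x - z| / d) - pos (1 - `|x - z| / d).

Lemma plateau1 d z x : 0 < d -> `|x - z| <= d -> plateau d z x = 1.
Proof.
move=> d0 h; have h1 : `|x - z| / d <= 1 by rewrite ler_pdivrMr// mul1r.
by rewrite /plateau !pos_id; lra.
Qed.

Lemma plateau0 d z x : 0 < d -> 2 * d <= `|x - z| -> plateau d z x = 0.
Proof.
move=> d0 h; have h1 : 2 <= `|x - z| / d by rewrite ler_pdivlMr.
by rewrite /plateau !pos_0; lra.
Qed.

Lemma plateau_in d z x : 0 < d -> 0 <= plateau d z x <= 1.
Proof.
move=> d0; rewrite /plateau; set u := `|x - z| / d.
have [h1|h1] := leP 0 (2 - u); have [h2|h2] := leP 0 (1 - u).
- by rewrite !pos_id//; apply/andP; split; lra.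
- by rewrite pos_id// (pos_0 (ltW h2)); apply/andP; split; lra.
- by exfalso; lra.
- by rewrite (pos_0 (ltW h1)) (pos_0 (ltW h2)); apply/andP; split; lra.
Qed.

Lemma plateau_cont d z : continuous (plateau d z).
Proof. by rewrite /plateau; cont; apply: pos_cont; cont. Qed.

End pos.

Section antiderivative.
Context {R : realType}.
Local Notation leb := (@lebesgue_measure R).

Lemma bounded_support_integrable (f : R -> R) (M N : R) : measT f ->
  (forall x, `|f x| <= M) -> (forall x, N < `|x| -> f x = 0) ->
  leb.-integrable setT (EFin \o f).
Proof.
move=> mf fM fN; have M0 : 0 <= M by exact: le_trans (fM 0).
pose g (x : R) := M * \1_(`[(- N)%R, N]%classic) x.
have g0 x : 0 <= g x by apply: mulr_ge0.
have mg : measT g by apply: mfunM => //; exact: mindic.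
have Ig : leb.-integrable setT (EFin \o g).
  apply/integrableP; split; first exact/mEFin.
  under eqint do rewrite /= ger0_norm// EFinM.
  rewrite ge0_integralZl//; last by apply/mEFin; exact: mindic.
  rewrite integral_indic// setIT lte_mul_pinfty ?lee_fin//.
  have H : (leb `[(- N)%R, N]%classic < +oo)%E.
    by rewrite lebesgue_measure_itv /=; case: ifP => // _; rewrite -EFinB ltry.
  exact: H.
apply: (le_integrable measurableT _ _ Ig); first exact/mEFin.
move=> x _; rewrite /= lee_fin (@ger0_norm _ (g x))// /g indicE.
have [h|h] := boolP (x \in `[(- N)%R, N]%classic); first by rewrite mulr1.
rewrite fN ?normr0 ?mulr0//.
by move: h; rewrite notin_setE /= in_itv /= -ler_norml => /negP; rewrite -ltNge.
Qed.

(** The primitive from minus infinity of the compactly supported function [p - k], plus [k * x]. *)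
Lemma antiderivative (p : R -> R) (k N M : R) : continuous p ->
  (forall x, `|p x - k| <= M) -> (forall x, N < `|x| -> p x = k) ->
  exists be : R -> R, forall x : R, is_derive x 1 be (p x).
Proof.
move=> cp pM pN; pose f x := p x - k.
have cf : continuous f by rewrite /f; cont.
have If : leb.-integrable setT (EFin \o f).
  apply: (@bounded_support_integrable f M N) => //; first exact: contm.
  by move=> x /pN pk; rewrite /f pk subrr.
pose F x := (\int[leb]_(t in [set` Interval -oo%O (BRight x)]) f t)%R.
exists (fun x => F x + k * x) => x.
have [dF F'] : derivable F x 1 /\ derive1 F x = f x.
  apply: (@continuous_FTC1 R f -oo%O x (x + 1)) => //; first by rewrite ltrDl.
  - exact: (integrableS _ _ _ If).
  - exact: ltNyr.
  - exact: cf.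
have dF1 : is_derive x 1 F (f x) by rewrite -F' derive1E; apply: DeriveDef.
have dk : is_derive x 1 (fun t : R => k * t) (k * 1 + x * 0) by der.
by apply: der_eq (derD dF1 dk) _; rewrite /f; ring.
Qed.

End antiderivative.

Lemma meas2 {R : realType} d (T : measurableType d) (f : R -> R -> R) (g h : T -> R) :
  measT (fun q : R * R => f q.1 q.2) -> measT g ->
  measT h -> measT (fun x => f (g x) (h x)).
Proof. by move=> mf mg mh; exact: (mcomp mf (mpair mg mh)). Qed.

Section nonneg.
Context {R : realType} d (T : measurableType d) (mu : {measure set T -> \bar R}).
Implicit Types f g : T -> R.
Local Open Scope ereal_scope.

Lemma ge0_intZl (k : R) f : (0 <= k)%R -> measT f -> (forall x, (0 <= f x)%R) ->
  \int[mu]_x (k * f x)%:E = k%:E * \int[mu]_x (f x)%:E.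
Proof.
move=> k0 mf f0; have mEf : measT (fun x => (f x)%:E) by exact/mEFin.
have f0' x : setT x -> 0 <= (f x)%:E by move=> _; rewrite lee_fin.
by under eqint do rewrite EFinM; rewrite ge0_integralZl.
Qed.

Lemma ge0_intD f g : measT f -> measT g ->
  (forall x, (0 <= f x)%R) -> (forall x, (0 <= g x)%R) ->
  \int[mu]_x (f x + g x)%:E = \int[mu]_x (f x)%:E + \int[mu]_x (g x)%:E.
Proof.
move=> mf mg f0 g0; have mEf : measT (fun x => (f x)%:E) by exact/mEFin.
have mEg : measT (fun x => (g x)%:E) by exact/mEFin.
have f0' x : setT x -> 0 <= (f x)%:E by move=> _; rewrite lee_fin.
have g0' x : setT x -> 0 <= (g x)%:E by move=> _; rewrite lee_fin.
exact: (ge0_integralD mu measurableT f0' mEf g0' mEg).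
Qed.

Lemma ge0_le_int f g : measT f -> measT g ->
  (forall x, (0 <= f x)%R) -> (forall x, (f x <= g x)%R) ->
  \int[mu]_x (f x)%:E <= \int[mu]_x (g x)%:E.
Proof.
move=> mf mg f0 fg; apply: ge0_le_integral => //.
- by move=> x _; rewrite lee_fin.
- exact/mEFin.
- exact/mEFin.
- by move=> x _; rewrite lee_fin.
Qed.

Lemma ge0_le_intE (f g : T -> \bar R) : measT f -> measT g ->
  (forall x, 0 <= f x) -> (forall x, f x <= g x) -> \int[mu]_x f x <= \int[mu]_x g x.
Proof.
move=> mf mg f0 fg; have f0' x : setT x -> 0 <= f x by [].
have fg' x : setT x -> f x <= g x by [].
by apply: ge0_le_integral.
Qed.

Lemma ge0_intDE (f g : T -> \bar R) : measT f -> measT g ->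
  (forall x, 0 <= f x) -> (forall x, 0 <= g x) ->
  \int[mu]_x (f x + g x) = \int[mu]_x f x + \int[mu]_x g x.
Proof.
move=> mf mg f0 g0; have f0' x : setT x -> 0 <= f x by [].
have g0' x : setT x -> 0 <= g x by [].
exact: (ge0_integralD mu measurableT f0' mf g0' mg).
Qed.

Lemma ge0_intZlE (k : R) (f : T -> \bar R) : (0 <= k)%R -> measT f ->
  (forall x, 0 <= f x) -> \int[mu]_x (k%:E * f x) = k%:E * \int[mu]_x f x.
Proof.
move=> k0 mf f0; have f0' x : setT x -> 0 <= f x by [].
by rewrite ge0_integralZl.
Qed.

Lemma int_ge0 (f : T -> \bar R) : (forall x, 0 <= f x) -> 0 <= \int[mu]_x f x.
Proof. by move=> f0; exact: intg_ge0. Qed.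

End nonneg.

(** * Multiplication operators averaged over a parameter *)

Section mult.
Context {R : realType}.
Local Notation leb := (@lebesgue_measure R).
Variables (rho : R) (rho2 : 2 < rho) (rho4 : rho < 4).
Variables (m : R -> R -> R) (mm : measT (fun q : R * R => m q.1 q.2)).
Variables (b l : R) (b0 : 0 <= b) (l0 : 0 <= l).
Local Open Scope ereal_scope.
Hypothesis m_size : forall x, \int[leb]_z (m z x ^+ 2)%:E <= b%:E.
Hypothesis m_diff : forall x y, \int[leb]_z ((m z x - m z y) ^+ 2)%:E <= (l * (x - y) ^+ 2)%:E.

Definition geo : R := fine (\sum_(i <oo) ((rho / 4) ^+ i)%:E).

Lemma geoE : \sum_(i <oo) ((rho / 4) ^+ i)%:E = geo%:E.
Proof.
rewrite fineK// ge0_fin_numE; last first.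
  by apply: nneseries_ge0 => i _ _; rewrite lee_fin exprn_ge0// divr_ge0//; have := rho2; lra.
by apply: geometric_lty; have := rho2; have := rho4; lra.
Qed.

Lemma geo_ge0 : (0 <= geo)%R.
Proof.
apply: fine_ge0; apply: nneseries_ge0 => i _ _.
by rewrite lee_fin exprn_ge0// divr_ge0//; have := rho2; lra.
Qed.

Let mz (x : R) : measT (m^~ x).
Proof. exact: (mcomp mm (mpair2 x)). Qed.

Let m1 : measT (fun q : R * (R * R) => m q.1 q.2.1).
Proof.
apply: (meas2 mm) => //; exact: (mcomp mfst msnd).
Qed.

Let m2 : measT (fun q : R * (R * R) => m q.1 q.2.2).
Proof.
apply: (meas2 mm) => //; exact: (mcomp msnd msnd).
Qed.

Section u.
Variables (u : R -> R[i]) (mu : cmeas u).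
Let msq : measT (fun x => sqn (u x)). Proof. exact: msqn. Qed.

Lemma mult_size : \int[leb]_z \int[leb]_x (sqn ((m z x)%:C%C * u x)%R)%:E
  <= b%:E * \int[leb]_x (sqn (u x))%:E.
Proof.
have E z x : sqn ((m z x)%:C%C * u x)%R = (sqn (u x) * m z x ^+ 2)%R.
  by rewrite sqnM sqn_real mulrC.
under eqint do under eqint do rewrite E.
rewrite (@ge0_swap _ _ _ _ _ leb leb (fun z x => sqn (u x) * m z x ^+ 2)%R); first last.
- by move=> x y; rewrite mulr_ge0 ?sqn_ge0 ?sqr_ge0.
- apply: mfunM; last exact: mfunX.
  exact: (mcomp msq msnd).
rewrite -(ge0_intZl leb b0 msq (fun x => sqn_ge0 (u x))).
apply: ge0_le_integral => //.
- by move=> x _; apply: intg_ge0 => z _; rewrite lee_fin mulr_ge0 ?sqn_ge0 ?sqr_ge0.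
- apply: (@mintp _ _ _ _ _ leb (fun x z => (sqn (u x) * m z x ^+ 2)%:E)).
    apply/mEFin; apply: mfunM.
      exact: (mcomp msq mfst).
    apply: mfunX; exact: (meas2 mm).
  by move=> x y; rewrite lee_fin mulr_ge0 ?sqn_ge0 ?sqr_ge0.
- by apply/mEFin; exact: mfunM.
move=> x _; rewrite (ge0_intZl leb (sqn_ge0 (u x)) (mfunX 2 (mz x)) (fun z => sqr_ge0 _)).
by rewrite muleC EFinM; apply: lee_wpmul2r; [rewrite lee_fin sqn_ge0|exact: m_size].
Qed.

Let mPk i : measT (fun q : R * R => Pk (e_ i) (q.1 - q.2)).
Proof.
apply: (mcomp (meas_Pk (e_gt0 i))).
exact: (mfunB mfst msnd).
Qed.

Let mQk i : measT (fun q : R * R => Qk (e_ i) (q.1 - q.2)).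
Proof.
apply: (mcomp (meas_Qk (e_gt0 i))).
exact: (mfunB mfst msnd).
Qed.

Let mD : measT (fun q : R * R => sqn (u q.1 - u q.2)%R).
Proof. by apply: msqn; apply: cmeasB; exact: (cmeas_comp mu). Qed.

Let mU1 : cmeas (fun q : R * (R * R) => (m q.1 q.2.1)%:C%C * u q.2.1)%R.
Proof.
apply: cmeasM; first by apply: cmeas_real.
apply: (cmeas_comp mu); exact: (mcomp mfst msnd).
Qed.

Let mU2 : cmeas (fun q : R * (R * R) => (m q.1 q.2.2)%:C%C * u q.2.2)%R.
Proof.
apply: cmeasM; first by apply: cmeas_real.
apply: (cmeas_comp mu); exact: (mcomp msnd msnd).
Qed.

Let mswap : measT (fun q : (R * R) * R => (q.2, q.1)).
Proof. exact: mpair. Qed.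

Let mu2 : measT (fun q : R * R => sqn (u q.2)).
Proof. exact: (mcomp msq msnd). Qed.

Let Pk0 i x : (0 <= Pk (e_ i) x :> R)%R. Proof. by rewrite Pk_ge0// e_gt0. Qed.
Let Qk0 i x : (0 <= Qk (e_ i) x :> R)%R. Proof. by rewrite Qk_ge0// e_gt0. Qed.

(** Leibniz splitting m(x) (u(x) - u(y)) + (m(x) - m(y)) u(y). In the second term the hypothesis on
    [m] produces (x - y)^2, which [Pk_sqr] trades for [e_ i ^+ 2] and the integrable kernel [Qk]. *)
Let split_diff i q : \int[leb]_z (sqn ((m z q.1)%:C%C * u q.1 - (m z q.2)%:C%C * u q.2)%R * Pk (e_ i) (q.1 - q.2))%:E
  <= (2 * b * (sqn (u q.1 - u q.2)%R * Pk (e_ i) (q.1 - q.2))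
     + 4 * l * e_ i ^+ 2 * (sqn (u q.2) * Qk (e_ i) (q.1 - q.2)))%:E.
Proof.
set D := sqn (u q.1 - u q.2)%R; set S := sqn (u q.2); set P := Pk _ _; set Q := Qk _ _.
have D0 : (0 <= D)%R by exact: sqn_ge0.
have S0 : (0 <= S)%R by exact: sqn_ge0.
have P0 : (0 <= P)%R := Pk0 i (q.1 - q.2).
have DP0 : (0 <= 2 * D * P)%R by apply: mulr_ge0 => //; exact: mulr_ge0.
have SP0 : (0 <= 2 * S * P)%R by apply: mulr_ge0 => //; exact: mulr_ge0.
have mm1 : measT (fun z => m z q.1 ^+ 2)%R.
  by apply: mfunX; exact: mz.
have mm2 : measT (fun z => (m z q.1 - m z q.2) ^+ 2)%R.
  by apply: mfunX; apply: mfunB; exact: mz.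
have sq1 z : (0 <= m z q.1 ^+ 2)%R by exact: sqr_ge0.
have sq2 z : (0 <= (m z q.1 - m z q.2) ^+ 2)%R by exact: sqr_ge0.
apply: (@le_trans _ _ (\int[leb]_z (2 * D * P * m z q.1 ^+ 2 + 2 * S * P * (m z q.1 - m z q.2) ^+ 2)%:E)).
  apply: ge0_le_int.
  - apply: mfunM => //; apply: msqn.
    apply: cmeasB; apply: cmeasM; try exact: cmeas_cst; apply: cmeas_real; exact: mz.
  - by apply: mfunD; apply: mfunM.
  - by move=> z; apply: mulr_ge0 => //; exact: sqn_ge0.
  move=> z.
  rewrite (_ : _ * u q.1 - _ = (m z q.1)%:C%C * (u q.1 - u q.2) + (m z q.1 - m z q.2)%:C%C * u q.2)%R; last first.
    by rewrite creB; ring.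
  have := sqnD_le ((m z q.1)%:C%C * (u q.1 - u q.2))%R ((m z q.1 - m z q.2)%:C%C * u q.2)%R.
  rewrite !sqnM !sqn_real -/D -/S => h.
  apply: le_trans (ler_wpM2r P0 h) _.
  by rewrite le_eqVlt; apply/orP; left; apply/eqP; ring.
rewrite ge0_intD; last 4 first.
- exact: mfunM.
- exact: mfunM.
- by move=> z; exact: mulr_ge0.
- by move=> z; exact: mulr_ge0.
rewrite (ge0_intZl leb DP0 mm1 sq1) (ge0_intZl leb SP0 mm2 sq2).
have DP1 : 0 <= (2 * D * P)%:E by rewrite lee_fin.
have SP1 : 0 <= (2 * S * P)%:E by rewrite lee_fin.
have h1 := lee_wpmul2l DP1 (m_size q.1).
have h2 := lee_wpmul2l SP1 (m_diff q.1 q.2).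
apply: le_trans (leeD h1 h2) _; rewrite -EFinD lee_fin.
have h3 := Pk_sqr (q.1 - q.2) (e_gt0 i); rewrite -/P -/Q in h3.
have h4 : (2 * S * l * ((q.1 - q.2) ^+ 2 * P) <= 2 * S * l * (2 * e_ i ^+ 2 * Q))%R.
  by apply: ler_wpM2l => //; apply: mulr_ge0 => //; exact: mulr_ge0.
lra.
Qed.

Lemma mult_osc i : \int[leb]_z osc i (fun x => (m z x)%:C%C * u x)%R
  <= (2 * b)%:E * osc i u + (8 * pi * l * e_ i ^+ 2)%:E * \int[leb]_x (sqn (u x))%:E.
Proof.
rewrite /osc (@ge0_swap _ _ _ _ _ leb (sprod leb leb) (fun z q =>
  sqn ((m z q.1)%:C%C * u q.1 - (m z q.2)%:C%C * u q.2) * Pk (e_ i) (q.1 - q.2))%R); first last.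
- by move=> x y; rewrite mulr_ge0 ?sqn_ge0 ?Pk0.
- apply: mfunM; last exact: (mcomp (mPk i) msnd).
  exact: (msqn (cmeasB mU1 mU2)).
have c0 : (0 <= 4 * l * e_ i ^+ 2)%R by rewrite !mulr_ge0// exprn_ge0// (ltW (e_gt0 i)).
have mA : measT (fun q : R * R => sqn (u q.1 - u q.2)%R * Pk (e_ i) (q.1 - q.2))%R.
  exact: mfunM.
have mB : measT (fun q : R * R => sqn (u q.2) * Qk (e_ i) (q.1 - q.2))%R.
  exact: mfunM.
have A0 (q : R * R) : (0 <= sqn (u q.1 - u q.2)%R * Pk (e_ i) (q.1 - q.2))%R.
  by apply: mulr_ge0; rewrite ?sqn_ge0 ?Pk0.
have B0 (q : R * R) : (0 <= sqn (u q.2) * Qk (e_ i) (q.1 - q.2))%R.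
  by apply: mulr_ge0; rewrite ?sqn_ge0 ?Qk0.
have b2 : (0 <= 2 * b)%R by apply: mulr_ge0.
apply: (@le_trans _ _ (\int[sprod leb leb]_q (2 * b * (sqn (u q.1 - u q.2)%R * Pk (e_ i) (q.1 - q.2))
   + 4 * l * e_ i ^+ 2 * (sqn (u q.2) * Qk (e_ i) (q.1 - q.2)))%:E)).
  apply: ge0_le_intE.
  - apply: (@mintp _ _ _ _ _ leb (fun q z =>
      (sqn ((m z q.1)%:C%C * u q.1 - (m z q.2)%:C%C * u q.2)%R * Pk (e_ i) (q.1 - q.2))%:E)).
      apply/mEFin; apply: mfunM; last exact: (mcomp (mPk i) mfst).
      exact: (msqn (cmeasB (cmeas_comp mU1 mswap) (cmeas_comp mU2 mswap))).
    by move=> x y; rewrite lee_fin mulr_ge0 ?sqn_ge0 ?Pk0.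
  - by apply/mEFin; apply: mfunD; exact: mfunM.
  - by move=> q; apply: intg_ge0 => z _; rewrite lee_fin mulr_ge0 ?sqn_ge0 ?Pk0.
  exact: split_diff.
rewrite ge0_intD; last 4 first.
- exact: mfunM.
- exact: mfunM.
- by move=> q; exact: mulr_ge0.
- by move=> q; exact: mulr_ge0.
rewrite (ge0_intZl (sprod leb leb) b2 mA A0) (ge0_intZl (sprod leb leb) c0 mB B0); apply: leeD => //.
have B1 x y : 0 <= (sqn (u y) * Qk (e_ i) (x - y))%:E by rewrite lee_fin; exact: (B0 (x, y)).
have mB1 : measT (fun q : R * R => (sqn (u q.2) * Qk (e_ i) (q.1 - q.2))%:E).
  exact/mEFin.
rewrite (@ge0_prod_int _ _ _ _ _ leb leb (fun x y => (sqn (u y) * Qk (e_ i) (x - y))%:E) mB1 B1).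
rewrite (@ge0_swapE _ _ _ _ _ leb leb (fun x y => (sqn (u y) * Qk (e_ i) (x - y))%:E) mB1 B1).
have pi2 : (0 <= 2 * pi :> R)%R by rewrite mulr_ge0// pi_ge0.
have E y : \int[leb]_x (sqn (u y) * Qk (e_ i) (x - y))%:E = (2 * pi * sqn (u y))%:E.
  have mQ : measT (fun x : R => Qk (e_ i) (x - y)).
    by apply: (mcomp (meas_Qk (e_gt0 i))); exact: mfunB.
  rewrite (ge0_intZl leb (sqn_ge0 (u y)) mQ (fun x => Qk0 i _)).
  rewrite (@ge0_integral_shift _ (- y) (fun x => (Qk (e_ i) x)%:E)) ?int_Qk ?e_gt0//.
  - by rewrite -EFinM mulrC.
  - by apply/mEFin; exact: (meas_Qk (e_gt0 i)).
  - by move=> x; rewrite lee_fin Qk0.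
under eqint do rewrite E.
rewrite (ge0_intZl leb pi2 msq (fun x => sqn_ge0 (u x))).
rewrite muleA -EFinM; apply: lee_wpmul2r; first by apply: intg_ge0 => x _; rewrite lee_fin sqn_ge0.
by rewrite lee_fin le_eqVlt; apply/orP; left; apply/eqP; ring.
Qed.

Definition Cmult : R := 2 * b + 8 * pi * l * geo.

Lemma Cmult_ge0 : (0 <= Cmult)%R.
Proof. by rewrite addr_ge0// !mulr_ge0 ?pi_ge0 ?geo_ge0. Qed.

(** The commutator error at scale [i] is O(4^-i) times the L2 norm, so its weighted sum is a
    geometric series of ratio [rho / 4]. The hypotheses on [m] are integrated over [z], so the
    localized pieces recombine without any counting of overlaps. *)
Lemma mult_N1 : \int[leb]_z N1 rho (fun x => (m z x)%:C%C * u x)%R <= Cmult%:E * N1 rho u.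
Proof.
have r0 : (0 < rho)%R by have := rho2; lra.
have mU : cmeas (fun q : R * R => (m q.1 q.2)%:C%C * u q.2)%R.
  by apply: cmeasM; [exact: cmeas_real|exact: (cmeas_comp mu)].
set S := \int[leb]_x (sqn (u x))%:E.
have S0 : 0 <= S by apply: intg_ge0 => x _; rewrite lee_fin sqn_ge0.
have ro i v : 0 <= (rho ^+ i)%:E * osc i v.
  by apply: mule_ge0; [rewrite lee_fin exprn_ge0// ltW|exact: osc_ge0].
have mo i : measT (fun z => (rho ^+ i)%:E * osc i (fun x => (m z x)%:C%C * u x)%R).
  by apply: mfuneM; exact: (meas_osc i mU).
rewrite /N1 ge0_integralD//; first last.
- by apply: ge0_emeasurable_sum => [i x _ _|i _]; [exact: ro|exact: mo].
- by move=> z _; apply: nneseries_ge0 => *; exact: ro.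
- apply: (@mintp _ _ _ _ _ leb (fun z x => (sqn ((m z x)%:C%C * u x)%R)%:E)).
    by apply/mEFin; exact: (msqn mU).
  by move=> x y; rewrite lee_fin sqn_ge0.
- by move=> z _; apply: intg_ge0 => x _; rewrite lee_fin sqn_ge0.
rewrite integral_nneseries//.
have c8 : (0 <= 8 * pi * l)%R by rewrite !mulr_ge0// pi_ge0.
have b2 : (0 <= 2 * b)%R by rewrite mulr_ge0.
have term i : \int[leb]_z ((rho ^+ i)%:E * osc i (fun x => (m z x)%:C%C * u x)%R) <=
    (2 * b)%:E * ((rho ^+ i)%:E * osc i u) + ((8 * pi * l)%:E * S) * ((rho / 4) ^+ i)%:E.
  rewrite ge0_integralZl//; first last.
  - by rewrite lee_fin exprn_ge0// ltW.
  - by move=> z _; exact: osc_ge0.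
  - exact: (meas_osc i mU).
  apply: (@le_trans _ _ ((rho ^+ i)%:E * ((2 * b)%:E * osc i u + (8 * pi * l * e_ i ^+ 2)%:E * S))).
    by apply: lee_wpmul2l; [rewrite lee_fin exprn_ge0// ltW|exact: mult_osc].
  rewrite ge0_muleDr; last 2 first.
  - by apply: mule_ge0; [rewrite lee_fin|exact: osc_ge0].
  - by apply: mule_ge0 => //; rewrite lee_fin mulr_ge0// sqr_ge0.
  apply: leeD; first by rewrite muleCA.
  rewrite muleA -EFinM muleAC -EFinM; apply: lee_wpmul2r => //.
  have -> : (e_ i ^+ 2 = 4^-1 ^+ i :> R)%R.
    by rewrite /e_ -exprM mulnC exprM; congr (_ ^+ _)%R; field.
  by rewrite lee_fin exprMn le_eqVlt; apply/orP; left; apply/eqP; ring.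
apply: (@le_trans _ _ (b%:E * S + ((2 * b)%:E * \sum_(i <oo) ((rho ^+ i)%:E * osc i u) + ((8 * pi * l)%:E * S) * geo%:E))).
  apply: leeD; first exact: mult_size.
  apply: (@le_trans _ _ (\sum_(i <oo) ((2 * b)%:E * ((rho ^+ i)%:E * osc i u) + ((8 * pi * l)%:E * S) * ((rho / 4) ^+ i)%:E))).
    apply: lee_nneseries => [i *|i *]; last exact: term.
    by apply: int_ge0 => z; exact: ro.
  have q0 i : 0 <= ((rho / 4) ^+ i)%:E by rewrite lee_fin exprn_ge0// divr_ge0//; have := rho2; lra.
  have S80 : 0 <= (8 * pi * l)%:E * S by apply: mule_ge0.
  rewrite nneseriesD; last 2 first.
  - by move=> i *; apply: mule_ge0; [rewrite lee_fin|exact: ro].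
  - by move=> i *; apply: mule_ge0.
  rewrite nneseriesZl//.
  apply: leeD => //; rewrite -geoE; apply: nneseries_le => [i|n]; first exact: mule_ge0.
  rewrite -ge0_sume_distrr//; apply: lee_wpmul2l => //.
  exact: nneseries_lim_ge.
set W := \sum_(i <oo) _; have W0 : 0 <= W by apply: nneseries_ge0 => *; exact: ro.
have g0 := geo_ge0.
rewrite (ge0_muleDr _ S0 W0) addeCA addeC; apply: leeD; last first.
  by apply: lee_wpmul2r => //; rewrite lee_fin /Cmult lerDl !mulr_ge0// pi_ge0.
rewrite muleAC -EFinM -ge0_muleDl; last 2 first.
- by rewrite lee_fin.
- by rewrite lee_fin; apply: mulr_ge0.
apply: lee_wpmul2r => //; rewrite lee_fin /Cmult; have := b0; lra.
Qed.

End u.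
End mult.

Lemma eq_leE {R : realType} (x y : \bar R) : x = y -> (x <= y)%E.
Proof. by move=> ->. Qed.

Lemma ge0_mule_comb {R : realType} (a b x y : \bar R) : (0 <= a -> 0 <= b -> 0 <= x -> 0 <= y ->
  a * x + b * y <= (a + b) * (x + y))%E.
Proof.
move=> a0 b0 x0 y0; rewrite ge0_muleDl//; apply: leeD; apply: lee_wpmul2l => //.
  by rewrite leeDl.
by rewrite leeDr.
Qed.

Lemma EFin_mul3 {R : realType} (a b c : R) (x : \bar R) :
  (a%:E * (b%:E * (c%:E * x)) = (a * (b * c))%:E * x)%E.
Proof. by rewrite !EFinM !muleA. Qed.

(** * Localization to intervals of a line *)

Section line_tools.
Context {R : realType}.
Local Notation leb := (@lebesgue_measure R).

Lemma bsupp_cintg (G : R -> R[i]) (M N : R) : cmeas G ->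
  (forall x, normc (G x) <= M) -> (forall x, N < `|x| -> G x = 0) -> cintg leb G.
Proof.
move=> mG GM GN; apply: (@le_cintg _ _ _ leb G (fun x => normc (G x)) mG) => //.
apply: (@bounded_support_integrable _ _ M N); first exact: mnormc.
  by move=> x; rewrite ger0_norm ?nc_ge0.
by move=> x /GN ->; rewrite normc_real normr0.
Qed.

Lemma int_indic_ball (k d x : R) : 0 <= k -> 0 <= d ->
  (\int[leb]_z (k * \1_(`[(x - d)%R, (x + d)%R]%classic) z)%:E = (k * (2 * d))%:E)%E.
Proof.
move=> k0 d0; rewrite ge0_intZl//.
rewrite integral_indic// setIT EFinM; congr (_ * _)%E.
have H : (leb `[(x - d)%R, (x + d)%R]%classic = (2 * d)%:E)%E.
  rewrite lebesgue_measure_itv /= lte_fin; case: ifP => h.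
    by rewrite -EFinB; congr EFin; ring.
  have -> : d = 0; last by rewrite mulr0.
  by apply/eqP; rewrite eq_le d0 andbT; move/negbT: h; rewrite -leNgt; lra.
exact: H.
Qed.

Lemma indic_ballE (d x z : R) : \1_(`[(x - d)%R, (x + d)%R]%classic) z = (`|x - z| <= d)%R%:R :> R.
Proof.
rewrite indicE; congr (_%:R); congr nat_of_bool.
apply/idP/idP.
  by rewrite inE /= in_itv /= => /andP[h1 h2]; rewrite ler_norml; apply/andP; split; lra.
by rewrite ler_norml inE /= in_itv /= => /andP[h1 h2]; apply/andP; split; lra.
Qed.

Section chi_mult.
Variables (d b0 l1 : R) (M : R -> R).
Hypotheses (d0 : 0 < d) (b00 : 0 <= b0) (l10 : 0 <= l1) (Mb : forall x, `|M x| <= b0)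
  (Ml : forall x y, `|M x - M y| <= l1 * `|x - y|) (mM : measT M).

Lemma chi_mult_meas : measT (fun q : R * R => chi d q.1 q.2 * M q.2).
Proof.
apply: mfunM; first exact: meas_chi.
exact: (mcomp mM msnd).
Qed.

Let mchi x : measT (fun z : R => chi d z x * M x).
Proof. by apply: mfunM => //; exact: (mcomp (meas_chi d) (mpair2 x)). Qed.

(** For given [x] the tent is at most [d] and is nonzero only for [z] in an interval of length
    [2 * d]. *)
Lemma chi_mult_size x : (\int[leb]_z ((chi d z x * M x) ^+ 2)%:E <= (2 * d ^+ 3 * b0 ^+ 2)%:E)%E.
Proof.
have k0 : 0 <= (d * b0) ^+ 2 by exact: sqr_ge0.
apply: (@le_trans _ _ (\int[leb]_z ((d * b0) ^+ 2 * \1_(`[(x - d)%R, (x + d)%R]%classic) z)%:E)%E).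
  apply: ge0_le_int.
  - by apply: mfunX; exact: mchi.
  - by apply: mfunM => //; exact: mindic.
  - by move=> z; exact: sqr_ge0.
  move=> z; rewrite indic_ballE; have [h|h] := leP `|x - z| d; last first.
    by rewrite chi_out// mul0r expr0n mulr0.
  rewrite mulr1 -[leLHS]ger0_norm ?sqr_ge0// normrX; apply: lerXn2r; rewrite ?nnegrE//.
    by apply: mulr_ge0 => //; exact: ltW.
  rewrite normrM; apply: ler_pM => //.
  by rewrite ger0_norm ?chi_ge0// chi_le// ltW.
rewrite (int_indic_ball _ k0 (ltW d0)) lee_fin le_eqVlt; apply/orP; left; apply/eqP; ring.
Qed.

(** The product rule gives the Lipschitz constant [d * l1 + b0], and the difference vanishes for [z]
    outside two intervals of length [2 * d]. *)
Lemma chi_mult_diff x y : (\int[leb]_z ((chi d z x * M x - chi d z y * M y) ^+ 2)%:E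
  <= (4 * d * (d * l1 + b0) ^+ 2 * (x - y) ^+ 2)%:E)%E.
Proof.
pose k := ((d * l1 + b0) * `|x - y|) ^+ 2; have k0 : 0 <= k by exact: sqr_ge0.
have mI v : measT (fun z : R => k * \1_(`[(v - d)%R, (v + d)%R]%classic) z).
  by apply: mfunM => //; exact: mindic.
have I0 v z : 0 <= k * \1_(`[(v - d)%R, (v + d)%R]%classic) z by apply: mulr_ge0.
apply: (@le_trans _ _ (\int[leb]_z (k * \1_(`[(x - d)%R, (x + d)%R]%classic) z +
     k * \1_(`[(y - d)%R, (y + d)%R]%classic) z)%:E)%E).
  apply: ge0_le_int.
  - apply: mfunX; apply: mfunB; exact: mchi.
  - by apply: mfunD; exact: mI.
  - by move=> z; exact: sqr_ge0.
  have dl0 : 0 <= d * l1 + b0 by apply: addr_ge0 => //; apply: mulr_ge0 => //; exact: ltW.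
  have H z : (chi d z x * M x - chi d z y * M y) ^+ 2 <= k.
    rewrite -[leLHS]ger0_norm ?sqr_ge0// normrX; apply: lerXn2r; rewrite ?nnegrE//.
      by apply: mulr_ge0.
    rewrite (_ : _ - _ = chi d z x * (M x - M y) + (chi d z x - chi d z y) * M y); last by ring.
    apply: le_trans (ler_normD _ _) _; rewrite !normrM mulrDl; apply: lerD.
      rewrite -mulrA; apply: ler_pM => //.
      by rewrite ger0_norm ?chi_ge0// chi_le// ltW.
    by rewrite mulrC; apply: ler_pM => //; exact: chi_lip.
  move=> z; have Hz := H z; rewrite !indic_ballE.
  have [hx|hx] := leP `|x - z| d; have [hy|hy] := leP `|y - z| d; rewrite ?mulr1 ?mulr0 ?addr0 ?add0r//.
    by apply: le_trans Hz _; rewrite lerDl.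
  by rewrite !chi_out// !mul0r subrr expr0n.
have E : (\int[leb]_z (k * \1_(`[(x - d)%R, (x + d)%R]%classic) z +
     k * \1_(`[(y - d)%R, (y + d)%R]%classic) z)%:E = (k * (2 * d))%:E + (k * (2 * d))%:E)%E.
  apply: etrans (ge0_intD leb (mI x) (mI y) (I0 x) (I0 y)) _.
  by congr (_ + _)%E; exact: (int_indic_ball _ k0 (ltW d0)).
rewrite E -EFinD lee_fin /k exprMn real_normK ?num_real//.
by rewrite le_eqVlt; apply/orP; left; apply/eqP; ring.
Qed.

End chi_mult.

Section kappa.
Variables (d : R) (d0 : 0 < d).

(** Normalizing constant of the partition of unity: the mass of the squared tent over all centres,
    the same at every point by [kap0E]. *)
Definition kap0 : R := fine (\int[leb]_z (chi d 0 z ^+ 2)%:E)%E.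

Let mchi x : measT (fun z : R => chi d z x).
Proof. exact: (mcomp (meas_chi d) (mpair2 x)). Qed.

Let mchi0 : measT (fun z : R => (chi d 0 z ^+ 2)%:E).
Proof.
apply/mEFin; apply: mfunX.
exact: (mcomp (meas_chi d) (mpair1 (0 : R))).
Qed.

Lemma kap0E r : (\int[leb]_z (chi d z r ^+ 2)%:E = kap0%:E)%E.
Proof.
have E : (\int[leb]_z (chi d z r ^+ 2)%:E = \int[leb]_z (chi d 0 z ^+ 2)%:E)%E.
  have n1 : (-1 : R) != 0 by rewrite oppr_eq0 oner_eq0.
  rewrite -(@ge0_integral_affine _ (-1) r (fun z => (chi d 0 z ^+ 2)%:E) n1 mchi0); last first.
    by move=> z; rewrite lee_fin sqr_ge0.
  rewrite normrN1 mul1e; apply: eqint => z _; rewrite /chi.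
  by rewrite (_ : -1 * z + r - 0 = r - z)//; ring.
rewrite E /kap0 fineK// ge0_fin_numE; last by apply: intg_ge0 => z _; rewrite lee_fin sqr_ge0.
rewrite -E; have mb (x : R) : `|(fun=> 1 : R) x| <= 1 by rewrite normr1.
have := chi_mult_size d0 ler01 mb r.
under eqint do rewrite mulr1.
by move=> H; apply: le_lt_trans H (ltry _).
Qed.

Lemma kap0_gt0 : 0 < kap0.
Proof.
have h : (((d / 2) ^+ 2 * (2 * (d / 2)))%:E <= kap0%:E)%E.
  have k0 : 0 <= (d / 2) ^+ 2 by exact: sqr_ge0.
  have d20 : 0 <= d / 2 by have := d0; lra.
  rewrite -(kap0E 0) -(int_indic_ball 0 k0 d20); apply: ge0_le_int.
  - by apply: mfunM => //; exact: mindic.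
  - by apply: mfunX; exact: mchi.
  - by move=> z; apply: mulr_ge0.
  move=> z; rewrite indic_ballE; have [h|h] := leP `|0 - z| (d / 2); last by rewrite mulr0 sqr_ge0.
  rewrite mulr1; apply: lerXn2r; rewrite ?nnegrE ?chi_ge0//.
  by rewrite /chi pos_id; have := d0; lra.
rewrite lee_fin in h; apply: lt_le_trans h; have h2 : 0 < d / 2 by have := d0; lra.
by apply: mulr_gt0; [exact: exprn_gt0|exact: mulr_gt0].
Qed.

End kappa.

Lemma eq_deriv_ball (f g f' g' : R -> R) (z d r : R) : (forall x : R, is_derive x 1 f (f' x)) ->
  (forall x : R, is_derive x 1 g (g' x)) -> (forall x, `|x - z| <= d -> f' x = g' x) ->
  `|r - z| <= d -> f r = g r + (f z - g z).
Proof.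
move=> df dg fg rd; pose h x := f x - g x.
have dh (x : R) : is_derive x 1 h (f' x - g' x) by apply: derD => //; exact: derN.
have ch : continuous h by move=> x; exact: der_cont (dh x).
suff : h r = h z by rewrite /h => e; rewrite -e; ring.
rewrite ler_norml in rd; have /andP[r1 r2] := rd.
have [rz|zr|->//] := ltgtP r z.
  have [c /andP[c1 c2]] := @MVT R h _ r z rz (fun x _ => dh x) (continuous_subspaceT ch).
  rewrite fg ?subrr ?mul0r; first by move/eqP; rewrite subr_eq0 => /eqP.
  by rewrite /= in c1 c2; rewrite !bnd_simp in c1 c2; rewrite ler_norml; apply/andP; split; lra.
have [c /andP[c1 c2]] := @MVT R h _ z r zr (fun x _ => dh x) (continuous_subspaceT ch).
rewrite fg ?subrr ?mul0r; first by move/eqP; rewrite subr_eq0 => /eqP.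
by rewrite /= in c1 c2; rewrite !bnd_simp in c1 c2; rewrite ler_norml; apply/andP; split; lra.
Qed.

End line_tools.

(** * The estimate along a line with variable coefficients *)

Section line.
Context {R : realType}.
Local Notation leb := (@lebesgue_measure R).
Variables (rho c Cq Lq K ell : R).
Hypotheses (rho2 : 2 < rho) (rho4 : rho < 4) (c0 : 0 < c) (c1 : c <= 1) (Cq0 : 0 < Cq)
  (Lq0 : 0 <= Lq) (K1 : 1 <= K) (ell0 : 0 <= ell).
Local Open Scope complex_scope.

(** On an interval of radius [d] the function [q] varies by at most c/4, and [d <= 1] allows the
    slow variation of [B] to be used there. Then [cl] and [cu] bound the normalized density |q| B /
    B(z) on such an interval around a good centre. *)
Let d : R := c / (4 * (Lq + c)).
Let cl : R := c / (2 * K).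
Let cu : R := Cq * K.
Let K0 : 0 < K. Proof. exact: lt_le_trans K1. Qed.
Let Lc0 : 0 < Lq + c. Proof. by have := c0; have := Lq0; lra. Qed.
Let d0 : 0 < d. Proof. by apply: divr_gt0 => //; exact: mulr_gt0. Qed.
Let d1 : d <= 1.
Proof. by rewrite ler_pdivrMr; [have := c0; have := Lq0; lra|exact: mulr_gt0]. Qed.
Let Ld : Lq * d <= c / 4.
Proof.
have -> : c / 4 = (Lq + c) * d by rewrite /d; field; rewrite !gt_eqF.
by apply: ler_wpM2r; [exact: ltW|have := c0; lra].
Qed.
Let cl0 : 0 < cl. Proof. by apply: divr_gt0 => //; exact: mulr_gt0. Qed.
Let cl1 : cl <= 1.
Proof. by rewrite ler_pdivrMr; [have := c1; have := K1; lra|exact: mulr_gt0]. Qed.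
Let cu0 : 0 < cu. Proof. exact: mulr_gt0. Qed.

(** Lipschitz constant of the quotient [wt] below: [ell] comes from the numerator, [Lq] from the
    denominator, which is at least [c]. *)
Let lw : R := ell / c + Lq / c ^+ 2.
Let lw0 : 0 <= lw.
Proof. by apply: addr_ge0; apply: divr_ge0 => //; [exact: ltW|exact: sqr_ge0]. Qed.

Definition Cline : R := (kap0 d)^-1 * (Ccore rho cl cu *
  (Cmult rho (2 * d ^+ 3 * c^-1 ^+ 2) (4 * d * (d * lw + c^-1) ^+ 2) +
   Cmult rho (2 * d ^+ 3 * 1 ^+ 2) (4 * d * (d * 0 + 1) ^+ 2))).

Let d30 : 0 <= 2 * d ^+ 3. Proof. by apply: mulr_ge0 => //; apply: exprn_ge0; exact: ltW. Qed.
Let szF : 0 <= 2 * d ^+ 3 * c^-1 ^+ 2. Proof. by apply: mulr_ge0 => //; exact: sqr_ge0. Qed.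
Let dfF : 0 <= 4 * d * (d * lw + c^-1) ^+ 2.
Proof. by apply: mulr_ge0; [apply: mulr_ge0 => //; exact: ltW|exact: sqr_ge0]. Qed.
Let szH : 0 <= 2 * d ^+ 3 * 1 ^+ 2. Proof. by apply: mulr_ge0 => //; exact: sqr_ge0. Qed.
Let dfH : 0 <= 4 * d * (d * 0 + 1) ^+ 2.
Proof. by apply: mulr_ge0; [apply: mulr_ge0 => //; exact: ltW|exact: sqr_ge0]. Qed.

Let Core : R := Ccore rho cl cu.
Let Core0 : 0 < Core. Proof. exact: Ccore_gt0. Qed.

Section data.
(** On a line parallel to e_j these are the symbol, its derivative divided by <xi>^(m-1), the weight
    <xi>^(m-1) and the cutoff. The derivative [q * B] of the phase is split into a bounded Lipschitz
    factor and a factor that is merely slowly varying, with no bound on its size. *)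
Variables (al q B w : R -> R) (F H : R * R -> R[i]) (M N : R).
Hypotheses (dal : forall x : R, is_derive x 1 al (q x * B x)) (cq : continuous q)
  (cB : continuous B) (B0 : forall x, 0 < B x) (qb : forall x, `|q x| <= Cq)
  (ql : forall x y, `|q x - q y| <= Lq * `|x - y|)
  (Bs : forall x y, `|x - y| <= 1 -> B x <= K * B y)
  (wb : forall x, `|w x| <= 1) (wl : forall x y, `|w x - w y| <= ell * `|x - y|)
  (mw : measT w)
  (wq : forall x, w x != 0 -> c <= `|q x|) (wN : forall x, N < `|x| -> w x = 0)
  (mF : cmeas F) (mH : cmeas H) (FM : forall z, normc (F z) <= M)
  (HM : forall z, normc (H z) <= M).

(** This is max(c, |q|): it equals |q| wherever [w] is nonzero and is bounded below everywhere, so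
    that dividing by it preserves Lipschitz bounds on the whole line. *)
Let mx x : R := c + pos (`|q x| - c).
Let mx_ge x : c <= mx x. Proof. by rewrite lerDl pos_ge0. Qed.
Let mx_id x : c <= `|q x| -> mx x = `|q x|.
Proof. by move=> h; rewrite /mx pos_id; lra. Qed.
Let mx_gt0 x : 0 < mx x. Proof. exact: lt_le_trans (mx_ge x). Qed.
Let mx_lip x y : `|mx x - mx y| <= Lq * `|x - y|.
Proof.
rewrite /mx (_ : _ - _ = pos (`|q x| - c) - pos (`|q y| - c)); last by ring.
apply: le_trans (pos_lip _ _) _; rewrite (_ : _ - _ = `|q x| - `|q y|); last by ring.
by apply: le_trans (ql x y); exact: ler_dist_dist.
Qed.

Let wt x : R := w x / mx x.
Let wt_b x : `|wt x| <= c^-1.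
Proof.
rewrite normrM normfV (gtr0_norm (mx_gt0 x)) -[leRHS]mul1r; apply: ler_pM => //.
  by rewrite invr_ge0 ltW.
by rewrite lef_pV2 ?posrE.
Qed.
Let wt_l x y : `|wt x - wt y| <= lw * `|x - y|.
Proof.
have nx : mx x != 0 by rewrite gt_eqF. have ny : mx y != 0 by rewrite gt_eqF.
have nc : c != 0 by rewrite gt_eqF.
have -> : wt x - wt y = (w x - w y) / mx x + w y * (mx y - mx x) / (mx x * mx y).
  by rewrite /wt; field; rewrite nx ny.
apply: le_trans (ler_normD _ _) _; rewrite /lw [leRHS]mulrDl; apply: lerD.
  rewrite normrM normfV (gtr0_norm (mx_gt0 x)) -mulrA (mulrC c^-1) mulrA.
  by apply: ler_pM => //; rewrite ?invr_ge0 ?(ltW (mx_gt0 x))// lef_pV2 ?posrE.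
rewrite !normrM normfV (gtr0_norm (mulr_gt0 (mx_gt0 x) (mx_gt0 y))).
rewrite -[Lq / _ * _]mulrA (mulrC (c ^+ 2)^-1) mulrA; apply: ler_pM => //.
- by rewrite invr_ge0 ltW// mulr_gt0.
- by rewrite -[leRHS]mul1r; apply: ler_pM => //; rewrite distrC.
- rewrite lef_pV2 ?posrE ?mulr_gt0// ?exprn_gt0// expr2.
  by apply: ler_pM; rewrite ?(ltW c0).
Qed.
Let cmx : continuous mx.
Proof. by rewrite /mx; cont; apply: pos_cont; cont. Qed.
Let mwt : measT wt.
Proof.
apply: mfunM => //; apply: contm => x.
by apply: cvgV; [rewrite gt_eqF|exact: cmx].
Qed.

Let mal : measT al.
Proof. by apply: contm => x; exact: der_cont (dal x). Qed.
Let mB : measT B. Proof. exact: contm. Qed.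

Let J (t tau r : R) : R[i] :=
  expi ((t - tau) * al r) * F (tau, r) * conjc (H (t, r)) * (B r * w r)%:C.
(** The integral localized near [z]. The square of the tent is shared: one factor goes into [Uz] and
    one into [Vz]. *)
Let Iz (t tau z : R) : R[i] := cint leb (fun r => J t tau r * (chi d z r ^+ 2)%:C).

Let Uz (z : R) (p : R * R) : R[i] := (chi d z p.2 * wt p.2)%:C * F p.
Let Vz (z : R) (p : R * R) : R[i] := (chi d z p.2 * 1)%:C * H p.

Let chi_supp z x : `|z| + d < `|x| -> chi d z x = 0.
Proof. by move=> h; apply: chi_out; have := lerB_dist x z; lra. Qed.

Let mchi z : measT (chi d z).
Proof. exact: (mcomp (meas_chi d) (mpair1 z)). Qed.

Let normc_real0 (x : R) : 0 <= x -> normc x%:C = x.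
Proof. by move=> x0; rewrite normc_real ger0_norm. Qed.

Let normM (x y : R[i]) : normc (x * y) = normc x * normc y.
Proof. by rewrite !normc_sqrt sqnM sqrtrM// sqn_ge0. Qed.

Let mUz z : cmeas (Uz z).
Proof.
apply: cmeasM => //; apply: cmeas_real; apply: mfunM.
  exact: (mcomp (mchi z) msnd).
exact: (mcomp mwt msnd).
Qed.

Let mVz z : cmeas (Vz z).
Proof.
apply: cmeasM => //; apply: cmeas_real; apply: mfunM => //.
exact: (mcomp (mchi z) msnd).
Qed.

Let M0 : 0 <= M. Proof. exact: le_trans (nc_ge0 _) (FM (0, 0)). Qed.

Let iUz z t : cintg leb (fun x => Uz z (t, x)).
Proof.
apply: (@bsupp_cintg _ _ (d * c^-1 * M) (`|z| + d)).
- exact: (cmeas_comp (mUz z) (mpair1 t)).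
- move=> x; rewrite /Uz normM normc_real; apply: ler_pM => //; first exact: nc_ge0.
  rewrite normrM; apply: ler_pM => //.
  by rewrite ger0_norm ?chi_ge0// chi_le// ltW.
- by move=> x xz; rewrite /Uz chi_supp// mul0r mul0r.
Qed.

Let iVz z t : cintg leb (fun x => Vz z (t, x)).
Proof.
apply: (@bsupp_cintg _ _ (d * M) (`|z| + d)).
- exact: (cmeas_comp (mVz z) (mpair1 t)).
- move=> x; rewrite /Vz normM normc_real; apply: ler_pM => //; first exact: nc_ge0.
  by rewrite mulr1 ger0_norm ?chi_ge0// chi_le// ltW.
- by move=> x xz; rewrite /Vz chi_supp// mul0r mul0r.
Qed.

Let rhsz z : \bar R := (Core%:E * (\int[leb]_t N1 rho (fun x => Uz z (t, x)) +
  \int[leb]_t N1 rho (fun x => Vz z (t, x))))%E.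

(** The variation c/4 keeps |q| below [c] on the whole interval, where [w] therefore vanishes. *)
Let bad z : `|q z| < 3 / 4 * c -> forall t tau, Iz t tau z = 0.
Proof.
move=> qz t tau; rewrite /Iz -(@cint0 _ _ _ leb); apply: eq_cint => r.
have [h|h] := leP `|r - z| d; last by rewrite chi_out// expr0n mulr0.
rewrite /J; have [->|/wq wr] := eqVneq (w r) 0; first by rewrite mulr0 mulr0 mul0r.
have h1 := ql r z; have h2 := lerB_dist (q r) (q z); have := Ld.
have : Lq * `|r - z| <= Lq * d by exact: ler_wpM2l.
by move=> *; exfalso; lra.
Qed.

(** On the interval [q] keeps its sign and |q| stays above c/2. Hence the phase is [A * be] up to a
    constant, with |A| = B(z) and [be'] between [cl] and [cu], and the amplitude [B * w] equals |A|
    times [wt] times the density. The factor |A| that [core] allows is exactly the weight <xi>^(m-1)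
    to be recovered. *)
Let good z : 3 / 4 * c <= `|q z| ->
  (\int[leb]_t \int[leb]_tau (normc (Iz t tau z))%:E <= rhsz z)%E.
Proof.
move=> qz.
have qr r : `|r - z| <= d -> c / 2 <= `|q r|.
  move=> h; have h1 := ql z r; have h2 := lerB_dist (q z) (q r); have := Ld.
  have : Lq * `|r - z| <= Lq * d by exact: ler_wpM2l.
  rewrite distrC => *; lra.
(* The weight may be arbitrarily large or small, but divided by its value at [z] it stays between
   1/K and K on the interval. *)
pose pz r := `|q r| * B r / B z.
have Bz0 := B0 z.
have cpz : continuous pz by rewrite /pz; cont.
have pz_in r : `|r - z| <= d -> cl <= pz r <= cu.
  move=> h; have h1 : `|r - z| <= 1 by apply: le_trans h d1.
  have b1 := Bs h1; have b2 : B z <= K * B r by apply: Bs; rewrite distrC.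
  have Br := B0 r; apply/andP; split; last first.
    rewrite /pz ler_pdivrMr// /cu -mulrA; apply: ler_pM => //; exact: ltW.
  rewrite /pz ler_pdivlMr// /cl.
  have -> : c / (2 * K) * B z = (c / 2) * (B z / K) by field; rewrite gt_eqF.
  apply: ler_pM; [by have := c0; lra|by apply: divr_ge0; exact: ltW|exact: qr|].
  by rewrite ler_pdivrMr// mulrC.
(* Extension of [pz] to the whole line: frozen outside the interval by [clamp], then lowered to the
   constant [cl] by [plateau]. It keeps the bounds [cl] and [cu], and being constant at infinity it
   satisfies the hypotheses of [antiderivative]. *)
pose p r := cl + (pz (clamp d z r) - cl) * plateau d z r.
have cp : continuous p.
  rewrite /p; cont; last exact: plateau_cont.
  by move=> x; apply: (@continuous_comp _ _ _ (clamp d z) pz); [exact: clamp_cont|exact: cpz].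
have p_in r : cl <= p r <= cu.
  have /andP[a1 a2] := pz_in _ (clamp_in z r (ltW d0)).
  have /andP[b1 b2] := plateau_in z r d0.
  set P := pz _ in a1 a2 *; set s := plateau d z r in b1 b2 *.
  have h1 : 0 <= (P - cl) * s by apply: mulr_ge0 => //; rewrite subr_ge0.
  have h2 : (P - cl) * s <= P - cl by rewrite ler_piMr// subr_ge0.
  by rewrite /p -/P -/s; apply/andP; split; lra.
have p_eq r : `|r - z| <= d -> p r = pz r.
  by move=> h; rewrite /p clamp_id// plateau1// mulr1; ring.
have [be dbe] : exists be : R -> R, forall x : R, is_derive x 1 be (p x).
  apply: (@antiderivative _ p cl (`|z| + 2 * d) cu cp).
    move=> x; have /andP[a1 a2] := p_in x; have := cl0.
    by rewrite ger0_norm; lra.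
  move=> x h; rewrite /p plateau0 ?mulr0 ?addr0//.
  by have := lerB_dist x z; lra.
have qz0 : q z != 0 by rewrite -normr_gt0; have := c0; lra.
pose A := Num.sg (q z) * B z.
have A0 : A != 0 by rewrite mulf_neq0 ?sgr_eq0// gt_eqF.
have nA : `|A| = B z by rewrite normrM normr_sg qz0 mul1r gtr0_norm.
have qs r : `|r - z| <= d -> q r = Num.sg (q z) * `|q r|.
  move=> h; have h1 := ql r z; have := Ld; have : Lq * `|r - z| <= Lq * d by exact: ler_wpM2l.
  have c00 := c0; have h3 := qr r h; move=> h4 h5.
  have h6 : `|q r - q z| <= c / 4 by lra.
  rewrite ler_norml in h6; have /andP[h7 h8] := h6.
  have [qp|qn|q00] := ltgtP 0 (q z); last by rewrite -q00 eqxx in qz0.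
    rewrite (gtr0_norm qp) in qz; rewrite gtr0_sg// mul1r gtr0_norm//; lra.
  rewrite (ltr0_norm qn) in qz; rewrite ltr0_sg// ltr0_norm; first by ring.
  lra.
have al_eq r : `|r - z| <= d -> al r = A * be r + (al z - A * be z).
  apply: (@eq_deriv_ball _ al (fun x => A * be x) _ (fun x => A * p x)) => // x.
  move=> h; rewrite p_eq// /pz (qs x h) normrM normr_sg qz0 mul1r normr_id /A.
  by field; rewrite gt_eqF.
have IE t tau : normc (Iz t tau z) = `|A| * normc (cint leb (fun x =>
      expi ((t - tau) * A * be x) * Uz z (tau, x) * conjc (Vz z (t, x)) * (p x)%:C)).
  pose k := expi ((t - tau) * (al z - A * be z)) * `|A|%:C.
  have -> : Iz t tau z = k * cint leb (fun x =>
      expi ((t - tau) * A * be x) * Uz z (tau, x) * conjc (Vz z (t, x)) * (p x)%:C).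
    rewrite -cintZl; last first.
      have mbe : measT be.
        by apply: contm => x; exact: der_cont (dbe x).
      have mp : measT p by exact: contm.
      apply: (@bsupp_cintg _ _ (1 * (d * c^-1 * M) * (d * M) * cu) (`|z| + d)).
      - apply: cmeasM; last exact: cmeas_real.
        apply: cmeasM; last by apply: cmeas_conj; exact: (cmeas_comp (mVz z) (mpair1 t)).
        apply: cmeasM; last exact: (cmeas_comp (mUz z) (mpair1 tau)).
        by apply: cmeas_expi; exact: mfunM.
      - move=> x.
        have h1 : normc (Uz z (tau, x)) <= d * c^-1 * M.
          rewrite /Uz normM normc_real; apply: ler_pM => //; first exact: nc_ge0.
          rewrite normrM; apply: ler_pM => //.
          by rewrite ger0_norm ?chi_ge0// chi_le// ltW.
        have h2 : normc (Vz z (t, x)) <= d * M.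
          rewrite /Vz normM normc_real; apply: ler_pM => //; first exact: nc_ge0.
          by rewrite mulr1 ger0_norm ?chi_ge0// chi_le// ltW.
        have /andP[a1 a2] := p_in x.
        have n1 := nc_ge0 (Uz z (tau, x)); have n2 := nc_ge0 (Vz z (t, x)).
        move: h1 h2 n1 n2; move: (Uz z (tau, x)) (Vz z (t, x)) => U V h1 h2 n1 n2.
        rewrite !normM normc_conj normc_expi normc_real !mul1r.
        apply: ler_pM => //; first exact: mulr_ge0.
          exact: ler_pM.
        by rewrite ger0_norm// (le_trans _ a1)// ltW.
      - by move=> x xz; rewrite /Uz chi_supp// !mul0r mulr0 !mul0r.
    apply: eq_cint => r; rewrite /J /Uz /Vz /=.
    have [h|h] := leP `|r - z| d; last by rewrite !chi_out// !(mul0r, mulr0, expr0n).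
    rewrite conjcM (_ : conjc (chi d z r * 1)%:C = (chi d z r)%:C); last first.
      by rewrite mulr1; apply/eqP; rewrite eq_complex /= oppr0 !eqxx.
    rewrite (al_eq r h) mulrDr expiD (mulrA (t - tau)) /k.
    (* Where [w r] is nonzero, the denominator of [wt] is |q r| and cancels the same factor in the
       density. *)
    have e1 : B r * w r = `|A| * (wt r * p r).
      rewrite nA p_eq// /pz /wt; have [->|/wq wr] := eqVneq (w r) 0; first by rewrite !(mul0r, mulr0).
      rewrite mx_id//; field; rewrite (gt_eqF Bz0) normr_eq0 /=.
      by rewrite -normr_gt0; exact: lt_le_trans wr.
    by rewrite e1 !creM; ring.
  by rewrite /k !normM normc_expi mul1r normc_real normr_id.
rewrite /rhsz; under eqint do under eqint do rewrite IE.
by apply: (@core R rho cl cu rho2 cl0 cl1 cu0 be p A (Uz z) (Vz z)) => // x;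
  have /andP[] := p_in x.
Qed.

Variable MB : R.
Hypothesis Bw : forall x, `|B x * w x| <= MB.

Let mJ d' (T : measurableType d') (t tau r : T -> R) : measT t ->
  measT tau -> measT r -> cmeas (fun x => J (t x) (tau x) (r x)).
Proof.
move=> mt mtau mr; apply: cmeasM; last first.
  by apply: cmeas_real; apply: mfunM; [exact: (mcomp mB)|exact: (mcomp mw)].
apply: cmeasM; last first.
  by apply: cmeas_conj; apply: (cmeas_comp mH); exact: mpair.
apply: cmeasM; last by apply: (cmeas_comp mF); exact: mpair.
apply: cmeas_expi; apply: mfunM; last exact: (mcomp mal).
exact: mfunB.
Qed.

Let iJ t tau : cintg leb (J t tau).
Proof.
apply: (@bsupp_cintg _ _ (1 * M * M * MB) N); first exact: mJ.
- move=> x; rewrite /J !normM normc_conj normc_expi normc_real.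
  by rewrite !mul1r; apply: ler_pM => //; rewrite ?mulr_ge0 ?nc_ge0//; apply: ler_pM; rewrite ?nc_ge0.
- by move=> x /wN w0; rewrite /J w0 mulr0 mulr0.
Qed.

Let chi2_ge0 z r : 0 <= chi d z r ^+ 2. Proof. exact: sqr_ge0. Qed.

Let mchi2 r : measT (fun z : R => chi d z r ^+ 2).
Proof. by apply: mfunX; exact: (mcomp (meas_chi d) (mpair2 r)). Qed.

(** Inserting the squared tent and integrating over [z] multiplies the integrand by [kap0]; Fubini's
    theorem then puts the integral over [z] outside. *)
Let kap_le t tau : ((kap0 d * normc (cint leb (J t tau)))%:E <=
  \int[leb]_z (normc (Iz t tau z))%:E)%E.
Proof.
have k0 := kap0_gt0 d0.
pose G (p : R * R) : R[i] := J t tau p.1 * (chi d p.2 p.1 ^+ 2)%:C.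
have mchi2' : measT (fun p : R * R => chi d p.2 p.1 ^+ 2).
  by apply: mfunX; exact: (meas2 (meas_chi d)).
have mG : cmeas G by apply: cmeasM; [exact: mJ|exact: cmeas_real].
have iG : cintg (leb \x leb)%E G.
  apply: cintg_tonelli => //.
  have mn : measT (fun x => normc (J t tau x)).
    by apply: mnormc; exact: mJ.
  have E r : (\int[leb]_z (normc (G (r, z)))%:E = (kap0 d * normc (J t tau r))%:E)%E.
    have e z : normc (G (r, z)) = normc (J t tau r) * chi d z r ^+ 2.
      by rewrite /G /= normM normc_real0.
    under eqint do rewrite e.
    by rewrite (ge0_intZl leb (nc_ge0 _) (mchi2 r) (fun z => chi2_ge0 z r)) kap0E// -EFinM mulrC.
  under eqint do rewrite E.
  rewrite (ge0_intZl leb (ltW k0) mn (fun x => nc_ge0 _)) lte_mul_pinfty ?lee_fin ?(ltW k0)//.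
  by have /cintgP[] := iJ t tau.
have Gz r : cint leb (fun z => G (r, z)) = (kap0 d)%:C * J t tau r.
  have ic : leb.-integrable setT (EFin \o (fun z : R => chi d z r ^+ 2)).
    apply/integrableP; split; first by apply/mEFin; exact: mchi2.
    under eqint do rewrite /= ger0_norm//.
    by rewrite kap0E// ltry.
  rewrite /G /= cintZl; last exact: cintg_real.
  rewrite cint_real mulrC; congr (_%:C * _).
  by apply: EFin_inj; rewrite -(RintE ic) kap0E.
have e1 : cint leb (fun r => cint leb (fun z => G (r, z))) = (kap0 d)%:C * cint leb (J t tau).
  by rewrite -cintZl; [apply: eq_cint => r; exact: Gz|exact: iJ].
have e2 : cint leb (fun z => cint leb (fun r => G (r, z))) = (kap0 d)%:C * cint leb (J t tau).
  exact (etrans (esym (cint_Fubini iG)) e1).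
have mIz : cmeas (fun z => cint leb (fun x => G (x, z))).
  apply: (@cmeas_cint _ _ _ _ _ leb (fun p : R * R => G (p.2, p.1))).
  by apply: (cmeas_comp mG); exact: mpair.
have e3 : kap0 d * normc (cint leb (J t tau)) = normc (cint leb (fun z => cint leb (fun r => G (r, z)))).
  by rewrite e2 normM (normc_real0 (ltW k0)).
rewrite e3; exact (le_normc_cint_meas leb mIz).
Qed.

Let mI : measT (fun p : (R * R) * R => normc (Iz p.1.1 p.1.2 p.2)).
Proof.
apply: mnormc; apply: (@cmeas_cint _ _ _ _ _ leb (fun p : ((R * R) * R) * R =>
  J p.1.1.1 p.1.1.2 p.2 * (chi d p.1.2 p.2 ^+ 2)%:C)).
have m1 : measT (fun p : ((R * R) * R) * R => p.1.1).
  exact: (mcomp mfst mfst).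
apply: cmeasM.
  apply: mJ; [exact: (mcomp mfst m1)|exact: (mcomp msnd m1)|exact: msnd].
apply: cmeas_real; apply: mfunX; apply: (meas2 (meas_chi d)); last exact: msnd.
exact: (mcomp msnd mfst).
Qed.

Let zF : R * R * R -> R[i] := fun p => Uz p.1.1 (p.1.2, p.2).
Let zH : R * R * R -> R[i] := fun p => Vz p.1.1 (p.1.2, p.2).

Let mzF : cmeas zF.
Proof.
rewrite /zF /Uz /=; apply: cmeasM.
  apply: cmeas_real; apply: mfunM; last exact: (mcomp mwt).
  apply: (meas2 (meas_chi d)); last exact: msnd.
  exact: (mcomp mfst mfst).
apply: (cmeas_comp mF); apply: mpair; last exact: msnd.
exact: (mcomp msnd mfst).
Qed.

Let mzH : cmeas zH.
Proof.
rewrite /zH /Vz /=; apply: cmeasM.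
  apply: cmeas_real; apply: mfunM => //.
  apply: (meas2 (meas_chi d)); last exact: msnd.
  exact: (mcomp mfst mfst).
apply: (cmeas_comp mH); apply: mpair; last exact: msnd.
exact: (mcomp msnd mfst).
Qed.

Let CF := Cmult rho (2 * d ^+ 3 * c^-1 ^+ 2) (4 * d * (d * lw + c^-1) ^+ 2).
Let CH := Cmult rho (2 * d ^+ 3 * 1 ^+ 2) (4 * d * (d * 0 + 1) ^+ 2).

Let intF : (\int[leb]_z \int[leb]_t N1 rho (fun x => Uz z (t, x)) <= CF%:E * \int[leb]_t N1 rho (fun x => F (t, x)))%E.
Proof.
have CF0 : 0 <= CF by exact: Cmult_ge0.
have c10 : 0 <= c^-1 by rewrite invr_ge0 ltW.
have mN := meas_N1 rho2 mzF.
have mN' : measT (fun p : R * R => N1 rho (fun x => Uz p.2 (p.1, x))).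
  exact (mcomp mN (mpair msnd mfst)).
have N0 x y : (0 <= N1 rho (fun r => Uz x (y, r)))%E by exact: N1_ge0.
rewrite (@ge0_swapE _ _ _ _ _ leb leb (fun z t => N1 rho (fun x => Uz z (t, x))) mN N0).
rewrite -(ge0_intZlE leb CF0); last 2 first.
- exact: (meas_N1 rho2 mF).
- by move=> t; exact: N1_ge0.
apply: ge0_le_intE.
- exact: (@mintp _ _ _ _ _ leb (fun t z => N1 rho (fun x => Uz z (t, x))) mN' (fun x y => N0 y x)).
- by apply: mfuneM; exact: (meas_N1 rho2 mF).
- by move=> t; apply: int_ge0 => z; exact: N1_ge0.
move=> t; apply: (@mult_N1 R rho rho2 rho4 (fun z x => chi d z x * wt x)) => //.
- exact: chi_mult_meas.
- by move=> x; exact: chi_mult_size.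
- by move=> x y; exact: chi_mult_diff.
- exact: (cmeas_comp mF (mpair1 t)).
Qed.

Let intH : (\int[leb]_z \int[leb]_t N1 rho (fun x => Vz z (t, x)) <= CH%:E * \int[leb]_t N1 rho (fun x => H (t, x)))%E.
Proof.
have CH0 : 0 <= CH by exact: Cmult_ge0.
have mN := meas_N1 rho2 mzH.
have mN' : measT (fun p : R * R => N1 rho (fun x => Vz p.2 (p.1, x))).
  exact (mcomp mN (mpair msnd mfst)).
have N0 x y : (0 <= N1 rho (fun r => Vz x (y, r)))%E by exact: N1_ge0.
rewrite (@ge0_swapE _ _ _ _ _ leb leb (fun z t => N1 rho (fun x => Vz z (t, x))) mN N0).
rewrite -(ge0_intZlE leb CH0); last 2 first.
- exact: (meas_N1 rho2 mH).
- by move=> t; exact: N1_ge0.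
apply: ge0_le_intE.
- exact: (@mintp _ _ _ _ _ leb (fun t z => N1 rho (fun x => Vz z (t, x))) mN' (fun x y => N0 y x)).
- by apply: mfuneM; exact: (meas_N1 rho2 mH).
- by move=> t; apply: int_ge0 => z; exact: N1_ge0.
have one1 (x : R) : `|(fun=> 1 : R) x| <= 1 by rewrite normr1.
have one2 (x y : R) : `|(fun=> 1 : R) x - (fun=> 1 : R) y| <= 0 * `|x - y| by rewrite subrr normr0 mul0r.
move=> t; apply: (@mult_N1 R rho rho2 rho4 (fun z x => chi d z x * 1)) => //.
- by apply: (@chi_mult_meas _ d (fun=> 1)).
- by move=> x; apply: (@chi_mult_size _ d 1 (fun=> 1)).
- by move=> x y; apply: (@chi_mult_diff _ d 1 0 (fun=> 1)).
- exact: (cmeas_comp mH (mpair1 t)).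
Qed.

(** The local bounds are integrated over the centres: they hold for good [z] by [core] and trivially
    for bad [z]. [mult_N1] reassembles the localized norms, with multiplier [chi * wt] for [F] and
    [chi] for [H]. *)
Lemma line_bound :
  (\int[leb]_t \int[leb]_tau (normc (cint leb (fun r => (expi ((t - tau) * al r) * F (tau, r)
     * conjc (H (t, r)) * (B r * w r)%:C)%R)))%:E
   <= Cline%:E * (\int[leb]_t N1 rho (fun x => F (t, x)) + \int[leb]_t N1 rho (fun x => H (t, x))))%E.
Proof.
have k0 := kap0_gt0 d0.
have NF0 : (0 <= \int[leb]_t N1 rho (fun x => F (t, x)))%E by apply: int_ge0 => t; exact: N1_ge0.
have NH0 : (0 <= \int[leb]_t N1 rho (fun x => H (t, x)))%E by apply: int_ge0 => t; exact: N1_ge0.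
have NU0 z : (0 <= \int[leb]_t N1 rho (fun x => Uz z (t, x)))%E by apply: int_ge0 => t; exact: N1_ge0.
have NV0 z : (0 <= \int[leb]_t N1 rho (fun x => Vz z (t, x)))%E by apply: int_ge0 => t; exact: N1_ge0.
have CE0 : (0 <= Core%:E)%E by rewrite lee_fin ltW.
have Izle z : (\int[leb]_t \int[leb]_tau (normc (Iz t tau z))%:E <= rhsz z)%E.
  have [h|h] := leP (3 / 4 * c) `|q z|; first exact: good.
  under eqint do under eqint do rewrite (bad h) normc_real0//.
  have r0 : (0 <= rhsz z)%E := mule_ge0 CE0 (adde_ge0 (NU0 z) (NV0 z)).
  by rewrite integral0_eq// => t _; rewrite integral0_eq.
have mJn : measT (fun p : R * R => normc (cint leb (J p.1 p.2))).
  apply: mnormc; apply: (@cmeas_cint _ _ _ _ _ leb (fun p : (R * R) * R => J p.1.1 p.1.2 p.2)).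
  by apply: mJ; [exact: (mcomp mfst mfst)|exact: (mcomp msnd mfst)|exact: msnd].
set X := (X in (X <= _)%E).
have X0 : (0 <= X)%E by apply: int_ge0 => t; apply: int_ge0 => tau; rewrite lee_fin nc_ge0.
have step1 : ((kap0 d)%:E * X <= \int[leb]_z rhsz z)%E.
  have e1 : ((kap0 d)%:E * X = \int[leb]_t \int[leb]_tau (kap0 d * normc (cint leb (J t tau)))%:E)%E.
    rewrite /X -(ge0_intZlE leb (ltW k0)); last 2 first.
    - apply: (@mintp _ _ _ _ _ leb (fun t tau => (normc (cint leb (J t tau)))%:E)).
        exact/mEFin.
      by move=> x y; rewrite lee_fin nc_ge0.
    - by move=> t; apply: int_ge0 => tau; rewrite lee_fin nc_ge0.
    apply: eqint => t _; rewrite (ge0_intZl leb (ltW k0))// => [|tau]; last exact: nc_ge0.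
    exact: (mcomp mJn (mpair1 t)).
  rewrite e1.
  have I0 (t tau z : R) : (0 <= (normc (Iz t tau z))%:E)%E by rewrite lee_fin nc_ge0.
  have mIE : measT (fun p : (R * R) * R => (normc (Iz p.1.1 p.1.2 p.2))%:E).
    exact/mEFin.
  have mIz : measT (fun p : R * R => \int[leb]_z (normc (Iz p.1 p.2 z))%:E)%E.
    exact: (@mintp _ _ _ _ _ leb (fun (p : R * R) z => (normc (Iz p.1 p.2 z))%:E)).
  apply: (@le_trans _ _ (\int[leb]_t \int[leb]_tau \int[leb]_z (normc (Iz t tau z))%:E)%E).
    apply: ge0_le_intE.
    - apply: (@mintp _ _ _ _ _ leb (fun t tau => (kap0 d * normc (cint leb (J t tau)))%:E)).
        by apply/mEFin; exact: mfunM.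
      by move=> x y; rewrite lee_fin mulr_ge0 ?nc_ge0// ltW.
    - apply: (@mintp _ _ _ _ _ leb (fun t tau => \int[leb]_z (normc (Iz t tau z))%:E)%E) => //.
      by move=> x y; exact: int_ge0.
    - by move=> t; apply: int_ge0 => tau; rewrite lee_fin mulr_ge0 ?nc_ge0// ltW.
    move=> t; apply: ge0_le_intE.
    - apply/mEFin; apply: mfunM => //.
      exact: (mcomp mJn (mpair1 t)).
    - exact: (mcomp mIz (mpair1 t)).
    - by move=> tau; rewrite lee_fin mulr_ge0 ?nc_ge0// ltW.
    by move=> tau; exact: kap_le.
  have m3 : measT (fun p : (R * R) * R => (normc (Iz p.1.1 p.2 p.1.2))%:E).
    exact (mcomp mIE (mpair (mpair
      (mcomp mfst mfst) msnd)
      (mcomp msnd mfst))).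
  have m4 : measT (fun p : R * R => \int[leb]_tau (normc (Iz p.1 tau p.2))%:E)%E.
    exact: (@mintp _ _ _ _ _ leb (fun (p : R * R) tau => (normc (Iz p.1 tau p.2))%:E)).
  have e2 t : (\int[leb]_tau \int[leb]_z (normc (Iz t tau z))%:E =
     \int[leb]_z \int[leb]_tau (normc (Iz t tau z))%:E)%E.
    have mt : measT (fun p : R * R => (normc (Iz t p.1 p.2))%:E).
      exact (mcomp mIE (mpair (mpair
        (mcst t) mfst) msnd)).
    exact (@ge0_swapE _ _ _ _ _ leb leb (fun tau z => (normc (Iz t tau z))%:E) mt (fun tau z => I0 t tau z)).
  under eqint do rewrite e2.
  have I4 t z : (0 <= \int[leb]_tau (normc (Iz t tau z))%:E)%E.
    by apply: int_ge0 => tau; exact: I0.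
  have m4' : measT (fun p : R * R => \int[leb]_tau (normc (Iz p.2 tau p.1))%:E)%E.
    exact (mcomp m4 (mpair msnd mfst)).
  have e3 := @ge0_swapE _ _ _ _ _ leb leb (fun t z => \int[leb]_tau (normc (Iz t tau z))%:E)%E m4 I4.
  apply: (le_trans (eq_leE e3)).
  apply: ge0_le_intE.
  - exact (@mintp _ _ _ _ _ leb (fun z t => \int[leb]_tau (normc (Iz t tau z))%:E)%E m4' (fun z t => I4 t z)).
  - apply: mfuneM; apply: emeasurable_funD.
      apply: (@mintp _ _ _ _ _ leb (fun z t => N1 rho (fun x => Uz z (t, x)))).
        exact: (meas_N1 rho2 mzF).
      by move=> x y; exact: N1_ge0.
    apply: (@mintp _ _ _ _ _ leb (fun z t => N1 rho (fun x => Vz z (t, x)))).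
      exact: (meas_N1 rho2 mzH).
    by move=> x y; exact: N1_ge0.
  - by move=> z; apply: int_ge0 => t; exact: I4.
  exact: Izle.
have step2 : (\int[leb]_z rhsz z <= Core%:E * ((CF + CH)%:E * (\int[leb]_t N1 rho (fun x => F (t, x)) + \int[leb]_t N1 rho (fun x => H (t, x)))))%E.
  have mU : measT (fun z => \int[leb]_t N1 rho (fun x => Uz z (t, x)))%E.
    apply: (@mintp _ _ _ _ _ leb (fun z t => N1 rho (fun x => Uz z (t, x)))).
      exact: (meas_N1 rho2 mzF).
    by move=> x y; exact: N1_ge0.
  have mV : measT (fun z => \int[leb]_t N1 rho (fun x => Vz z (t, x)))%E.
    apply: (@mintp _ _ _ _ _ leb (fun z t => N1 rho (fun x => Vz z (t, x)))).
      exact: (meas_N1 rho2 mzH).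
    by move=> x y; exact: N1_ge0.
  rewrite /rhsz (ge0_intZlE leb (ltW Core0)); last 2 first.
  - exact (emeasurable_funD mU mV).
  - by move=> z; exact (adde_ge0 (NU0 z) (NV0 z)).
  apply: lee_wpmul2l; first exact: CE0.
  have e4 := ge0_intDE leb mU mV NU0 NV0.
  apply: (le_trans (eq_leE e4)); rewrite EFinD.
  have CF0 : (0 <= CF%:E)%E by rewrite lee_fin; exact: Cmult_ge0.
  have CH0 : (0 <= CH%:E)%E by rewrite lee_fin; exact: Cmult_ge0.
  apply: le_trans (leeD intF intH) _.
  exact (ge0_mule_comb CF0 CH0 NF0 NH0).
have -> : X = ((kap0 d)^-1%:E * ((kap0 d)%:E * X))%E.
  by rewrite muleA -EFinM mulVf ?mul1e// gt_eqF.
apply: (@le_trans _ _ ((kap0 d)^-1%:E * (Core%:E * ((CF + CH)%:E * (\int[leb]_t N1 rho (fun x => F (t, x)) + \int[leb]_t N1 rho (fun x => H (t, x))))))%E).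
  apply: lee_wpmul2l; first by rewrite lee_fin invr_ge0 ltW.
  exact: le_trans step1 step2.
exact (eq_leE (EFin_mul3 _ _ _ _)).
Qed.

End data.

Lemma Cline_ge0 : 0 <= Cline.
Proof.
apply: mulr_ge0; first by rewrite invr_ge0 ltW// kap0_gt0.
apply: mulr_ge0; first exact: ltW.
by apply: addr_ge0; exact: Cmult_ge0.
Qed.

End line.

(** * Powers, Euclidean geometry and homogeneous functions *)

Section powers.
Context {R : realType}.
Implicit Types x y p K : R.

(** The sign of [p] decides which of the two comparisons is the relevant one. *)
Lemma powR_comparable x y p K : 0 < x -> 0 < y -> 1 <= K -> x <= K * y -> y <= K * x ->
  x `^ p <= K `^ `|p| * y `^ p.
Proof.
move=> x0 y0 K1 xy yx; have K0 : 0 <= K by exact: le_trans K1.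
have [p0|p0] := leP 0 p.
  rewrite (ger0_norm p0) -powRM//; last exact: ltW.
  by apply: ge0_ler_powR => //; rewrite nnegrE ?mulr_ge0// ltW.
have h : y `^ (- p) <= K `^ (- p) * x `^ (- p).
  rewrite -powRM//; last exact: ltW.
  apply: ge0_ler_powR => //; first by rewrite oppr_ge0 ltW.
    by rewrite nnegrE ltW.
  by rewrite nnegrE mulr_ge0// ltW.
rewrite (powRN y) (powRN x) in h; have X0 := powR_gt0 p x0; have Y0 := powR_gt0 p y0.
rewrite ltr0_norm//; set k := K `^ (- p) in h *.
rewrite -lef_pV2 ?posrE//; last by apply: mulr_gt0 => //; apply: powR_gt0; exact: lt_le_trans K1.
have k0 : 0 < k by apply: powR_gt0; exact: lt_le_trans K1.
rewrite invfM -(ler_pM2l k0) mulrA mulfV ?gt_eqF// mul1r.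
by apply: le_trans h _; rewrite -powRN powRN.
Qed.

End powers.

Section pointwise_continuity.
Context {R : realType} {T : topologicalType}.
Implicit Types (f g : T -> R) (x : T).

Lemma fcont_cst (c : R) x : {for x, continuous (fun _ : T => c)}.
Proof. exact: cvg_cst. Qed.

Lemma fcontD f g x : {for x, continuous f} -> {for x, continuous g} ->
  {for x, continuous (fun y => f y + g y)}.
Proof. by move=> cf cg; exact: cvgD cf cg. Qed.

Lemma fcontM f g x : {for x, continuous f} -> {for x, continuous g} ->
  {for x, continuous (fun y => f y * g y)}.
Proof. by move=> cf cg; exact: cvgM cf cg. Qed.

Lemma fcont_norm f x : {for x, continuous f} -> {for x, continuous (fun y => `|f y|)}.
Proof. by move=> cf; exact: cvg_norm cf. Qed.

Lemma fcont_sum n (f : 'I_n -> T -> R) x : (forall i, {for x, continuous (f i)}) ->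
  {for x, continuous (fun y => \sum_(i < n) f i y)}.
Proof.
move=> cf; apply: (@cvg_big _ _ +%R 0 xpredT) => [[a b]|i _]; last exact: cf.
exact: (cvgD cvg_fst cvg_snd).
Qed.

Lemma fcont_comp (h : R -> R) f x : {for x, continuous f} -> {for f x, continuous h} ->
  {for x, continuous (fun y => h (f y))}.
Proof. by move=> cf ch; exact: (continuous_comp cf ch). Qed.

End pointwise_continuity.

Section euclidean.
Context {R : realType} {n : nat}.
Implicit Types x y : 'rV[R]_n.

Lemma dotp_ge0 x : 0 <= dotp x x.
Proof. by apply: sumr_ge0 => j _; rewrite -expr2 sqr_ge0. Qed.

Lemma coord_le_dotp x j : x ord0 j ^+ 2 <= dotp x x.
Proof.
rewrite /dotp (bigD1 j)//= -expr2 lerDl; apply: sumr_ge0 => i _; by rewrite -expr2 sqr_ge0.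
Qed.

Lemma dotp_eq0 x : (dotp x x == 0) = (x == 0).
Proof.
apply/eqP/eqP => [h|->]; last by rewrite /dotp big1// => j _; rewrite mxE mul0r.
apply/rowP => j; rewrite mxE; apply/eqP; rewrite -sqrf_eq0 eq_le sqr_ge0 andbT.
by rewrite -h coord_le_dotp.
Qed.

Lemma enorm_sqr x : enorm x ^+ 2 = dotp x x.
Proof. by rewrite /enorm sqr_sqrtr// dotp_ge0. Qed.

Lemma enorm_ge0 x : 0 <= enorm x. Proof. exact: sqrtr_ge0. Qed.

Lemma enorm_gt0 x : (0 < enorm x) = (x != 0).
Proof. by rewrite sqrtr_gt0 lt_neqAle dotp_ge0 andbT eq_sym dotp_eq0. Qed.

Lemma coord_le_enorm x j : `|x ord0 j| <= enorm x.
Proof. by rewrite -sqrtr_sqr; apply: ler_wsqrtr; exact: coord_le_dotp. Qed.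

Lemma japanese_sqr x : japanese x ^+ 2 = 1 + dotp x x.
Proof. by rewrite /japanese enorm_sqr sqr_sqrtr// addr_ge0// dotp_ge0. Qed.

Lemma japanese_ge1 x : 1 <= japanese x.
Proof. by rewrite -[leLHS]sqrtr1; apply: ler_wsqrtr; rewrite lerDl sqr_ge0. Qed.

Lemma japanese_gt0 x : 0 < japanese x. Proof. exact: lt_le_trans (japanese_ge1 x). Qed.

Lemma enorm_le_japanese x : enorm x <= japanese x.
Proof.
rewrite -(@ler_pXn2r _ 2)// ?nnegrE ?enorm_ge0 ?(ltW (japanese_gt0 x))//.
by rewrite japanese_sqr enorm_sqr lerDr.
Qed.

Lemma japanese_le x : japanese x <= 1 + enorm x.
Proof.
have e0 := enorm_ge0 x.
rewrite -(@ler_pXn2r _ 2)// ?nnegrE ?addr_ge0 ?(ltW (japanese_gt0 x))//.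
rewrite japanese_sqr -enorm_sqr; set e := enorm x in e0 *.
by rewrite -subr_ge0 (_ : _ - _ = 2 * e); [exact: mulr_ge0|ring].
Qed.

Lemma dotpZ (l : R) x : dotp (l *: x) (l *: x) = l ^+ 2 * dotp x x.
Proof. by rewrite /dotp mulr_sumr; apply: eq_bigr => j _; rewrite !mxE; ring. Qed.

Lemma enormZ (l : R) x : enorm (l *: x) = `|l| * enorm x.
Proof. by rewrite /enorm dotpZ sqrtrM ?sqr_ge0// sqrtr_sqr. Qed.

Lemma dotp_line x (j : 'I_n) (s : R) :
  dotp (x + s *: evec j) (x + s *: evec j) = dotp x x + 2 * s * x ord0 j + s ^+ 2.
Proof.
rewrite /dotp (bigD1 j)//= [in RHS](bigD1 j)//=.
have -> : \sum_(i | i != j) (x + s *: evec j) ord0 i * (x + s *: evec j) ord0 i = \sum_(i | i != j) x ord0 i * x ord0 i.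
  by apply: eq_bigr => i ij; rewrite !mxE eqxx (negbTE ij) /= mulr0 addr0.
by rewrite !mxE !eqxx /=; ring.
Qed.

Lemma dotp_continuous : continuous (fun x => dotp x x).
Proof. by move=> x; apply: fcont_sum => j; apply: fcontM; exact: coord_continuous. Qed.

Lemma enorm_continuous : continuous (@enorm R n).
Proof. by move=> x; apply: continuous_comp; [exact: dotp_continuous|exact: sqrt_continuous]. Qed.

Lemma japanese_continuous : continuous (@japanese R n).
Proof.
rewrite (_ : @japanese R n = (fun x => Num.sqrt (1 + dotp x x))); last first.
  by apply/funext => x; rewrite /japanese enorm_sqr.
move=> x; apply: (@continuous_comp _ _ _ (fun y : 'rV[R]_n => 1 + dotp y y) Num.sqrt); last exact: sqrt_continuous.
by apply: fcontD; [exact: fcont_cst|exact: dotp_continuous].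
Qed.

Lemma near_neq0 x : x != 0 -> \forall y \near x, y != 0.
Proof.
move=> x0; have : 0 < dotp x x by rewrite lt_neqAle eq_sym dotp_eq0 x0 dotp_ge0.
move=> h; have := @dotp_continuous x => /cvgr_gt /(_ _ h); apply: filterS => y y0.
by rewrite -dotp_eq0 gt_eqF.
Qed.

Lemma ball_compact (M : R) : compact [set x : 'rV[R]_n | enorm x <= M].
Proof.
apply: bounded_closed_compact.
  exists M; split; first exact: num_real.
  move=> N MN x /= xM; apply: le_trans (ltW MN).
  rewrite /Num.norm /= mx_normrE; apply: bigmax_le => [|[i j] _]; first exact: le_trans (enorm_ge0 x) xM.
  by rewrite (ord1 i); apply: le_trans (coord_le_enorm x j) xM.
by apply: (@closed_comp _ _ (@enorm R n) [set r : R | r <= M]) => [x _|]; [exact: enorm_continuous|exact: closed_le].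
Qed.

Lemma sphere_compact : compact [set x : 'rV[R]_n | enorm x = 1].
Proof.
apply: (subclosed_compact _ (@ball_compact 1)) => [|x /= ->//].
by apply: (@closed_comp _ _ (@enorm R n) [set r : R | r = 1]) => [x _|]; [exact: enorm_continuous|exact: closed_eq].
Qed.

End euclidean.

Section directional.
Context {R : realType} {n : nat}.
Implicit Types (x v : 'rV[R]_n) (f : 'rV[R]_n -> R).

Lemma line_quotient f x v (s : R) :
  (fun h : R => h^-1 *: (((fun t : R => f (x + t *: v)) \o shift s) (h *: 1) - f (x + s *: v))) =
  (fun h : R => h^-1 *: ((f \o shift (x + s *: v)) (h *: v) - f (x + s *: v))).
Proof.
apply/funext => h /=; congr (_ *: (f _ - _)).
have -> : h *: (1 : R) = h by rewrite /GRing.scale /= mulr1.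
by rewrite scalerDl addrCA.
Qed.

Lemma is_derive_line f x v (s : R) : derivable f (x + s *: v) v ->
  is_derive s 1 (fun t : R => f (x + t *: v)) ('D_v f (x + s *: v)).
Proof.
by move=> df; apply: DeriveDef; rewrite /derivable /derive line_quotient.
Qed.

Lemma line_is_derive f x v (c : R) : is_derive (0 : R) 1 (fun t : R => f (x + t *: v)) c ->
  is_derive x v f c.
Proof.
move=> [df <-]; have := line_quotient f x v 0; rewrite scale0r addr0 => E.
by apply: DeriveDef; [move: df|]; rewrite /derivable /derive /= ?scale0r ?addr0 E.
Qed.

(** Along the line through [l *: x], homogeneity turns [f] into l^p times its values along the line
    through [x], run at speed 1/l. It applies where the argument is nonzero, hence only for
    parameters near 0, which is enough for a derivative. *)
Lemma homogeneous_derive f (p : R) v :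
  (forall (l : R) x, 0 < l -> x != 0 -> f (l *: x) = l `^ p * f x) ->
  (forall x, x != 0 -> derivable f x v) ->
  forall (l : R) x, 0 < l -> x != 0 -> 'D_v f (l *: x) = l `^ (p - 1) * 'D_v f x.
Proof.
move=> fh df l x l0 x0; have ln : l != 0 by rewrite gt_eqF.
have : is_derive (l *: x) v f (l `^ (p - 1) * 'D_v f x); last by move=> [].
apply: line_is_derive.
have dx := @is_derive_line f x v 0; rewrite scale0r addr0 in dx; have {dx} := dx (df _ x0).
move=> dx.
have dl : is_derive (0 : R) 1 (fun t : R => l^-1 * t) l^-1.
  apply: (@der_eq _ _ _ (l^-1 * 1 + 0 * 0)); last by ring.
  by apply: derM.
have dc : is_derive (0 : R) 1 (fun t : R => f (x + (l^-1 * t) *: v)) ('D_v f x * l^-1).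
  by apply: (@der_comp _ (fun s => f (x + s *: v)) (fun t => l^-1 * t)) => //; rewrite mulr0.
have dm : is_derive (0 : R) 1 (fun t : R => l `^ p * f (x + (l^-1 * t) *: v)) (l `^ (p - 1) * 'D_v f x).
  apply: (@der_eq _ _ _ (l `^ p * ('D_v f x * l^-1) + f (x + (l^-1 * 0) *: v) * 0)).
    by apply: derM => //; exact: der_cst.
  by rewrite mulr0 addr0 powRB ?ln ?implybT// powRr1 ?ltW//; ring.
apply: near_eq_is_derive dm.
have c1 : l^-1 * t @[t --> (0 : R)] --> (0 : R).
  have cc : continuous (fun t : R => l^-1 * t) by cont.
  by have := cc 0; rewrite /continuous_at mulr0.
have c0 : x + (l^-1 * t) *: v @[t --> (0 : R)] --> x.
  have := cvgD (cvg_cst x) (cvgZr_tmp (a := v) c1); rewrite scale0r addr0; exact.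
have H : \forall t \near (0 : R), x + (l^-1 * t) *: v != 0 := c0 _ (near_neq0 x0).
apply: filterS H => t h.
by rewrite -fh// scalerDr scalerA mulrA mulfV// mul1r.
Qed.

(** The constant is the maximum of |f| on the unit sphere. If the sphere is empty there are no
    nonzero points, and 0 will do. *)
Lemma homogeneous_bound f (p : R) :
  (forall (l : R) x, 0 < l -> x != 0 -> f (l *: x) = l `^ p * f x) ->
  (forall x, x != 0 -> {for x, continuous f}) ->
  exists2 C : R, 0 <= C & forall x, x != 0 -> `|f x| <= C * enorm x `^ p.
Proof.
move=> fh cf; pose S := [set x : 'rV[R]_n | enorm x = 1].
have unit x : x != 0 -> S ((enorm x)^-1 *: x).
  by move=> x0; rewrite /S /= enormZ normfV ger0_norm ?enorm_ge0// mulVf// gt_eqF// enorm_gt0.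
have scal x : x != 0 -> f x = enorm x `^ p * f ((enorm x)^-1 *: x).
  move=> x0; have e0 : 0 < enorm x by rewrite enorm_gt0.
  rewrite -fh//; last by rewrite scaler_eq0 invr_eq0 (gt_eqF e0) (negbTE x0).
  by rewrite scalerA mulfV ?gt_eqF// scale1r.
have [S0|S0] := pselect (S !=set0); last first.
  exists 0 => // x x0; exfalso; apply: S0; exists ((enorm x)^-1 *: x); exact: unit.
have cn : {within S, continuous (fun x => `|f x|)}.
  apply: continuous_in_subspaceT => x /set_mem; rewrite /S /= => x1.
  apply: (@continuous_comp _ _ _ f Num.norm); last exact: norm_continuous.
  by apply: cf; rewrite -enorm_gt0 x1.
have [c cS cmax] := compact_EVT_max S0 sphere_compact cn.
exists `|f c| => // x x0; rewrite (scal x x0) normrM ger0_norm ?powR_ge0// mulrC.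
by apply: ler_wpM2r; [exact: powR_ge0|apply: cmax; apply/mem_set; exact: unit].
Qed.

Lemma homogeneous_lower f (p : R) :
  (forall (l : R) x, 0 < l -> x != 0 -> f (l *: x) = l `^ p * f x) ->
  (forall x, x != 0 -> {for x, continuous f}) -> (forall x, x != 0 -> 0 < f x) ->
  exists2 c : R, 0 < c & forall x, x != 0 -> c * enorm x `^ p <= f x.
Proof.
move=> fh cf fp; pose S := [set x : 'rV[R]_n | enorm x = 1].
have unit x : x != 0 -> S ((enorm x)^-1 *: x).
  by move=> x0; rewrite /S /= enormZ normfV ger0_norm ?enorm_ge0// mulVf// gt_eqF// enorm_gt0.
have scal x : x != 0 -> f x = enorm x `^ p * f ((enorm x)^-1 *: x).
  move=> x0; have e0 : 0 < enorm x by rewrite enorm_gt0.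
  rewrite -fh//; last by rewrite scaler_eq0 invr_eq0 (gt_eqF e0) (negbTE x0).
  by rewrite scalerA mulfV ?gt_eqF// scale1r.
have [S0|S0] := pselect (S !=set0); last first.
  exists 1 => // x x0; exfalso; apply: S0; exists ((enorm x)^-1 *: x); exact: unit.
have cn : {within S, continuous f}.
  apply: continuous_in_subspaceT => x /set_mem; rewrite /S /= => x1.
  by apply: cf; rewrite -enorm_gt0 x1.
have [c cS cmin] := compact_EVT_min S0 sphere_compact cn.
exists (f c); first by apply: fp; rewrite -enorm_gt0; move/set_mem: cS => /= ->.
move=> x x0; rewrite (scal x x0) mulrC.
by apply: ler_wpM2l; [exact: powR_ge0|apply: cmin; apply/mem_set; exact: unit].
Qed.

End directional.

(** * Multi-indices of length one and two *)

Section multi_indices.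
Context {R : realType} {n : nat}.
Implicit Types (f : 'rV[R]_n -> R) (i j : 'I_n).

Definition mi1 j : @multi_index n := [ffun k => (k == j) : nat].
Definition mi2 i j : @multi_index n := [ffun k => ((k == i) + (k == j))%N].

Let flat0 (al : 'I_n -> nat) s : (forall k, k \in s -> al k = 0%N) ->
  flatten [seq nseq (al k) k | k <- s] = [::].
Proof.
elim: s => //= k s IH h; rewrite h ?mem_head//= IH// => l ls.
by apply: h; rewrite in_cons ls orbT.
Qed.

Lemma mi1_size j : mi_size (mi1 j) = 1%N.
Proof.
by rewrite /mi_size (bigD1 j)//= ffunE eqxx big1// => k kj; rewrite ffunE (negbTE kj).
Qed.

Lemma mi2_size i j : mi_size (mi2 i j) = 2%N.
Proof.
rewrite -[2%N]/(1 + 1)%N -{1}(mi1_size i) -(mi1_size j) /mi_size -big_split/=.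
by apply: eq_bigr => k _; rewrite !ffunE.
Qed.

Let enum_split j : exists p1 p2, [/\ enum 'I_n = p1 ++ j :: p2,
  forall k, k \in p1 -> (k < j)%N & forall k, k \in p2 -> (j < k)%N].
Proof.
have jin : j \in enum 'I_n by rewrite mem_enum.
have so : sorted ltn (map val (enum 'I_n)) by rewrite val_enum_ord iota_ltn_sorted.
move: (enum 'I_n) jin so => s jin; case/splitPr: jin => p1 p2 so; exists p1, p2; split => //.
  move=> k kp; move: so; rewrite map_cat sorted_pairwise; last exact: ltn_trans.
  rewrite pairwise_cat => /and3P[/allrelP h _ _]; apply: h; first exact: map_f.
  by rewrite /= mem_head.
move=> k kp; move: so; rewrite map_cat sorted_pairwise; last exact: ltn_trans.
rewrite pairwise_cat => /and3P[_ _ /=/andP[/allP h _]]; apply: h; exact: map_f.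
Qed.

Lemma mi1_deriv j f : mi_deriv (mi1 j) f = 'D_(evec j) f.
Proof.
rewrite /mi_deriv; have [p1 [p2 [-> h1 h2]]] := enum_split j.
rewrite map_cat flatten_cat /= ffunE eqxx /= !flat0//= => k kp; rewrite ffunE; apply/eqP; rewrite eqb0.
  by apply/eqP => e; have := h2 _ kp; rewrite e ltnn.
by apply/eqP => e; have := h1 _ kp; rewrite e ltnn.
Qed.

(** [mi_deriv] differentiates in the order of the enumeration, with the smallest index outermost.
    The symbol hypotheses therefore speak of this second derivative for i <= j, a restriction that
    propagates to the Lipschitz bounds and dictates the shape of the cutoffs. *)
Lemma mi2_deriv i j f : (i <= j)%N -> mi_deriv (mi2 i j) f = 'D_(evec i) ('D_(evec j) f).
Proof.
move=> ij; rewrite /mi_deriv; have [p1 [p2 [E h1 h2]]] := enum_split j.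
have p20 : flatten [seq nseq (mi2 i j k) k | k <- p2] = [::].
  apply: flat0 => k kp; have jk := h2 _ kp; rewrite ffunE.
  have ki : k != i by apply/eqP => e; have := leq_ltn_trans ij jk; rewrite e ltnn.
  have kj : k != j by apply/eqP => e; move: jk; rewrite e ltnn.
  by rewrite (negbTE ki) (negbTE kj).
have [ei|ne] := eqVneq i j.
  rewrite E map_cat flatten_cat /= p20 cats0 flat0; first by rewrite ffunE ei eqxx.
  move=> k kp; have kj : k != j by apply/eqP => e; have := h1 _ kp; rewrite e ltnn.
  by rewrite ffunE ei (negbTE kj).
have ip : i \in p1.
  have : i \in enum 'I_n by rewrite mem_enum.
  rewrite E mem_cat in_cons (negbTE ne) /= => /orP[//|/h2].
  by rewrite ltnNge ij.
have [p3 [p4 [E' h3 h4]]] := enum_split i.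
have p30 : flatten [seq nseq (mi2 i j k) k | k <- p3] = [::].
  apply: flat0 => k kp; have jk := h3 _ kp; rewrite ffunE.
  have ki : k != i by apply/eqP => e; move: jk; rewrite e ltnn.
  have kj : k != j by apply/eqP => e; have := leq_trans jk ij; rewrite e ltnn.
  by rewrite (negbTE ki) (negbTE kj).
have jp : j \in p4.
  have : j \in enum 'I_n by rewrite mem_enum.
  rewrite E' mem_cat in_cons eq_sym (negbTE ne) /= => /orP[/h3|//].
  by rewrite ltnNge ij.
have u4 : uniq p4 by have := enum_uniq 'I_n; rewrite E' cat_uniq /= => /and3P[_ _ /andP[]].
have p4E : flatten [seq nseq (mi2 i j k) k | k <- p4] = [:: j].
  case/splitPr: jp u4 h4 {E'} => a b u4 h4; rewrite map_cat flatten_cat /= ffunE eqxx eq_sym (negbTE ne) /=.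
  move: u4; rewrite cat_uniq /= negb_or => /and3P[_ /andP[ja _] /andP[jb _]].
  have z s : j \notin s -> {subset s <= a ++ j :: b} -> flatten [seq nseq (mi2 i j k) k | k <- s] = [::].
    move=> js sub; apply: flat0 => k ks; rewrite ffunE.
    have ik := h4 _ (sub _ ks); have ki : k != i by apply/eqP => e; move: ik; rewrite e ltnn.
    by rewrite (negbTE ki); have [e|//] := eqVneq k j; rewrite e (negbTE js) in ks.
  rewrite z//; last by move=> k ka; rewrite mem_cat ka.
  by rewrite z// => k kb; rewrite mem_cat in_cons kb !orbT.
rewrite E' map_cat flatten_cat /= p30 p4E ffunE eqxx (negbTE ne) //=.
Qed.

End multi_indices.

(** * Symbol estimates and nondegenerate directions *)

Section orders.
Context {R : realType} {n : nat}.
Implicit Types (x : 'rV[R]_n) (G Gm : 'rV[R]_n -> R).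

Lemma enorm0 : enorm (0 : 'rV[R]_n) = 0.
Proof. by apply/eqP; rewrite eq_le enorm_ge0 andbT leNgt enorm_gt0 eqxx. Qed.

Lemma powR_enorm_japanese x (p : R) : 1 <= enorm x ->
  enorm x `^ p <= 2 `^ `|p| * japanese x `^ p /\ japanese x `^ p <= 2 `^ `|p| * enorm x `^ p.
Proof.
move=> x1; have e0 : 0 < enorm x by exact: lt_le_trans x1.
have h1 := enorm_le_japanese x; have h2 := japanese_le x; have j0 := japanese_gt0 x.
by split; apply: powR_comparable => //; lra.
Qed.

Lemma powR_japanese_ball x (p K : R) : 1 <= K -> enorm x <= K - 1 ->
  1 <= K `^ `|p| * japanese x `^ p /\ japanese x `^ p <= K `^ `|p|.
Proof.
move=> K1 xK; have h1 := japanese_ge1 x; have h2 := japanese_le x.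
have j0 := japanese_gt0 x; have KJ : K <= K * japanese x by rewrite ler_peMr//; lra.
split.
  rewrite -[leLHS](_ : 1 `^ p = 1); last by rewrite powR1.
  by apply: powR_comparable => //; lra.
rewrite -[leRHS]mulr1 -[X in _ * X](_ : 1 `^ p = 1); last by rewrite powR1.
by apply: powR_comparable => //; lra.
Qed.

(** Outside the unit ball the homogeneous part has order [p] and the difference a lower one; inside,
    [G] is bounded by compactness. *)
Lemma order_bound G Gm (p C : R) : continuous G ->
  (forall (l : R) x, 0 < l -> x != 0 -> Gm (l *: x) = l `^ p * Gm x) ->
  (forall x, x != 0 -> {for x, continuous Gm}) ->
  (forall x, 1 <= enorm x -> `|G x - Gm x| <= C * enorm x `^ (p - 1)) ->
  exists2 D : R, 0 <= D & forall x, `|G x| <= D * japanese x `^ p.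
Proof.
move=> cG hG cGm GC; have [Cm Cm0 hCm] := homogeneous_bound hG cGm.
have S0 : [set x : 'rV[R]_n | enorm x <= 1] !=set0 by exists 0; rewrite /= enorm0.
have cn : {within [set x : 'rV[R]_n | enorm x <= 1], continuous (fun x => `|G x|)}.
  by apply: continuous_subspaceT => x; apply: fcont_norm; exact: cG.
have [x0 _ xmax] := compact_EVT_max S0 (@ball_compact R n 1) cn.
have K0 : 0 <= 2 `^ `|p| :> R by exact: powR_ge0.
have D1 : 0 <= (`|G x0| + (Cm + `|C|)) * 2 `^ `|p|.
  by apply: mulr_ge0 => //; rewrite !addr_ge0.
exists ((`|G x0| + (Cm + `|C|)) * 2 `^ `|p|) => // x.
rewrite -mulrA mulrDl; have j0 := powR_ge0 (japanese x) p.
have t1 : 0 <= `|G x0| * (2 `^ `|p| * japanese x `^ p) by rewrite !mulr_ge0.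
have t2 : 0 <= (Cm + `|C|) * (2 `^ `|p| * japanese x `^ p) by rewrite !mulr_ge0// addr_ge0.
have [x1|x1] := leP (enorm x) 1.
  apply: (@le_trans _ _ (`|G x0| * (2 `^ `|p| * japanese x `^ p))); last by rewrite lerDl.
  apply: (@le_trans _ _ `|G x0|); first by apply: xmax; apply/mem_set.
  rewrite ler_peMr//; have h2 : 1 <= 2 :> R by lra.
  by have [] := @powR_japanese_ball x p 2 h2 _; lra.
apply: (@le_trans _ _ ((Cm + `|C|) * (2 `^ `|p| * japanese x `^ p))); last by rewrite lerDr.
have x2 := ltW x1; have xn : x != 0 by rewrite -enorm_gt0 (lt_trans _ x1).
have [h _] := powR_enorm_japanese p x2.
apply: (@le_trans _ _ ((Cm + `|C|) * enorm x `^ p)); last by apply: ler_wpM2l => //; rewrite addr_ge0.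
rewrite mulrDl (_ : G x = Gm x + (G x - Gm x)); last by ring.
apply: le_trans (ler_normD _ _) _; apply: lerD; first exact: hCm.
apply: le_trans (GC _ x2) _; apply: (@le_trans _ _ (`|C| * enorm x `^ (p - 1))).
  by apply: ler_wpM2r; [exact: powR_ge0|exact: ler_norm].
by apply: ler_wpM2l; [exact: normr_ge0|apply: ler_powR; [exact: x2|rewrite lerBlDr lerDl]].
Qed.

(** Beyond the radius [R0] the error is at most half of the homogeneous lower bound, since it is one
    order smaller; on the ball of radius [R0] the positive continuous function [G] has a positive
    minimum. *)
Lemma order_lower G Gm (p C : R) : continuous G -> (forall x, 0 < G x) ->
  (forall (l : R) x, 0 < l -> x != 0 -> Gm (l *: x) = l `^ p * Gm x) ->
  (forall x, x != 0 -> {for x, continuous Gm}) -> (forall x, x != 0 -> 0 < Gm x) ->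
  (forall x, 1 <= enorm x -> `|G x - Gm x| <= C * enorm x `^ (p - 1)) ->
  exists2 c : R, 0 < c & forall x, c * japanese x `^ p <= G x.
Proof.
move=> cG G0 hG cGm Gm0 GC; have [c0 c00 hc0] := homogeneous_lower hG cGm Gm0.
pose R0 := 1 + 2 * `|C| / c0.
have C0 : 0 <= 2 * `|C| / c0 by apply: divr_ge0; [rewrite mulr_ge0|exact: ltW].
have S0 : [set x : 'rV[R]_n | enorm x <= R0] !=set0 by exists 0; rewrite /= enorm0 /R0; lra.
have cn : {within [set x : 'rV[R]_n | enorm x <= R0], continuous G} by exact: continuous_subspaceT.
have [x0 _ xmin] := compact_EVT_min S0 (@ball_compact R n R0) cn.
pose c1 := c0 / 2 * (2 `^ `|p|)^-1; pose c2 := G x0 * ((R0 + 1) `^ `|p|)^-1.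
have k1 : 0 < 2 `^ `|p| :> R by exact: powR_gt0.
have k2 : 0 < (R0 + 1) `^ `|p| by apply: powR_gt0; rewrite /R0; lra.
have c10 : 0 < c1 by apply: mulr_gt0; [lra|rewrite invr_gt0].
have c20 : 0 < c2 by apply: mulr_gt0; [exact: G0|rewrite invr_gt0].
exists (Num.min c1 c2); first by rewrite lt_min c10.
move=> x; have j0 := powR_ge0 (japanese x) p.
have [x1|x1] := leP (enorm x) R0.
  apply: (@le_trans _ _ (c2 * japanese x `^ p)); first by apply: ler_wpM2r; [exact: j0|rewrite ge_min lexx orbT].
  apply: (@le_trans _ _ (G x0)); last by apply: xmin; apply/mem_set.
  rewrite /c2 -mulrA ler_piMr ?(ltW (G0 _))// ler_pdivrMl// mulr1.
  have h2 : 1 <= R0 + 1 by rewrite /R0; lra.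
  by have [] := @powR_japanese_ball x p (R0 + 1) h2 _; lra.
apply: (@le_trans _ _ (c1 * japanese x `^ p)); first by apply: ler_wpM2r; [exact: j0|rewrite ge_min lexx].
have x2 : 1 <= enorm x by move: x1; rewrite /R0; lra.
have xn : x != 0 by rewrite -enorm_gt0 (lt_le_trans _ x2).
have [_ h] := powR_enorm_japanese p x2.
apply: (@le_trans _ _ (c0 / 2 * enorm x `^ p)).
  by rewrite /c1 -mulrA; apply: ler_wpM2l; [lra|rewrite ler_pdivrMl].
have e0 : 0 < enorm x by rewrite enorm_gt0.
have P0 := powR_gt0 (p - 1) e0.
have E : enorm x `^ p = enorm x * enorm x `^ (p - 1).
  transitivity (enorm x `^ (1 + (p - 1))); first by congr (_ `^ _); ring.
  have hp : (1 + (p - 1) == 0) ==> (enorm x != 0) by apply/implyP => _; rewrite gt_eqF.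
  by rewrite (powRD hp) powRr1// ltW.
have h1 := hc0 _ xn; have := GC _ x2; rewrite ler_norml => /andP[h2 _].
have h3 : C * enorm x `^ (p - 1) <= `|C| * enorm x `^ (p - 1).
  by apply: ler_wpM2r; [exact: ltW|exact: ler_norm].
have h4 : `|C| <= c0 / 2 * enorm x.
  have : 2 * `|C| / c0 < enorm x by move: x1; rewrite /R0; lra.
  by rewrite ltr_pdivrMr// => ?; lra.
have h5 : `|C| * enorm x `^ (p - 1) <= c0 / 2 * enorm x `^ p.
  by rewrite E mulrA; apply: ler_wpM2r => //; exact: ltW.
lra.
Qed.

End orders.

Lemma lipschitz_derive {R : realType} (f f' : R -> R) (L : R) :
  (forall x : R, is_derive x 1 f (f' x)) -> (forall x, `|f' x| <= L) ->
  forall x y, `|f x - f y| <= L * `|x - y|.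
Proof.
move=> df fL x y; wlog xy : x y / x <= y.
  by move=> H; have [/H//|/ltW/H] := leP x y; rewrite distrC (distrC y).
move: xy; rewrite le_eqVlt => /predU1P[->|xy]; first by rewrite !subrr normr0 mulr0.
have cf : continuous f by move=> z; exact: der_cont (df z).
have [z _ e] := @MVT R f f' x y xy (fun z _ => df z) (continuous_subspaceT cf).
by rewrite distrC e normrM (distrC x); apply: ler_wpM2r.
Qed.

Section bessel_weight.
Context {R : realType} {n : nat} (r : R).
Implicit Types x : 'rV[R]_n.

Definition jp x : R := japanese x `^ r.

Lemma jp_gt0 x : 0 < jp x. Proof. exact/powR_gt0/japanese_gt0. Qed.

Lemma jpE x : jp x = (1 + dotp x x) `^ (r / 2).
Proof.
by rewrite /jp /japanese enorm_sqr -powR12_sqrt ?addr_ge0 ?dotp_ge0// -powRrM mulrC.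
Qed.

Lemma jp_continuous : continuous jp.
Proof.
move=> x; apply: (@fcont_comp _ _ (fun v => v `^ r)); first exact: japanese_continuous.
exact: der_cont (is_derive1_powR r (japanese_gt0 x)).
Qed.

Lemma is_derive_jp x (j : 'I_n) (s : R) : is_derive s 1 (fun t : R => jp (x + t *: evec j))
  (r * (x + s *: evec j) ord0 j / japanese (x + s *: evec j) ^+ 2 * jp (x + s *: evec j)).
Proof.
have E : (fun t : R => jp (x + t *: evec j)) = (fun t : R => (1 + (dotp x x + 2 * t * x ord0 j + t ^+ 2)) `^ (r / 2)).
  by apply/funext => t; rewrite jpE dotp_line.
rewrite E; set v := fun t : R => 1 + (dotp x x + 2 * t * x ord0 j + t ^+ 2).
have vs : v s = japanese (x + s *: evec j) ^+ 2 by rewrite japanese_sqr dotp_line.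
have v0 : 0 < v s by rewrite vs exprn_gt0// japanese_gt0.
have dv : is_derive s 1 v (2 * (x + s *: evec j) ord0 j).
  rewrite /v; eapply der_eq; first by der.
  by rewrite !mxE !eqxx /=; ring.
apply: (@der_eq _ _ _ (r / 2 * v s `^ (r / 2 - 1) * (2 * (x + s *: evec j) ord0 j))).
  apply: (@der_comp _ (fun y : R => y `^ (r / 2)) v) => //.
  exact: is_derive1_powR.
have hp : (r / 2 == 1) ==> (v s != 0) by apply/implyP => _; rewrite gt_eqF.
rewrite (powRB hp) (powRr1 (ltW v0)) jpE -japanese_sqr -vs.
by field; rewrite gt_eqF.
Qed.

(** A unit step multiplies 1 + |x|^2 by at most 4, in either direction. *)
Lemma jp_slow x (j : 'I_n) (s : R) : `|s| <= 1 ->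
  jp (x + s *: evec j) <= 2 `^ `|r| * jp x.
Proof.
have key y (t : R) : `|t| <= 1 -> japanese (y + t *: evec j) <= 2 * japanese y.
  move=> t1; have j0 := japanese_gt0 y.
  have n1 : japanese (y + t *: evec j) \is Num.nneg by rewrite nnegrE ltW// japanese_gt0.
  have n2 : 2 * japanese y \is Num.nneg by rewrite nnegrE; apply: mulr_ge0 => //; exact: ltW.
  rewrite -(@ler_pXn2r _ 2 _ _ _ n1 n2)//.
  rewrite exprMn !japanese_sqr dotp_line; have h := coord_le_dotp y j.
  have h1 : t ^+ 2 <= 1 by rewrite -real_normK ?num_real// expr_le1.
  by have := sqr_ge0 (t - y ord0 j); rewrite sqrrB => h2; have := dotp_ge0 y; lra.
move=> s1; apply: powR_comparable; rewrite ?japanese_gt0 ?key//; first by lra.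
by have := key (x + s *: evec j) (- s); rewrite normrN -addrA -scalerDl subrr scale0r addr0; apply.
Qed.

End bessel_weight.

Section symbol.
Context {R : realType} (n : nat) (m : R) (a am : 'rV[R]_n -> R).
Hypotheses (a_smooth : smooth_on setT a)
  (am_smooth : smooth_on [set xi : 'rV[R]_n | xi != 0] am)
  (am_homog : forall (lam : R) (xi : 'rV[R]_n), 0 < lam -> xi != 0 ->
     am (lam *: xi) = lam `^ m * am xi)
  (a_grad : forall xi : 'rV[R]_n, gradient a xi != 0)
  (am_grad : forall xi : 'rV[R]_n, xi != 0 -> gradient am xi != 0)
  (a_am : forall al : @multi_index n, exists Cal : R,
     forall xi : 'rV[R]_n, 1 <= enorm xi ->
       `|mi_deriv al (fun eta => a eta - am eta) xi|
         <= Cal * enorm xi `^ (m - 1 - (mi_size al)%:R)).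
Implicit Types (i j : 'I_n) (xi : 'rV[R]_n).

Let d j f : 'rV[R]_n -> R := 'D_(evec j) f.

Let da j xi : derivable a xi (evec j). Proof. by have [_] := a_smooth [::] (x := xi) I. Qed.
Let cda j : continuous (d j a). Proof. by move=> xi; have [] := a_smooth [:: j] (x := xi) I. Qed.
Let dda i j xi : derivable (d j a) xi (evec i).
Proof. by have [_] := a_smooth [:: j] (x := xi) I. Qed.
Let cdda i j : continuous (d i (d j a)).
Proof. by move=> xi; have [] := a_smooth [:: i; j] (x := xi) I. Qed.
Let dam j xi : xi != 0 -> derivable am xi (evec j).
Proof. by move=> h; have [_] := am_smooth [::] h. Qed.
Let cdam j xi : xi != 0 -> {for xi, continuous (d j am)}.
Proof. by move=> h; have [] := am_smooth [:: j] h. Qed.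
Let ddam i j xi : xi != 0 -> derivable (d j am) xi (evec i).
Proof. by move=> h; have [_] := am_smooth [:: j] h. Qed.
Let cddam i j xi : xi != 0 -> {for xi, continuous (d i (d j am))}.
Proof. by move=> h; have [] := am_smooth [:: i; j] h. Qed.

Let diff1 j xi : xi != 0 -> d j (fun eta => a eta - am eta) xi = d j a xi - d j am xi.
Proof. by move=> h; rewrite /d -deriveB; [|exact: da|exact: dam]. Qed.

Let diff2 i j xi : xi != 0 ->
  d i (d j (fun eta => a eta - am eta)) xi = d i (d j a) xi - d i (d j am) xi.
Proof.
move=> h; rewrite /d -deriveB; [|exact: dda|exact: ddam].
apply: near_eq_derive; apply: filterS (near_neq0 h) => y y0; exact: diff1.
Qed.

Let hom1 j (l : R) xi : 0 < l -> xi != 0 -> d j am (l *: xi) = l `^ (m - 1) * d j am xi.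
Proof. exact: (homogeneous_derive am_homog (@dam j)). Qed.

Let hom2 i j (l : R) xi : 0 < l -> xi != 0 -> d i (d j am) (l *: xi) = l `^ (m - 1 - 1) * d i (d j am) xi.
Proof. exact: (homogeneous_derive (@hom1 j) (@ddam i j)). Qed.

Let neq xi : 1 <= enorm xi -> xi != 0.
Proof. by move=> h; rewrite -enorm_gt0 (lt_le_trans _ h). Qed.

Let cmp1 j : exists C : R, forall xi, 1 <= enorm xi -> `|d j a xi - d j am xi| <= C * enorm xi `^ (m - 1 - 1).
Proof.
have [C hC] := a_am (mi1 j); exists C => xi x1.
by have := hC _ x1; rewrite mi1_deriv mi1_size -diff1//; exact: neq.
Qed.

Let cmp2 i j : (i <= j)%N -> exists C : R, forall xi, 1 <= enorm xi ->
  `|d i (d j a) xi - d i (d j am) xi| <= C * enorm xi `^ (m - 1 - 1 - 1).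
Proof.
move=> ij; have [C hC] := a_am (mi2 i j); exists C => xi x1.
have := hC _ x1; rewrite mi2_deriv// mi2_size -diff2; last exact: neq.
by rewrite (_ : m - 1 - 2%:R = m - 1 - 1 - 1)//; ring.
Qed.

Lemma first_order : exists2 C : R, 0 <= C & forall j xi, `|d j a xi| <= C * jp (m - 1) xi.
Proof.
have H j : exists C : R, 0 <= C /\ forall xi, `|d j a xi| <= C * jp (m - 1) xi.
  have [C hC] := cmp1 j.
  by have [D D0 hD] := order_bound (@cda j) (@hom1 j) (@cdam j) hC; exists D.
have [f hf] := choice H; exists (\sum_j f j).
  by apply: sumr_ge0 => j _; have [] := hf j.
move=> j xi; have [f0 fj] := hf j; apply: le_trans (fj xi) _.
apply: ler_wpM2r; first exact/ltW/jp_gt0.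
by rewrite (bigD1 j)//= lerDl; apply: sumr_ge0 => k _; have [] := hf k.
Qed.

(** The comparison gives order [m - 2]; it is relaxed to [m - 1], the order of the weight by which
    [qsym] divides. *)
Lemma second_order : exists2 C : R, 0 <= C & forall i j xi, (i <= j)%N ->
  `|d i (d j a) xi| <= C * jp (m - 1) xi.
Proof.
have H (p : 'I_n * 'I_n) : exists C : R, 0 <= C /\ forall xi, (p.1 <= p.2)%N -> `|d p.1 (d p.2 a) xi| <= C * jp (m - 1) xi.
  case: p => i j /=; have [ij|ij] := leqP i j; last by exists 0.
  have [C hC] := cmp2 ij.
  have [D D0 hD] := order_bound (@cdda i j) (@hom2 i j) (@cddam i j) hC; exists D; split => // xi _.
  apply: le_trans (hD xi) _; apply: ler_wpM2l => //; apply: ler_powR; first exact: japanese_ge1.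
  by lra.
have [f hf] := choice H; exists (\sum_p f p).
  by apply: sumr_ge0 => j _; have [] := hf j.
move=> i j xi ij; have [f0 /(_ xi ij) fj] := hf (i, j); apply: le_trans fj _.
apply: ler_wpM2r; first exact/ltW/jp_gt0.
by rewrite (bigD1 (i, j))//= lerDl; apply: sumr_ge0 => k _; have [] := hf k.
Qed.

Let grad_pos (f : 'rV[R]_n -> R) xi : gradient f xi != 0 -> 0 < \sum_j `|d j f xi|.
Proof.
move=> h; rewrite lt_neqAle sumr_ge0// andbT eq_sym; apply: contra h => /eqP h.
apply/eqP/rowP => j; rewrite !mxE; apply/eqP; rewrite -normr_eq0; apply/eqP.
by apply: (psumr_eq0P _ h).
Qed.

(** [order_lower] is applied to the sum of the |d_j a|, which is positive because the gradient does
    not vanish; some term carries its share of the sum. The share is 1/(n + 1) rather than 1/n,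
    which makes the pigeonhole inequality strict. *)
Lemma elliptic : exists2 c : R, 0 < c & forall xi, exists j, c * jp (m - 1) xi <= `|d j a xi|.
Proof.
have [C hC] := choice (fun j => cmp1 j).
have [||||||c c0 hc] := @order_lower R n (fun xi => \sum_j `|d j a xi|) (fun xi => \sum_j `|d j am xi|) (m - 1) (\sum_j C j).
- by move=> xi; apply: fcont_sum => j; apply: fcont_norm; exact: cda.
- by move=> xi; exact: grad_pos.
- move=> l xi l0 x0; rewrite mulr_sumr; apply: eq_bigr => j _.
  by rewrite hom1// normrM ger0_norm// powR_ge0.
- by move=> xi x0; apply: fcont_sum => j; apply: fcont_norm; exact: cdam.
- by move=> xi x0; apply: grad_pos; exact: am_grad.
- move=> xi x1; rewrite -sumrB mulr_suml; apply: le_trans (ler_norm_sum _ _ _) _.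
  apply: ler_sum => j _; apply: le_trans (hC j xi x1); exact: ler_dist_dist.
exists (c / n.+1%:R); first exact: divr_gt0.
move=> xi; apply: contrapT => /forallNP H.
have B0 := jp_gt0 (m - 1) xi.
have : \sum_(j < n) `|d j a xi| <= \sum_(j < n) (c / n.+1%:R * jp (m - 1) xi).
  by apply: ler_sum => j _; apply: ltW; rewrite ltNge; apply/negP; exact: H.
have := hc xi; rewrite sumr_const card_ord => h1 h2.
have h3 : 0 < c * jp (m - 1) xi by exact: mulr_gt0.
have : c / n.+1%:R * jp (m - 1) xi *+ n < c * jp (m - 1) xi.
  rewrite -mulr_natr (_ : _ * _ * _ = c * jp (m - 1) xi * (n%:R / n.+1%:R)); last by ring.
  by rewrite -[ltRHS]mulr1 ltr_pM2l// ltr_pdivrMr// mul1r ltr_nat.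
by rewrite ltNge; move=> /negP; apply; exact: le_trans h2.
Qed.

(** The derivative divided by its order of growth: bounded, Lipschitz along suitable directions,
    with some component bounded below at every point. All constants of the line estimate refer to
    it. *)
Definition qsym j xi : R := 'D_(evec j) a xi / jp (m - 1) xi.

Lemma qsym_lipschitz : exists2 L : R, 0 <= L & forall i j xi (s t : R), (i <= j)%N ->
  `|qsym j (xi + s *: evec i) - qsym j (xi + t *: evec i)| <= L * `|s - t|.
Proof.
have [C1 C10 h1] := first_order; have [C2 C20 h2] := second_order.
exists (C2 + C1 * `|m - 1|); first by rewrite addr_ge0// mulr_ge0.
move=> i j xi s t ij.
pose x u := xi + u *: evec i; pose B u := jp (m - 1) (x u).
have B0 u : 0 < B u by exact: jp_gt0.
pose B' u := (m - 1) * (x u) ord0 i / japanese (x u) ^+ 2 * B u.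
have dB (u : R) : is_derive u 1 B (B' u) by exact: is_derive_jp.
pose D u := d j a (x u); pose D' u := d i (d j a) (x u).
have dD (u : R) : is_derive u 1 D (D' u) by apply: is_derive_line; exact: dda.
apply: (@lipschitz_derive R (fun u => D u * (B u)^-1) (fun u => D u * (- B u ^- 2 * B' u) + (B u)^-1 * D' u)) => u.
  by apply: derM => //; apply: derV => //; rewrite gt_eqF.
apply: le_trans (ler_normD _ _) _; rewrite addrC; apply: lerD.
  rewrite normrM normfV (gtr0_norm (B0 u)) mulrC ler_pdivrMr//; exact: h2.
have b' : `|B' u| <= `|m - 1| * B u.
  rewrite /B' normrM (gtr0_norm (B0 u)); apply: ler_wpM2r; first exact: ltW.
  rewrite -mulrA normrM -[leRHS]mulr1; apply: ler_wpM2l => //.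
  have j1 := japanese_ge1 (x u); rewrite normrM normfV (@ger0_norm _ (_ ^+ 2)) ?sqr_ge0//.
  rewrite ler_pdivrMr ?exprn_gt0 ?japanese_gt0// mul1r.
  apply: (@le_trans _ _ (japanese (x u))).
    exact: le_trans (coord_le_enorm _ _) (enorm_le_japanese _).
  by rewrite expr2 ler_peMr// ltW// japanese_gt0.
rewrite normrM normrM normrN normfV (@ger0_norm _ (_ ^+ 2)) ?sqr_ge0//.
apply: (@le_trans _ _ ((C1 * B u) * ((B u ^+ 2)^-1 * (`|m - 1| * B u)))).
  apply: ler_pM; rewrite ?mulr_ge0 ?invr_ge0 ?sqr_ge0//; first exact: h1.
  by apply: ler_wpM2l => //; rewrite invr_ge0 sqr_ge0.
rewrite le_eqVlt; apply/orP; left; apply/eqP; field; by rewrite gt_eqF.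
Qed.

Lemma qsym_bound : exists2 C : R, 0 < C & forall j xi, `|qsym j xi| <= C.
Proof.
have [C C0 h] := first_order; exists (C + 1); first by lra.
move=> j xi; have B0 := jp_gt0 (m - 1) xi; rewrite /qsym normrM normfV (gtr0_norm B0) ler_pdivrMr//.
apply: le_trans (h j xi) _; apply: ler_wpM2r; [exact: ltW|lra].
Qed.

Lemma qsym_lower : exists c : R, [/\ 0 < c, c <= 1 & forall xi, exists j, c <= `|qsym j xi|].
Proof.
have [c c0 h] := elliptic; exists (Num.min c 1); split; first by rewrite lt_min c0 ltr01.
  by rewrite ge_min lexx orbT.
move=> xi; have [j hj] := h xi; exists j; have B0 := jp_gt0 (m - 1) xi.
rewrite /qsym normrM normfV (gtr0_norm B0) ler_pdivlMr//; apply: le_trans hj.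
by apply: ler_wpM2r; [exact: ltW|rewrite ge_min lexx].
Qed.

Lemma qsym_continuous j : continuous (qsym j).
Proof.
move=> xi; apply: (@fcontM _ _ (d j a) (fun x => (jp (m - 1) x)^-1)); first exact: cda.
apply: (@fcont_comp _ _ GRing.inv); first exact: jp_continuous.
by apply: inv_continuous; rewrite gt_eqF// jp_gt0.
Qed.

Lemma is_derive_symbol j xi (s : R) : is_derive s 1 (fun t : R => a (xi + t *: evec j))
  (qsym j (xi + s *: evec j) * jp (m - 1) (xi + s *: evec j)).
Proof.
rewrite /qsym mulfVK ?gt_eqF ?jp_gt0//.
by apply: is_derive_line; exact: da.
Qed.

End symbol.

(** * The partition of frequency space *)

Section products.
Context {R : realType}.

Lemma prod_in01 (I : Type) (s : seq I) (P : pred I) (f : I -> R) :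
  (forall i, 0 <= f i <= 1) -> 0 <= \prod_(i <- s | P i) f i <= 1.
Proof.
move=> h; apply: (big_ind (fun x : R => 0 <= x <= 1)); first by rewrite ler01 lexx.
  by move=> x y /andP[x0 x1] /andP[y0 y1]; rewrite mulr_ge0//= mulr_ile1.
by move=> i _.
Qed.

Lemma prod_lip (I : Type) (s : seq I) (P : pred I) (f g : I -> R) :
  (forall i, 0 <= f i <= 1) -> (forall i, 0 <= g i <= 1) ->
  `|\prod_(i <- s | P i) f i - \prod_(i <- s | P i) g i| <= \sum_(i <- s | P i) `|f i - g i|.
Proof.
move=> hf hg; elim: s => [|x s IH]; first by rewrite !big_nil subrr normr0.
rewrite !big_cons; case: ifP => // _.
set F := \prod_(i <- s | P i) f i; set G := \prod_(i <- s | P i) g i.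
have /andP[F0 F1] : 0 <= F <= 1 by exact: prod_in01.
have /andP[g0 g1] := hg x.
rewrite (_ : _ - _ = (f x - g x) * F + g x * (F - G)); last by ring.
apply: le_trans (ler_normD _ _) _; rewrite !normrM; apply: lerD.
  by rewrite (ger0_norm F0) ler_piMr.
by rewrite (ger0_norm g0); apply: le_trans IH; rewrite ler_piMl.
Qed.

(** A telescoping product. For values in {0, 1} the left side singles out the largest [j] with
    [e j = 1]. *)
Lemma sum_last_factor n (e : 'I_n -> R) :
  \sum_(j < n) e j * \prod_(i < n | (j < i)%N) (1 - e i) = 1 - \prod_(i < n) (1 - e i).
Proof.
elim: n e => [|n IH] e; first by rewrite !big_ord0 subrr.
rewrite !big_ord_recl /=.
have -> : \prod_(i < n.+1 | (0 < i)%N) (1 - e i) = \prod_(i < n) (1 - e (lift ord0 i)).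
  by rewrite big_mkcond big_ord_recl /= mul1r.
have E (j : 'I_n) : \prod_(i < n.+1 | (bump 0 j < i)%N) (1 - e i) = \prod_(i < n | (j < i)%N) (1 - e (lift ord0 i)).
  rewrite big_mkcond big_ord_recl /= mul1r [RHS]big_mkcond.
  by apply: eq_bigr => i _; rewrite /bump !leq0n !add1n ltnS.
have -> : \sum_(i < n) e (lift ord0 i) * \prod_(i0 < n.+1 | (bump 0 i < i0)%N) (1 - e i0) =
    1 - \prod_(i < n) (1 - e (lift ord0 i)).
  by rewrite -(IH (fun i => e (lift ord0 i))); apply: eq_bigr => j _; rewrite E.
by ring.
Qed.

Lemma plateau_lip (d z x y : R) : 0 < d -> `|plateau d z x - plateau d z y| <= 2 / d * `|x - y|.
Proof.
move=> d0; rewrite /plateau.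
rewrite (_ : _ - _ = (pos (2 - `|x - z| / d) - pos (2 - `|y - z| / d)) -
  (pos (1 - `|x - z| / d) - pos (1 - `|y - z| / d))); last by ring.
have h (k : R) : `|pos (k - `|x - z| / d) - pos (k - `|y - z| / d)| <= d^-1 * `|x - y|.
  apply: le_trans (pos_lip _ _) _.
  rewrite (_ : _ - _ = d^-1 * (`|y - z| - `|x - z|)); last by ring.
  rewrite normrM (gtr0_norm (x := d^-1)) ?invr_gt0//; apply: ler_wpM2l; first by rewrite invr_ge0 ltW.
  apply: le_trans (ler_dist_dist _ _) _.
  by rewrite (_ : y - z - (x - z) = - (x - y)); [rewrite normrN|ring].
apply: le_trans (ler_normB _ _) _; have := h 2; have := h 1; lra.
Qed.

(** Equal to 0 for |x| <= c/2, to 1 for |x| >= c, and linear in |x| between. *)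
Definition ramp (c x : R) : R := pos (2 * `|x| / c - 1) - pos (2 * `|x| / c - 2).

Lemma ramp_in (c x : R) : 0 <= ramp c x <= 1.
Proof.
rewrite /ramp; set u := 2 * `|x| / c.
have [h1|h1] := leP 0 (u - 1); have [h2|h2] := leP 0 (u - 2).
- by rewrite !pos_id//; apply/andP; split; lra.
- by rewrite pos_id// (pos_0 (ltW h2)); apply/andP; split; lra.
- by exfalso; lra.
- by rewrite (pos_0 (ltW h1)) (pos_0 (ltW h2)); apply/andP; split; lra.
Qed.

Lemma ramp1 (c x : R) : 0 < c -> c <= `|x| -> ramp c x = 1.
Proof.
move=> c0 h; have h1 : 2 <= 2 * `|x| / c by rewrite ler_pdivlMr//; lra.
by rewrite /ramp !pos_id; lra.
Qed.

Lemma ramp_neq0 (c x : R) : 0 < c -> ramp c x != 0 -> c / 2 <= `|x|.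
Proof.
move=> c0; apply: contraNle => h; have h1 : 2 * `|x| / c <= 1 by rewrite ler_pdivrMr//; lra.
by rewrite /ramp !pos_0; lra.
Qed.

Lemma ramp_lip (c x y : R) : 0 < c -> `|ramp c x - ramp c y| <= 4 / c * `|x - y|.
Proof.
move=> c0; rewrite /ramp.
rewrite (_ : _ - _ = (pos (2 * `|x| / c - 1) - pos (2 * `|y| / c - 1)) -
  (pos (2 * `|x| / c - 2) - pos (2 * `|y| / c - 2))); last by ring.
have h (k : R) : `|pos (2 * `|x| / c - k) - pos (2 * `|y| / c - k)| <= 2 / c * `|x - y|.
  apply: le_trans (pos_lip _ _) _.
  rewrite (_ : _ - _ = 2 / c * (`|x| - `|y|)); last by ring.
  rewrite normrM (@gtr0_norm _ (2 / c)) ?divr_gt0//; apply: ler_wpM2l; first by rewrite divr_ge0// ltW.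
  exact: ler_dist_dist.
apply: le_trans (ler_normB _ _) _; have := h 1; have := h 2.
rewrite (_ : 4 / c * `|x - y| = 2 / c * `|x - y| + 2 / c * `|x - y|); last by ring.
by lra.
Qed.

Lemma meas_ramp (c : R) : measT (ramp c).
Proof.
apply: contm; rewrite /ramp; cont; apply: pos_cont; cont.
Qed.

End products.

Section cutoffs.
Context {R : realType} {n : nat}.
Variables (q : 'I_n -> 'rV[R]_n -> R) (c L N : R).
Hypotheses (c0 : 0 < c) (L0 : 0 <= L) (N_ge1 : 1 <= N)
  (q_low : forall xi, exists j, c <= `|q j xi|)
  (q_lip : forall (i j : 'I_n) (xi : 'rV[R]_n) (s t : R), (i <= j)%N ->
    `|q j (xi + s *: evec i) - q j (xi + t *: evec i)| <= L * `|s - t|).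
Implicit Types (j : 'I_n) (xi : 'rV[R]_n).

(** The product runs over i > j and not over i < j: the variation of [cutw j] along e_j then
    involves [q i] only for i >= j, the range in which [q_lip] holds. *)
Definition cutw j xi : R := ramp c (q j xi) * \prod_(i < n | (j < i)%N) (1 - ramp c (q i xi)).

(** A truncation to a cube of frequencies, which makes the integrals converge. Its Lipschitz
    constant is bounded uniformly in [N >= 1], so it can be attached to the cutoffs and removed in
    the limit. *)
Definition kapN xi : R := \prod_(k < n) plateau N 0 (xi ord0 k).

Let N0 : 0 < N. Proof. exact: lt_le_trans ltr01 N_ge1. Qed.

Let cramp_in x : 0 <= 1 - ramp c x <= 1.
Proof. by have /andP[h1 h2] := ramp_in c x; apply/andP; split; lra. Qed.

Lemma kapN_in xi : 0 <= kapN xi <= 1.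
Proof. by apply: prod_in01 => k; exact: plateau_in. Qed.

Lemma kapN0 xi j : 2 * N <= `|xi ord0 j| -> kapN xi = 0.
Proof. by move=> h; rewrite /kapN (bigD1 j)//= plateau0 ?subr0// mul0r. Qed.

Lemma kapN1 xi : (forall j, `|xi ord0 j| <= N) -> kapN xi = 1.
Proof. by move=> h; rewrite /kapN big1// => j _; rewrite plateau1// subr0. Qed.

Lemma meas_kapN : measT kapN.
Proof.
apply: measurable_prod => k _.
apply: (mcomp (f := plateau N 0)); last exact: mcoord.
exact: contm (@plateau_cont _ _ _).
Qed.

(** Only the factor of index [j] depends on the parameter, with constant 2/N <= 2. *)
Lemma kapN_lip j xi (s t : R) : `|kapN (xi + s *: evec j) - kapN (xi + t *: evec j)| <= 2 * `|s - t|.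
Proof.
apply: le_trans (prod_lip _ _ (fun k => plateau_in 0 _ N0) (fun k => plateau_in 0 _ N0)) _.
rewrite (bigD1 j)//= big1 ?addr0 => [|k kj]; last first.
  by rewrite !mxE eqxx (negbTE kj) /= !mulr0 subrr normr0.
apply: le_trans (plateau_lip _ _ _ N0) _; rewrite !mxE !eqxx /= !mulr1.
rewrite (_ : _ + s - _ = s - t); last by ring.
by apply: ler_wpM2r => //; rewrite ler_pdivrMr//; have := N_ge1; lra.
Qed.

Lemma cutw_in j xi : 0 <= cutw j xi <= 1.
Proof.
have /andP[h1 h2] := ramp_in c (q j xi).
have /andP[h3 h4] : 0 <= \prod_(i < n | (j < i)%N) (1 - ramp c (q i xi)) <= 1 by exact: prod_in01.
by rewrite /cutw mulr_ge0//= mulr_ile1.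
Qed.

Lemma cutw_neq0 j xi : cutw j xi != 0 -> c / 2 <= `|q j xi|.
Proof. by rewrite mulf_eq0 negb_or => /andP[h _]; exact: ramp_neq0. Qed.

(** Some [ramp] equals 1 by [q_low], so the product left over in [sum_last_factor] vanishes. *)
Lemma sum_cutw xi : \sum_j cutw j xi = 1.
Proof.
rewrite /cutw (sum_last_factor (fun i => ramp c (q i xi))).
have [j hj] := q_low xi.
by rewrite (bigD1 j)//= ramp1// subrr mul0r subr0.
Qed.

(** There are at most n + 1 factors, all in [0, 1] and each with Lipschitz constant [4 / c * L]
    along e_j. *)
Lemma cutw_lip j xi (s t : R) :
  `|cutw j (xi + s *: evec j) - cutw j (xi + t *: evec j)| <= n.+1%:R * (4 / c * L) * `|s - t|.
Proof.
have c40 : 0 <= 4 / c by rewrite divr_ge0// ltW.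
have K0 : 0 <= 4 / c * L * `|s - t| by apply: mulr_ge0 => //; exact: mulr_ge0.
have hq (i : 'I_n) : (j <= i)%N -> `|ramp c (q i (xi + s *: evec j)) - ramp c (q i (xi + t *: evec j))| <= 4 / c * L * `|s - t|.
  move=> ji; apply: le_trans (ramp_lip _ _ c0) _; rewrite -[leRHS]mulrA; apply: ler_wpM2l => //; exact: q_lip.
rewrite /cutw; set e := ramp c _; set e' := ramp c _; set p := \prod_(_ | _) _; set p' := \prod_(_ | _) _.
have /andP[p0 p1] : 0 <= p <= 1 by exact: prod_in01.
have /andP[e0 e1] : 0 <= e' <= 1 by exact: ramp_in.
rewrite (_ : _ - _ = (e - e') * p + e' * (p - p')); last by ring.
apply: le_trans (ler_normD _ _) _.
rewrite (normrM (e - e')) (normrM e') (ger0_norm p0) (ger0_norm e0).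
have h1 : `|e - e'| * p <= 4 / c * L * `|s - t|.
  by apply: le_trans (hq j (leqnn j)); rewrite ler_piMr.
have h2 : e' * `|p - p'| <= n%:R * (4 / c * L * `|s - t|).
  apply: (@le_trans _ _ `|p - p'|); first by rewrite ler_piMl.
  apply: le_trans (prod_lip _ _ (fun k => cramp_in _) (fun k => cramp_in _)) _.
  rewrite big_mkcond; apply: (@le_trans _ _ (\sum_(i < n) (4 / c * L * `|s - t|))).
    apply: ler_sum => i _; case: ifP => // ji.
    rewrite (_ : _ - _ = - (ramp c (q i (xi + s *: evec j)) - ramp c (q i (xi + t *: evec j)))); last by ring.
    by rewrite normrN; apply: hq; exact: ltnW.
  by rewrite sumr_const card_ord -[leLHS]mulr_natl.
by rewrite -natr1; lra.
Qed.

Lemma cutw_kapN_lip j xi (s t : R) :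
  `|cutw j (xi + s *: evec j) * kapN (xi + s *: evec j) - cutw j (xi + t *: evec j) * kapN (xi + t *: evec j)|
   <= (n.+1%:R * (4 / c * L) + 2) * `|s - t|.
Proof.
set w := cutw _ _; set k := kapN _; set w' := cutw _ _; set k' := kapN _.
have /andP[k0 k1] : 0 <= k <= 1 by exact: kapN_in.
have /andP[w0 w1] : 0 <= w' <= 1 by exact: cutw_in.
rewrite (_ : _ - _ = (w - w') * k + w' * (k - k')); last by ring.
apply: le_trans (ler_normD _ _) _.
rewrite (normrM (w - w')) (normrM w') (ger0_norm k0) (ger0_norm w0) mulrDl; apply: lerD.
  by apply: le_trans (cutw_lip j xi s t); rewrite ler_piMr.
by apply: le_trans (kapN_lip j xi s t); rewrite ler_piMl.
Qed.

End cutoffs.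

(** * Bessel's inequality on R^n *)

Section fourier_rV.
Context {R : realType} {n : nat}.
Local Notation Rn := 'rV[R]_n.
Local Notation leb := (@lebesgue_measure R).
Local Notation Leb := (@lebesgue_rV R n).
Local Open Scope complex_scope.

Lemma meas_dotp2 : measT (fun z : Rn * Rn => dotp z.1 z.2).
Proof.
apply: measurable_sum => j; apply: mfunM.
  exact: (mcomp (mcoord j) mfst).
exact: (mcomp (mcoord j) msnd).
Qed.

Lemma dotpC (x y : Rn) : dotp x y = dotp y x.
Proof. by apply: eq_bigr => j _; rewrite mulrC. Qed.

Variable sg : R.
Hypothesis sg1 : sg = 1 \/ sg = -1.

(** The sign [sg] treats the Fourier transform (-1) and the inverse transform (+1, up to
    normalization) together. *)
Definition phn (z : Rn * Rn) : R := sg * dotp z.2 z.1.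

Lemma meas_phn : measT phn.
Proof.
apply: mfunM => //.
exact: (mcomp meas_dotp2 (mpair msnd mfst)).
Qed.

Definition En (e : R) (x : Rn) : R := \prod_(j < n) Ek e (x ord0 j).
Definition Pn (e : R) (x y : Rn) : R := \prod_(j < n) Pk e (x ord0 j - y ord0 j).

Lemma meas_En e : measT (En e).
Proof.
apply: measurable_prod => j _.
exact: (mcomp (meas_Ek e) (mcoord j)).
Qed.

Lemma meas_Pn e : 0 < e -> measT (fun q : Rn * Rn => Pn e q.1 q.2).
Proof.
move=> e0; apply: measurable_prod => j _.
apply: (mcomp (meas_Pk e0)); apply: mfunB.
  exact: (mcomp (mcoord j) mfst).
exact: (mcomp (mcoord j) msnd).
Qed.

Lemma En_ge0 e x : 0 < e -> 0 <= En e x.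
Proof. by move=> e0; apply: prodr_ge0 => j _; exact: Ek_ge0. Qed.

Lemma En_le1 e x : 0 < e -> En e x <= 1.
Proof.
by move=> e0; have /andP[] : 0 <= En e x <= 1 by apply: prod_in01 => j; rewrite Ek_ge0 ?Ek_le1.
Qed.

Lemma Pn_ge0 e x y : 0 < e -> 0 <= Pn e x y.
Proof. by move=> e0; apply: prodr_ge0 => j _; exact: Pk_ge0. Qed.

Lemma PnC e x y : Pn e x y = Pn e y x.
Proof. by apply: eq_bigr => j _; rewrite -PkN opprB. Qed.

Lemma En_integrable e : 0 < e -> Leb.-integrable setT (EFin \o En e).
Proof.
move=> e0; apply/integrableP; split; first by apply/mEFin; exact: meas_En.
under eqint do rewrite /= ger0_norm ?En_ge0//.
rewrite (ge0_integral_prod (p := fun=> Ek e)) => [|_|_ x]; [|exact: meas_Ek|exact: Ek_ge0].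
under eq_bigr do rewrite int_Ek//.
by rewrite -(big_morph EFin (@EFinM R) erefl) ltry.
Qed.

Lemma int_Pn e x : 0 < e -> (\int[Leb]_y (Pn e x y)%:E = ((2 * pi) ^+ n)%:E)%E.
Proof.
move=> e0; rewrite (eqint (fun y : Rn => (\prod_(j < n) Pk e (y ord0 j - x ord0 j))%:E)); last first.
  by move=> y _; rewrite PnC.
rewrite (ge0_integral_prod (p := fun j r => Pk e (r - x ord0 j))); last 2 first.
- by move=> j; apply: (mcomp (meas_Pk e0)); exact: mfunB.
- by move=> *; exact: Pk_ge0.
under eq_bigr do rewrite int_Pk1//.
by rewrite -(big_morph EFin (@EFinM R) erefl) prodr_const card_ord.
Qed.

Lemma FT_En e (xi zeta : Rn) : 0 < e ->
  cint Leb (fun X => expi (phn (X, xi) - phn (X, zeta)) * (En e X)%:C) = (Pn e xi zeta)%:C.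
Proof.
move=> e0; pose p (j : 'I_n) (r : R) : R[i] := expi (r * (sg * (xi ord0 j - zeta ord0 j))) * (Ek e r)%:C.
have E (X : Rn) : expi (phn (X, xi) - phn (X, zeta)) * (En e X)%:C = \prod_(j < n) p j (X ord0 j).
  rewrite /phn /= -mulrBr /dotp -sumrB mulr_sumr /En rmorph_prod /=.
  rewrite big_split /=; congr (_ * _).
  elim/big_rec2: _ => [|j y1 y2 _ <-]; first exact: expi0.
  by rewrite expiD; congr (expi _ * _); ring.
rewrite (eq_cint Leb E).
have [_ ->] := @cint_prod R n p (fun j => Ek_expi_integrable _ e0).
rewrite /Pn rmorph_prod; apply: eq_bigr => j _; rewrite FT_Ek//.
by case: sg1 => ->; rewrite ?mul1r// mulN1r PkN.
Qed.

Lemma En_lim (X : Rn) : En (e_ i) X @[i --> \oo] --> (1 : R).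
Proof.
have H : (\prod_(j < n) Ek (e_ i) (X ord0 j)) @[i --> \oo] --> \prod_(j < n) (1 : R).
  apply: (@cvg_big R _ (fun x y : R => x * y) 1 xpredT) => [[a b]|j _]; last exact: Ek_lim.
  exact: (cvgM cvg_fst cvg_snd).
by rewrite big1 in H.
Qed.

Definition FTn (u : Rn -> R[i]) (X : Rn) : R[i] := FT Leb phn u X.

Let l2 u := cintg Leb u /\ (\int[Leb]_x (sqn (u x))%:E < +oo)%E.

Let L2p1 u : l2 u -> L2p Leb (fun=> 1) u.
Proof.
move=> [iu su]; split; [|split]; first by under eq_fun do rewrite mulr1.
  exact: cintg_meas iu.
by under eqint do rewrite mulr1.
Qed.

Let pi2n : 0 <= (2 * pi) ^+ n :> R.
Proof. by rewrite exprn_ge0// mulr_ge0// pi_ge0. Qed.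

Lemma bessel_rV u : cintg Leb u -> (\int[Leb]_x (sqn (u x))%:E < +oo)%E ->
  (\int[Leb]_X (sqn (FTn u X))%:E <= ((2 * pi) ^+ n)%:E * \int[Leb]_x (sqn (u x))%:E)%E.
Proof.
move=> iu su; have lu : l2 u by split.
have := @FT_bessel R _ _ _ _ Leb Leb phn meas_phn (fun i => En (e_ i)) (fun i => Pn (e_ i))
  (fun i => meas_En _) (fun i X => En_ge0 X (e_gt0 i)) (fun i => En_integrable (e_gt0 i))
  (fun i xi zeta => FT_En xi zeta (e_gt0 i)) (fun=> 1) ((2 * pi) ^+ n) (mcst _) (fun=> ler01) pi2n
  (fun i xi zeta => Pn_ge0 xi zeta (e_gt0 i)) (fun i xi zeta => PnC _ xi zeta) (fun i => meas_Pn (e_gt0 i)).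
have IP i xi : (\int[Leb]_y (Pn (e_ i) xi y * (fun=> 1) y)%:E = ((2 * pi) ^+ n)%:E)%E.
  by rewrite -(int_Pn xi (e_gt0 i)); apply: eqint => y _; rewrite mulr1.
move=> /(_ IP En_lim u (L2p1 lu)).
have -> : (\int[Leb]_xi (sqn (u xi) * 1)%:E = \int[Leb]_xi (sqn (u xi))%:E)%E.
  by apply: eqint => y _; rewrite mulr1.
apply: le_trans; apply: eq_leE; apply: eqint => X _; congr (sqn _)%:E.
by apply: eq_cint => x; rewrite mulr1.
Qed.

End fourier_rV.

Lemma sqn_expi_sub1 {R : realType} (x : R) : sqn (expi x - 1) <= 4 /\ sqn (expi x - 1) <= 2 * x ^+ 2.
Proof.
split.
  have := sqnB_le (expi x) 1; rewrite sqn_expi (_ : sqn (1 : R[i]) = 1); first by lra.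
  by rewrite /sqn /= expr1n expr0n addr0.
have h (f f' : R -> R) : (forall x : R, is_derive x 1 f (f' x)) -> (forall x, `|f' x| <= 1) ->
    (f x - f 0) ^+ 2 <= x ^+ 2.
  move=> df fb; rewrite -(@ger0_norm _ (x ^+ 2)) ?sqr_ge0// -(@ger0_norm _ (_ ^+ 2)) ?sqr_ge0// !normrX.
  apply: lerXn2r; rewrite ?nnegrE//.
  by have := lipschitz_derive df fb x 0; rewrite mul1r subr0.
have h1 := h cos (fun x => - sin x * 1); have h2 := h sin (fun x => cos x * 1).
have {}h1 : (cos x - cos 0) ^+ 2 <= x ^+ 2.
  apply: h1 => y; first by eapply der_eq; [by apply: der_cos; exact: der_id|].
  by rewrite mulr1 normrN; rewrite ler_norml sin_geN1 sin_le1.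
have {}h2 : (sin x - sin 0) ^+ 2 <= x ^+ 2.
  apply: h2 => y; first by eapply der_eq; [by apply: der_sin; exact: der_id|].
  by rewrite mulr1 ler_norml cos_geN1 cos_le1.
have -> : sqn (expi x - 1) = (cos x - cos 0) ^+ 2 + (sin x - sin 0) ^+ 2.
  by rewrite cos0 sin0 /sqn /= !subr0.
by lra.
Qed.

(** * Choice of the dyadic weight *)

Section parameters.
Context {R : realType} (s : R).
Hypothesis hs : 2^-1 < s.

(* [rho] is chosen so that 2 < rho < 2 ^ (2 sigma) with sigma = min(s, 3/4), which makes both
   the weight of the one-dimensional norm and the series over dyadic scales summable. *)
Definition sigma : R := Num.min s (3 / 4).
Definition theta : R := 2^-1 `^ (2 * sigma).
Definition rho : R := (2 + theta^-1) / 2.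

Lemma sigma_gt : 1 < 2 * sigma.
Proof. by rewrite /sigma; have := hs; case: (leP s (3/4)) => ? ?; lra. Qed.
Lemma sigma_le : 2 * sigma <= 3 / 2.
Proof. by rewrite /sigma; case: (leP s (3/4)) => ?; lra. Qed.
Lemma sigma_le_s : sigma <= s. Proof. by rewrite /sigma ge_min lexx. Qed.

Lemma theta_gt0 : 0 < theta. Proof. by apply: powR_gt0; rewrite invr_gt0. Qed.

Lemma theta_lt : theta < 2^-1.
Proof.
have h2 : (0 : R) < 2^-1 by rewrite invr_gt0.
have -> : theta = 2^-1 * 2^-1 `^ (2 * sigma - 1).
  by rewrite mulr_powRB1//; have := sigma_gt; lra.
have e1 : 1 `^ (2 * sigma - 1) = 1 :> R by rewrite powR1.
rewrite -[ltRHS]mulr1 ltr_pM2l// -[ltRHS]e1; apply: gt0_ltr_powR.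
- by have := sigma_gt; lra.
- by rewrite nnegrE ltW.
- by rewrite nnegrE.
- by rewrite invf_lt1// ltr1n.
Qed.

Lemma theta_ge : 4^-1 <= theta.
Proof.
have h2 : (0 : R) < 2^-1 by rewrite invr_gt0.
have -> : 4^-1 = 2^-1 `^ (2%:R) :> R by rewrite powR_mulrn; [field|exact: ltW].
apply: ger_powR; first by rewrite h2 invf_le1// ler1n.
by have := sigma_le; lra.
Qed.

Lemma rho_gt2 : 2 < rho.
Proof.
have h := theta_lt; have h0 := theta_gt0; have : 2 < theta^-1.
  by rewrite -[ltLHS]invrK ltf_pV2// ?posrE// invr_gt0.
rewrite /rho; lra.
Qed.

Lemma rho_lt4 : rho < 4.
Proof.
have h := theta_ge; have h0 := theta_gt0; have : theta^-1 <= 4.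
  by rewrite -[leRHS]invrK lef_pV2// ?posrE// invr_gt0.
rewrite /rho; lra.
Qed.

(** [rho] is the midpoint of 2 and 1/theta, hence [rho * theta] is theta + 1/2, and theta < 1/2. *)
Lemma rho_theta : 0 <= rho * theta < 1.
Proof.
have h := theta_lt; have h0 := theta_gt0; apply/andP; split.
  by apply: mulr_ge0; [have := rho_gt2; lra|exact: ltW].
have -> : rho * theta = theta + 2^-1 by rewrite /rho; field; rewrite gt_eqF.
lra.
Qed.

Lemma e_sigma i : (e_ i : R) `^ (2 * sigma) = theta ^+ i.
Proof.
rewrite /e_ /theta; elim: i => [|i IH]; first by rewrite !expr0 powR1.
by rewrite !exprS powRM ?invr_ge0// ?exprn_ge0 ?invr_ge0// IH.
Qed.

Definition scales : R := fine (\sum_(i <oo) ((rho * theta) ^+ i)%:E)%E.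

Lemma scalesE : (\sum_(i <oo) ((rho * theta) ^+ i)%:E = scales%:E)%E.
Proof.
have /andP[h0 h1] := rho_theta.
rewrite fineK// ge0_fin_numE; first exact: geometric_lty.
by apply: nneseries_ge0 => i _ _; rewrite lee_fin exprn_ge0.
Qed.

Lemma scales_ge0 : 0 <= scales.
Proof.
have /andP[h0 h1] := rho_theta.
by apply: fine_ge0; apply: nneseries_ge0 => i _ _; rewrite lee_fin exprn_ge0.
Qed.

Local Notation leb := (@lebesgue_measure R).

(** With y = e_i |x| the integral is O(min(1, y^2)): for large [y] by the total mass of [Pk], for
    small [y] by its second moment. Since 2 sigma lies between 0 and 2, this is O(y^(2 sigma)), and
    e_i^(2 sigma) = theta^i. *)
Lemma scale_bound (i : nat) (x : R) : (\int[leb]_r (Pk (e_ i) r * sqn (expi (r * x) - 1))%:E <=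
   (8 * pi * (theta ^+ i * `|x| `^ (2 * sigma)))%:E)%E.
Proof.
have e0 := @e_gt0 R i; have pi0 := pi_ge0 R.
have mP := meas_Pk e0; have mQ := meas_Qk e0.
have mS : measT (fun r : R => sqn (expi (r * x) - 1)).
  apply: msqn; apply: cmeasB; last exact: cmeas_cst.
  by apply: cmeas_expi; exact: mfunM.
have mPS : measT (fun r : R => Pk (e_ i) r * sqn (expi (r * x) - 1)) by exact: mfunM.
have PS0 (r : R) : 0 <= Pk (e_ i) r * sqn (expi (r * x) - 1) by rewrite mulr_ge0 ?Pk_ge0 ?sqn_ge0.
have -> : theta ^+ i * `|x| `^ (2 * sigma) = (e_ i * `|x|) `^ (2 * sigma).
  by rewrite powRM ?(ltW e0)// e_sigma.
set y := e_ i * `|x|; have y0 : 0 <= y by rewrite mulr_ge0// ltW.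
have sg := sigma_gt; have sl := sigma_le.
have [y1|y1] := leP 1 y.
  apply: (@le_trans _ _ (\int[leb]_r (4 * Pk (e_ i) r)%:E)%E).
    apply: ge0_le_int => //; first exact: mfunM.
    move=> r; rewrite mulrC; apply: ler_wpM2r; first exact: Pk_ge0.
    by have [] := sqn_expi_sub1 (r * x).
  rewrite ge0_intZl//; last by move=> r; exact: Pk_ge0.
  have -> : (\int[leb]_r (Pk (e_ i) r)%:E = (2 * pi)%:E)%E.
    by rewrite -(int_Pk1 0 e0); apply: eqint => r _; rewrite subr0.
  rewrite -EFinM lee_fin (_ : 4 * (2 * pi) = 8 * pi * 1); last by ring.
  apply: ler_wpM2l; first by rewrite mulr_ge0.
  by rewrite -[leLHS](powRr0 y); apply: ler_powR => //; lra.
apply: (@le_trans _ _ (\int[leb]_r (4 * (e_ i * x) ^+ 2 * Qk (e_ i) r)%:E)%E).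
  apply: ge0_le_int => //; first exact: mfunM.
  move=> r; have [_ h] := sqn_expi_sub1 (r * x).
  apply: le_trans (ler_wpM2l (Pk_ge0 r e0) h) _.
  have := ler_wpM2l (sqr_ge0 x) (Pk_sqr r e0); set P := Pk _ _; set Q := Qk _ _ => h1.
  rewrite (_ : P * _ = 2 * (x ^+ 2 * (r ^+ 2 * P))); last by ring.
  rewrite (_ : 4 * _ * Q = 2 * (x ^+ 2 * (2 * e_ i ^+ 2 * Q))); last by ring.
  exact: ler_wpM2l.
rewrite ge0_intZl//; last 2 first.
- by rewrite mulr_ge0// sqr_ge0.
- by move=> r; exact: Qk_ge0.
rewrite int_Qk// -EFinM lee_fin (_ : _ * (2 * pi) = 8 * pi * (e_ i * x) ^+ 2); last by ring.
apply: ler_wpM2l; first by rewrite mulr_ge0.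
have -> : (e_ i * x) ^+ 2 = y ^+ 2 by rewrite /y !exprMn real_normK ?num_real.
rewrite -powR_mulrn//; have [->|yn] := eqVneq y 0.
  by rewrite !powR0//; apply/eqP; lra.
by apply: ger_powR; [rewrite lt_neqAle eq_sym yn y0 ltW|lra].
Qed.

End parameters.

(** * From the spatial weight to the one-dimensional norm *)

Section boxes.
Context {R : realType} {n : nat}.
Local Notation Rn := 'rV[R]_n.
Local Notation Leb := (@lebesgue_rV R n).

Definition inbox (T : R) (x : Rn) : Prop := forall k, `|x ord0 k| <= T.

Definition boxvol (T : R) : R :=
  \prod_(k < n) fine (lebesgue_measure (`[(- T)%R, T]%classic : set (measurableTypeR R))).

Lemma boxvol_ge0 T : 0 <= boxvol T.
Proof. by apply: prodr_ge0 => k _; exact: fine_ge0. Qed.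

Lemma box_int_le (G : Rn -> R[i]) (M T : R) : cmeas G ->
  (forall x, normc (G x) <= M) -> (forall x, ~ inbox T x -> G x = 0) ->
  (\int[Leb]_x (normc (G x))%:E <= (M * boxvol T)%:E)%E.
Proof.
move=> mG GM G0; have M0 : 0 <= M by exact: le_trans (nc_ge0 _) (GM 0).
pose I (k : 'I_n) (r : R) : R := \1_(`[(- T)%R, T]%classic) r.
have mI k : measT (I k) by exact: mindic.
have I0 k r : 0 <= I k r by rewrite /I indicE.
have m1 : measT (fun x : Rn => \prod_(k < n) I k (x ord0 k)).
  by apply: measurable_prod => k _; exact: (mcomp (mI k) (mcoord k)).
have P0 (x : Rn) : 0 <= \prod_(k < n) I k (x ord0 k) by apply: prodr_ge0 => k _; exact: I0.
apply: (@le_trans _ _ (\int[Leb]_x (M * \prod_(k < n) I k (x ord0 k))%:E)%E).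
  apply: ge0_le_int.
  - exact: mnormc.
  - exact: mfunM.
  - by move=> x; exact: nc_ge0.
  move=> x; have [h|/G0 ->] := pselect (inbox T x); last first.
    by rewrite normc_real normr0 mulr_ge0.
  rewrite big1 ?mulr1// => k _; rewrite /I indicE mem_set//= in_itv /= -ler_norml; exact: h.
rewrite (ge0_intZl Leb M0 m1 P0) ge0_integral_prod//.
have E k : (\int[lebesgue_measure]_r (I k r)%:E = (fine (lebesgue_measure (`[(- T)%R, T]%classic : set (measurableTypeR R))))%:E)%E.
  rewrite integral_indic// setIT fineK//.
  have H : (lebesgue_measure (`[(- T)%R, T]%classic : set (measurableTypeR R)) \is a fin_num)%E.
    by rewrite lebesgue_measure_itv /=; case: ifP => // _; rewrite -EFinB.
  exact: H.
under eq_bigr do rewrite E.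
by rewrite -(big_morph EFin (@EFinM R) erefl) -EFinM.
Qed.

Lemma box_cintg (G : Rn -> R[i]) (M T : R) : cmeas G ->
  (forall x, normc (G x) <= M) -> (forall x, ~ inbox T x -> G x = 0) -> cintg Leb G.
Proof.
move=> mG GM G0; apply/cintgP; split => //.
exact: le_lt_trans (box_int_le mG GM G0) (ltry _).
Qed.

End boxes.

Lemma meas_japanese {R : realType} (n : nat) (p : R) :
  measT (fun x : 'rV[R]_n => japanese x `^ p).
Proof.
have md : measT (fun x : 'rV[R]_n => dotp x x).
  by apply: measurable_sum => k; apply: mfunM; exact: mcoord.
have -> : (fun x : 'rV[R]_n => japanese x `^ p) = (fun x => (1 + dotp x x) `^ (p / 2)).
  by apply/funext => x; exact: jpE.
by apply: (mcomp (measurable_powR _)); exact: mfunD.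
Qed.

Section sobolev.
Context {R : realType} {n : nat}.
Local Notation Rn := 'rV[R]_n.+1.
Local Notation leb := (@lebesgue_measure R).
Local Notation Leb := (@lebesgue_rV R n.+1).
Local Open Scope complex_scope.
Variables (s : R) (hs : 2^-1 < s) (sg : R) (sg1 : sg = 1 \/ sg = -1).
Local Notation rho := (rho s).
Variable u : Rn -> R[i].
Hypotheses (iu : cintg Leb u) (su : (\int[Leb]_x (sqn (u x))%:E < +oo)%E).

Let U := FTn sg u.
Let mu : cmeas u. Proof. exact: cintg_meas iu. Qed.
Let mU : cmeas U. Proof. by apply: cmeas_FT => //; exact: meas_phn. Qed.
Let pi2n : 0 <= (2 * pi) ^+ n.+1 :> R.
Proof. by rewrite exprn_ge0// mulr_ge0// pi_ge0. Qed.
Let msu : measT (fun x => sqn (u x)). Proof. exact: msqn. Qed.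

Let dotp_evec (x : Rn) (r : R) (j : 'I_n.+1) (xi : Rn) : dotp x (xi + r *: evec j) = dotp x xi + r * x ord0 j.
Proof.
rewrite /dotp (bigD1 j)//= [in RHS](bigD1 j)//= !mxE !eqxx /=.
rewrite (eq_bigr (fun k => x ord0 k * xi ord0 k)); first by ring.
by move=> k kj; rewrite !mxE eqxx (negbTE kj) /= mulr0 addr0.
Qed.

(** A shift of the transform along e_j is a modulation of [u] in the variable x_j. *)
Let FT_shift (j : 'I_n.+1) (r : R) (xi : Rn) :
  U (xi + r *: evec j) - U xi = FTn sg (fun x => (expi (r * (sg * x ord0 j)) - 1) * u x) xi.
Proof.
rewrite /U /FTn /FT -cintB.
- apply: eq_cint => x; rewrite /phn /= dotp_evec.
  rewrite (_ : sg * (dotp x xi + r * x ord0 j) = sg * dotp x xi + r * (sg * x ord0 j)); last by ring.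
  by rewrite expiD; ring.
- by apply: FT_integrable => //; exact: meas_phn.
- by apply: FT_integrable => //; exact: meas_phn.
Qed.

Let mexp (j : 'I_n.+1) (r : R) : cmeas (fun x : Rn => expi (r * (sg * x ord0 j)) - 1).
Proof.
apply: cmeasB; last exact: cmeas_cst.
apply: cmeas_expi; apply: mfunM => //; apply: mfunM => //.
exact: mcoord.
Qed.

Let shift_bound (j : 'I_n.+1) (r : R) :
  (\int[Leb]_xi (sqn (U (xi + r *: evec j)%R - U xi)%R)%:E <=
   ((2 * pi) ^+ n.+1)%:E * \int[Leb]_x (sqn (expi (r * (sg * x ord0 j)) - 1)%R * sqn (u x))%:E)%E.
Proof.
under eqint do rewrite FT_shift.
have e (x : Rn) : sqn ((expi (r * (sg * x ord0 j)) - 1) * u x) = sqn (expi (r * (sg * x ord0 j)) - 1) * sqn (u x).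
  exact: sqnM.
apply: le_trans (bessel_rV sg1 _ _) _.
- apply: (@cintgM _ _ _ Leb (fun x : Rn => expi (r * (sg * x ord0 j)) - 1) u 2) => //.
  move=> x; rewrite normc_sqrt (_ : 2 = Num.sqrt (2 ^+ 2)); last by rewrite sqrtr_sqr ger0_norm.
  by apply: ler_wsqrtr; have [h _] := sqn_expi_sub1 (r * (sg * x ord0 j)); lra.
- under eqint do rewrite e.
  apply: (@le_lt_trans _ _ (\int[Leb]_x (4 * sqn (u x))%:E)%E).
    apply: ge0_le_int.
    + by apply: mfunM => //; exact: (msqn (mexp j r)).
    + exact: mfunM.
    + by move=> x; rewrite mulr_ge0 ?sqn_ge0.
    by move=> x; apply: ler_wpM2r; [exact: sqn_ge0|have [] := sqn_expi_sub1 (r * (sg * x ord0 j))].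
  by rewrite ge0_intZl// ?lte_mul_pinfty// => x; exact: sqn_ge0.
by under eqint do rewrite e.
Qed.

Let mfam (j : 'I_n.+1) : cmeas (fun p : R * (R * 'rV[R]_n) => U (ins j p.2 + p.1 *: evec j) - U (ins j p.2)).
Proof.
have mi : measT (fun p : R * (R * 'rV[R]_n) => ins j p.2).
  exact: (mcomp (meas_ins j) msnd).
have mi2 : measT (fun p : R * (R * 'rV[R]_n) => ins j p.2 + p.1 *: evec j).
  have -> : (fun p : R * (R * 'rV[R]_n) => ins j p.2 + p.1 *: evec j) = (fun p => ins j (p.2.1 + p.1, p.2.2)).
    by apply/funext => -[r [x y]] /=; rewrite -ins_add.
  apply: (mcomp (meas_ins j)); apply: mpair.
    apply: mfunD => //; exact: (mcomp mfst msnd).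
  exact: (mcomp msnd msnd).
by apply: cmeasB; [exact: (cmeas_comp mU mi2)|exact: (cmeas_comp mU mi)].
Qed.

(** In [osc] the second point is written as the first plus [r]. Integrating over all lines then
    gives the L2 norm on R^n of a difference of transforms, which Bessel's inequality converts into
    the weight |exp(i r x_j) - 1|^2 on |u|^2; [scale_bound] integrates that weight against [Pk]. *)
Let osc_bound (j : 'I_n.+1) (i : nat) :
  (\int[lebesgue_rV n]_y osc i (fun r => U (ins j (r, y))) <=
   ((2 * pi) ^+ n.+1)%:E * \int[Leb]_x (8 * pi * (theta s ^+ i * `|x ord0 j| `^ (2 * sigma s)) * sqn (u x))%:E)%E.
Proof.
have e0 := @e_gt0 R i.
have mP := meas_Pk e0.
have P0 (r : R) : 0 <= Pk (e_ i) r by exact: Pk_ge0.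
pose W (r : R) (p : R * 'rV[R]_n) : R := Pk (e_ i) r * sqn (U (ins j p + r *: evec j) - U (ins j p)).
have W0 r p : 0 <= W r p by rewrite mulr_ge0 ?sqn_ge0.
have mW : measT (fun q : R * (R * 'rV[R]_n) => W q.1 q.2).
  apply: mfunM; first exact: (mcomp mP mfst).
  exact: (msqn (mfam j)).
have E1 y : (osc i (fun r => U (ins j (r, y))) = \int[leb]_x \int[leb]_r (W r (x, y))%:E)%E.
  have mUy : cmeas (fun r : R => U (ins j (r, y))).
    by apply: (cmeas_comp mU); exact: (mcomp (meas_ins j) (mpair2 y)).
  have mq : measT (fun q : R * R => (sqn (U (ins j (q.1, y)) - U (ins j (q.2, y)))%R * Pk (e_ i) (q.1 - q.2))%:E).
    apply/mEFin; apply: mfunM.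
      by apply: msqn; apply: cmeasB; exact: (cmeas_comp mUy).
    by apply: (mcomp mP); exact: (mfunB mfst msnd).
  have q0 x z : (0 <= (sqn (U (ins j (x, y)) - U (ins j (z, y)))%R * Pk (e_ i) (x - z))%:E)%E.
    by rewrite lee_fin mulr_ge0 ?sqn_ge0.
  rewrite /osc (@ge0_prod_int _ _ _ _ _ leb leb (fun x z => (sqn (U (ins j (x, y)) - U (ins j (z, y)))%R * Pk (e_ i) (x - z))%:E) mq q0).
  rewrite (@ge0_swapE _ _ _ _ _ leb leb (fun x z => (sqn (U (ins j (x, y)) - U (ins j (z, y)))%R * Pk (e_ i) (x - z))%:E) mq q0); apply: eqint => x _.
  rewrite -(@ge0_integral_shift _ x (fun z => (sqn (U (ins j (z, y)) - U (ins j (x, y)))%R * Pk (e_ i) (z - x))%:E)).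
  - by apply: eqint => r _; rewrite /W addrK (addrC r x) ins_add; congr EFin; exact: mulrC.
  - apply/mEFin; apply: mfunM.
      by apply: msqn; apply: cmeasB; [exact: mUy|exact: cmeas_cst].
    by apply: (mcomp mP); exact: mfunB.
  - by move=> z; rewrite lee_fin mulr_ge0 ?sqn_ge0.
under eqint do rewrite E1.
have mE : measT (fun q : (R * 'rV[R]_n) * R => (W q.2 q.1)%:E).
  apply/mEFin; exact: (mcomp mW (mpair msnd mfst)).
have E2 : (\int[lebesgue_rV n]_y \int[leb]_x \int[leb]_r (W r (x, y))%:E =
   \int[leb]_r \int[Leb]_xi (Pk (e_ i) r * sqn (U (xi + r *: evec j)%R - U xi)%R)%:E)%E.
  have mI : measT (fun q : R * 'rV[R]_n => \int[leb]_r (W r q)%:E)%E.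
    exact: (@mintp _ _ _ _ _ leb (fun q r => (W r q)%:E) mE (fun q r => W0 r q)).
  have I0 x y : (0 <= \int[leb]_r (W r (x, y))%:E)%E by apply: int_ge0 => r; rewrite lee_fin.
  rewrite -(@ge0_swapE _ _ _ _ _ leb (lebesgue_rV n) (fun x y => \int[leb]_r (W r (x, y))%:E)%E mI I0).
  rewrite -(@ge0_prod_int _ _ _ _ _ leb (lebesgue_rV n) (fun x y => \int[leb]_r (W r (x, y))%:E)%E mI I0).
  have E3 : (\int[leb \x lebesgue_rV n]_z \int[leb]_r (W r (z.1, z.2))%:E =
      \int[sprod leb (lebesgue_rV n)]_z \int[leb]_r (W r z)%:E)%E.
    by apply: eqint => -[x y] _.
  rewrite E3 (@ge0_swapE _ _ _ _ _ (sprod leb (lebesgue_rV n)) leb (fun z r => (W r z)%:E) mE); last first.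
    by move=> z r; rewrite lee_fin.
  apply: eqint => r _.
  have mr : measT (fun xi : Rn => (Pk (e_ i) r * sqn (U (xi + r *: evec j)%R - U xi)%R)%:E).
    under eq_fun do rewrite FT_shift.
    apply/mEFin; apply: mfunM => //; apply: msqn.
    apply: cmeas_FT; first exact: meas_phn.
    by apply: cmeasM.
  rewrite (ge0_integral_rV' j mr); last by move=> xi; rewrite lee_fin mulr_ge0 ?sqn_ge0.
  apply: (@ge0_prod_int _ _ _ _ _ leb (lebesgue_rV n) (fun x y => (W r (x, y))%:E)).
    by apply/mEFin; exact: (mcomp mW (mpair1 r)).
  by move=> x y; rewrite lee_fin.
rewrite E2.
have mV : measT (fun q : R * Rn => sqn (expi (q.1 * (sg * q.2 ord0 j)) - 1)).
  apply: msqn; apply: cmeasB; last exact: cmeas_cst.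
  apply: cmeas_expi; apply: mfunM => //; apply: mfunM => //.
  exact: (mcomp (mcoord j) msnd).
have mV1 (r : R) : measT (fun x : Rn => sqn (expi (r * (sg * x ord0 j)) - 1)).
  exact: (mcomp mV (mpair1 r)).
pose V (r : R) (x : Rn) : R := sqn (u x) * (Pk (e_ i) r * sqn (expi (r * (sg * x ord0 j)) - 1)).
have V0 r x : 0 <= V r x.
  by apply: mulr_ge0; [exact: sqn_ge0|apply: mulr_ge0; [exact: P0|exact: sqn_ge0]].
have mVV : measT (fun q : R * Rn => V q.1 q.2).
  apply: mfunM; first exact: (mcomp msu msnd).
  by apply: mfunM => //; exact: (mcomp mP mfst).
have mVr : measT (fun r => \int[Leb]_x (V r x)%:E)%E.
  apply: (@mintp _ _ _ _ _ Leb (fun r x => (V r x)%:E)); first exact/mEFin.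
  by move=> r x; rewrite lee_fin.
apply: (@le_trans _ _ (\int[leb]_r (((2 * pi) ^+ n.+1)%:E * \int[Leb]_x (V r x)%:E))%E).
  apply: ge0_le_intE.
  - have mWx : measT (fun q : R * Rn => (Pk (e_ i) q.1 * sqn (U (q.2 + q.1 *: evec j)%R - U q.2)%R)%:E).
      have mrest : measT (fun x : Rn => (x ord0 j, \row_l x ord0 (lift j l)) : R * 'rV[R]_n).
        apply: mpair; first exact: mcoord.
        apply: measurable_fun_rV => l; rewrite (_ : _ \o _ = rV_coord (lift j l)).
          exact: mcoord.
        by apply/funext => x; rewrite /rV_coord /= mxE.
      have := mcomp mW (mpair mfst (mcomp mrest msnd)).
      move=> /mEFin; apply: eq_measurable_fun => q _ /=.
      by rewrite /W /= insP.
    apply: (@mintp _ _ _ _ _ Leb (fun r xi => (Pk (e_ i) r * sqn (U (xi + r *: evec j)%R - U xi)%R)%:E)) => //.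
    by move=> r xi; rewrite lee_fin mulr_ge0 ?sqn_ge0.
  - exact: mfuneM.
  - by move=> r; apply: int_ge0 => xi; rewrite lee_fin mulr_ge0 ?sqn_ge0.
  move=> r; rewrite ge0_intZl//; last 2 first.
  - apply: msqn; under eq_fun do rewrite FT_shift.
    by apply: cmeas_FT; [exact: meas_phn|exact: cmeasM].
  - by move=> xi; exact: sqn_ge0.
  have E4 : (\int[Leb]_x (V r x)%:E = (Pk (e_ i) r)%:E * \int[Leb]_x (sqn (expi (r * (sg * x ord0 j)) - 1)%R * sqn (u x))%:E)%E.
    rewrite -ge0_intZl//; last 2 first.
    - exact: mfunM.
    - by move=> x; rewrite mulr_ge0 ?sqn_ge0.
    by apply: eqint => x _; rewrite /V; congr EFin; ring.
  rewrite E4 muleCA; apply: lee_wpmul2l; first by rewrite lee_fin.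
  exact: shift_bound.
rewrite ge0_intZlE//; last by move=> r; apply: int_ge0 => x; rewrite lee_fin.
apply: lee_wpmul2l; first by rewrite lee_fin.
rewrite (@ge0_swap _ _ _ _ _ leb Leb V mVV V0).
apply: ge0_le_intE.
- apply: (@mintp _ _ _ _ _ leb (fun x r => (V r x)%:E)).
    apply/mEFin; exact: (mcomp mVV (mpair msnd mfst)).
  by move=> x r; rewrite lee_fin.
- apply/mEFin; apply: mfunM => //; apply: mfunM => //; apply: mfunM => //.
  apply: (mcomp (measurable_powR _)); apply: mcomp => //; exact: mcoord.
- by move=> x; apply: int_ge0 => r; rewrite lee_fin.
move=> x; rewrite /V ge0_intZl ?sqn_ge0//; last 2 first.
- by apply: mfunM => //; exact: (mcomp mV (mpair2 x)).
- by move=> r; rewrite mulr_ge0 ?sqn_ge0.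
rewrite [X in (_ <= X%:E)%E]mulrC EFinM; apply: lee_wpmul2l; first by rewrite lee_fin sqn_ge0.
have := scale_bound hs i (sg * x ord0 j).
by rewrite (_ : `|sg * _| = `|x ord0 j|)//; case: sg1 => ->; rewrite ?mul1r// mulN1r normrN.
Qed.

Definition Csob : R := (2 * pi) ^+ n.+1 * (1 + 8 * pi * scales s).

(** The bounds [osc_bound] are summed over the scales as a geometric series of ratio
    [rho * theta < 1], and [sigma <= s] bounds |x_j|^(2 sigma) by the spatial weight. *)
Lemma sobolev_N1 (j : 'I_n.+1) :
  (\int[lebesgue_rV n]_y N1 rho (fun r => U (ins j (r, y))) <=
   Csob%:E * \int[Leb]_x (japanese x `^ (2 * s) * sqn (u x))%:E)%E.
Proof.
have r2 := rho_gt2 hs; have r0 : 0 < rho by lra.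
have mUi : cmeas (fun p : 'rV[R]_n * R => U (ins j (p.2, p.1))).
  by apply: (cmeas_comp mU); apply: (mcomp (meas_ins j)); exact: mpair.
have mo i : measT (fun y => (rho ^+ i)%:E * osc i (fun r => U (ins j (r, y))))%E.
  by apply: mfuneM; exact: (meas_osc i mUi).
have ro i v : (0 <= (rho ^+ i)%:E * osc i v)%E.
  by apply: mule_ge0; [rewrite lee_fin exprn_ge0// ltW|exact: osc_ge0].
set S := (\int[Leb]_x (japanese x `^ (2 * s) * sqn (u x))%:E)%E.
have mj (p : R) := @meas_japanese R n.+1 p.
have Sle : (\int[Leb]_x (sqn (u x))%:E <= S)%E.
  apply: ge0_le_int => //; first exact: mfunM.
    by move=> x; exact: sqn_ge0.
  move=> x; rewrite ler_peMl ?sqn_ge0//.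
  rewrite -[leLHS](powRr0 (japanese x)); apply: ler_powR; first exact: japanese_ge1.
  by have := hs; lra.
have S0 : (0 <= S)%E by apply: le_trans Sle; apply: int_ge0 => x; rewrite lee_fin sqn_ge0.
rewrite /N1 ge0_intDE; last 4 first.
- apply: (@mintp _ _ _ _ _ leb (fun y r => (sqn (U (ins j (r, y))))%:E)).
    apply/mEFin; exact: (msqn mUi).
  by move=> y r; rewrite lee_fin sqn_ge0.
- by apply: ge0_emeasurable_sum => [i x _ _|i _]; [exact: ro|exact: mo].
- by move=> y; apply: int_ge0 => r; rewrite lee_fin sqn_ge0.
- by move=> y; apply: nneseries_ge0 => i *; exact: ro.
rewrite -(@ge0_integral_rV R n j (fun x => (sqn (U x))%:E)); last 2 first.
- by apply/mEFin; exact: msqn.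
- by move=> x; rewrite lee_fin sqn_ge0.
rewrite integral_nneseries//.
have pi0 := pi_ge0 R; have c8 : 0 <= 8 * pi * (2 * pi) ^+ n.+1 :> R by rewrite !mulr_ge0.
have term i : (\int[lebesgue_rV n]_y ((rho ^+ i)%:E * osc i (fun r => U (ins j (r, y)))) <=
    ((8 * pi * (2 * pi) ^+ n.+1)%:E * S) * ((rho * theta s) ^+ i)%:E)%E.
  rewrite ge0_intZlE; last 3 first.
  - by rewrite exprn_ge0// ltW.
  - exact: (meas_osc i mUi).
  - by move=> y; exact: osc_ge0.
  have th0 : 0 <= theta s ^+ i by rewrite exprn_ge0// ltW// theta_gt0.
  have ri0 : (0 <= (rho ^+ i)%:E)%E by rewrite lee_fin exprn_ge0// ltW.
  apply: le_trans (lee_wpmul2l ri0 (osc_bound j i)) _.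
  have H : (\int[Leb]_x (8 * pi * (theta s ^+ i * `|x ord0 j| `^ (2 * sigma s)) * sqn (u x))%:E <= (8 * pi * theta s ^+ i)%:E * S)%E.
    rewrite /S -ge0_intZl; last 3 first.
    - by rewrite !mulr_ge0.
    - exact: mfunM.
    - by move=> x; rewrite mulr_ge0 ?sqn_ge0 ?powR_ge0.
    apply: ge0_le_int.
    - apply: mfunM => //; apply: mfunM => //; apply: mfunM => //.
      apply: (mcomp (measurable_powR _)); apply: mcomp => //; exact: mcoord.
    - by apply: mfunM => //; exact: mfunM.
    - by move=> x; rewrite !mulr_ge0 ?sqn_ge0 ?powR_ge0.
    move=> x; rewrite [leRHS]mulrA; apply: ler_wpM2r; first exact: sqn_ge0.
    rewrite mulrA; apply: ler_wpM2l; first by rewrite !mulr_ge0.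
    apply: (@le_trans _ _ (japanese x `^ (2 * sigma s))).
      apply: ge0_ler_powR; rewrite ?nnegrE ?(ltW (japanese_gt0 _))//.
        by have := sigma_gt hs; lra.
      exact: le_trans (coord_le_enorm _ _) (enorm_le_japanese _).
    by apply: ler_powR; [exact: japanese_ge1|have := sigma_le_s s; lra].
  have p0 : (0 <= ((2 * pi) ^+ n.+1)%:E :> \bar R)%E by rewrite lee_fin.
  apply: le_trans (lee_wpmul2l ri0 (lee_wpmul2l p0 H)) _; apply: eq_leE.
  rewrite EFin_mul3 [RHS]muleAC -EFinM; congr (_%:E * _)%E.
  by rewrite [(rho * _) ^+ i]exprMn; ring.
have sc0 := scales_ge0 hs.
apply: (@le_trans _ _ (((2 * pi) ^+ n.+1)%:E * S + ((8 * pi * (2 * pi) ^+ n.+1)%:E * S) * (scales s)%:E)%E).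
  apply: leeD.
    apply: le_trans (bessel_rV sg1 iu su) _; apply: lee_wpmul2l => //; by rewrite lee_fin.
  rewrite -scalesE//; apply: nneseries_le => [i|k].
    by apply: int_ge0 => y; exact: ro.
  have S80 : (0 <= (8 * pi * (2 * pi) ^+ n.+1)%:E * S)%E by apply: mule_ge0; rewrite ?lee_fin.
  have /andP[rt0 rt1] := rho_theta hs.
  have q0 i : (0 <= ((rho * theta s) ^+ i)%:E)%E by rewrite lee_fin exprn_ge0.
  apply: (@le_trans _ _ (\sum_(0 <= i < k) (((8 * pi * (2 * pi) ^+ n.+1)%:E * S) * ((rho * theta s) ^+ i)%:E))%E).
    by apply: lee_sum => i _; exact: term.
  rewrite -ge0_sume_distrr//; apply: lee_wpmul2l => //; exact: nneseries_lim_ge.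
rewrite muleAC -EFinM -ge0_muleDl ?lee_fin//; last by rewrite mulr_ge0.
by apply: lee_wpmul2r => //; rewrite lee_fin /Csob le_eqVlt; apply/orP; left; apply/eqP; ring.
Qed.

End sobolev.

(** * Measurability of continuous functions on R^n *)

Section continuous_measurable.
Context {R : realType} {n : nat}.
Local Notation Rn := 'rV[R]_n.

(** Rounding down to the grid of mesh 2^-k. The sigma-algebra is generated by the coordinates, so
    cubes are readily measurable; a function composed with [rnd k] is constant on each of countably
    many cubes, and converges pointwise when it is continuous. *)
Let rnd (k : nat) (x : Rn) : Rn := \row_j ((Num.floor (2 ^+ k * x ord0 j))%:~R / 2 ^+ k).

Let rnd_close k x j : `|(x - rnd k x) ord0 j| <= 2 ^- k.
Proof.
have p0 : 0 < 2 ^+ k :> R by exact: exprn_gt0.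
rewrite !mxE; set y := x ord0 j; have h1 := floor_le_tmp (2 ^+ k * y).
have h2 := floorD1_gt (2 ^+ k * y); rewrite intrD in h2.
set z := (Num.floor _)%:~R in h1 h2 *.
have e : y - z / 2 ^+ k = (2 ^+ k * y - z) / 2 ^+ k by field; rewrite gt_eqF.
rewrite e ger0_norm; last by apply: divr_ge0; [rewrite subr_ge0|exact: ltW].
rewrite ler_pdivrMr// mulVf ?gt_eqF//; rewrite /= in h2; lra.
Qed.

Let rnd_cvg x : rnd k x @[k --> \oo] --> x.
Proof.
apply/cvgrPdist_le => e e0.
have h : (2^-1 : R) ^+ k @[k --> \oo] --> (0 : R).
  by apply: cvg_expr; rewrite ger0_norm ?invr_ge0// invf_lt1// ltr1n.
near=> k; have hk : `|(2^-1 : R) ^+ k| <= e by near: k; exact: cvgr0_norm_le.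
rewrite exprVn in hk; rewrite /Num.norm /= mx_normrE; apply: bigmax_le => [|[i j] _]; first exact: ltW.
rewrite (ord1 i); apply: le_trans (rnd_close k x j) _; apply: le_trans hk; exact: ler_norm.
Unshelve. all: by end_near. Qed.

Let measurable_rnd (f : Rn -> R) k : measT (fun x => f (rnd k x)).
Proof.
have p0 : 0 < 2 ^+ k :> R by exact: exprn_gt0.
move=> _ Y mY; rewrite setTI.
pose cell (v : 'rV[int]_n) : set Rn := box (fun j => `[(v ord0 j)%:~R / 2 ^+ k, (v ord0 j + 1)%:~R / 2 ^+ k[%classic).
have mcell v : measurable (cell v) by apply: meas_box => j; exact: measurable_itv.
pose pt (v : 'rV[int]_n) : Rn := \row_j ((v ord0 j)%:~R / 2 ^+ k).
have cellE v x : cell v x -> rnd k x = pt v.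
  move=> h; apply/rowP => j; rewrite !mxE; congr (_%:~R / _).
  have := h j; rewrite /= in_itv /= => /andP[h1 h2]; apply: floor_def.
  by rewrite ler_pdivrMr// mulrC in h1; rewrite ltr_pdivlMr// mulrC in h2; rewrite h1.
have incell (x : Rn) : cell (\row_j Num.floor (2 ^+ k * x ord0 j)) x.
  move=> j; rewrite /= in_itv /= !mxE ler_pdivrMr// ltr_pdivlMr// mulrC floor_le_tmp /=.
  exact: floorD1_gt.
pose A (i : nat) : set Rn := if @unpickle 'rV[int]_n i is Some v then [set x | Y (f (pt v)) /\ cell v x] else set0.
have -> : (fun x => f (rnd k x)) @^-1` Y = \bigcup_i A i.
  apply/seteqP; split => x /=.
    move=> Yx; exists (pickle (\row_j Num.floor (2 ^+ k * x ord0 j) : 'rV[int]_n)) => //.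
    by rewrite /A pickleK /=; split; [rewrite -(cellE _ _ (incell x))|exact: incell].
  move=> [i _]; rewrite /A; case: unpickle => // v [h /cellE e].
  by rewrite e.
apply: bigcupT_measurable => i; rewrite /A; case: unpickle => // v.
have [h|h] := pselect (Y (f (pt v))).
  by have -> : [set x | Y (f (pt v)) /\ cell v x] = cell v by apply/seteqP; split => x // [].
by have -> : [set x | Y (f (pt v)) /\ cell v x] = set0 by apply/seteqP; split => x // [].
Qed.

Lemma cont_mrV (f : Rn -> R) : continuous f -> measT f.
Proof.
move=> cf; apply: (@measurable_fun_cvg _ _ _ setT (fun k x => f (rnd k x))).
  by move=> k; exact: measurable_rnd.
move=> x _; apply: (@cvg_comp _ _ _ (fun k => rnd k x) f \oo (nbhs x)); [exact: rnd_cvg|exact: cf].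
Qed.

End continuous_measurable.

Section finite_sums.
Context {R : realType} d (T : measurableType d) (mu : {measure set T -> \bar R}).

Lemma cint_sum n (F : 'I_n -> T -> R[i]) : (forall i, cintg mu (F i)) ->
  cint mu (fun x => \sum_(i < n) F i x) = \sum_(i < n) cint mu (F i).
Proof.
move=> iF; suff [] : cintg mu (fun x => \sum_(i < n) F i x) /\
  cint mu (fun x => \sum_(i < n) F i x) = \sum_(i < n) cint mu (F i) by [].
elim: n F iF => [|n IH] F iF.
  have E0 : (fun x => \sum_(i < 0) F i x) = (fun=> 0) by apply/funext => x; rewrite big_ord0.
  rewrite E0 big_ord0 cint0; split => //.
  by apply: (@cintg_real R _ T mu (fun=> 0)); exact: integrable0.
have [iS eS] := IH (fun i => F (lift ord0 i)) (fun i => iF _).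
have E : (fun x => \sum_(i < n.+1) F i x) = (fun x => F ord0 x + \sum_(i < n) F (lift ord0 i) x).
  by apply/funext => x; rewrite big_ord_recl.
by rewrite E; split; [exact: cintgD|rewrite cintD// eS big_ord_recl].
Qed.

Lemma normc_sum n (z : 'I_n -> R[i]) : normc (\sum_(i < n) z i) <= \sum_(i < n) normc (z i).
Proof.
elim: n z => [|n IH] z; first by rewrite !big_ord0 normc_real normr0.
rewrite !big_ord_recl; apply: le_trans (le_normcD _ _) _; by rewrite lerD2l.
Qed.

End finite_sums.

Lemma ge0_swap3 {R : realType} d1 d2 d3 (T1 : measurableType d1) (T2 : measurableType d2)
  (T3 : measurableType d3) (m1 : {sigma_finite_measure set T1 -> \bar R})
  (m2 : {sigma_finite_measure set T2 -> \bar R}) (m3 : {sigma_finite_measure set T3 -> \bar R})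
  (L : T1 -> T2 -> T3 -> \bar R) : measT (fun p : (T1 * T2) * T3 => L p.1.1 p.1.2 p.2) ->
  (forall x y z, 0 <= L x y z)%E ->
  (\int[m1]_x \int[m2]_y \int[m3]_z L x y z = \int[m3]_z \int[m1]_x \int[m2]_y L x y z)%E.
Proof.
move=> mL L0.
have mLx x : measT (fun p : T2 * T3 => L x p.1 p.2).
  exact (mcomp mL (mpair (mpair (mcst x) mfst) msnd)).
have e x : (\int[m2]_y \int[m3]_z L x y z = \int[m3]_z \int[m2]_y L x y z)%E.
  exact: (@ge0_swapE _ _ _ _ _ m2 m3 (fun y z => L x y z) (mLx x) (L0 x)).
under eqint do rewrite e.
have mL' : measT (fun p : (T1 * T3) * T2 => L p.1.1 p.2 p.1.2).
  exact (mcomp mL (mpair (mpair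
    (mcomp mfst mfst) msnd)
    (mcomp msnd mfst))).
have mI := @mintp _ _ _ (T1 * T3)%type T2 m2 (fun p y => L p.1 y p.2) mL' (fun p y => L0 p.1 y p.2).
exact: (@ge0_swapE _ _ _ _ _ m1 m3 (fun x z => \int[m2]_y L x y z)%E mI (fun x z => int_ge0 m2 (fun y => L0 x y z))).
Qed.

(** * The bilinear estimate for bounded data of bounded support *)

Section nice_functions.
Context {R : realType} {n : nat}.
Local Notation Rn := 'rV[R]_n.
Local Notation leb := (@lebesgue_measure R).
Local Notation Leb := (@lebesgue_rV R n).

Definition nice (M T : R) (f : R * Rn -> R[i]) : Prop :=
  [/\ cmeas f, forall z, normc (f z) <= M &
      forall z, ~ (`|z.1| <= T /\ inbox T z.2) -> f z = 0].

Definition pft (f : R * Rn -> R[i]) (z : R * Rn) : R[i] := FTn (-1) (fun x => f (z.1, x)) z.2.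

Variables (M T : R) (f : R * Rn -> R[i]) (nf : nice M T f).

Let mf : cmeas f. Proof. by have [] := nf. Qed.
Let fM z : normc (f z) <= M. Proof. by have [_ + _] := nf; apply. Qed.
Let f0 z : ~ (`|z.1| <= T /\ inbox T z.2) -> f z = 0. Proof. by have [_ _] := nf; apply. Qed.

Lemma nice_ge0 : 0 <= M. Proof. exact: le_trans (nc_ge0 _) (fM (0, 0)). Qed.

Lemma nice_cmeas t : cmeas (fun x => f (t, x)).
Proof. exact: (cmeas_comp mf (mpair1 t)). Qed.

Lemma nice_int t : (\int[Leb]_x (normc (f (t, x)))%:E <= (M * boxvol (n := n) T)%:E)%E.
Proof.
apply: (box_int_le (nice_cmeas t) (fun x => fM (t, x))) => x h.
by apply: f0 => -[_].
Qed.

Lemma nice_integrable t : cintg Leb (fun x => f (t, x)).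
Proof. by apply/cintgP; split; [exact: nice_cmeas|exact: le_lt_trans (nice_int t) (ltry _)]. Qed.

Lemma nice_sqr t : (\int[Leb]_x (sqn (f (t, x)))%:E < +oo)%E.
Proof.
have mn : measT (fun x => normc (f (t, x))) by exact: mnormc (nice_cmeas t).
apply: (@le_lt_trans _ _ (\int[Leb]_x (M * normc (f (t, x)))%:E)%E).
  apply: ge0_le_int.
  - exact: msqn (nice_cmeas t).
  - exact: mfunM.
  - by move=> x; exact: sqn_ge0.
  by move=> x; rewrite -normc_sqrE expr2; apply: ler_wpM2r; [exact: nc_ge0|exact: fM].
rewrite (ge0_intZl Leb nice_ge0 mn (fun x => nc_ge0 _)).
rewrite lte_mul_pinfty ?lee_fin ?nice_ge0//; exact: le_lt_trans (nice_int t) (ltry _).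
Qed.

Lemma cmeas_pft : cmeas (pft f).
Proof.
apply: (@cmeas_cint _ _ _ _ _ Leb (fun q : (R * Rn) * Rn => expi (phn (-1) (q.1.2, q.2)) * f (q.1.1, q.2))).
apply: cmeasM.
  apply: cmeas_expi; apply: (mcomp (meas_phn _)); apply: mpair => //.
  exact: (mcomp msnd mfst).
apply: (cmeas_comp mf); apply: mpair => //.
exact: (mcomp mfst mfst).
Qed.

Lemma pft_bound z : normc (pft f z) <= M * boxvol (n := n) T.
Proof.
rewrite -lee_fin; apply: le_trans (nice_int z.1).
have i1 := FT_integrable (meas_phn (-1)) z.2 (nice_integrable z.1).
apply: le_trans (le_normc_cint i1) _; apply: eq_leE; apply: eqint => x _.
by rewrite !normc_sqrt sqnM sqn_expi mul1r.
Qed.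

Lemma pft_out z : T < `|z.1| -> pft f z = 0.
Proof.
move=> h; rewrite /pft /FTn /FT -(@cint0 _ _ _ Leb); apply: eq_cint => x.
by rewrite f0 ?mulr0//= => -[h1 _]; move: h; rewrite ltNge h1.
Qed.

End nice_functions.

Section pairing_bound.
Context {R : realType} (n : nat) (m s : R) (hs : 2^-1 < s) (a am : 'rV[R]_n.+1 -> R).
Local Notation Rn := 'rV[R]_n.+1.
Local Notation leb := (@lebesgue_measure R).
Local Notation Leb := (@lebesgue_rV R n.+1).
Local Open Scope complex_scope.
Hypotheses (a_smooth : smooth_on setT a)
  (am_smooth : smooth_on [set xi : Rn | xi != 0] am)
  (am_homog : forall (lam : R) (xi : Rn), 0 < lam -> xi != 0 ->
     am (lam *: xi) = lam `^ m * am xi)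
  (a_grad : forall xi : Rn, gradient a xi != 0)
  (am_grad : forall xi : Rn, xi != 0 -> gradient am xi != 0)
  (a_am : forall al : @multi_index n.+1, exists Cal : R,
     forall xi : Rn, 1 <= enorm xi ->
       `|mi_deriv al (fun eta => a eta - am eta) xi|
         <= Cal * enorm xi `^ (m - 1 - (mi_size al)%:R)).

Lemma symbol_continuous : continuous a.
Proof. by move=> xi; have [] := a_smooth [::] (x := xi) I. Qed.

Let q := qsym m a.
Let B := @jp R n.+1 (m - 1).

Let mB : measT B. Proof. exact: cont_mrV (@jp_continuous R n.+1 (m - 1)). Qed.
Let ma : measT a. Proof. exact: cont_mrV symbol_continuous. Qed.
Let mq j : measT (q j).
Proof. by apply: cont_mrV; exact: qsym_continuous a_smooth _. Qed.

(** Up to a power of 2 pi, the L2 pairing of <D>^(m-1) exp(i (t - tau) a(D)) f(tau) with h(t),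
    computed on the Fourier side and truncated to frequencies of size [N]. *)
Definition pairing (N : R) (f h : R * Rn -> R[i]) (t tau : R) : R[i] :=
  cint Leb (fun xi => expi ((t - tau) * a xi) * pft f (tau, xi) * conjc (pft h (t, xi)) *
    (jp (m - 1) xi * kapN N xi)%:C).

Definition wL2 (f : R * Rn -> R[i]) : \bar R :=
  (\int[leb]_t \int[Leb]_x (japanese x `^ (2 * s) * sqn (f (t, x)))%:E)%E.

Lemma jp_inbox_bound (N : R) : 1 <= N -> exists2 D : R, 0 <= D & forall xi : Rn, inbox (2 * N) xi -> jp (m - 1) xi <= D.
Proof.
(* [K - 1] is at least 1 + |xi|^2 on the box, and therefore at least |xi|. *)
move=> N1; pose K : R := 2 + n.+1%:R * (2 * N) ^+ 2.
have K1 : 1 <= K.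
  have : 0 <= n.+1%:R * (2 * N) ^+ 2 by rewrite mulr_ge0 ?sqr_ge0.
  by rewrite /K; lra.
exists (K `^ `|m - 1|); first exact: powR_ge0.
move=> xi h; have e0 := enorm_ge0 xi; have h2 : enorm xi ^+ 2 <= n.+1%:R * (2 * N) ^+ 2.
  rewrite enorm_sqr /dotp; apply: (@le_trans _ _ (\sum_(j < n.+1) (2 * N) ^+ 2)).
    apply: ler_sum => j _; rewrite -expr2 -real_normK ?num_real//.
    by apply: lerXn2r; rewrite ?nnegrE ?h// (le_trans (normr_ge0 _) (h j)).
  by rewrite sumr_const card_ord -[leLHS]mulr_natl.
have [] := @powR_japanese_ball R n.+1 xi (m - 1) K K1 _ => //.
have : enorm xi <= 1 + enorm xi ^+ 2 by have := sqr_ge0 (enorm xi - 1); rewrite sqrrB1 => h3; lra.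
by rewrite /K => h3; lra.
Qed.

(** The constant does not depend on [N], nor on the bounds and supports of [f] and [h], which only
    make the integrals converge. On the piece [W j] the frequency integral is done along e_j first,
    where [line_bound] applies; the resulting norms are summed over the lines by [sobolev_N1]. *)
Lemma pairing_bound : exists2 C : R, 0 <= C & forall (N : R), 1 <= N -> forall f h Mf Tf Mh Th,
  nice Mf Tf f -> nice Mh Th h ->
  (\int[leb]_t \int[leb]_tau (normc (pairing N f h t tau))%:E <= C%:E * (wL2 f + wL2 h))%E.
Proof.
have [Cq Cq0 qb] := qsym_bound a_smooth am_smooth am_homog a_am.
have [Lq Lq0 ql] := qsym_lipschitz a_smooth am_smooth am_homog a_am.
have [c [c0 c1 qc]] := qsym_lower a_smooth am_smooth am_homog a_grad am_grad a_am.
pose K : R := 2 `^ `|m - 1|.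
have K1 : 1 <= K by rewrite -[leLHS](powRr0 2); apply: ler_powR; rewrite ?ler1n.
(* The Lipschitz constant of [cutw_kapN_lip] in dimension [n.+1]. *)
pose ell : R := n.+2%:R * (4 / c * Lq) + 2.
have ell0 : 0 <= ell.
  by apply: addr_ge0 => //; rewrite !mulr_ge0// invr_ge0 ltW.
have r2 := rho_gt2 hs; have r4 := rho_lt4 s.
(* [cutw j] is nonzero only where |q_j| >= c/2, so this value replaces [c] in the line estimate. *)
have c20 : 0 < c / 2 by lra. have c21 : c / 2 <= 1 by lra.
pose CL := Cline (rho s) (c / 2) Cq Lq K ell.
have CL0 : 0 <= CL by exact: Cline_ge0.
have Cs0 : 0 <= Csob (n := n) s.
  have := scales_ge0 hs; have := pi_ge0 R => h1 h2.
  by rewrite /Csob mulr_ge0 ?exprn_ge0 ?mulr_ge0// addr_ge0// !mulr_ge0.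
exists (n.+1%:R * (CL * Csob (n := n) s)); first by apply: mulr_ge0 => //; exact: mulr_ge0.
move=> N hN f h Mf Tf Mh Th nf nh.
have [D D0 hD] := jp_inbox_bound hN.
pose F := pft f; pose H := pft h.
have mF : cmeas F by exact: cmeas_pft nf.
have mH : cmeas H by exact: cmeas_pft nh.
pose MF := Num.max (Mf * boxvol (n := n.+1) Tf) (Mh * boxvol (n := n.+1) Th).
have FM z : normc (F z) <= MF by apply: le_trans (pft_bound nf z) _; rewrite le_max lexx.
have HM z : normc (H z) <= MF by apply: le_trans (pft_bound nh z) _; rewrite le_max lexx orbT.
have MF0 : 0 <= MF by exact: le_trans (nc_ge0 _) (FM (0, 0)).
pose W j xi := cutw q c j xi * kapN N xi.
have mW j : measT (W j).
  apply: mfunM; last exact: meas_kapN.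
  apply: mfunM; first exact: (mcomp (meas_ramp c) (mq j)).
  have -> : (fun xi => \prod_(i < n.+1 | (j < i)%N) (1 - ramp c (q i xi))) =
      (fun xi => \prod_(i < n.+1) (if (j < i)%N then 1 - ramp c (q i xi) else 1)).
    by apply/funext => xi; rewrite big_mkcond.
  apply: measurable_prod => i _; case: (j < i)%N; last exact: mcst.
  by apply: mfunB => //; exact: (mcomp (meas_ramp c) (mq i)).
have Wb j xi : `|W j xi| <= 1.
  have /andP[w0 w1] := cutw_in q c j xi; have /andP[k0 k1] := kapN_in hN xi.
  by rewrite /W ger0_norm; [exact: mulr_ile1|exact: mulr_ge0].
have W0 j xi : ~ inbox (2 * N) xi -> W j xi = 0.
  move=> hx; have [k hk] : exists k, 2 * N < `|xi ord0 k|.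
    apply: contrapT => /forallNP hn; apply: hx => k; rewrite leNgt; apply/negP; exact: hn.
  by rewrite /W (kapN0 hN (ltW hk)) mulr0.
have Wsum xi : \sum_j W j xi = kapN N xi by rewrite -mulr_suml (sum_cutw c0 qc) mul1r.
have BWb j xi : `|B xi * W j xi| <= D.
  have [hx|hx] := pselect (inbox (2 * N) xi); last by rewrite W0// mulr0 normr0.
  rewrite normrM -[leRHS]mulr1; apply: ler_pM => //.
  by rewrite ger0_norm ?hD// ltW// jp_gt0.
pose G j (t tau : R) (xi : Rn) : R[i] := expi ((t - tau) * a xi) * F (tau, xi) * conjc (H (t, xi)) * (B xi * W j xi)%:C.
have mG j d' (T : measurableType d') (t tau : T -> R) (xi : T -> Rn) : measT t ->
    measT tau -> measT xi -> cmeas (fun x => G j (t x) (tau x) (xi x)).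
  move=> mt mtau mxi; apply: cmeasM; last first.
    apply: cmeas_real; apply: mfunM; [exact: (mcomp mB mxi)|exact: (mcomp (mW j) mxi)].
  apply: cmeasM; last by apply: cmeas_conj; exact: (cmeas_comp mH (mpair mt mxi)).
  apply: cmeasM; last exact: (cmeas_comp mF (mpair mtau mxi)).
  apply: cmeas_expi; apply: mfunM; [exact: mfunB|exact: (mcomp ma mxi)].
have normM (x y : R[i]) : normc (x * y) = normc x * normc y.
  by rewrite !normc_sqrt sqnM sqrtrM// sqn_ge0.
have iG j t tau : cintg Leb (G j t tau).
  apply: (@box_cintg _ _ _ (1 * MF * MF * D) (2 * N)); first exact: mG.
    move=> xi; rewrite /G !normM normc_conj normc_expi normc_real.
    have n1 := nc_ge0 (F (tau, xi)); have n2 := nc_ge0 (H (t, xi)).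
    have b1 := FM (tau, xi); have b2 := HM (t, xi).
    by rewrite !mul1r; apply: ler_pM => //; [exact: mulr_ge0|exact: ler_pM].
  by move=> xi hx; rewrite /G W0// mulr0 mulr0.
have pE t tau : pairing N f h t tau = \sum_j cint Leb (G j t tau).
  rewrite -cint_sum//; apply: eq_cint => xi; rewrite /G -mulr_sumr; congr (_ * _).
  by rewrite -Wsum mulr_sumr rmorph_sum.
pose L j (y : 'rV[R]_n) (t tau : R) : R := normc (cint leb (fun r => G j t tau (ins j (r, y)))).
have L0 j y t tau : 0 <= L j y t tau by exact: nc_ge0.
have mL j : measT (fun p : (R * R) * 'rV[R]_n => L j p.2 p.1.1 p.1.2).
  apply: mnormc; apply: (@cmeas_cint _ _ _ _ _ leb (fun p : ((R * R) * 'rV[R]_n) * R => G j p.1.1.1 p.1.1.2 (ins j (p.2, p.1.2)))).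
  have m1 : measT (fun p : ((R * R) * 'rV[R]_n) * R => p.1.1).
    exact: (mcomp mfst mfst).
  apply: mG; [exact: (mcomp mfst m1)|exact: (mcomp msnd m1)|].
  apply: (mcomp (meas_ins j)); apply: mpair => //.
  exact: (mcomp msnd mfst).
have Gle j t tau : ((normc (cint Leb (G j t tau)))%:E <= \int[lebesgue_rV n]_y (L j y t tau)%:E)%E.
  rewrite (cint_rV j (iG j t tau)); apply: le_normc_cint_meas.
  apply: (@cmeas_cint _ _ _ _ _ leb (fun p : 'rV[R]_n * R => G j t tau (ins j (p.2, p.1)))).
  apply: mG => //; apply: (mcomp (meas_ins j)); exact: mpair.
have mNrm j : measT (fun p : R * R => normc (cint Leb (G j p.1 p.2))).
  apply: mnormc; apply: (@cmeas_cint _ _ _ _ _ Leb (fun p : (R * R) * Rn => G j p.1.1 p.1.2 p.2)).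
  by apply: mG => //; [exact: (mcomp mfst mfst)|exact: (mcomp msnd mfst)].
have wF0 : (0 <= wL2 f)%E.
  by apply: int_ge0 => t; apply: int_ge0 => x; rewrite lee_fin mulr_ge0 ?powR_ge0 ?sqn_ge0.
have wH0 : (0 <= wL2 h)%E.
  by apply: int_ge0 => t; apply: int_ge0 => x; rewrite lee_fin mulr_ge0 ?powR_ge0 ?sqn_ge0.
have sob (g : R * Rn -> R[i]) Mg Tg j : nice Mg Tg g ->
    (\int[lebesgue_rV n]_y \int[leb]_t N1 (rho s) (fun r => pft g (t, ins j (r, y))) <= (Csob (n := n) s)%:E * wL2 g)%E.
  move=> ng; have mg : cmeas g by case: ng.
  have mpg : cmeas (fun p : (R * 'rV[R]_n) * R => pft g (p.1.1, ins j (p.2, p.1.2))).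
    apply: (cmeas_comp (cmeas_pft ng)); apply: mpair.
      exact: (mcomp mfst mfst).
    apply: (mcomp (meas_ins j)); apply: mpair => //.
    exact: (mcomp msnd mfst).
  have mN := meas_N1 r2 mpg.
  have N0 t y : (0 <= N1 (rho s) (fun r => pft g (t, ins j (r, y))))%E by exact: N1_ge0.
  rewrite -(@ge0_swapE _ _ _ _ _ leb (lebesgue_rV n) (fun t y => N1 (rho s) (fun r => pft g (t, ins j (r, y)))) mN N0).
  have mw : measT (fun z : R * Rn => (japanese z.2 `^ (2 * s) * sqn (g z))%:E).
    apply/mEFin; apply: mfunM; last exact: msqn.
    exact: (mcomp (meas_japanese _) msnd).
  have w0 t x : (0 <= (japanese x `^ (2 * s) * sqn (g (t, x)))%:E)%E.
    by rewrite lee_fin mulr_ge0 ?powR_ge0 ?sqn_ge0.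
  have mwx : measT (fun t => \int[Leb]_x (japanese x `^ (2 * s) * sqn (g (t, x)))%:E)%E.
    by apply: (@mintp _ _ _ _ _ Leb (fun t x => (japanese x `^ (2 * s) * sqn (g (t, x)))%:E) _ w0);
      move: mw; apply: eq_measurable_fun => -[].
  rewrite -(ge0_intZlE leb Cs0 mwx (fun t => int_ge0 Leb (w0 t))).
  apply: ge0_le_intE.
  - exact: (@mintp _ _ _ _ _ (lebesgue_rV n) (fun t y => N1 (rho s) (fun r => pft g (t, ins j (r, y)))) mN N0).
  - exact: mfuneM.
  - by move=> t; apply: int_ge0 => y; exact: N0.
  move=> t; exact: (@sobolev_N1 R n s hs (-1) (or_intror erefl) (fun x => g (t, x)) (nice_integrable ng t) (nice_sqr ng t) j).
have line j y : (\int[leb]_t \int[leb]_tau (L j y t tau)%:E <=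
    CL%:E * (\int[leb]_t N1 (rho s) (fun r => F (t, ins j (r, y))) + \int[leb]_t N1 (rho s) (fun r => H (t, ins j (r, y)))))%E.
  pose x0 := ins j (0, y).
  have xE r : ins j (r, y) = x0 + r *: evec j by rewrite /x0 -ins_add add0r.
  have cline : continuous (fun r : R => x0 + r *: evec j).
    by move=> r; apply: cvgD; [exact: cvg_cst|apply: cvgZr_tmp; exact: cvg_id].
  have ccomp (g : Rn -> R) : continuous g -> continuous (fun r : R => g (ins j (r, y))).
    move=> cg; have -> : (fun r : R => g (ins j (r, y))) = g \o (fun r => x0 + r *: evec j).
      by apply/funext => r; rewrite /= xE.
    by move=> r; apply: continuous_comp; [exact: cline|exact: cg].
  have mi : measT (fun r : R => ins j (r, y)).
    exact: (mcomp (meas_ins j) (mpair2 y)).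
  have mi2 : measT (fun z : R * R => (z.1, ins j (z.2, y))).
    by apply: mpair => //; exact: (mcomp mi msnd).
  apply: (@line_bound R (rho s) (c / 2) Cq Lq K ell r2 r4 c20 c21 Cq0 Lq0 K1 ell0
    (fun r => a (ins j (r, y))) (fun r => q j (ins j (r, y))) (fun r => B (ins j (r, y)))
    (fun r => W j (ins j (r, y))) (fun z => F (z.1, ins j (z.2, y))) (fun z => H (z.1, ins j (z.2, y))) MF (2 * N)) => //.
  - move=> r; rewrite xE (_ : (fun r0 : R => a (ins j (r0, y))) = (fun r0 => a (x0 + r0 *: evec j))).
      exact: is_derive_symbol.
    by apply/funext => r0; rewrite xE.
  - by apply: ccomp; exact: qsym_continuous a_smooth j.
  - by apply: ccomp; exact: jp_continuous.
  - by move=> r; exact: jp_gt0.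
  - by move=> r1 r3; rewrite !xE; exact: ql.
  - move=> r1 r3 r13; rewrite !xE.
    rewrite (_ : x0 + r1 *: evec j = x0 + r3 *: evec j + (r1 - r3) *: evec j); first exact: jp_slow.
    by rewrite -addrA -scalerDl (addrC r3) subrK.
  - by move=> r1 r3; rewrite !xE; exact: (cutw_kapN_lip c0 Lq0 hN ql).
  - exact: (mcomp (mW j) mi).
  - move=> r; rewrite /W mulf_eq0 negb_or => /andP[h1 _]; exact: cutw_neq0 h1.
  - move=> r hr; apply: W0 => /(_ j); rewrite insE /= leNgt; by rewrite hr.
  - exact: (cmeas_comp mF mi2).
  - exact: (cmeas_comp mH mi2).
have perj j : (\int[leb]_t \int[leb]_tau (normc (cint Leb (G j t tau)))%:E <= (CL * Csob (n := n) s)%:E * (wL2 f + wL2 h))%E.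
  have mLE : measT (fun p : (R * R) * 'rV[R]_n => (L j p.2 p.1.1 p.1.2)%:E) by exact/mEFin.
  have LE0 t tau y : (0 <= (L j y t tau)%:E)%E by rewrite lee_fin.
  have mLy := @mintp _ _ _ _ _ (lebesgue_rV n) (fun (p : R * R) y => (L j y p.1 p.2)%:E) mLE (fun p y => LE0 p.1 p.2 y).
  apply: (@le_trans _ _ (\int[leb]_t \int[leb]_tau \int[lebesgue_rV n]_y (L j y t tau)%:E)%E).
    apply: ge0_le_intE.
    - exact (@mintp _ _ _ _ _ leb (fun t tau => (normc (cint Leb (G j t tau)))%:E)
        ((mEFin _ _).2 (mNrm j)) (fun t tau => nc_ge0 (cint Leb (G j t tau)))).
    - exact: (@mintp _ _ _ _ _ leb (fun t tau => \int[lebesgue_rV n]_y (L j y t tau)%:E)%E mLy (fun t tau => int_ge0 (lebesgue_rV n) (LE0 t tau))).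
    - by move=> t; apply: int_ge0 => tau; rewrite lee_fin nc_ge0.
    move=> t; apply: ge0_le_intE.
    - by apply/mEFin; exact: (mcomp (mNrm j) (mpair1 t)).
    - exact: (mcomp mLy (mpair1 t)).
    - by move=> tau; rewrite lee_fin nc_ge0.
    by move=> tau; exact: Gle.
  rewrite (@ge0_swap3 _ _ _ _ _ _ _ leb leb (lebesgue_rV n) (fun t tau y => (L j y t tau)%:E) mLE LE0).
  have mNg (g : R * Rn -> R[i]) : cmeas g -> measT (fun y => \int[leb]_t N1 (rho s) (fun r => g (t, ins j (r, y))))%E.
    move=> mg; have mpg : cmeas (fun p : ('rV[R]_n * R) * R => g (p.1.2, ins j (p.2, p.1.1))).
      apply: (cmeas_comp mg); apply: mpair.
        exact: (mcomp msnd mfst).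
      apply: (mcomp (meas_ins j)); apply: mpair => //.
      exact: (mcomp mfst mfst).
    apply: (@mintp _ _ _ _ _ leb (fun y t => N1 (rho s) (fun r => g (t, ins j (r, y))))).
      exact: (meas_N1 r2 mpg).
    by move=> *; exact: N1_ge0.
  have NF0 (g : R * Rn -> R[i]) y : (0 <= \int[leb]_t N1 (rho s) (fun r => g (t, ins j (r, y))))%E.
    by apply: int_ge0 => t; exact: N1_ge0.
  apply: (@le_trans _ _ (\int[lebesgue_rV n]_y (CL%:E * (\int[leb]_t N1 (rho s) (fun r => F (t, ins j (r, y))) + \int[leb]_t N1 (rho s) (fun r => H (t, ins j (r, y))))))%E).
    apply: ge0_le_intE.
    - have mL2 : measT (fun p : ('rV[R]_n * R) * R => (L j p.1.1 p.1.2 p.2)%:E).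
        exact (mcomp mLE (mpair (mpair
          (mcomp msnd mfst) msnd) (mcomp mfst mfst))).
      have mL3 := @mintp _ _ _ ('rV[R]_n * R)%type _ leb (fun p tau => (L j p.1 p.2 tau)%:E) mL2 (fun p tau => LE0 p.2 tau p.1).
      exact: (@mintp _ _ _ _ _ leb (fun y t => \int[leb]_tau (L j y t tau)%:E)%E mL3 (fun y t => int_ge0 leb (fun tau => LE0 t tau y))).
    - apply: mfuneM; exact (emeasurable_funD (mNg F mF) (mNg H mH)).
    - by move=> y; apply: int_ge0 => t; apply: int_ge0 => tau; exact: LE0.
    exact: line.
  rewrite (ge0_intZlE (lebesgue_rV n) CL0 (emeasurable_funD (mNg F mF) (mNg H mH)) (fun y => adde_ge0 (NF0 F y) (NF0 H y))).
  rewrite (ge0_intDE (lebesgue_rV n) (mNg F mF) (mNg H mH) (NF0 F) (NF0 H)).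
  rewrite [(_ * Csob _)%:E]EFinM -[leRHS]muleA; apply: lee_wpmul2l; first by rewrite lee_fin.
  rewrite ge0_muleDr//; apply: leeD; [exact: sob nf|exact: sob nh].
have nGE j t tau : (0 <= (normc (cint Leb (G j t tau)))%:E)%E by rewrite lee_fin nc_ge0.
have mGt j := @mintp _ _ _ _ _ leb (fun t tau => (normc (cint Leb (G j t tau)))%:E)
   ((mEFin _ _).2 (mNrm j)) (nGE j).
apply: (@le_trans _ _ (\sum_j \int[leb]_t \int[leb]_tau (normc (cint Leb (G j t tau)))%:E)%E).
  rewrite -ge0_integral_sum//; last by move=> j t _; apply: int_ge0 => tau; exact: nGE.
  have mp : measT (fun p : R * R => normc (pairing N f h p.1 p.2)).
    have -> : (fun p : R * R => normc (pairing N f h p.1 p.2)) = (fun p => normc (\sum_j cint Leb (G j p.1 p.2))).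
      by apply/funext => p; rewrite pE.
    apply: mnormc.
    have mc j : cmeas (fun p : R * R => cint Leb (G j p.1 p.2)).
      apply: (@cmeas_cint _ _ _ _ _ Leb (fun p : (R * R) * Rn => G j p.1.1 p.1.2 p.2)).
      by apply: mG => //; [exact: (mcomp mfst mfst)|exact: (mcomp msnd mfst)].
    split.
      under eq_fun do rewrite raddf_sum; by apply: measurable_sum => j; have [] := mc j.
    under eq_fun do rewrite raddf_sum; by apply: measurable_sum => j; have [] := mc j.
  apply: ge0_le_intE.
  - exact (@mintp _ _ _ _ _ leb (fun t tau => (normc (pairing N f h t tau))%:E)
      ((mEFin _ _).2 mp) (fun t tau => nc_ge0 (pairing N f h t tau))).
  - by apply: emeasurable_sum => j; exact: mGt.
  - by move=> t; apply: int_ge0 => tau; rewrite lee_fin nc_ge0.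
  move=> t; rewrite -ge0_integral_sum//; last first.
    by move=> j; apply/mEFin; exact: (mcomp (mNrm j) (mpair1 t)).
  apply: ge0_le_intE.
  - apply/mEFin; exact: (mcomp mp (mpair1 t)).
  - apply: emeasurable_sum => j; apply/mEFin; exact: (mcomp (mNrm j) (mpair1 t)).
  - by move=> tau; rewrite lee_fin nc_ge0.
  move=> tau; rewrite pE sumEFin lee_fin; exact: normc_sum.
apply: (@le_trans _ _ (\sum_(j < n.+1) ((CL * Csob (n := n) s)%:E * (wL2 f + wL2 h)))%E).
  by apply: lee_sum => j _; exact: perj.
rewrite -ge0_sume_distrl; last by move=> j _; rewrite lee_fin mulr_ge0.
apply: lee_wpmul2r; first exact: adde_ge0.
by rewrite sumEFin lee_fin sumr_const card_ord -[leLHS]mulr_natl.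
Qed.

End pairing_bound.

Lemma is_derive_Rintegral {R : realType} d (T : measurableType d) (mu : {measure set T -> \bar R})
  (f f' : R -> T -> R) (G : T -> R) (s : R) :
  (forall t, mu.-integrable setT (EFin \o f t)) ->
  (forall (t : R) y, is_derive t 1 (f ^~ y) (f' t y)) ->
  mu.-integrable setT (EFin \o G) -> (forall t y, `|t - s| < 1 -> `|f' t y| <= G y) ->
  is_derive s 1 (fun t => \int[mu]_y f t y) (\int[mu]_y f' s y).
Proof.
move=> if_ df iG fG.
have Is : `]s - 1, s + 1[%classic s by rewrite /= in_itv /=; apply/andP; split; lra.
have pE t y : partial1of2 f t y = f' t y by exact: der_val (df t y).
have G0 y : 0 <= G y by apply: le_trans (normr_ge0 _) (fG s y _); rewrite subrr normr0.
have df1 t y : `]s - 1, s + 1[%classic t -> setT y -> derivable (f ^~ y) t 1.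
  by move=> _ _; exact: der_derivable (df t y).
have ub t y : `]s - 1, s + 1[%classic t -> setT y -> `|partial1of2 f t y| <= G y.
  rewrite /= in_itv /= => /andP[h1 h2] _; rewrite pE; apply: fG; rewrite ltr_norml; apply/andP; split; lra.
have h1 := derivable_under_integral measurableT Is (fun t _ => if_ t) df1 G0 iG ub.
have h2 := differentiation_under_integral measurableT Is (fun t _ => if_ t) df1 G0 iG ub.
apply: DeriveDef => //; rewrite derive1E in h2; rewrite h2.
by congr fine; apply: eqint => y _; rewrite pE.
Qed.

(** * A class of test functions *)

Section rapid_decay.
Context {R : realType} {n : nat}.
Local Notation Rn := 'rV[R]_n.
Local Notation Leb := (@lebesgue_rV R n).
Implicit Types (u v : Rn -> R) (j l : 'I_n) (x y : Rn).

Definition rap u : Prop := measT u /\ forall p : R, exists C, forall x, jp p x * `|u x| <= C.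

Definition ddir j u u' : Prop :=
  forall x (s : R), is_derive s 1 (fun t : R => u (x + t *: evec j)) (u' (x + s *: evec j)).

(** Iterated derivatives in one direction at a time, all rapidly decreasing. They give decay of the
    transform in each coordinate, hence in <x>; and the class is preserved by the transform, by the
    coordinates and by all real powers of <x>. *)
Fixpoint dN j k u : Prop :=
  rap u /\ if k is k'.+1 then exists2 u', ddir j u u' & dN j k' u' else True.

Definition rapid_smooth u : Prop := forall j k, dN j k u.

Lemma jpD (p r : R) x : jp (p + r) x = jp p x * jp r x.
Proof. by rewrite /jp powRD//; apply/implyP => _; rewrite gt_eqF//; exact: japanese_gt0. Qed.

Lemma jp_le (p r : R) x : p <= r -> jp p x <= jp r x.
Proof. by move=> pr; apply: ler_powR => //; exact: japanese_ge1. Qed.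

Lemma coord_le_jp x l : `|x ord0 l| <= jp 1 x.
Proof.
rewrite /jp powRr1; last exact: ltW (japanese_gt0 x).
apply: le_trans (coord_le_enorm _ _) _; exact: enorm_le_japanese.
Qed.

Lemma rap_bound u (p : R) : rap u -> exists2 C, 0 <= C & forall x, `|u x| <= C * jp (- p) x.
Proof.
move=> [_ /(_ p)[C hC]]; have C0 : 0 <= C.
  by apply: le_trans (hC 0); apply: mulr_ge0 => //; apply: ltW; exact: jp_gt0.
exists C => // x; have e : jp p x * jp (- p) x = 1 by rewrite -jpD subrr /jp powRr0.
rewrite -[leLHS]mul1r -e mulrAC; apply: ler_wpM2r => //; apply: ltW; exact: jp_gt0.
Qed.

Lemma rapD u v : rap u -> rap v -> rap (fun x => u x + v x).
Proof.
move=> [mu hu] [mv hv]; split; first exact: mfunD.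
move=> p; have [C hC] := hu p; have [D hD] := hv p; exists (C + D) => x.
apply: le_trans (lerD (hC x) (hD x)); rewrite -mulrDr; apply: ler_wpM2l; last exact: ler_normD.
by apply: ltW; exact: jp_gt0.
Qed.

Lemma rapM (c : Rn -> R) (K r : R) u : measT c -> 0 <= K ->
  (forall x, `|c x| <= K * jp r x) -> rap u -> rap (fun x => c x * u x).
Proof.
move=> mc K0 hc [mu hu]; split; first exact: mfunM.
move=> p; have [C hC] := hu (r + p); exists (K * C) => x.
apply: le_trans (_ : K * (jp (r + p) x * `|u x|) <= _); last by apply: ler_wpM2l => //; exact: hC.
rewrite jpD normrM mulrCA (_ : K * _ = (K * jp r x) * (jp p x * `|u x|)); last by ring.
apply: ler_wpM2r; last exact: hc.
by apply: mulr_ge0 => //; apply: ltW; exact: jp_gt0.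
Qed.

Lemma rap_jp r u : rap u -> rap (fun x => jp r x * u x).
Proof.
apply: (rapM (K := 1) (r := r)) => //; first exact: meas_japanese.
by move=> x; rewrite mul1r ger0_norm// ltW// jp_gt0.
Qed.

Lemma rap_coord l u : rap u -> rap (fun x => x ord0 l * u x).
Proof.
apply: (rapM (K := 1) (r := 1)) => //; first exact: mcoord.
by move=> x; rewrite mul1r; exact: coord_le_jp.
Qed.

Lemma dN_rap j k u : dN j k u -> rap u. Proof. by case: k => [|k] []. Qed.

Lemma dNS j k u : dN j k.+1 u -> dN j k u.
Proof.
elim: k u => [|k IH] u [ru [u' du /= hu]]; first by split.
by split => //; exists u' => //; exact: IH.
Qed.

Lemma dND j k u v : dN j k u -> dN j k v -> dN j k (fun x => u x + v x).
Proof.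
elim: k u v => [|k IH] u v [ru hu] [rv hv]; (split; first exact: rapD) => //.
have [u' du u'k] := hu; have [v' dv v'k] := hv; exists (fun x => u' x + v' x); last exact: IH.
by move=> x s; exact: (derD (du x s) (dv x s)).
Qed.

Lemma dNZ j k (c : R) u : dN j k u -> dN j k (fun x => c * u x).
Proof.
have rc v : rap v -> rap (fun x => c * v x).
  apply: (rapM (K := `|c|) (r := 0)) => // x; by rewrite /jp powRr0 mulr1.
elim: k u => [|k IH] u [ru hu]; (split; first exact: rc) => //.
have [u' du u'k] := hu; exists (fun x => c * u' x); last exact: IH.
move=> x s; apply: (der_eq (derM (der_cst c s) (du x s))); ring.
Qed.

Lemma coord_line x l j (s : R) : (x + s *: evec j) ord0 l = x ord0 l + s * (l == j)%:R.
Proof. by rewrite !mxE. Qed.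

Lemma dN_coord j k l u : dN j k u -> dN j k (fun x => x ord0 l * u x).
Proof.
elim: k u => [|k IH] u [ru hu]; (split; first exact: rap_coord) => //.
have [u' du u'k] := hu; exists (fun x => x ord0 l * u' x + (l == j)%:R * u x).
  move=> x s.
  have dl : is_derive s 1 (fun t : R => (x + t *: evec j) ord0 l) (l == j)%:R.
    have -> : (fun t : R => (x + t *: evec j) ord0 l) = (fun t => x ord0 l + t * (l == j)%:R).
      by apply/funext => t; rewrite coord_line.
    by eapply der_eq; [by der|ring].
  by apply: (der_eq (derM dl (du x s))); ring.
apply: dND; first exact: IH.
by apply: dNZ; apply: dNS; split => //; exists u'.
Qed.

Lemma dN_jp j k (r : R) u : dN j k u -> dN j k (fun x => jp r x * u x).
Proof.
elim: k r u => [|k IH] r u [ru hu]; (split; first exact: rap_jp) => //.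
have [u' du u'k] := hu; exists (fun x => jp r x * u' x + r * (x ord0 j * (jp (r - 2) x * u x))).
  move=> x s; apply: (der_eq (derM (is_derive_jp r x j s) (du x s))).
  have e : jp (r - 2) (x + s *: evec j) = jp r (x + s *: evec j) / japanese (x + s *: evec j) ^+ 2.
    by rewrite jpD /jp powRN -(powR_mulrn 2) ?ltW ?japanese_gt0.
  by rewrite e /jp; ring.
have uk : dN j k u by apply: dNS; split => //; exists u'.
by apply: dND; [exact: IH|apply: dNZ; apply: dN_coord; exact: IH].
Qed.

Lemma rapid_smoothD u v : rapid_smooth u -> rapid_smooth v -> rapid_smooth (fun x => u x + v x).
Proof. by move=> hu hv j k; exact: dND. Qed.

Lemma rapid_smoothZ (c : R) u : rapid_smooth u -> rapid_smooth (fun x => c * u x).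
Proof. by move=> hu j k; exact: dNZ. Qed.

Lemma rapid_smooth_jp (r : R) u : rapid_smooth u -> rapid_smooth (fun x => jp r x * u x).
Proof. by move=> hu j k; exact: dN_jp. Qed.

Lemma rapid_smooth_coord l u : rapid_smooth u -> rapid_smooth (fun x => x ord0 l * u x).
Proof. by move=> hu j k; exact: dN_coord. Qed.

Let prodw x : R := \prod_(j < n) (1 + x ord0 j ^+ 2)^-1.

Let jp_prodw x : jp (- (n%:R * 2)) x <= prodw x.
Proof.
have J0 := japanese_gt0 x; rewrite /jp powRN mulrC powRrM powR_mulrn ?powR_ge0// (powR_mulrn 2 (ltW J0)).
rewrite -exprVn -[X in _ ^+ X](card_ord n) -prodr_const /prodw; apply: ler_prod => j _.
rewrite invr_ge0 exprn_ge0 ?(ltW J0)//= lef_pV2 ?posrE ?exprn_gt0//; last by have := sqr_ge0 (x ord0 j); lra.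
by rewrite japanese_sqr lerD2l; exact: coord_le_dotp.
Qed.

(** (1 + |x|^2)^-n is at most the product of the (1 + x_j^2)^-1, whose integral factors into
    one-dimensional ones. *)
Lemma jp_integrable : Leb.-integrable setT (EFin \o jp (- (n%:R * 2))).
Proof.
have m1 : measT (fun r : R => (1 + r ^+ 2)^-1).
  by apply: contm; apply: (@der_continuous _ _ _) => x; der; have := sqr_ge0 x; lra.
have p0 (r : R) : 0 <= (1 + r ^+ 2)^-1 by rewrite invr_ge0; have := sqr_ge0 r; lra.
apply/integrableP; split; first by apply/mEFin; exact: meas_japanese.
apply: (@le_lt_trans _ _ (\int[Leb]_x (prodw x)%:E)%E).
  under eqint do rewrite /= ger0_norm ?powR_ge0//.
  apply: ge0_le_int.
  - exact: meas_japanese.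
  - by apply: measurable_prod => j _; exact: (mcomp m1 (mcoord j)).
  - by move=> x; apply: ltW; exact: jp_gt0.
  exact: jp_prodw.
rewrite (ge0_integral_prod (p := fun=> fun r => (1 + r ^+ 2)^-1))//.
have e : (\int[lebesgue_measure]_r ((1 + r ^+ 2)^-1)%:E = (pi : R)%:E)%E.
  have := int_Qk (ltr01 : 0 < (1 : R)).
  have -> : (\int[lebesgue_measure]_x (Qk 1 x)%:E = \int[lebesgue_measure]_x (2 * (1 + x ^+ 2)^-1)%:E :> \bar R)%E.
    by apply: eqint => r _; rewrite /Qk expr1n mulr1.
  rewrite (ge0_intZl lebesgue_measure _ m1 p0) ?ler0n// EFinM => /(congr1 (fun z => 2^-1%:E * z)%E).
  by rewrite !muleA -EFinM mulVf// !mul1e.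
by under eq_bigr do rewrite e; rewrite -(big_morph EFin (@EFinM R) erefl) ltry.
Qed.

Lemma rap_integrable u : rap u -> Leb.-integrable setT (EFin \o u).
Proof.
move=> ru; have [C C0 hC] := rap_bound (n%:R * 2) ru; have [mu _] := ru.
apply: (le_integrable _ _ _ (integrableZl _ C jp_integrable)) => //; first exact/mEFin.
move=> x _; rewrite /= lee_fin; apply: le_trans (hC x) _; exact: ler_norm.
Qed.

Lemma rap_sqr u : rap u -> rap (fun x => u x ^+ 2).
Proof.
move=> ru; have [C C0 hC] := rap_bound 0 ru; have [mu _] := ru.
have -> : (fun x => u x ^+ 2) = (fun x => u x * u x) by apply/funext => x; rewrite expr2.
by apply: (rapM (K := C) (r := 0)) => // x; have := hC x; rewrite oppr0.
Qed.

End rapid_decay.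

(** * Fourier transforms of rapidly decreasing functions *)

Section fourier_rapid.
Context {R : realType} {n : nat}.
Local Notation Rn := 'rV[R]_n.
Local Notation Leb := (@lebesgue_rV R n).
Implicit Types (u v : Rn -> R) (j l : 'I_n) (x y : Rn) (th : R).

(** A cosine transform with a phase: [th = 0] and [th = - pi / 2] give the cosine and sine parts,
    and differentiation in [x] shifts [th] by [pi / 2]. One real family is thus closed under the
    operations used. *)
Definition ctr th u x : R := \int[Leb]_y (cos (dotp x y + th) * u y).

Let measurable_cosR : measT (@cos R).
Proof. exact: contm (@continuous_cos R). Qed.

Let mcos x th : measT (fun y : Rn => cos (dotp x y + th)).
Proof.
apply: (mcomp measurable_cosR); apply: mfunD => //.
exact: (mcomp meas_dotp2 (mpair1 x)).
Qed.

Let cos1 (z : R) : `|cos z| <= 1. Proof. by rewrite ler_norml cos_geN1 cos_le1. Qed.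

Lemma ctr_integrable x th u : Leb.-integrable setT (EFin \o u) ->
  Leb.-integrable setT (EFin \o (fun y => cos (dotp x y + th) * u y)).
Proof.
move=> iu; have mu : measT u by apply/mEFin; exact: measurable_int iu.
apply: (le_integrable _ _ _ iu) => //.
  by apply/mEFin; apply: mfunM => //; exact: mcos.
by move=> y _; rewrite /= lee_fin normrM ler_piMl.
Qed.

Lemma meas_ctr th u : measT u -> measT (ctr th u).
Proof.
move=> mu; apply: (@meas_Rintegral_param _ _ _ _ _ Leb (fun z : Rn * Rn => cos (dotp z.1 z.2 + th) * u z.2)).
apply: mfunM; last exact: (mcomp mu msnd).
apply: (mcomp measurable_cosR); apply: mfunD => //.
exact: meas_dotp2.
Qed.

Lemma ctr_bound th u : Leb.-integrable setT (EFin \o u) ->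
  forall x, `|ctr th u x| <= \int[Leb]_y `|u y|.
Proof.
move=> iu x; apply: le_trans (le_normr_Rintegral measurableT (ctr_integrable x th iu)) _.
apply: le_Rintegral => //.
- exact: (integrable_norm (ctr_integrable x th iu)).
- exact: (integrable_norm iu).
by move=> y _; rewrite normrM ler_piMl.
Qed.

Let dotp_linel x y j (t : R) : dotp (x + t *: evec j) y = dotp x y + t * y ord0 j.
Proof.
rewrite /dotp (eq_bigr (fun k => x ord0 k * y ord0 k + t * ((k == j)%:R * y ord0 k))); last first.
  by move=> k _; rewrite coord_line; ring.
rewrite big_split /= -mulr_sumr; congr (_ + _ * _); rewrite (bigD1 j)//= eqxx mul1r big1 ?addr0// => k kj.
by rewrite (negbTE kj) mul0r.
Qed.

Lemma ctr_ddir th u j : rap u ->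
  ddir j (ctr th u) (ctr (th + pi / 2) (fun y => y ord0 j * u y)).
Proof.
move=> ru x s; have iu := rap_integrable ru; have iju := rap_integrable (rap_coord j ru).
have := @is_derive_Rintegral R _ _ Leb (fun t y => cos (dotp (x + t *: evec j) y + th) * u y)
  (fun t y => cos (dotp (x + t *: evec j) y + (th + pi / 2)) * (y ord0 j * u y))
  (fun y => `|y ord0 j * u y|) s; apply.
- by move=> t; exact: ctr_integrable.
- move=> t y.
  have -> : (fun t : R => cos (dotp (x + t *: evec j) y + th) * u y) = (fun t => cos (dotp x y + t * y ord0 j + th) * u y).
    by apply/funext => r; rewrite dotp_linel.
  eapply der_eq; first by der.
  by rewrite dotp_linel [X in cos X * (_ * _)]addrA cosDpihalf; ring.
- exact: (integrable_norm iju).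
- by move=> t y _; rewrite normrM ler_piMl.
Qed.

Let measurable_translate d (T : measurableType d) (v : Rn -> T) j (s : R) :
  measT v -> measT (fun y : Rn => v (y + s *: evec j)).
Proof.
move=> mv; apply: (mcomp mv); apply: measurable_fun_rV => i.
rewrite (_ : _ \o _ = (fun y : Rn => y ord0 i + s * (i == j)%:R)); last first.
  by apply/funext => y; rewrite /rV_coord /= coord_line.
by apply: mfunD => //; exact: mcoord.
Qed.

Lemma ge0_integral_translate (f : Rn -> \bar R) j (s : R) : measT f ->
  (forall x, 0 <= f x)%E -> (\int[Leb]_y f (y + s *: evec j)%R = \int[Leb]_y f y)%E.
Proof.
move=> mf f0; have mfs := measurable_translate j s mf; case: n j f mf f0 mfs => [[]//|n'] j f mf f0 mfs.
rewrite (ge0_integral_rV j mfs (fun z => f0 _)) (ge0_integral_rV j mf f0); apply: eqint => y _.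
rewrite -(ge0_integral_shift s (f := fun r => f (ins j (r, y))))//.
  by apply: eqint => r _; rewrite ins_add.
exact: (mcomp mf (mcomp (meas_ins j) (mpair2 y))).
Qed.

Lemma Rintegral_translate u j (s : R) : Leb.-integrable setT (EFin \o u) ->
  Leb.-integrable setT (EFin \o (fun y => u (y + s *: evec j))) /\
  \int[Leb]_y u (y + s *: evec j) = \int[Leb]_y u y.
Proof.
move=> iu; have /integrableP[mEu fu] := iu; split.
  apply/integrableP; split; first exact: (measurable_translate j s mEu).
  rewrite (ge0_integral_translate (f := fun y => `|(u y)%:E|%E) j s)//.
  by apply: mcomp => //; exact: measurable_abse.
have ep := ge0_integral_translate j s (measurable_funepos mEu) (fun x => funepos_ge0 (EFin \o u) x).
have en := ge0_integral_translate j s (measurable_funeneg mEu) (fun x => funeneg_ge0 (EFin \o u) x).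
have ep' : (\int[Leb]_y (fun y => (u (y + s *: evec j)%R)%:E)^\+ y = \int[Leb]_y (EFin \o u)^\+ y)%E.
  by rewrite -ep; apply: eqint => y _; rewrite !funeposE.
have en' : (\int[Leb]_y (fun y => (u (y + s *: evec j)%R)%:E)^\- y = \int[Leb]_y (EFin \o u)^\- y)%E.
  by rewrite -en; apply: eqint => y _; rewrite !funenegE.
by rewrite /Rintegral [in LHS]integralE ep' en' -integralE.
Qed.

(* The integral of [u (x + s e_j)] does not depend on [s]: differentiate it at [s = 0]. *)
Lemma Rintegral_ddir u u' j : rap u -> rap u' -> ddir j u u' -> \int[Leb]_y u' y = 0.
Proof.
move=> ru ru' du; have iu := rap_integrable ru; have [C C0 hC] := rap_bound (n%:R * 2) ru'.
have itr t := (Rintegral_translate j t iu).1.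
have h := @is_derive_Rintegral R _ _ Leb (fun t y => u (y + t *: evec j)) (fun t y => u' (y + t *: evec j))
  (fun y => C * 2 `^ `|- (n%:R * 2)| * jp (- (n%:R * 2)) y) 0 itr (fun t y => du y t).
have {}h : is_derive (0 : R) 1 (fun t => \int[Leb]_y u (y + t *: evec j)) (\int[Leb]_y u' (y + 0 *: evec j)).
  apply: h; first exact: (integrableZl _ _ jp_integrable).
  move=> t y; rewrite subr0 => /ltW t1; apply: le_trans (hC _) _; rewrite -mulrA; apply: ler_wpM2l => //.
  exact: jp_slow.
have e : (fun t => \int[Leb]_y u (y + t *: evec j)) = (fun=> \int[Leb]_y u y).
  by apply/funext => t; exact: (Rintegral_translate j t iu).2.
rewrite e in h; have := der_val h; have := der_val (der_cst (\int[Leb]_y u y) 0) => -> /esym.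
by under eq_Rintegral do rewrite scale0r addr0.
Qed.

(** Integration by parts: the derivative along e_l of cos(<x, y> + th - pi/2) u(y) has integral 0
    and contains x_l cos(<x, y> + th) u(y). Each derivative of [u] thus yields one power of x_l. *)
Lemma ctr_decay l k th u : dN l k u ->
  exists C, forall x, `|x ord0 l| ^+ k * `|ctr th u x| <= C.
Proof.
elim: k th u => [|k IH] th u h.
  by exists (\int[Leb]_y `|u y|) => x; rewrite mul1r; apply: ctr_bound; exact: rap_integrable (dN_rap h).
have [ru [u' du hu']] := h; have ru' := dN_rap hu'.
have [C hC] := IH (th - pi / 2) u' hu'; exists C => x.
suff E : x ord0 l * ctr th u x = - ctr (th - pi / 2) u' x.
  by apply: le_trans (hC x); rewrite exprSr -mulrA -normrM E normrN.
have mc t : measT (fun y : Rn => cos (dotp x y + t)) by exact: mcos.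
have rc t v : rap v -> rap (fun y => cos (dotp x y + t) * v y).
  by apply: (rapM (K := 1) (r := 0)) => // y; rewrite /jp powRr0 mulr1.
pose w y := cos (dotp x y + (th - pi / 2)) * u y.
pose w' y := x ord0 l * (cos (dotp x y + th) * u y) + cos (dotp x y + (th - pi / 2)) * u' y.
have rw' : rap w'.
  apply: rapD; last exact: rc.
  apply: (rapM (K := `|x ord0 l|) (r := 0)) => //; last exact: rc.
  by move=> y; rewrite /jp powRr0 mulr1.
have dw : ddir l w w'.
  move=> y s.
  have dc : is_derive s 1 (fun t : R => cos (dotp x (y + t *: evec l) + (th - pi / 2))) (x ord0 l * cos (dotp x (y + s *: evec l) + th)).
    have -> : (fun t : R => cos (dotp x (y + t *: evec l) + (th - pi / 2))) = (fun t => cos (dotp y x + t * x ord0 l + (th - pi / 2))).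
      by apply/funext => t; rewrite dotpC dotp_linel.
    eapply der_eq; first by der.
    have -> : dotp x (y + s *: evec l) + th = (dotp y x + s * x ord0 l + (th - pi / 2)) + pi / 2.
      by rewrite dotpC dotp_linel; ring.
    by rewrite cosDpihalf; ring.
  by apply: (der_eq (derM dc (du y s))); rewrite /w'; ring.
have := Rintegral_ddir (rc _ _ ru) rw' dw.
have i1 := rap_integrable (rc th _ ru).
rewrite /w' RintegralD//; last 2 first.
- exact: (integrableZl _ _ i1).
- exact: rap_integrable (rc _ _ ru').
by rewrite RintegralZl// => /eqP; rewrite addr_eq0 => /eqP.
Qed.

End fourier_rapid.

Section rapid_transform.
Context {R : realType} {n : nat}.
Local Notation Rn := 'rV[R]_n.
Local Notation Leb := (@lebesgue_rV R n).
Implicit Types (u v : Rn -> R) (j l : 'I_n) (x y : Rn) (th : R).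

(** If <x>^2 > n + 1 and all coordinates were smaller than <x> / (n + 1), summing their squares
    would give |x|^2 <= n, a contradiction. *)
Let japanese_coord x : japanese x <= n.+1%:R \/ exists l, japanese x <= n.+1%:R * `|x ord0 l|.
Proof.
have K1 : 1 <= n.+1%:R :> R by rewrite ler1n.
have [h|h] := leP (japanese x ^+ 2) n.+1%:R.
  left; rewrite -(@ler_pXn2r _ 2)// ?nnegrE ?(ltW (japanese_gt0 x))//; apply: le_trans h _.
  by rewrite expr2 ler_peMr.
right; apply: contrapT => /forallNP hn.
have hl l : n.+1%:R * x ord0 l ^+ 2 <= japanese x ^+ 2.
  have /negP := hn l; rewrite -ltNge => /ltW hh.
  apply: (@le_trans _ _ ((n.+1%:R * `|x ord0 l|) ^+ 2)).
    rewrite exprMn real_normK ?num_real//; apply: ler_wpM2r; first exact: sqr_ge0.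
    by rewrite expr2 ler_peMr.
  by rewrite ler_pXn2r// nnegrE ?(ltW (japanese_gt0 x))// mulr_ge0.
have : \sum_(l < n) n.+1%:R * x ord0 l ^+ 2 <= \sum_(l < n) japanese x ^+ 2 by apply: ler_sum => l _.
rewrite -mulr_sumr sumr_const card_ord -[X in _ <= X]mulr_natl => hs.
have e : dotp x x = \sum_(l < n) x ord0 l ^+ 2 by apply: eq_bigr => l _; rewrite expr2.
rewrite -e in hs; have := japanese_sqr x; set J := japanese x ^+ 2 in h hs * => J2.
have nS : n.+1%:R = n%:R + 1 :> R by rewrite natr1.
by have n0 : 0 <= n%:R :> R by []; rewrite nS in h hs; rewrite J2 in h hs; nra.
Qed.

Lemma rap_of_coord v : measT v -> (exists C, forall x, `|v x| <= C) ->
  (forall l (M : nat), exists C, forall x, `|x ord0 l| ^+ M * `|v x| <= C) -> rap v.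
Proof.
move=> mv [C0 hC0] hv; split => // p; pose M := Num.bound `|p|.
have pM : p <= M%:R by apply: le_trans (ler_norm p) _; apply: ltW; exact: archi_boundP.
have [C hC] := choice (fun l => hv l M).
have C00 : 0 <= C0 by exact: le_trans (hC0 0).
have Cl0 l : 0 <= C l by apply: le_trans (hC l 0); apply: mulr_ge0 => //; exact: exprn_ge0.
have S0 : 0 <= \sum_l C l by exact: sumr_ge0.
have K0 : 0 <= n.+1%:R ^+ M :> R by exact: exprn_ge0.
exists (n.+1%:R ^+ M * (C0 + \sum_l C l)) => x.
apply: (@le_trans _ _ (japanese x ^+ M * `|v x|)).
  apply: ler_wpM2r => //; apply: le_trans (jp_le x pM) _.
  by rewrite /jp powR_mulrn// ltW// japanese_gt0.
have J0 := ltW (japanese_gt0 x).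
have [h|[l h]] := japanese_coord x.
  apply: ler_pM => //; first exact: exprn_ge0.
    by rewrite lerXn2r// nnegrE.
  by apply: le_trans (hC0 x) _; rewrite lerDl.
apply: (@le_trans _ _ (n.+1%:R ^+ M * (`|x ord0 l| ^+ M * `|v x|))).
  rewrite mulrA -exprMn; apply: ler_wpM2r => //.
  by rewrite lerXn2r// nnegrE// mulr_ge0.
apply: ler_wpM2l => //; apply: le_trans (hC l x) _.
rewrite (bigD1 l)//= addrCA lerDl addr_ge0//; exact: sumr_ge0.
Qed.

Lemma rap_ctr th u : rapid_smooth u -> rap u -> rap (ctr th u).
Proof.
move=> su ru; apply: rap_of_coord.
- by apply: meas_ctr; case: ru.
- by exists (\int[Leb]_y `|u y|); apply: ctr_bound; exact: rap_integrable.
- by move=> l M; exact: ctr_decay (su l M).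
Qed.

Lemma rapid_smooth_ctr th u : rapid_smooth u -> rapid_smooth (ctr th u).
Proof.
move=> su j k; elim: k th u su => [|k IH] th u su; (split; first exact: rap_ctr (dN_rap (su j 0%N))) => //.
exists (ctr (th + pi / 2) (fun y => y ord0 j * u y)); first exact: ctr_ddir (dN_rap (su j 0%N)).
by apply: IH; exact: rapid_smooth_coord.
Qed.

Let mi_one (N : nat) j : @multi_index n := [ffun k => if k == j then N else 0%N].

Let mi_one_deriv (N : nat) j u : mi_deriv (mi_one N j) u = pderivs (nseq N j) u.
Proof.
rewrite /mi_deriv; congr pderivs.
have H (s : seq 'I_n) : uniq s -> flatten [seq nseq (mi_one N j k) k | k <- s] = if j \in s then nseq N j else [::].
  elim: s => //= k s IH /andP[ks us]; rewrite IH// ffunE in_cons eq_sym.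
  case: eqVneq => [->|kj] //=; rewrite (negbTE ks); by rewrite cats0.
by rewrite H ?enum_uniq// mem_enum.
Qed.

Let mi_one_monomial (N : nat) l x : monomial (mi_one N l) x = x ord0 l ^+ N.
Proof.
rewrite /monomial (bigD1 l)//= ffunE eqxx big1 ?mulr1// => k kl.
by rewrite ffunE (negbTE kl) expr0.
Qed.

Lemma rschwartz_rapid u : rschwartz u -> rapid_smooth u.
Proof.
move=> [su hu] j k; rewrite -[u]/(pderivs (nseq 0 j) u); move: 0%N => N.
have rN (N' : nat) : rap (pderivs (nseq N' j) u).
  apply: rap_of_coord.
  - by apply: cont_mrV => x; have [] := su (nseq N' j) x I.
  - have [C hC] := hu (mi_one 0 j) (mi_one N' j); exists C => x.
    by have := hC x; rewrite mi_one_deriv mi_one_monomial expr0 mul1r.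
  - move=> l M; have [C hC] := hu (mi_one M l) (mi_one N' j); exists C => x.
    by have := hC x; rewrite mi_one_deriv mi_one_monomial normrM normrX.
elim: k N => [|k IH] N; (split; first exact: rN) => //.
exists (pderivs (nseq N.+1 j) u); last exact: IH.
by move=> x s; apply: is_derive_line; have [_] := su (nseq N j) (x + s *: evec j) I; apply.
Qed.

Definition rapidc (w : Rn -> R[i]) : Prop :=
  rapid_smooth (fun x => cRe (w x)) /\ rapid_smooth (fun x => cIm (w x)).

Lemma rapidc_jp (r : R) w : rapidc w -> rapidc (fun x => (jp r x)%:C%C * w x).
Proof.
move=> [h1 h2]; split.
  under eq_fun do rewrite cReM /= mul0r subr0; exact: rapid_smooth_jp.
under eq_fun do rewrite cImM /= mul0r addr0; exact: rapid_smooth_jp.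
Qed.

Lemma rapidcZ (c : R) w : rapidc w -> rapidc (fun x => c%:C%C * w x).
Proof.
move=> [h1 h2]; split.
  under eq_fun do rewrite cReM /= mul0r subr0; exact: rapid_smoothZ.
under eq_fun do rewrite cImM /= mul0r addr0; exact: rapid_smoothZ.
Qed.

End rapid_transform.

Section rapid_complex.
Context {R : realType} {n : nat}.
Local Notation Rn := 'rV[R]_n.+1.
Local Notation Leb := (@lebesgue_rV R n.+1).
Implicit Types (w : Rn -> R[i]).

Lemma rapid_smooth_rap (u : Rn -> R) : rapid_smooth u -> rap u.
Proof. by move=> /(_ ord0 0%N) /dN_rap. Qed.

Lemma rapidc_integrable w : rapidc w -> cintg Leb w.
Proof. by move=> [h1 h2]; split; apply: rap_integrable; exact: rapid_smooth_rap. Qed.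

Lemma rapidc_bounded w : rapidc w -> exists D, forall x, normc (w x) <= D.
Proof.
move=> [/rapid_smooth_rap h1 /rapid_smooth_rap h2].
have [C1 C10 hC1] := rap_bound 0 h1; have [C2 C20 hC2] := rap_bound 0 h2; exists (C1 + C2) => x.
apply: le_trans (normc_ReIm _) _.
by apply: lerD; [have := hC1 x|have := hC2 x]; rewrite oppr0 /jp powRr0 mulr1.
Qed.

Lemma rapidc_weight_sqr (p : R) w : rapidc w -> (\int[Leb]_x (jp p x * sqn (w x))%:E < +oo)%E.
Proof.
move=> [h1 h2]; have r1 := rap_jp p (rap_sqr (rapid_smooth_rap h1)).
have r2 := rap_jp p (rap_sqr (rapid_smooth_rap h2)).
have /integrableP[m1] := rap_integrable (rapD r1 r2); apply: le_lt_trans.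
apply: eq_leE; apply: eqint => x _; rewrite /= ger0_norm ?mulrDr//.
by rewrite addr_ge0// mulr_ge0 ?sqr_ge0// ltW// jp_gt0.
Qed.

Lemma rapidc_FTn (sg : R) w : sg = 1 \/ sg = -1 -> rapidc w -> rapidc (FTn sg w).
Proof.
move=> sg1 hw; have [h1 h2] := hw; have iw := rapidc_integrable hw.
have cE (z : R) : cos (sg * z) = cos (z + 0) by case: sg1 => ->; rewrite ?mul1r ?mulN1r ?cosN addr0.
have sE (z : R) : sin (sg * z) = sg * cos (z + (- (pi / 2))).
  by rewrite cosBpihalf; case: sg1 => ->; rewrite ?mul1r ?mulN1r ?sinN.
have ic th (u : Rn -> R) x : rapid_smooth u -> Leb.-integrable setT (EFin \o (fun y => cos (dotp x y + th) * u y)).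
  by move=> su; apply: ctr_integrable; apply: rap_integrable; exact: rapid_smooth_rap.
pose P := fun x => cRe (w x); pose Q := fun x => cIm (w x).
split.
  have -> : (fun x => cRe (FTn sg w x)) = (fun x => ctr 0 P x + (- sg) * ctr (- (pi / 2)) Q x).
    apply/funext => x; rewrite /FTn /FT Re_cint /ctr -RintegralZl//; last exact: ic.
    rewrite -RintegralD//; [|exact: ic|exact: (integrableZl _ _ (ic _ _ _ h2))].
    by apply: eq_Rintegral => y _; rewrite cReM /= /phn /= dotpC cE sE -/(P y) -/(Q y); ring.
  by apply: rapid_smoothD; [|apply: rapid_smoothZ]; exact: rapid_smooth_ctr.
have -> : (fun x => cIm (FTn sg w x)) = (fun x => ctr 0 Q x + sg * ctr (- (pi / 2)) P x).
  apply/funext => x; rewrite /FTn /FT /cint /cintegral /= /ctr -RintegralZl//; last exact: ic.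
  rewrite -RintegralD//; [|exact: ic|exact: (integrableZl _ _ (ic _ _ _ h1))].
  by apply: eq_Rintegral => y _; rewrite cImM /= /phn /= dotpC cE sE -/(P y) -/(Q y); ring.
by apply: rapid_smoothD; [|apply: rapid_smoothZ]; exact: rapid_smooth_ctr.
Qed.

(** The path from [x] to [y] changes one coordinate at a time, and along each segment the derivative
    is bounded. *)
Lemma rapidc_lipschitz w : rapidc w ->
  exists2 L : R, 0 <= L & forall x y, normc (w y - w x) <= L * \sum_j `|y ord0 j - x ord0 j|.
Proof.
move=> [h1 h2].
have lip (u : Rn -> R) : rapid_smooth u -> exists2 L : R, 0 <= L & forall x y, `|u y - u x| <= L * \sum_j `|y ord0 j - x ord0 j|.
  move=> su; have hj j : exists L, forall x (s : R), `|u (x + s *: evec j) - u x| <= L * `|s|.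
    have [ru [u' du hu']] := su j 1%N; have [C C0 hC] := rap_bound 0 hu'.1.
    exists C => x s; have := lipschitz_derive (du x) (L := C) _ s 0; rewrite scale0r addr0 subr0; apply => t.
    by have := hC (x + t *: evec j); rewrite oppr0 /jp powRr0 mulr1.
  have [L hL] := choice hj; have L0 j : 0 <= L j.
    by have := hL j 0 1; rewrite normr1 mulr1; apply: le_trans.
  exists (\sum_j L j); first exact: sumr_ge0.
  have key (s : seq 'I_n.+1) (c : 'I_n.+1 -> R) x : `|u (x + \sum_(j <- s) c j *: evec j) - u x| <= (\sum_j L j) * \sum_(j <- s) `|c j|.
    elim: s x => [|j s IH] x; first by rewrite !big_nil addr0 subrr normr0 mulr0.
    rewrite !big_cons addrA mulrDr (_ : _ - u x = (u (x + c j *: evec j) - u x) + (u (x + c j *: evec j + \sum_(k <- s) c k *: evec k) - u (x + c j *: evec j))); last by ring.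
    apply: le_trans (ler_normD _ _) _; apply: lerD => //; apply: le_trans (hL j x (c j)) _.
    by apply: ler_wpM2r => //; rewrite (bigD1 j)//= lerDl; exact: sumr_ge0.
  move=> x y; have := key (index_enum _) (fun j => y ord0 j - x ord0 j) x.
  suff -> : x + \sum_j (y ord0 j - x ord0 j) *: evec j = y by [].
  rewrite (_ : \sum_j _ = y - x); first by rewrite addrC subrK.
  by rewrite [RHS]row_sum_delta; apply: eq_bigr => j _; rewrite !mxE.
have [L1 L10 hL1] := lip _ h1; have [L2 L20 hL2] := lip _ h2.
exists (L1 + L2); first exact: addr_ge0.
move=> x y; apply: le_trans (normc_ReIm _) _; rewrite mulrDl !cReD !cImD cReN cImN.
exact: lerD.
Qed.

End rapid_complex.

Lemma dominated_small {R : realType} d (T : measurableType d) (mu : {measure set T -> \bar R})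
  (f : nat -> T -> R) (g : T -> R) (eps : R) : 0 < eps ->
  (forall k, measT (f k)) -> (forall k x, 0 <= f k x <= g x) ->
  measT g -> (\int[mu]_x (g x)%:E < +oo)%E -> (forall x, f k x @[k --> \oo] --> (0 : R)) ->
  exists K, forall k, (K <= k)%N -> (\int[mu]_x (f k x)%:E <= eps%:E)%E.
Proof.
move=> e0 mf fg mg ig f0.
have g0 x : 0 <= g x by have /andP[h1 h2] := fg 0%N x; exact: le_trans h2.
have iG : mu.-integrable setT (EFin \o g).
  apply/integrableP; split; first exact/mEFin.
  by under eqint do rewrite /= ger0_norm//.
have fc x : (f k x)%:E @[k --> \oo] --> (0%:E : \bar R).
  by apply: cvg_EFin; [exact: nearW|exact: f0].
have fb x (k : nat) : setT x -> (`|(f k x)%:E| <= (EFin \o g) x)%E.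
  by move=> _; have /andP[h1 h2] := fg k x; rewrite /= lee_fin ger0_norm.
have [_ _] := @dominated_convergence _ _ _ mu setT measurableT (fun k x => (f k x)%:E) (fun=> 0%:E) (EFin \o g)
  (fun k => (mEFin _ _).2 (mf k)) (mcst _) (aeW _ (fun x _ => fc x)) iG (aeW _ fb).
rewrite integral0 => /fine_cvgP[nf /cvgr0_norm_lt/(_ _ e0) nl].
have [K _ hK] := filterI nf nl; exists K => k /hK[/= fk]; rewrite -{2}(fineK fk) lee_fin => h.
by apply: le_trans (ltW h); exact: ler_norm.
Qed.

(** * Fourier inversion *)

Section inversion.
Context {R : realType} {n : nat}.
Local Notation Rn := 'rV[R]_n.+1.
Local Notation Leb := (@lebesgue_rV R n.+1).
Local Notation leb := (@lebesgue_measure R).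
Local Open Scope complex_scope.

Let pi0 : 0 < 2 * pi :> R. Proof. by rewrite mulr_gt0// pi_gt0. Qed.

Lemma int_coord_Pn (e : R) (x : Rn) j : 0 < e ->
  (\int[Leb]_y (`|y ord0 j - x ord0 j| * Pn e x y)%:E <= (e * (2 * pi) ^+ n.+1)%:E)%E.
Proof.
move=> e0; pose p k (r : R) := (if k == j then `|r - x ord0 j| else 1) * Pk e (r - x ord0 k).
have mp k : measT (p k).
  apply: mfunM; last by apply: (mcomp (meas_Pk e0)); exact: mfunB.
  case: eqP => _ //; apply: mcomp => //; exact: mfunB.
have p0 k r : 0 <= p k r by apply: mulr_ge0; [case: eqP|exact: Pk_ge0].
have E (y : Rn) : `|y ord0 j - x ord0 j| * Pn e x y = \prod_k p k (y ord0 k).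
  rewrite /p big_split /= (bigD1 j)//= eqxx big1 ?mulr1; last by move=> k /negbTE ->.
  by congr (_ * _); rewrite PnC.
under eqint do rewrite E.
rewrite ge0_integral_prod// (bigD1 j)//= exprS mulrCA mulrC -mulrA.
have i1 k : k != j -> (\int[leb]_r (p k r)%:E = (2 * pi)%:E)%E.
  move=> /negbTE kj; rewrite -(int_Pk1 (x ord0 k) e0); apply: eqint => r _.
  by rewrite /p kj mul1r.
rewrite (eq_bigr (fun=> (2 * pi)%:E)) => [|k kj]; last exact: i1.
have -> : (\prod_(i < n.+1 | i != j) (2 * pi)%:E = ((2 * pi) ^+ n)%:E :> \bar R)%E.
  rewrite -(big_morph EFin (@EFinM R) erefl) prodr_const cardC1 card_ord //.
have i2 : (\int[leb]_r (p j r)%:E <= (e * (2 * pi))%:E)%E.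
  have mQ : measT (fun r : R => Qk e (r - x ord0 j)).
    by apply: (mcomp (meas_Qk e0)); exact: mfunB.
  have Q0 r : 0 <= Qk e (r - x ord0 j) by exact: Qk_ge0.
  apply: (@le_trans _ _ (\int[leb]_r (e * Qk e (r - x ord0 j))%:E)%E).
    apply: ge0_le_int; [exact: mp|exact: mfunM|exact: p0|].
    by move=> r; rewrite /p eqxx; exact: Pk_abs.
  rewrite (ge0_intZl leb (ltW e0) mQ Q0) EFinM; apply: lee_wpmul2l; first by rewrite lee_fin ltW.
  apply: eq_leE; rewrite -(int_Qk e0).
  exact: (ge0_integral_shift (- x ord0 j) (f := fun r => (Qk e r)%:E)) ((mEFin _ _).2 (meas_Qk e0)) (fun r => Qk_ge0 r e0).
apply: (@le_trans _ _ ((e * (2 * pi))%:E * ((2 * pi) ^+ n)%:E)%E).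
  by apply: lee_wpmul2r => //; rewrite lee_fin exprn_ge0// ltW.
by apply: eq_leE; rewrite -EFinM; congr (_%:E); ring.
Qed.

Section w.
Variable w : Rn -> R[i].
Hypothesis hw : rapidc w.
Let F := FTn (-1) w.

Let iw : cintg Leb w. Proof. exact: rapidc_integrable. Qed.
Let iF : cintg Leb F. Proof. by apply: rapidc_integrable; apply: rapidc_FTn => //; right. Qed.

Let A i x := cint Leb (fun X => expi (phn 1 (x, X)) * F X * (En (e_ i) X)%:C).

(** The cutoff [En] makes the double integral absolutely convergent; after Fubini's theorem the
    frequency integral is the product kernel [Pn]. *)
Let AE i x : A i x = cint Leb (fun y => w y * (Pn (e_ i) x y)%:C).
Proof.
pose H (z : Rn * Rn) : R[i] := (expi (phn 1 (z.1, x) - phn 1 (z.1, z.2))) * (((En (e_ i) z.1)%:C) * w z.2).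
have mH1 : cmeas (fun z : Rn * Rn => expi (phn 1 (z.1, x) - phn 1 (z.1, z.2))).
  apply: cmeas_expi; apply: mfunB; last by exact: (mcomp (meas_phn 1) (mpair mfst msnd)).
  exact: (mcomp (meas_phn 1) (mpair mfst (mcst x))).
have iE : cintg Leb (fun X => (En (e_ i) X)%:C) by apply: cintg_real; exact: En_integrable (e_gt0 i).
have iH : cintg (Leb \x Leb)%E H.
  apply: (cintgM (C := 1) mH1); first by move=> z; rewrite normc_expi.
  exact (cintg_mulX iE iw).
have iFT X := FT_integrable (meas_phn (-1)) X iw.
transitivity (cint Leb (fun X => cint Leb (fun y => H (X, y)))).
  apply: eq_cint => X; rewrite /F /FTn /FT -cintZl// -cintZr; last exact: cintgZl.
  apply: eq_cint => y; rewrite /H /= expiD -[phn 1 (x, X)]/(1 * dotp X x) (_ : phn 1 (X, x) = 1 * dotp X x).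
    by rewrite (_ : - phn 1 (X, y) = phn (-1) (X, y)); [ring|rewrite /phn /= mul1r mulN1r].
  by rewrite /phn /= dotpC.
rewrite (cint_Fubini iH); apply: eq_cint => y; rewrite /H /=.
rewrite -(FT_En (or_introl erefl) x y (e_gt0 i)) -cintZl; last first.
  apply: (cintgM (C := 1)) => //; last by move=> z; rewrite normc_expi.
  apply: cmeas_expi; apply: mfunB; first exact: (mcomp (meas_phn 1) (mpair2 x)).
  exact: (mcomp (meas_phn 1) (mpair2 y)).
by apply: eq_cint => X; ring.
Qed.

(** [Pn (e_ i)] is an approximate identity of mass [(2 * pi) ^+ n.+1] and width [e_ i]. A Lipschitz
    function is reproduced with an error given by the first moments of the kernel, bounded in
    [int_coord_Pn]. *)
Let near_w : exists2 L : R, 0 <= L & forall i x, normc (A i x - ((2 * pi) ^+ n.+1)%:C * w x) <= L * e_ i.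
Proof.
have [L L0 hL] := rapidc_lipschitz hw.
exists (L * (n.+1%:R * (2 * pi) ^+ n.+1)); first by rewrite !mulr_ge0// exprn_ge0// ltW.
move=> i x; have e0 := e_gt0 (R := R) i; rewrite AE.
have mP : measT (fun y => Pn (e_ i) x y) by exact: (mcomp (meas_Pn e0) (mpair1 x)).
have iP : Leb.-integrable setT (EFin \o (fun y => Pn (e_ i) x y)).
  apply/integrableP; split; first exact/mEFin.
  by under eqint do rewrite /= ger0_norm ?Pn_ge0//; rewrite int_Pn// ltry.
have iPc : cintg Leb (fun y => (Pn (e_ i) x y)%:C) by exact: cintg_real.
have [D hD] := rapidc_bounded hw.
have -> : ((2 * pi) ^+ n.+1)%:C = cint Leb (fun y => (Pn (e_ i) x y)%:C).
  by rewrite cint_real /Rintegral int_Pn.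
rewrite mulrC -cintZl// -cintB//; last 2 first.
- exact: cintgM (cintg_meas iw) hD iPc.
- exact: cintgZl.
rewrite -lee_fin; apply: le_trans (le_normc_cint_meas _ _) _.
  apply: cmeasB; [apply: cmeasM; [exact: cintg_meas iw|exact: cmeas_real]|exact: cintg_meas (cintgZl _ iPc)].
have mc j : measT (fun y : Rn => `|y ord0 j - x ord0 j| * Pn (e_ i) x y).
  apply: mfunM => //; apply: mcomp => //; apply: mfunB => //; exact: mcoord.
have c0 j (y : Rn) : 0 <= `|y ord0 j - x ord0 j| * Pn (e_ i) x y by apply: mulr_ge0 => //; exact: Pn_ge0.
apply: (@le_trans _ _ (\int[Leb]_y (L * \sum_j `|y ord0 j - x ord0 j| * Pn (e_ i) x y)%:E)%E).
  apply: ge0_le_int.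
  - apply: mnormc; apply: cmeasB; [apply: cmeasM; [exact: cintg_meas iw|exact: cmeas_real]|exact: cintg_meas (cintgZl _ iPc)].
  - by apply: mfunM => //; exact: measurable_sum.
  - by move=> y; exact: nc_ge0.
  move=> y; rewrite -mulrBl Normc.normcM normc_real ger0_norm ?Pn_ge0//.
  by rewrite -mulr_suml mulrA; apply: ler_wpM2r; [exact: Pn_ge0|exact: hL].
rewrite (ge0_intZl Leb L0); [|exact: measurable_sum|by move=> y; exact: sumr_ge0].
rewrite -mulrA EFinM; apply: lee_wpmul2l; first by rewrite lee_fin.
under eqint do rewrite -sumEFin.
rewrite ge0_integral_sum//; [|by move=> j; exact/mEFin|by move=> j y _; rewrite lee_fin].
apply: (@le_trans _ _ (\sum_(j < n.+1) (e_ i * (2 * pi) ^+ n.+1)%:E)%E).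
  by apply: lee_sum => j _; exact: int_coord_Pn.
by apply: eq_leE; rewrite sumEFin sumr_const card_ord -mulr_natl; congr (_%:E); ring.
Qed.

(** [A i x] tends to the left side by dominated convergence as the cutoff is removed, and to the
    right side by [near_w]. *)
Lemma fourier_inversion x : FTn 1 F x = ((2 * pi) ^+ n.+1)%:C * w x.
Proof.
have [L L0 hL] := near_w.
suff H (eps : R) : 0 < eps -> normc (FTn 1 F x - ((2 * pi) ^+ n.+1)%:C * w x) <= eps * (1 + L).
  apply/eqP; rewrite -subr_eq0; apply/eqP; set D := _ - _ in H *.
  apply/Normc.eq0_normc; apply/eqP; rewrite eq_le nc_ge0 andbT leNgt; apply/negP => D0.
  have L1 : 0 < 2 * (1 + L) by lra.
  have := H (normc D / (2 * (1 + L))) (divr_gt0 D0 L1).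
  have -> : normc D / (2 * (1 + L)) * (1 + L) = normc D / 2 by field; rewrite gt_eqF; lra.
  by lra.
move=> e0; have mF := cintg_meas iF.
have mE i : measT (fun X : Rn => 1 - En (e_ i) X).
  by apply: mfunB => //; exact: meas_En.
have E01 i (X : Rn) : 0 <= 1 - En (e_ i) X <= 1.
  by rewrite subr_ge0 En_le1 ?e_gt0//= gerBl En_ge0 ?e_gt0.
have Ec (X : Rn) : normc (F X) * (1 - En (e_ i) X) @[i --> \oo] --> (0 : R).
  have h1 : (1 - En (e_ i) X) @[i --> \oo] --> ((1 : R) - 1) by apply: cvgB; [exact: cvg_cst|exact: En_lim].
  have h2 : normc (F X) * (1 - En (e_ i) X) @[i --> \oo] --> (normc (F X) * (1 - 1) : R).
    by apply: cvgM => //; exact: cvg_cst.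
  by rewrite subrr mulr0 in h2.
have FE i (X : Rn) : 0 <= normc (F X) * (1 - En (e_ i) X) <= normc (F X).
  have /andP[h1 h2] := E01 i X; have n0 := nc_ge0 (F X).
  by rewrite mulr_ge0//= ler_piMr.
have [K hK] := @dominated_small R _ _ Leb (fun i X => normc (F X) * (1 - En (e_ i) X)) (fun X => normc (F X)) eps e0
  (fun i => mfunM (mnormc mF) (mE i))
  FE (mnormc mF) ((cintgP _ _).1 iF).2 Ec.
have ec : (e_ i : R) @[i --> \oo] --> (0 : R).
  by apply: cvg_expr; rewrite ger0_norm ?invr_ge0// invf_lt1// ltr1n.
have [K2 _ hK2] := (cvgr0_norm_le _ ec) eps e0.
pose i := maxn K K2; have {hK} h1 := hK i (leq_maxl _ _).
have {hK2} h2 : e_ i <= eps by apply: le_trans (ler_norm _) _; apply: hK2; exact: leq_maxr.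
rewrite (_ : _ - _ = (FTn 1 F x - A i x) + (A i x - ((2 * pi) ^+ n.+1)%:C * w x)); last by ring.
apply: le_trans (le_normcD _ _) _; rewrite (_ : eps * (1 + L) = eps + eps * L); last by ring.
apply: lerD; last first.
  by apply: le_trans (hL i x) _; rewrite mulrC; apply: ler_wpM2r.
rewrite -lee_fin; apply: le_trans h1.
have iX := FT_integrable (meas_phn 1) x iF.
have iEX : cintg Leb (fun X => expi (phn 1 (x, X)) * F X * (En (e_ i) X)%:C).
  under [X in cintg _ X]eq_fun do rewrite mulrC.
  apply: (cintgM (C := 1) (cmeas_real (meas_En _))) => // X.
  by rewrite normc_real ger0_norm ?En_ge0 ?En_le1 ?e_gt0.
rewrite /FTn /FT -cintB//; apply: le_trans (le_normc_cint (cintgB iX iEX)) _.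
apply: eq_leE; apply: eqint => X _; congr (_%:E).
rewrite -[X in normc (X - _)]mulr1 -mulrBr -(_ : 1%:C = 1)// -creB.
rewrite !normc_sqrt !sqnM sqn_expi mul1r sqrtrM ?sqn_ge0// sqn_real sqrtr_sqr ger0_norm//.
by have /andP[] := E01 i X.
Qed.

End w.
End inversion.

(** * Completeness of L2 and minimal elements *)

Section L2_convergence.
Context {R : realType} d (T : measurableType d) (mu : {measure set T -> \bar R}).
Implicit Types (u v : T -> R[i]).

(** The series of the 4^j f_j has a finite integral, so its sum is finite almost everywhere and
    bounds each of its terms. *)
Lemma ae_decay (f : nat -> T -> \bar R) : (forall j, measT (f j)) ->
  (forall j x, 0 <= f j x)%E -> (forall j, \int[mu]_x f j x <= ((16^-1 : R) ^+ j)%:E)%E ->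
  {ae mu, forall x, exists2 C : R, 0 <= C & forall j, (f j x <= (C * 4^-1 ^+ j)%:E)%E}.
Proof.
move=> mf f0 fI; pose S x := (\sum_(j <oo) ((4 ^+ j)%:E * f j x))%E.
have p4 j : 0 <= 4 ^+ j :> R by exact: exprn_ge0.
have t0 j x : (0 <= (4 ^+ j)%:E * f j x)%E by apply: mule_ge0; rewrite ?lee_fin.
have mt j : measT (fun x => (4 ^+ j)%:E * f j x)%E by exact: mfuneM.
have S0 x : (0 <= S x)%E by apply: nneseries_ge0 => j _ _; exact: t0.
have mS : measT S.
  by apply: (ge0_emeasurable_sum (P := xpredT)) => // j x _ _; exact: t0.
have IS : (\int[mu]_x S x < +oo)%E.
  rewrite integral_nneseries//.
  apply: (@le_lt_trans _ _ (\sum_(j <oo) ((4^-1 : R) ^+ j)%:E)%E).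
    apply: lee_nneseries => [j _ _|j _]; first by apply: intg_ge0 => x _; exact: t0.
    rewrite ge0_intZlE//; apply: (@le_trans _ _ ((4 ^+ j)%:E * ((16^-1 : R) ^+ j)%:E)%E).
      by apply: lee_wpmul2l; rewrite ?lee_fin.
    apply: eq_leE; rewrite -EFinM -exprMn; congr ((_ ^+ _)%:E); by field.
  by apply: geometric_lty; [rewrite invr_ge0|rewrite invf_lt1//; lra].
apply: (ae_mono (ge0_ae_lty mS S0 IS)) => x Sx; exists (fine (S x)); first exact: fine_ge0.
have Sf : (fine (S x))%:E = S x by rewrite fineK// ge0_fin_numE.
move=> j; have p0 : 0 < 4 ^+ j :> R by exact: exprn_gt0.
have h : ((4 ^+ j)%:E * f j x <= (fine (S x))%:E)%E by rewrite Sf; exact: (nneseries_term j (fun i => t0 i x)).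
have e : f j x = ((4^-1 ^+ j)%:E * ((4 ^+ j)%:E * f j x))%E.
  by rewrite muleA -EFinM -exprMn mulVf// expr1n mul1e.
rewrite e mulrC EFinM; apply: lee_wpmul2l h; by rewrite lee_fin exprn_ge0// invr_ge0.
Qed.

(** The upper limit is measurable with or without convergence, and is the limit at every point where
    both parts converge. *)
Let lim_re (u : nat -> T -> R[i]) (x : T) : R[i] :=
  (fine (limn_esup (fun j => (cRe (u j x))%:E)) +i* fine (limn_esup (fun j => (cIm (u j x))%:E)))%C.

(** By [ae_decay] consecutive differences are almost everywhere bounded by a geometric series, of
    ratio 1/2 after taking square roots. Fatou's lemma then passes the Cauchy bound to the limit. *)
Lemma L2_complete (u : nat -> T -> R[i]) : (forall j, cmeas (u j)) ->
  (forall i j, (j <= i)%N -> \int[mu]_x (sqn (u i x - u j x))%:E <= ((16^-1 : R) ^+ j)%:E)%E ->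
  exists2 g, cmeas g & forall j, (\int[mu]_x (sqn (g x - u j x))%:E <= ((16^-1 : R) ^+ j)%:E)%E.
Proof.
move=> mu_ uI; exists (lim_re u).
  split; apply: (mcomp (fine_measurable measurableT)); apply: measurable_fun_limn_esup => j;
    apply/mEFin; by case: (mu_ j).
move=> j.
have md i k : measT (fun x => (sqn (u i x - u k x))%:E).
  by apply/mEFin; apply: msqn; exact: cmeasB.
have d0 i k x : (0 <= (sqn (u i x - u k x))%:E)%E by rewrite lee_fin sqn_ge0.
have := ae_decay (fun i => md i.+1 i) (fun i => d0 i.+1 i) (fun i => uI i.+1 i (leqnSn i)).
move=> ae; apply: (@le_trans _ _ (\int[mu]_x limn_einf (fun i => (sqn (u (i + j)%N x - u j x))%:E))%E); last first.
  apply: le_trans (fatou _ _ _ _) _ => //.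
  rewrite limn_einf_lim; apply: lime_le; first exact: is_cvg_einfs.
  apply: nearW => i; apply: le_trans (uI (i + j)%N j (leq_addl i j)).
  by apply: ereal_inf_lbound; exists i => /=.
apply: ae_ge0_le_integral => //.
- by move=> x _; rewrite lee_fin sqn_ge0.
- apply/mEFin; apply: msqn; apply: cmeasB => //.
  split; apply: (mcomp (fine_measurable measurableT)); apply: measurable_fun_limn_esup => i;
    apply/mEFin; by case: (mu_ i).
- move=> x _; rewrite limn_einf_lim; apply: lime_ge; first exact: is_cvg_einfs.
  by apply: nearW => i; apply: le_ereal_inf_tmp => _ [k _ <-].
- have -> : (fun x => limn_einf (fun i => (sqn (u (i + j)%N x - u j x))%:E)) =
      (fun x => - limn_esup (fun i => - (sqn (u (i + j)%N x - u j x))%:E))%E.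
    apply/funext => x; rewrite -limn_einfN; congr limn_einf; by apply/funext => i; rewrite /comp oppeK.
  apply: (mcomp (@oppe_measurable R setT)); apply: measurable_fun_limn_esup => i.
  by apply: (mcomp (@oppe_measurable R setT)); exact: md.
apply: (ae_mono ae) => x [C C0 hC] _.
have cv (p : R[i] -> R) : (forall z w, p (z - w) = p z - p w) -> (forall z, p z ^+ 2 <= sqn z) -> cvgn (fun i => p (u i x)).
  move=> pB pN.
  have hk i : `|p (u i.+1 x) - p (u i x)| <= Num.sqrt C * 2^-1 ^+ i.
    rewrite -pB -(@ler_pXn2r _ 2)// ?nnegrE// ?mulr_ge0 ?sqrtr_ge0 ?exprn_ge0 ?invr_ge0//.
    rewrite real_normK ?num_real// exprMn sqr_sqrtr// -exprM mulnC exprM.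
    apply: le_trans (pN _) _; have := hC i; rewrite lee_fin => /le_trans; apply.
    by rewrite (_ : (2^-1 : R) ^+ 2 = 4^-1)//; field.
  have cs : cvgn (series (fun i => p (u i.+1 x) - p (u i x))).
    have g0 i : 0 <= geometric (Num.sqrt C) 2^-1 i.
      by apply: mulr_ge0; [exact: sqrtr_ge0|apply: exprn_ge0; rewrite invr_ge0].
    apply: normed_cvg; apply: (@series_le_cvg _ _ _ (fun i => normr_ge0 _) g0 hk).
    apply: is_cvg_geometric_series; rewrite ger0_norm ?invr_ge0// invf_lt1//; lra.
  have -> : (fun i => p (u i x)) = (fun i => p (u 0%N x) + series (fun i => p (u i.+1 x) - p (u i x)) i).
    by apply/funext => i; rewrite /series /= telescope_sumr// addrC subrK.
  by apply: is_cvgD => //; exact: is_cvg_cst.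
have cRe : cvgn (fun i => cRe (u i x)).
  by apply: cv => [z w|z]; rewrite ?cReD ?cReN// /sqn lerDl sqr_ge0.
have cIm : cvgn (fun i => cIm (u i x)).
  by apply: cv => [z w|z]; rewrite ?cImD ?cImN// /sqn lerDr sqr_ge0.
have limE (p : R[i] -> R) : cvgn (fun i => p (u i x)) -> fine (limn_esup (fun i => (p (u i x))%:E)) = limn (fun i => p (u i x)).
  move=> cp; have h : (p (u i x))%:E @[i --> \oo] --> (limn (fun i => p (u i x)))%:E.
    by apply: cvg_EFin; [exact: nearW|exact: cp].
  by have [_ ->] := cvg_limn_einf_sup h.
apply: eq_leE.
have sh (p : R[i] -> R) : cvgn (fun i => p (u i x)) -> (p (u (i + j)%N x)) @[i --> \oo] --> limn (fun i => p (u i x)).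
  by move=> cp; rewrite (cvg_shiftn j (fun i => p (u i x))).
have h : (sqn (u (i + j)%N x - u j x)) @[i --> \oo] --> sqn (lim_re u x - u j x).
  rewrite /sqn !cReD !cReN !cImD !cImN /lim_re /= (limE _ cRe) (limE _ cIm).
  under eq_fun do rewrite !cReD !cReN !cImD !cImN.
  apply: cvgD; rewrite !expr2; apply: cvgM; (apply: cvgB; [exact: sh|exact: cvg_cst]).
have hE : (sqn (u (i + j)%N x - u j x))%:E @[i --> \oo] --> (sqn (lim_re u x - u j x))%:E.
  by apply: cvg_EFin; [exact: nearW|exact: h].
by have [-> _] := cvg_limn_einf_sup hE.
Qed.

Lemma parallelogram (z w : R[i]) : sqn (z - w) + 4 * sqn ((2^-1)%:C%C * (z + w)) = 2 * sqn z + 2 * sqn w.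
Proof. by case: z => a b; case: w => c e; rewrite /sqn /=; field. Qed.

(* The infima of [q v = \int |v|^2] over the decreasing convex sets [K N] are
   nondecreasing in [N]; near-minimizers are Cauchy by the parallelogram law. *)
Lemma min_norm_cauchy (K : nat -> (T -> R[i]) -> Prop) (B : R) :
  (forall N v, K N v -> cmeas v /\ (\int[mu]_x (sqn (v x))%:E <= B%:E)%E) ->
  (forall N v w, K N v -> K N w -> K N (fun x => (2^-1)%:C%C * (v x + w x))) ->
  (forall N M v, (N <= M)%N -> K M v -> K N v) -> (forall N, exists v, K N v) ->
  exists u : nat -> T -> R[i], (forall j, K j (u j)) /\
    forall i j, (j <= i)%N -> (\int[mu]_x (sqn (u i x - u j x))%:E <= ((16^-1 : R) ^+ j)%:E)%E.
Proof.
move=> KB Kmid Kdec Kne; pose q v := fine (\int[mu]_x (sqn (v x))%:E)%E.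
have qE N v : K N v -> (\int[mu]_x (sqn (v x))%:E)%E = (q v)%:E.
  move=> /KB[mv hv]; rewrite /q fineK// ge0_fin_numE; first exact: le_lt_trans hv (ltry _).
  by apply: int_ge0 => x; rewrite lee_fin sqn_ge0.
have qB N v : K N v -> q v <= B by move=> Kv; have [_] := KB _ _ Kv; rewrite (qE _ _ Kv) lee_fin.
pose S : set R := [set c | exists N, forall v, K N v -> c <= q v].
have S0 : S !=set0.
  exists 0; exists 0%N => v _; apply: fine_ge0; apply: int_ge0 => x; rewrite lee_fin; exact: sqn_ge0.
have SB : has_ubound S.
  exists B => c [N h]; have [v Kv] := Kne N; exact: le_trans (h v Kv) (qB _ _ Kv).
have supS : has_sup S by split.
(* [d0] is the limit of the infima. The terms of the sequence will have norm at most [d0 + de j] and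
   their midpoints at least [d0 - de j]; the parallelogram law then leaves [8 * de j], that is
   16^-j. *)
pose d0 := sup S; pose de (j : nat) : R := 16^-1 ^+ j / 8.
have de0 j : 0 < de j by rewrite divr_gt0// exprn_gt0// invr_gt0.
have hN0 (j : nat) : exists N : nat, forall v, K N v -> d0 - de j <= q v.
  have [c [M hM] hc] := sup_adherent (de0 j) supS.
  exists M => v Kv; exact: le_trans (ltW hc) (hM v Kv).
have [N hN] := choice hN0.
(* An index beyond N 0, ..., N j, so that an element of [K (M i)] lies in [K (N j)] for every j <=
   i; the summand [j] puts it in [K j] as well. *)
pose M j := (j + \sum_(i < j.+1) N i)%N.
have NM j i : (j <= i)%N -> (N j <= M i)%N.
  move=> ji; rewrite /M; have jl : (j < i.+1)%N by [].
  by rewrite (bigD1 (Ordinal jl))//= addnCA leq_addr.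
have hu0 j : exists v, K (M j) v /\ q v <= d0 + de j.
  apply: contrapT => /forallNP h.
  have : S (d0 + de j).
    exists (M j) => v Kv; apply: ltW; rewrite ltNge; apply/negP => hq; exact: (h v).
  by move=> /(ub_le_sup SB); rewrite -/d0; have := de0 j; lra.
have [u hu] := choice hu0.
exists u; split => [j|i j ji]; first by have [h _] := hu j; apply: Kdec h; exact: leq_addr.
have [Ki qi] := hu i; have [Kj qj] := hu j.
have Ki' := Kdec _ _ _ (NM _ _ ji) Ki; have Kj' := Kdec _ _ _ (NM j j (leqnn j)) Kj.
have Km := Kmid _ _ _ Ki' Kj'; have qm := hN _ _ Km.
have [[mi _] [mj _]] := (KB _ _ Ki, KB _ _ Kj); have [mm _] := KB _ _ Km.
have ms v : cmeas v -> measT (fun x => sqn (v x)) by exact: msqn.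
have s0 v x : 0 <= sqn (v x : R[i]) by exact: sqn_ge0.
have md := cmeasB mi mj.
have E : (\int[mu]_x (sqn (u i x - u j x))%:E + 4%:E * (q (fun x => (2^-1)%:C%C * (u i x + u j x)))%:E =
   2%:E * (q (u i))%:E + 2%:E * (q (u j))%:E)%E.
  rewrite -(qE _ _ Km) -(qE _ _ Ki) -(qE _ _ Kj).
  have p4 : 0 <= 4 :> R by [].
  have p2 : 0 <= 2 :> R by [].
  have nn (c : R) v : 0 <= c -> forall x, 0 <= c * sqn (v x : R[i]) by move=> c0 x; apply: mulr_ge0.
  have mn (c : R) v : cmeas v -> measT (fun x => c * sqn (v x)).
    by move=> mv; apply: mfunM => //; exact: ms.
  rewrite -(ge0_intZl mu p4 (ms _ mm) (s0 _)) -(ge0_intZl mu p2 (ms _ mi) (s0 _)) -(ge0_intZl mu p2 (ms _ mj) (s0 _)).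
  rewrite -(ge0_intD mu (ms _ md) (mn 4 _ mm) (s0 _) (nn 4 _ p4)) -(ge0_intD mu (mn 2 _ mi) (mn 2 _ mj) (nn 2 _ p2) (nn 2 _ p2)).
  by apply: eqint => x _; rewrite parallelogram.
have de_le : de i <= de j by rewrite ler_pM2r// ler_wiXn2l// ?invr_ge0// invf_le1//; lra.
have deE : (16^-1 : R) ^+ j = 8 * de j by rewrite /de; field.
rewrite -!EFinM -EFinD in E; rewrite deE.
move: E; case: (\int[mu]_x _)%E => [r| |]//= -[].
by move=> E; rewrite lee_fin; lra.
Qed.

End L2_convergence.

(** * Truncations and the oriented time integral *)

Section truncation.
Context {R : realType} {n : nat}.
Local Notation Rn := 'rV[R]_n.
Local Notation leb := (@lebesgue_measure R).
Local Notation Leb := (@lebesgue_rV R n).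
Local Open Scope complex_scope.

Definition indT (T : R) (z : R * Rn) : R :=
  \1_(`[- T, T]%classic) z.1 * \prod_(j < n) \1_(`[- T, T]%classic) (z.2 ord0 j).

Let ind01 (A : set R) (r : R) : 0 <= (\1_A r : R) <= 1.
Proof. by rewrite indicE; case: (_ \in _); rewrite ?lexx ?ler01. Qed.

Lemma indT_in T z : 0 <= indT T z <= 1.
Proof.
have /andP[a0 a1] := ind01 `[- T, T]%classic z.1.
have /andP[b0 b1] := prod_in01 (index_enum 'I_n) xpredT (fun j => ind01 `[- T, T]%classic (z.2 ord0 j)).
by rewrite /indT mulr_ge0//= mulr_ile1.
Qed.

Lemma indT1 T z : `|z.1| <= T -> inbox T z.2 -> indT T z = 1.
Proof.
move=> h1 h2; rewrite /indT indicE mem_set; last by rewrite /= in_itv /= -ler_norml.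
by rewrite big1 ?mulr1// => j _; rewrite indicE mem_set//= in_itv /= -ler_norml; exact: h2.
Qed.

Lemma indT0 T z : ~ (`|z.1| <= T /\ inbox T z.2) -> indT T z = 0.
Proof.
move=> h; have [h1|h1] := leP `|z.1| T; last first.
  by rewrite /indT indicE memNset ?mul0r//= in_itv /= -ler_norml leNgt h1.
have [j hj] : exists j, T < `|z.2 ord0 j|.
  apply: contrapT => /forallNP hn; apply: h; split => // j; rewrite leNgt; apply/negP; exact: hn.
by rewrite /indT (bigD1 j)//= [X in _ * (X * _)]indicE memNset ?(mul0r, mulr0)//= in_itv /= -ler_norml leNgt hj.
Qed.

Lemma meas_indT T : measT (indT T).
Proof.
have mI : measT (\1_(`[- T, T]%classic) : R -> R) by exact: mindic.
apply: mfunM; first exact: (mcomp mI mfst).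
apply: measurable_prod => j _.
exact (mcomp mI (mcomp (mcoord j) msnd)).
Qed.

Lemma indT_lim z : exists K, forall k : nat, (K <= k)%N -> indT (k%:R + 1) z = 1.
Proof.
pose M := `|z.1| + \sum_j `|z.2 ord0 j|; exists (Num.bound M) => k hk.
have M0 : 0 <= M by rewrite addr_ge0// sumr_ge0.
have Mk : M <= k%:R + 1.
  apply: le_trans (ltW (archi_boundP M0)) _; apply: (@le_trans _ _ (k%:R : R)); [by rewrite ler_nat|by rewrite lerDl].
apply: indT1; first by apply: le_trans Mk; rewrite lerDl sumr_ge0.
move=> j; apply: le_trans Mk; rewrite /M (bigD1 j)//= addrCA lerDl addr_ge0// sumr_ge0//.
Qed.

Lemma int_le_support (G : R -> R[i]) (M T : R) : 0 <= M -> 0 <= T -> cmeas G ->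
  (forall r, normc (G r) <= M) -> (forall r, T < `|r| -> G r = 0) ->
  (\int[leb]_r (normc (G r))%:E <= (M * (2 * T))%:E)%E.
Proof.
move=> M0 T0 mG GM G0; rewrite -(int_indic_ball 0 M0 T0).
apply: ge0_le_int; [exact: mnormc| |by move=> r; exact: nc_ge0|].
  by apply: mfunM => //; exact: mindic.
move=> r; rewrite sub0r add0r indicE; have [h|h] := leP `|r| T.
  by rewrite mem_set ?mulr1//= in_itv /= -ler_norml.
by rewrite G0// normc_real normr0; apply: mulr_ge0.
Qed.

Lemma nice_prod_integrable (M T : R) (f : R * Rn -> R[i]) : nice M T f -> cintg (leb \x Leb)%E f.
Proof.
move=> nf; have [mf fM f0] := nf; have M0 := nice_ge0 nf.
apply: cintg_tonelli => //; have V0 := boxvol_ge0 (n := n) T.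
pose V : R := M * boxvol (n := n) T; pose T' := Num.max T 0.
apply: (@le_lt_trans _ _ (\int[leb]_t (V * \1_(`[0 - T', 0 + T']%classic) t)%:E)%E).
  apply: ge0_le_intE.
  - apply: (@mintp _ _ _ _ _ Leb (fun t x => (normc (f (t, x)))%:E)); last by move=> *; rewrite lee_fin nc_ge0.
    by apply/mEFin; have := mnormc mf; apply: eq_measurable_fun => -[].
  - by apply/mEFin; apply: mfunM => //; exact: mindic.
  - by move=> t; apply: int_ge0 => x; rewrite lee_fin nc_ge0.
  move=> t; rewrite indicE; have [h|h] := leP `|t| T'.
    rewrite mem_set ?mulr1; last by rewrite /= in_itv /= sub0r add0r -ler_norml.
    exact: nice_int nf t.
  rewrite integral0_eq ?lee_fin ?mulr_ge0// => x _; rewrite f0 ?normc_real ?normr0// => -[h1 _].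
  by move: h; rewrite ltNge (le_trans h1)// le_max lexx.
rewrite int_indic_ball ?ltry//; [exact: mulr_ge0|by rewrite le_max lexx orbT].
Qed.

End truncation.

Section duhamel_kernel.
Context {R : realType}.
Local Notation leb := (@lebesgue_measure R).
Local Open Scope complex_scope.

(** The indicator of the interval between 0 and [t], for either sign of [t]. Together with the
    orientation [et] it turns the integral from 0 to [t] into one over the whole line, jointly
    measurable in both times. *)
Definition Iv (t tau : R) : R := ((0 <= tau) && (tau <= t) || (t <= tau) && (tau <= 0))%:R.
Definition et (t : R) : R := if 0 <= t then 1 else -1.

Lemma IvP t tau : Iv t tau = 0 \/ Iv t tau = 1.
Proof. by rewrite /Iv; case: (_ || _); [right|left]. Qed.

Lemma Iv01 t tau : 0 <= Iv t tau <= 1.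
Proof. by have [->|->] := IvP t tau; rewrite ?lexx ?ler01. Qed.

Lemma et_norm t : `|et t| = 1.
Proof. by rewrite /et; case: ifP; rewrite ?normrN normr1. Qed.

Lemma meas_Iv : measT (fun p : R * R => Iv p.1 p.2).
Proof.
have m1 (f g : R * R -> R) : measT f -> measT g -> measurable [set p | f p <= g p].
  by move=> mf mg; rewrite -[X in measurable X]setTI; exact: measurable_fun_le.
pose A : set (R * R) := ([set p | 0 <= p.2] `&` [set p | p.2 <= p.1]) `|` ([set p | p.1 <= p.2] `&` [set p | p.2 <= 0]).
have mA : measurable A.
  by apply: measurableU; apply: measurableI; apply: m1.
have -> : (fun p : R * R => Iv p.1 p.2) = \1_A; last exact: mindic.
apply/funext => p; rewrite indicE /Iv; congr (_%:R); congr nat_of_bool; apply/idP/idP.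
  by move=> /orP[/andP[h1 h2]|/andP[h1 h2]]; apply/mem_set; [left|right].
by move=> /set_mem[[h1 h2]|[h1 h2]]; apply/orP; [left|right]; apply/andP.
Qed.

Lemma int_Iv t : (\int[leb]_tau (Iv t tau)%:E <= `|t|%:E)%E.
Proof.
have t0 : 0 <= `|t| / 2 by rewrite divr_ge0.
have -> : `|t|%:E = (1 * (2 * (`|t| / 2)))%:E :> \bar R by congr (_%:E); field.
rewrite -(int_indic_ball (t / 2) ler01 t0); apply: ge0_le_int.
- exact: (mcomp meas_Iv (mpair1 t)).
- by apply: mfunM => //; exact: mindic.
- by move=> tau; have /andP[] := Iv01 t tau.
move=> tau; rewrite mul1r indicE /Iv; case h : (_ || _) => //.
rewrite mem_set//= in_itv /=; move: h => /orP[/andP[h1 h2]|/andP[h1 h2]].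
  by rewrite ger0_norm; [apply/andP; split; lra|lra].
by rewrite ler0_norm; [apply/andP; split; lra|lra].
Qed.

Lemma cintegral0E t (F : R -> R[i]) :
  cintegral0 t F = (et t)%:C * cint leb (fun tau => (Iv t tau)%:C * F tau).
Proof.
have E (A : set R) : (forall tau, (tau \in A) = (Iv t tau == 1)) ->
    cintegral leb A F = cint leb (fun tau => (Iv t tau)%:C * F tau).
  move=> hA; rewrite /cint /cintegral; congr (_ +i* _); rewrite Rintegral_mkcond; apply: eq_Rintegral => tau _;
    rewrite /patch hA; have [->|->] := IvP t tau; rewrite ?eqxx ?(eq_sym 0) ?oner_eq0 ?mul1r ?mul0r//.
have K (b : bool) : ((b%:R : R) == 1) = b by case: b; rewrite ?eqxx// eq_sym oner_eq0.
have memE (a b tau : R) : (tau \in (`[a, b]%classic : set R)) = (a <= tau <= b).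
  by apply/idP/idP => [/set_mem|h]; [rewrite /= in_itv|apply/mem_set; rewrite /= in_itv].
rewrite /cintegral0 /et; case: ifPn => t0.
  rewrite mul1r; apply: E => tau; rewrite memE /Iv K; case h0: (_ && _) => //=.
  apply/esym/negbTE; apply/negP => /andP[h1 h2]; move/negP: h0; apply; apply/andP; split; lra.
rewrite (_ : (-1)%:C = -1); last by rewrite rmorphN1.
rewrite mulN1r; congr (- _); apply: E => tau; rewrite memE /Iv K orbC; case: (_ && _) => //=.
by apply/esym/negbTE; apply/negP => /andP[h1 h2]; move: t0; rewrite -ltNge; lra.
Qed.

End duhamel_kernel.

(** * Duality and convergence of pairings with test functions *)

Section duality.
Context {R : realType} {n : nat}.
Local Notation Rn := 'rV[R]_n.
Local Notation Leb := (@lebesgue_rV R n).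

(** Fubini's theorem, the phase being symmetric in position and frequency. *)
Lemma FT_dual (G u : Rn -> R[i]) : cintg Leb G -> cintg Leb u ->
  forall sg : R, cint Leb (fun x => FTn sg G x * u x) = cint Leb (fun xi => G xi * FTn sg u xi).
Proof.
move=> iG iu sg.
pose H (z : Rn * Rn) : R[i] := expi (phn sg z) * (u z.1 * G z.2).
have iH : cintg (Leb \x Leb)%E H.
  apply: (cintgM (C := 1)); [exact: cmeas_expi (meas_phn sg)|by move=> z; rewrite normc_expi|].
  exact (cintg_mulX iu iG).
have iGx x := FT_integrable (meas_phn sg) x iG.
have iux y := FT_integrable (meas_phn sg) y iu.
transitivity (cint Leb (fun x => cint Leb (fun y => H (x, y)))).
  apply: eq_cint => x; rewrite /FTn /FT -(cintZr (u x) (iGx x)).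
  by apply: eq_cint => y; rewrite /H /=; ring.
rewrite (cint_Fubini iH); apply: eq_cint => y; rewrite /FTn /FT -(cintZl (G y) (iux y)).
by apply: eq_cint => x; rewrite /H /phn /= dotpC; ring.
Qed.

End duality.

Section transform_pairing.
Context {R : realType} {n : nat}.
Local Notation Rn := 'rV[R]_n.+1.
Local Notation leb := (@lebesgue_measure R).
Local Notation Leb := (@lebesgue_rV R n.+1).
Local Open Scope complex_scope.
Variables (a : Rn -> R) (w : Rn -> R[i]).
Hypotheses (ma : measT a) (iw : cintg Leb w)
  (sw : (\int[Leb]_x (sqn (w x))%:E < +oo)%E).

(** The propagator is applied to the test side, [w] being the inverse transform of a test function
    times <xi>^(m-1). The pairing [TT] with data that are merely in L2 is then a convergent
    integral. *)
Definition vt (kap : Rn -> R) (t : R) (z : R * Rn) : R[i] :=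
  FTn (-1) (fun xi => expi ((t - z.1) * a xi) * ((kap xi)%:C * w xi)) z.2.

Definition TT (F : R * Rn -> R[i]) kap t : R[i] :=
  cint (leb \x Leb)%E (fun z => (Iv t z.1)%:C * (F z * vt kap t z)).

Let c2 : R := (2 * pi) ^+ n.+1.
Let c20 : 0 <= c2. Proof. by apply: exprn_ge0; apply: mulr_ge0 => //; exact: pi_ge0. Qed.
Let W2 (kap : Rn -> R) := (\int[Leb]_x (kap x ^+ 2 * sqn (w x))%:E)%E.

Section one_multiplier.
Variable kap : Rn -> R.
Hypotheses (mkap : measT kap) (kap1 : forall x, `|kap x| <= 1).

Let mw : cmeas w. Proof. exact: cintg_meas iw. Qed.

Lemma cmeas_vt t : cmeas (vt kap t).
Proof.
apply: (@cmeas_cint _ _ _ _ _ Leb (fun q : (R * Rn) * Rn => expi (phn (-1) (q.1.2, q.2)) *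
  (expi ((t - q.1.1) * a q.2) * ((kap q.2)%:C * w q.2)))).
apply: cmeasM.
  apply: cmeas_expi; apply: (mcomp (meas_phn _)); apply: mpair => //.
  exact: (mcomp msnd mfst).
apply: cmeasM.
  apply: cmeas_expi; apply: mfunM; last exact: (mcomp ma msnd).
  by apply: mfunB => //; exact: (mcomp mfst mfst).
by apply: cmeasM; [apply: cmeas_real; exact: (mcomp mkap msnd)|exact: (cmeas_comp mw msnd)].
Qed.

Lemma vt_integrable t tau : cintg Leb (fun xi => expi ((t - tau) * a xi) * ((kap xi)%:C * w xi)).
Proof.
apply: (cintgM (C := 1)); [by apply: cmeas_expi; exact: mfunM|by move=> x; rewrite normc_expi|].
by apply: (cintgM (C := 1)); [exact: cmeas_real|by move=> x; rewrite normc_real|].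
Qed.

Let W2_lty : (W2 kap < +oo)%E.
Proof.
apply: le_lt_trans sw; apply: ge0_le_int.
- by apply: mfunM; [exact: mfunX|exact: msqn].
- exact: msqn.
- by move=> x; rewrite mulr_ge0 ?sqr_ge0 ?sqn_ge0.
move=> x; rewrite ler_piMl ?sqn_ge0// -real_normK ?num_real//; exact: exprn_ile1.
Qed.

Lemma vt_bessel t tau : (\int[Leb]_x (sqn (vt kap t (tau, x)))%:E <= c2%:E * W2 kap)%E.
Proof.
have e : (\int[Leb]_x (sqn (expi ((t - tau) * a x) * ((kap x)%:C * w x)))%:E = W2 kap)%E.
  by apply: eqint => x _; rewrite !sqnM sqn_expi mul1r sqn_real.
rewrite -e; apply: (@bessel_rV R n.+1 (-1) (or_intror erefl) _ (vt_integrable t tau)).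
by rewrite e.
Qed.

Lemma Iv_vt_bessel t : (\int[leb]_tau \int[Leb]_x (Iv t tau * sqn (vt kap t (tau, x)))%:E <= `|t|%:E * (c2%:E * W2 kap))%E.
Proof.
have W0 : (0 <= W2 kap)%E by apply: int_ge0 => x; rewrite lee_fin mulr_ge0 ?sqr_ge0 ?sqn_ge0.
have Wf : W2 kap = (fine (W2 kap))%:E by rewrite fineK// ge0_fin_numE.
have mI : measT (Iv t) by exact: (mcomp meas_Iv (mpair1 t)).
have Iv0 tau : 0 <= Iv t tau by have /andP[] := Iv01 t tau.
have mv := msqn (cmeas_vt t).
rewrite Wf -EFinM; set K := c2 * _; have K0 : 0 <= K by apply: mulr_ge0 => //; exact: fine_ge0.
apply: (@le_trans _ _ (\int[leb]_tau (K * Iv t tau)%:E)%E).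
  apply: ge0_le_intE.
  - apply: (@mintp _ _ _ _ _ Leb (fun tau x => (Iv t tau * sqn (vt kap t (tau, x)))%:E)).
      apply/mEFin; apply: mfunM; first exact: (mcomp mI mfst).
      by move: mv; apply: eq_measurable_fun => -[].
    by move=> tau x; rewrite lee_fin mulr_ge0 ?sqn_ge0.
  - by apply/mEFin; exact: mfunM.
  - by move=> tau; apply: int_ge0 => x; rewrite lee_fin mulr_ge0 ?sqn_ge0.
  move=> tau; rewrite (ge0_intZl Leb (Iv0 tau)); last 2 first.
  - exact: (mcomp mv (mpair1 tau)).
  - by move=> x; exact: sqn_ge0.
  rewrite mulrC EFinM; apply: lee_wpmul2l; first by rewrite lee_fin.
  by apply: le_trans (vt_bessel t tau) _; rewrite {1}Wf -EFinM.
rewrite (ge0_intZl leb K0 mI Iv0) [leRHS]EFinM [leLHS]muleC; apply: lee_wpmul2r; [by rewrite lee_fin|exact: int_Iv].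
Qed.

(** Young's inequality with a free parameter: [TT_cvg] chooses [lam] differently for the two kinds
    of error. *)
Lemma TT_bound (F : R * Rn -> R[i]) t (lam : R) : 0 < lam -> cmeas F ->
  (\int[leb \x Leb]_z (sqn (F z))%:E < +oo)%E ->
  cintg (leb \x Leb)%E (fun z => (Iv t z.1)%:C * (F z * vt kap t z)) /\
  ((normc (TT F kap t))%:E <= lam%:E * \int[leb \x Leb]_z (sqn (F z))%:E + lam^-1%:E * (`|t|%:E * (c2%:E * W2 kap)))%E.
Proof.
move=> l0 mF sF.
have mI : measT (fun z : R * Rn => Iv t z.1).
  exact: (mcomp meas_Iv (mcomp (mpair1 t) mfst)).
have Iv0 tau : 0 <= Iv t tau by have /andP[] := Iv01 t tau.
have mv := cmeas_vt t; have mH : cmeas (fun z => (Iv t z.1)%:C * (F z * vt kap t z)).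
  by apply: cmeasM; [exact: cmeas_real|exact: cmeasM].
have B : (\int[leb \x Leb]_z (normc ((Iv t z.1)%:C * (F z * vt kap t z)))%:E <=
    lam%:E * \int[leb \x Leb]_z (sqn (F z))%:E + lam^-1%:E * (`|t|%:E * (c2%:E * W2 kap)))%E.
  have m2 : measT (fun z => Iv t z.1 * sqn (vt kap t z)).
    by apply: mfunM => //; exact: msqn.
  have p2 z : 0 <= Iv t z.1 * sqn (vt kap t z) by rewrite mulr_ge0 ?sqn_ge0.
  have m3 : measT (fun z => sqn (F z)) by exact: msqn.
  have p3 z : 0 <= sqn (F z) by exact: sqn_ge0.
  have li : 0 <= lam^-1 by rewrite invr_ge0 ltW.
  apply: (@le_trans _ _ (\int[leb \x Leb]_z (lam * sqn (F z) + lam^-1 * (Iv t z.1 * sqn (vt kap t z)))%:E)%E).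
    apply: ge0_le_int.
    - exact: mnormc.
    - apply: mfunD; apply: mfunM => //; exact: msqn.
    - by move=> z; exact: nc_ge0.
    move=> z; rewrite !normc_sqrt !sqnM sqrtrM ?sqn_ge0// -!normc_sqrt normc_real sqrtrM ?sqn_ge0// -!normc_sqrt.
    have f0 := nc_ge0 (F z); have v0 := nc_ge0 (vt kap t z); rewrite -!normc_sqrE.
    have := sqr_ge0 (lam * normc (F z) - normc (vt kap t z)).
    set x := normc (F z) in f0 *; set y := normc _ in v0 * => sq.
    have ll : lam^-1 * lam = 1 by rewrite mulVf// gt_eqF.
    have h1 : x * y <= lam * x ^+ 2 + lam^-1 * y ^+ 2.
      have := mulr_ge0 li sq; have -> : lam^-1 * (lam * x - y) ^+ 2 = (lam^-1 * lam) * lam * x ^+ 2 - 2 * (lam^-1 * lam) * (x * y) + lam^-1 * y ^+ 2 by ring.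
      rewrite ll; have : 0 <= x * y by exact: mulr_ge0.
      lra.
    have h2 : 0 <= lam * x ^+ 2 by apply: mulr_ge0; [exact: ltW|exact: sqr_ge0].
    by have [->|->] := IvP t z.1; rewrite ?normr0 ?normr1 ?mul0r ?mul1r ?mulr0 ?addr0.
  rewrite (ge0_intD (leb \x Leb)%E); last 4 first.
  - by apply: mfunM => //; exact: msqn.
  - exact: mfunM.
  - by move=> z; apply: mulr_ge0; [exact: ltW|exact: sqn_ge0].
  - by move=> z; exact: mulr_ge0.
  rewrite (ge0_intZl (leb \x Leb)%E (ltW l0) m3 p3) (ge0_intZl (leb \x Leb)%E li m2 p2).
  apply: leeD => //; apply: lee_wpmul2l; first by rewrite lee_fin.
  rewrite (@ge0_prod_int _ _ _ _ _ leb Leb (fun tau x => (Iv t tau * sqn (vt kap t (tau, x)))%:E)).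
  - exact: Iv_vt_bessel.
  - by apply/mEFin; move: m2; apply: eq_measurable_fun => -[].
  - by move=> tau x; rewrite lee_fin mulr_ge0 ?sqn_ge0.
have i1 : cintg (leb \x Leb)%E (fun z => (Iv t z.1)%:C * (F z * vt kap t z)).
  apply/cintgP; split => //; apply: le_lt_trans B _.
  have sF0 : (0 <= \int[leb \x Leb]_z (sqn (F z))%:E)%E by apply: int_ge0 => z; rewrite lee_fin sqn_ge0.
  have W0 : (0 <= W2 kap)%E by apply: int_ge0 => x; rewrite lee_fin mulr_ge0 ?sqr_ge0 ?sqn_ge0.
  rewrite -(fineK (x := W2 kap)) ?ge0_fin_numE// -!EFinM.
  rewrite -(fineK (x := (\int[leb \x Leb]_z (sqn (F z))%:E)%E)) ?ge0_fin_numE// -EFinM -EFinD ltry//.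
by split => //; apply: le_trans (le_normc_cint i1) _.
Qed.

End one_multiplier.

(* [F_k -> f] in L^2 and [kap_k w -> w] in L^2 give [TT F_k kap_k -> TT f 1]. *)
Lemma TT_cvg (f : R * Rn -> R[i]) (F : nat -> R * Rn -> R[i]) (kap : nat -> Rn -> R) t (eps : R) :
  0 < eps -> cmeas f -> (\int[leb \x Leb]_z (sqn (f z))%:E < +oo)%E ->
  (forall k, cmeas (F k)) -> (forall k z, sqn (F k z) <= sqn (f z)) ->
  (forall k, measT (kap k)) -> (forall k x, 0 <= kap k x <= 1) ->
  (forall d : R, 0 < d -> exists K, forall k, (K <= k)%N -> (\int[leb \x Leb]_z (sqn (f z - F k z))%:E <= d%:E)%E) ->
  (forall d : R, 0 < d -> exists K, forall k, (K <= k)%N -> (W2 (fun x => 1 - kap k x)%R <= d%:E)%E) ->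
  exists K, forall k, (K <= k)%N -> normc (TT (F k) (kap k) t - TT f (fun=> 1) t) <= eps.
Proof.
move=> e0 mf sf mF Ff mk k01 hF hk.
have f0 : (0 <= \int[leb \x Leb]_z (sqn (f z))%:E)%E by apply: int_ge0 => z; rewrite lee_fin sqn_ge0.
have W0 k : (0 <= W2 k)%E by apply: int_ge0 => x; rewrite lee_fin mulr_ge0 ?sqr_ge0 ?sqn_ge0.
have W1 : (W2 (fun=> 1%R) < +oo)%E by move: sw; apply: le_lt_trans; apply: eq_leE; apply: eqint => x _; rewrite expr1n mul1r.
pose A := fine (\int[leb \x Leb]_z (sqn (f z))%:E)%E; pose Bw := fine (W2 (fun=> 1%R)).
have Ae : (\int[leb \x Leb]_z (sqn (f z))%:E)%E = A%:E by rewrite /A fineK// ge0_fin_numE.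
have Be : W2 (fun=> 1%R) = Bw%:E by rewrite /Bw fineK// ge0_fin_numE.
have A0 : 0 <= A by exact: fine_ge0. have B0 : 0 <= Bw by exact: fine_ge0.
pose b := `|t| * c2; have b0 : 0 <= b by exact: mulr_ge0.
have e4 : 0 < eps / 4 by rewrite divr_gt0.
(* [l1] is large, to make the fixed norm of the test side harmless where the data differ; [l2] is
   small, to make the fixed norm of the data harmless where the multipliers differ. *)
pose l1 := (b * Bw + 1) / (eps / 4); have l10 : 0 < l1 by rewrite divr_gt0// ltr_pwDr// mulr_ge0.
pose l2 := eps / 4 / (A + 1); have l20 : 0 < l2 by rewrite divr_gt0// ltr_pwDr.
have d10 : 0 < eps / 4 / l1 by exact: divr_gt0.
have b1 : 0 < b + 1 by lra.
have d20 : 0 < eps / 4 * l2 / (b + 1) by apply: divr_gt0 => //; exact: mulr_gt0.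
have [K1 hK1] := hF _ d10; have [K2 hK2] := hk _ d20.
exists (maxn K1 K2) => k; rewrite geq_max => /andP[/hK1 {}hK1 /hK2 {}hK2].
have k1 x : `|kap k x| <= 1 by have /andP[h1 h2] := k01 k x; rewrite ger0_norm.
have o1 (x : Rn) : `|1 : R| <= 1 by rewrite normr1.
have d1 x : `|1 - kap k x| <= 1 by have /andP[h1 h2] := k01 k x; rewrite ger0_norm ?subr_ge0// gerBl.
have md : measT (fun x => 1 - kap k x) by exact: mfunB.
have m1 : measT (fun _ : Rn => 1 : R) by exact: mcst.
have sFk : (\int[leb \x Leb]_z (sqn (F k z))%:E <= A%:E)%E.
  by rewrite -Ae; exact (ge0_le_int (leb \x Leb)%E (msqn (mF k)) (msqn mf) (fun z => sqn_ge0 _) (Ff k)).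
have sFk' := le_lt_trans sFk (ltry A).
have sD := le_lt_trans hK1 (ltry _).
have [i1 n1] := TT_bound m1 o1 t l10 (cmeasB mf (mF k)) sD.
have [i2 n2] := TT_bound md d1 t l20 (mF k) sFk'.
have [i3 _] := TT_bound m1 o1 t l10 mf sf.
have [i4 _] := TT_bound (mk k) k1 t l10 (mF k) sFk'.
have vtB z : vt (fun x => 1 - kap k x) t z = vt (fun=> 1) t z - vt (kap k) t z.
  have j1 := FT_integrable (meas_phn (-1)) z.2 (vt_integrable m1 o1 t z.1).
  have j2 := FT_integrable (meas_phn (-1)) z.2 (vt_integrable (mk k) k1 t z.1).
  by rewrite /vt /FTn /FT -cintB//; apply: eq_cint => x; rewrite creB; ring.
have E : TT f (fun=> 1) t - TT (F k) (kap k) t =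
    TT (fun z => f z - F k z) (fun=> 1) t + TT (F k) (fun x => 1 - kap k x) t.
  rewrite /TT -(cintB i3 i4) -(cintD i1 i2); apply: eq_cint => z; rewrite vtB; ring.
rewrite -[X in normc X]opprB normc_sqrt sqnN -normc_sqrt E; apply: le_trans (le_normcD _ _) _.
have q1 : normc (TT (fun z => f z - F k z) (fun=> 1) t) <= eps / 4 + eps / 4.
  rewrite -lee_fin; apply: le_trans n1 _; rewrite Be -!EFinM EFinD; apply: leeD.
    apply: (@le_trans _ _ (l1%:E * (eps / 4 / l1)%:E)%E); first by apply: lee_wpmul2l => //; rewrite lee_fin ltW.
    by rewrite -EFinM lee_fin mulrC divfK// gt_eqF.
  have bB0 : 0 <= b * Bw by exact: mulr_ge0.
  rewrite lee_fin /l1 invf_div (_ : eps / 4 / (b * Bw + 1) * (`|t| * (c2 * Bw)) = eps / 4 * (b * Bw) / (b * Bw + 1)); last by rewrite /b; ring.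
  by rewrite ler_pdivrMr ?ltr_pwDr//; apply: ler_wpM2l; [exact: ltW|rewrite lerDl].
have q2 : normc (TT (F k) (fun x => 1 - kap k x) t) <= eps / 4 + eps / 4.
  rewrite -lee_fin; apply: le_trans n2 _; rewrite EFinD; apply: leeD.
    apply: (@le_trans _ _ (l2%:E * A%:E)%E); first by apply: lee_wpmul2l => //; rewrite lee_fin ltW.
    by rewrite -EFinM lee_fin /l2 mulrAC ler_pdivrMr ?ltr_pwDr//; apply: ler_wpM2l; [exact: ltW|rewrite lerDl].
  rewrite muleA -EFinM muleA -EFinM.
  apply: (@le_trans _ _ ((l2^-1 * `|t| * c2)%:E * (eps / 4 * l2 / (b + 1))%:E)%E).
    by apply: lee_wpmul2l => //; rewrite lee_fin -mulrA; apply: mulr_ge0 => //; rewrite invr_ge0 ltW.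
  have -> : ((l2^-1 * `|t| * c2)%:E * (eps / 4 * l2 / (b + 1))%:E = ((l2^-1 * l2) * (eps / 4 * b / (b + 1)))%:E)%E.
    by rewrite -EFinM; congr (_%:E); rewrite /b; ring.
  rewrite lee_fin.
  by rewrite mulVf ?gt_eqF// mul1r ler_pdivrMr//; apply: ler_wpM2l; [exact: ltW|rewrite lerDl].
apply: le_trans (lerD q1 q2) _.
suff -> : eps / 4 + eps / 4 + (eps / 4 + eps / 4) = eps by [].
by field.
Qed.

End transform_pairing.

(** * Weak limits in L2 of space-time *)

Section weak_limit.
Context {R : realType} {n : nat}.
Local Notation Rn := 'rV[R]_n.
Local Notation leb := (@lebesgue_measure R).
Local Notation Leb := (@lebesgue_rV R n).

Definition slice_pair (V : R * Rn -> R[i]) (t : R) (psi : Rn -> R[i]) : R[i] :=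
  cint Leb (fun x => V (t, x) * psi x).

Let pair_integrable (V : R * Rn -> R[i]) t psi : cmeas V -> (\int[Leb]_x (sqn (V (t, x)))%:E < +oo)%E ->
  cmeas psi -> (\int[Leb]_x (sqn (psi x))%:E < +oo)%E -> cintg Leb (fun x => V (t, x) * psi x).
Proof.
move=> mV sV mp sp; have mVt : cmeas (fun x => V (t, x)) by exact: (cmeas_comp mV (mpair1 t)).
have m1 := msqn mVt; have m2 := msqn mp.
apply: (le_cintg (G := fun x => 2^-1 * (sqn (V (t, x)) + sqn (psi x)))); first exact: cmeasM.
  apply/integrableP; split; first by apply/mEFin; apply: mfunM => //; exact: mfunD.
  have h2 : 0 <= 2^-1 :> R by rewrite invr_ge0.
  have s0 x : 0 <= sqn (V (t, x)) + sqn (psi x) by rewrite addr_ge0 ?sqn_ge0.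
  under eqint do rewrite /= ger0_norm ?mulr_ge0//.
  rewrite (ge0_intZl Leb h2 (mfunD m1 m2) s0).
  rewrite (ge0_intD Leb m1 m2 (fun x => sqn_ge0 _) (fun x => sqn_ge0 _)).
  rewrite lte_mul_pinfty ?lee_fin//; exact: lte_add_pinfty.
by move=> x; exact: normcM_le.
Qed.

(** Elements of nearly minimal norm converge strongly, and fast enough for [ae_decay] to give
    convergence in L2 of whole slices at almost every time. One null set of times therefore serves
    all test functions at once, although [Phi] may be uncountable. *)
Lemma weak_limit (V_ : nat -> R * Rn -> R[i]) (B : R) (Phi : (Rn -> R[i]) -> Prop) (L : R -> (Rn -> R[i]) -> R[i]) :
  (forall k, cmeas (V_ k)) -> (forall k, \int[leb \x Leb]_z (sqn (V_ k z))%:E <= B%:E)%E ->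
  (forall k t, \int[Leb]_x (sqn (V_ k (t, x)))%:E < +oo)%E ->
  (forall psi, Phi psi -> cmeas psi /\ (\int[Leb]_x (sqn (psi x))%:E < +oo)%E) ->
  (forall t psi, Phi psi -> forall eps : R, 0 < eps ->
     exists K, forall k, (K <= k)%N -> normc (slice_pair (V_ k) t psi - L t psi) <= eps) ->
  exists G : R * Rn -> R[i], [/\ cmeas G, (\int[leb \x Leb]_z (sqn (G z))%:E <= (2 * B)%:E)%E &
    {ae leb, forall t, forall psi, Phi psi -> slice_pair G t psi = L t psi}].
Proof.
move=> mV BV sV hPhi cV.
(* The last clause says that any bound for the tail of [V_] from [N] on also holds for [V]. It is
   stable under midpoints by the triangle inequality, becomes stronger as [N] grows, is satisfied by
   [V_ N], and forces the correct pairings in the limit. *)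
pose K N V := [/\ cmeas V, (\int[leb \x Leb]_z (sqn (V z))%:E <= B%:E)%E,
  forall t, (\int[Leb]_x (sqn (V (t, x)))%:E < +oo)%E &
  forall t psi, Phi psi -> forall eps, (forall k, (N <= k)%N -> normc (slice_pair (V_ k) t psi - L t psi) <= eps) ->
    normc (slice_pair V t psi - L t psi) <= eps].
have mslice (V : R * Rn -> R[i]) t : cmeas V -> cmeas (fun x => V (t, x)).
  by move=> mv; exact: (cmeas_comp mv (mpair1 t)).
have mid_le (v w : R[i]) : sqn ((2^-1)%:C%C * (v + w)) <= 2^-1 * sqn v + 2^-1 * sqn w.
  by rewrite sqnM sqn_real; have := sqnD_le v w; have := sqn_ge0 (v + w); nra.
have h20 : 0 <= 2^-1 :> R by rewrite invr_ge0.
have mid_int d (T : measurableType d) (mu : {measure set T -> \bar R}) (v w : T -> R[i]) : cmeas v -> cmeas w ->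
    (\int[mu]_x (sqn ((2^-1)%:C%C * (v x + w x)))%:E <= (2^-1)%:E * \int[mu]_x (sqn (v x))%:E + (2^-1)%:E * \int[mu]_x (sqn (w x))%:E)%E.
  move=> mv mw; have ms1 := msqn mv; have ms2 := msqn mw.
  rewrite -(ge0_intZl mu h20 ms1 (fun x => sqn_ge0 _)) -(ge0_intZl mu h20 ms2 (fun x => sqn_ge0 _)).
  have n0 (u : T -> R[i]) x : 0 <= 2^-1 * sqn (u x) by rewrite mulr_ge0 ?sqn_ge0.
  rewrite -(ge0_intD mu (mfunM (mcst _) ms1) (mfunM (mcst _) ms2) (n0 v) (n0 w)).
  apply: ge0_le_int.
  - by apply: msqn; apply: cmeasM; [exact: cmeas_cst|exact: cmeasD].
  - by apply: mfunD; exact: mfunM.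
  - by move=> x; exact: sqn_ge0.
  by move=> x; exact: mid_le.
have [u [uK uC]] : exists u : nat -> R * Rn -> R[i], (forall j, K j (u j)) /\
    forall i j, (j <= i)%N -> (\int[leb \x Leb]_x (sqn (u i x - u j x))%:E <= ((16^-1 : R) ^+ j)%:E)%E.
  apply: (@min_norm_cauchy _ _ _ (leb \x Leb)%E K B).
  - by move=> N V [].
  - move=> N v w [mv Bv sv Kv] [mw Bw sw Kw].
    have mvw : cmeas (fun x => (2^-1)%:C%C * (v x + w x)) by apply: cmeasM; [exact: cmeas_cst|exact: cmeasD].
    split => //.
    + apply: le_trans (mid_int _ _ _ _ _ mv mw) _.
      apply: (@le_trans _ _ ((2^-1)%:E * B%:E + (2^-1)%:E * B%:E)%E).
        by apply: leeD; apply: lee_wpmul2l => //; rewrite lee_fin.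
      by rewrite -!EFinM -EFinD lee_fin; lra.
    + move=> t; apply: le_lt_trans (mid_int _ _ _ _ _ (mslice v t mv) (mslice w t mw)) _.
      by apply: lte_add_pinfty; apply: lte_mul_pinfty; rewrite ?lee_fin.
    + move=> t psi hp eps he; have [mp sp] := hPhi _ hp.
      have iv := pair_integrable mv (sv t) mp sp; have iw := pair_integrable mw (sw t) mp sp.
      have -> : slice_pair (fun x => (2^-1)%:C%C * (v x + w x)) t psi - L t psi =
          (2^-1)%:C%C * ((slice_pair v t psi - L t psi) + (slice_pair w t psi - L t psi)).
        rewrite /slice_pair (_ : cint Leb _ = (2^-1)%:C%C * (cint Leb (fun x => v (t, x) * psi x) + cint Leb (fun x => w (t, x) * psi x))).
          set X := cint _ _; set Y := cint _ _; set Z := L _ _.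
          have e : (2^-1)%:C%C * Z + (2^-1)%:C%C * Z = Z.
            rewrite -mulrDl -creD (_ : 2^-1 + 2^-1 = 1 :> R); last by field.
            by rewrite mul1r.
          by rewrite -{1}e; ring.
        rewrite -cintD// -cintZl; last exact: cintgD.
        by apply: eq_cint => x; ring.
      rewrite Normc.normcM normc_real ger0_norm//.
      have := Kv t psi hp eps he; have := Kw t psi hp eps he; have := le_normcD (slice_pair v t psi - L t psi) (slice_pair w t psi - L t psi).
      by set A := normc _; set D := normc _; set E := normc _; lra.
  - move=> N M v NM [mv Bv sv Kv]; split => // t psi hp eps he; apply: Kv => // k Mk; apply: he; exact: leq_trans Mk.
  - move=> N; exists (V_ N); split; [exact: mV|exact: BV|exact: sV|].
    by move=> t psi hp eps; apply.
have mu_ j : cmeas (u j) by case: (uK j).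
have [G mG GC] := @L2_complete R _ _ (leb \x Leb)%E u mu_ uC.
have mGu j : cmeas (fun z => G z - u j z) by exact (cmeasB mG (mu_ j)).
exists G; split => //.
  have p2 : 0 <= 2 :> R by [].
  (* The factor 2 in the conclusion comes from |z + w|^2 <= 2 |z|^2 + 2 |w|^2. *)
  have jB j : (\int[leb \x Leb]_z (sqn (G z))%:E <= (2 * B)%:E + (2 * (16^-1 : R) ^+ j)%:E)%E.
    have [_ Bu _ _] := uK j; have m1 := msqn (mu_ j); have m2 := msqn (mGu j).
    apply: (@le_trans _ _ (\int[leb \x Leb]_z (2 * sqn (u j z) + 2 * sqn (G z - u j z))%:E)%E).
      apply: ge0_le_int.
      - exact: msqn.
      - by apply: mfunD; exact: mfunM.
      - by move=> z; exact: sqn_ge0.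
      by move=> z; have := sqnD_le (u j z) (G z - u j z); rewrite addrC subrK.
    have n0 (v : R * Rn -> R[i]) x : 0 <= 2 * sqn (v x) by rewrite mulr_ge0 ?sqn_ge0.
    rewrite (ge0_intD (leb \x Leb)%E (mfunM (mcst _) m1) (mfunM (mcst _) m2) (n0 (u j)) (n0 (fun z => G z - u j z))).
    rewrite (ge0_intZl (leb \x Leb)%E p2 m1 (fun x => sqn_ge0 _)) (ge0_intZl (leb \x Leb)%E p2 m2 (fun x => sqn_ge0 _)) !EFinM.
    by apply: leeD; apply: lee_wpmul2l.
  apply/lee_addgt0Pr => e e0.
  have ec : (2 * (16^-1 : R) ^+ i) @[i --> \oo] --> (2 * 0 : R).
    apply: cvgM; [exact: cvg_cst|]; apply: cvg_expr; rewrite ger0_norm ?invr_ge0// invf_lt1//; lra.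
  rewrite mulr0 in ec; have [j _ /(_ j (leqnn j)) hj] := (cvgr0_norm_le _ ec) e e0.
  apply: le_trans (jB j) _; apply: leeD => //; rewrite lee_fin; apply: le_trans hj; exact: ler_norm.
have mQ j : measT (fun t => \int[Leb]_x (sqn (G (t, x) - u j (t, x)))%:E)%E.
  apply: (@mintp _ _ _ _ _ Leb (fun t x => (sqn (G (t, x) - u j (t, x)))%:E)); last by move=> *; rewrite lee_fin sqn_ge0.
  by apply/mEFin; have := msqn (mGu j); apply: eq_measurable_fun => -[].
have Q0 j t : (0 <= \int[Leb]_x (sqn (G (t, x) - u j (t, x)))%:E)%E by apply: int_ge0 => x; rewrite lee_fin sqn_ge0.
have QI j : (\int[leb]_t \int[Leb]_x (sqn (G (t, x) - u j (t, x)))%:E <= ((16^-1 : R) ^+ j)%:E)%E.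
  rewrite -(@ge0_prod_int _ _ _ _ _ leb Leb (fun t x => (sqn (G (t, x) - u j (t, x)))%:E)).
  - by apply: le_trans (GC j); apply: eq_leE; apply: eqint => -[].
  - by apply/mEFin; have := msqn (mGu j); apply: eq_measurable_fun => -[].
  - by move=> *; rewrite lee_fin sqn_ge0.
apply: (ae_mono (ae_decay mQ Q0 QI)) => t [C C0 hC] psi hp; have [mp sp] := hPhi _ hp.
have sD j : (\int[Leb]_x (sqn (G (t, x) - u j (t, x)))%:E < +oo)%E by exact: le_lt_trans (hC j) (ltry _).
pose A := fine (\int[Leb]_x (sqn (psi x))%:E)%E.
have p0 : (0 <= \int[Leb]_x (sqn (psi x))%:E)%E by apply: int_ge0 => x; rewrite lee_fin sqn_ge0.
have Ae : (\int[Leb]_x (sqn (psi x))%:E)%E = A%:E by rewrite /A fineK// ge0_fin_numE.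
have A0 : 0 <= A by exact: fine_ge0.
have diff j (lam : R) : 0 < lam -> normc (slice_pair G t psi - slice_pair (u j) t psi) <= lam * (C * 4^-1 ^+ j) + lam^-1 * A.
  move=> l0; have [_ _ su _] := uK j.
  have iD := pair_integrable (mGu j) (sD j) mp sp; have iu := pair_integrable (mu_ j) (su t) mp sp.
  have E : slice_pair G t psi = cint Leb (fun x => (G (t, x) - u j (t, x)) * psi x) + slice_pair (u j) t psi.
    by rewrite /slice_pair -cintD//; apply: eq_cint => x; ring.
  rewrite E addrK -lee_fin; apply: le_trans (le_normc_cint iD) _.
  have ms1 : measT (fun x => sqn (G (t, x) - u j (t, x))) by exact: msqn (mslice _ t (mGu j)).
  have ms2 := msqn mp; have li : 0 <= lam^-1 by rewrite invr_ge0 ltW.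
  apply: (@le_trans _ _ (\int[Leb]_x (lam * sqn (G (t, x) - u j (t, x)) + lam^-1 * sqn (psi x))%:E)%E).
    apply: ge0_le_int.
    - by apply: mnormc; apply: cmeasM => //; exact: (mslice _ t (mGu j)).
    - by apply: mfunD; exact: mfunM.
    - by move=> x; exact: nc_ge0.
    move=> x; rewrite Normc.normcM -!normc_sqrE.
    have f0 := nc_ge0 (G (t, x) - u j (t, x)); have v0 := nc_ge0 (psi x).
    set y := normc _ in f0 *; set v := normc (psi x) in v0 *.
    have sq := sqr_ge0 (lam * y - v); have ll : lam^-1 * lam = 1 by rewrite mulVf// gt_eqF.
    have := mulr_ge0 li sq; have -> : lam^-1 * (lam * y - v) ^+ 2 = (lam^-1 * lam) * lam * y ^+ 2 - 2 * (lam^-1 * lam) * (y * v) + lam^-1 * v ^+ 2 by ring.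
    rewrite ll; have : 0 <= y * v by exact: mulr_ge0.
    lra.
  have n1 x : 0 <= lam * sqn (G (t, x) - u j (t, x)) by apply: mulr_ge0; [exact: ltW|exact: sqn_ge0].
  have n2 x : 0 <= lam^-1 * sqn (psi x) by apply: mulr_ge0 => //; exact: sqn_ge0.
  rewrite (ge0_intD Leb (mfunM (mcst _) ms1) (mfunM (mcst _) ms2) n1 n2).
  rewrite (ge0_intZl Leb (ltW l0) ms1 (fun x => sqn_ge0 _)) (ge0_intZl Leb li ms2 (fun x => sqn_ge0 _)) Ae EFinD !(EFinM lam) (EFinM lam^-1).
  by apply: leeD => //; apply: lee_wpmul2l => //; rewrite lee_fin ltW.
suff H (eps : R) : 0 < eps -> normc (slice_pair G t psi - L t psi) <= 3 * eps.
  apply/eqP; rewrite -subr_eq0; apply/eqP; apply: Normc.eq0_normc; apply/eqP; rewrite eq_le nc_ge0 andbT leNgt; apply/negP => D0.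
  have := H _ (divr_gt0 D0 (ltr0n R 6)); set X := normc _ in D0 *; lra.
move=> e0; pose lam := (A + 1) / eps; have l0 : 0 < lam by rewrite divr_gt0// ltr_pwDr.
have [K0 hK0] := cV t psi hp eps e0.
have ec : (lam * (C * 4^-1 ^+ j)) @[j --> \oo] --> (lam * (C * 0) : R).
  apply: cvgM; [exact: cvg_cst|]; apply: cvgM; [exact: cvg_cst|].
  by apply: cvg_expr; rewrite ger0_norm ?invr_ge0// invf_lt1//; lra.
rewrite !mulr0 in ec; have [K1 _ hK1] := (cvgr0_norm_le _ ec) eps e0.
pose j := maxn K0 K1; have {}hK1 := le_trans (ler_norm _) (hK1 j (leq_maxr _ _)).
have [_ _ _ Kj] := uK j.
have h1 : normc (slice_pair (u j) t psi - L t psi) <= eps.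
  by apply: Kj => // k jk; apply: hK0; exact: leq_trans (leq_maxl _ _) jk.
have h2 := diff j lam l0.
have h3 : lam^-1 * A <= eps.
  by rewrite /lam invf_div mulrAC ler_pdivrMr ?ltr_pwDr//; apply: ler_wpM2l; [exact: ltW|rewrite lerDl].
rewrite -[slice_pair G t psi](subrK (slice_pair (u j) t psi)) -addrA; apply: le_trans (le_normcD _ _) _.
apply: le_trans (lerD (le_trans h2 (lerD hK1 h3)) h1) _.
by suff -> : eps + eps + eps = 3 * eps by []; ring.
Qed.

End weak_limit.

(** * Approximate solutions *)

Section approximants.
Context {R : realType} (n : nat) (m s : R) (hs : 2^-1 < s) (a : 'rV[R]_n.+1 -> R).
Local Notation Rn := 'rV[R]_n.+1.
Local Notation leb := (@lebesgue_measure R).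
Local Notation Leb := (@lebesgue_rV R n.+1).
Local Open Scope complex_scope.
Variable f : R * Rn -> R[i].
Hypotheses (ca : continuous a) (mf : cmeas f) (Wf : (wL2 s f < +oo)%E).

Let ma : measT a. Proof. exact: cont_mrV. Qed.
Let mB : measT (@jp R n.+1 (m - 1)). Proof. exact: meas_japanese. Qed.
Let c2 : R := (2 * pi) ^+ n.+1.
Let c20 : 0 < c2. Proof. by apply: exprn_gt0; apply: mulr_gt0 => //; exact: pi_gt0. Qed.

Let Nk (k : nat) : R := k%:R + 1.
Let Nk1 k : 1 <= Nk k. Proof. by rewrite /Nk lerDr. Qed.
Let Nk0 k : 0 <= Nk k. Proof. exact: le_trans ler01 (Nk1 k). Qed.

(** A cutoff in the size of [f], which together with the cutoff in space-time makes the truncated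
    data bounded. *)
Let low (k : nat) (z : R * Rn) : R := \1_(`[- Nk k, Nk k]%classic) (normc (f z)).
Let cutf k z : R := indT (Nk k) z * low k z.

Definition ftr k z : R[i] := (cutf k z)%:C * f z.

Let mcutf k : measT (cutf k).
Proof.
apply: mfunM; first exact: meas_indT.
have mI : measT (\1_(`[- Nk k, Nk k]%classic) : R -> R) by exact: mindic.
exact: (mcomp mI (mnormc mf)).
Qed.

Let low01 k z : low k z = 0 /\ Nk k < normc (f z) \/ low k z = 1 /\ normc (f z) <= Nk k.
Proof.
have E : (normc (f z) \in (`[- Nk k, Nk k]%classic : set R)) = (normc (f z) <= Nk k).
  apply/idP/idP => [/set_mem|h]; first by rewrite /= in_itv /= => /andP[].
  by apply/mem_set; rewrite /= in_itv /= h andbT; have := nc_ge0 (f z); have := Nk0 k; lra.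
by rewrite /low indicE E; case: leP; [right|left].
Qed.

Let cutf_in k z : 0 <= cutf k z <= 1.
Proof.
have /andP[h1 h2] := indT_in (Nk k) z.
by rewrite /cutf; case: (low01 k z) => -[-> _]; rewrite ?mulr0 ?mulr1 ?lexx ?ler01 ?h1.
Qed.

Lemma ftr_nice k : nice (Nk k) (Nk k) (ftr k).
Proof.
split; first by apply: cmeasM => //; exact: cmeas_real.
  move=> z; rewrite Normc.normcM normc_real.
  have /andP[h1 h2] := indT_in (Nk k) z; have n0 := nc_ge0 (f z).
  rewrite /cutf; case: (low01 k z) => -[-> h]; rewrite ?mulr0 ?normr0 ?mul0r// mulr1 ger0_norm//.
  by apply: le_trans h; rewrite ler_piMl.
by move=> z h; rewrite /ftr /cutf indT0// mul0r mul0r.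
Qed.

Let cmeas_ftr k : cmeas (ftr k). Proof. by have [] := ftr_nice k. Qed.

Lemma ftr_le k z : sqn (ftr k z) <= sqn (f z).
Proof.
have /andP[h1 h2] := cutf_in k z; rewrite /ftr sqnM sqn_real ler_piMl ?sqn_ge0//.
exact: exprn_ile1.
Qed.

Let mw (g : R * Rn -> R[i]) (p : R) : cmeas g -> measT (fun z => japanese z.2 `^ p * sqn (g z)).
Proof.
move=> mg; apply: mfunM; last exact: msqn.
exact: (mcomp (meas_japanese _) msnd).
Qed.

Lemma weight_prod (g : R * Rn -> R[i]) (p : R) : cmeas g ->
  (\int[leb \x Leb]_z (japanese z.2 `^ p * sqn (g z))%:E = \int[leb]_t \int[Leb]_x (japanese x `^ p * sqn (g (t, x)))%:E)%E.
Proof.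
move=> mg; rewrite -(@ge0_prod_int _ _ _ _ _ leb Leb (fun t x => (japanese x `^ p * sqn (g (t, x)))%:E)).
- by apply: eqint => -[].
- by apply/mEFin; have := mw p mg; apply: eq_measurable_fun => -[].
- by move=> t x; rewrite lee_fin mulr_ge0 ?powR_ge0 ?sqn_ge0.
Qed.

Let s0 : 0 <= 2 * s. Proof. by have := hs; lra. Qed.

Lemma ftr_wL2 k : (wL2 s (ftr k) <= wL2 s f)%E.
Proof.
rewrite /wL2 -!weight_prod//; apply: ge0_le_int.
- exact: mw.
- exact: mw.
- by move=> z; rewrite mulr_ge0 ?powR_ge0 ?sqn_ge0.
by move=> z; apply: ler_wpM2l; [exact: powR_ge0|exact: ftr_le].
Qed.

Lemma f_L2 : (\int[leb \x Leb]_z (sqn (f z))%:E < +oo)%E.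
Proof.
apply: le_lt_trans Wf; rewrite /wL2 -weight_prod//; apply: ge0_le_int.
- exact: msqn.
- exact: mw.
- by move=> z; exact: sqn_ge0.
move=> z; rewrite ler_peMl ?sqn_ge0// -[leLHS](powRr0 (japanese z.2)).
by apply: ler_powR => //; exact: japanese_ge1.
Qed.

Let ftr_lim z : exists K, forall k, (K <= k)%N -> ftr k z = f z.
Proof.
have [K1 hK1] := indT_lim z; pose K2 := Num.bound (normc (f z)).
exists (maxn K1 K2) => k; rewrite geq_max => /andP[h1 h2].
have h3 : normc (f z) <= Nk k.
  apply: le_trans (ltW (archi_boundP (nc_ge0 _))) _; apply: (@le_trans _ _ (k%:R : R)); by [rewrite ler_nat|rewrite lerDl].
rewrite /ftr /cutf hK1// mul1r; case: (low01 k z) => -[-> h]; last by rewrite mul1r.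
by move: h; rewrite ltNge h3.
Qed.

Lemma ftr_cvg (d : R) : 0 < d -> exists K, forall k, (K <= k)%N ->
  (\int[leb \x Leb]_z (sqn (f z - ftr k z))%:E <= d%:E)%E.
Proof.
move=> d0; have h1 k : measT (fun z => sqn (f z - ftr k z)) by apply: msqn; exact: cmeasB.
have h2 k z : 0 <= sqn (f z - ftr k z) <= sqn (f z).
  rewrite sqn_ge0 /= (_ : f z - ftr k z = (1 - cutf k z)%:C * f z); last by rewrite creB /ftr mulrBl mul1r.
  have /andP[c0 c1] := cutf_in k z; rewrite sqnM sqn_real ler_piMl ?sqn_ge0//.
  by apply: exprn_ile1; rewrite ?subr_ge0// gerBl.
have h3 z : sqn (f z - ftr k z) @[k --> \oo] --> (0 : R).
  have [K hK] := ftr_lim z; apply: cvg_near_cst.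
  by exists K => // k /= Kk; rewrite hK// subrr sqn0.
exact (@dominated_small R _ _ (leb \x Leb)%E (fun k z => sqn (f z - ftr k z)) (fun z => sqn (f z)) d d0 h1 h2
  (msqn mf) f_L2 h3).
Qed.

Definition Hk k t (z : R * Rn) : R[i] :=
  expi ((t - z.1) * a z.2) * pft (ftr k) z * (jp (m - 1) z.2 * kapN (Nk k) z.2)%:C.

Definition Gk k t xi : R[i] := (et t)%:C * cint leb (fun tau => (Iv t tau)%:C * Hk k t (tau, xi)).

(** The solution for data truncated by [ftr] and frequencies truncated by [kapN]: a genuine
    function, given by absolutely convergent integrals. [Gk] is its transform in space, the oriented
    time integral of [Hk]. *)
Definition gk k (z : R * Rn) : R[i] := (c2^-1)%:C * FTn 1 (Gk k z.1) z.2.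

Let mHk2 k d (T : measurableType d) (t : T -> R) (z : T -> R * Rn) : measT t -> measT z ->
  cmeas (fun y => Hk k (t y) (z y)).
Proof.
move=> mt mz; have m1 := mcomp mfst mz; have m2 := mcomp msnd mz.
apply: cmeasM; last first.
  apply: cmeas_real; apply: mfunM; [exact: (mcomp mB m2)|].
  exact (mcomp (meas_kapN (Nk k)) m2).
apply: cmeasM; last exact: (cmeas_comp (cmeas_pft (ftr_nice k)) mz).
apply: cmeas_expi; apply: mfunM; [exact: mfunB|exact: (mcomp ma m2)].
Qed.

Lemma Hk_nice k : exists2 M, 0 <= M & forall t, nice M (2 * Nk k) (Hk k t).
Proof.
have [D D0 hD] := @jp_inbox_bound R n m (Nk k) (Nk1 k).
pose M0 := Nk k * boxvol (n := n.+1) (Nk k).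
have M00 : 0 <= M0 by apply: mulr_ge0 => //; exact: boxvol_ge0.
exists (M0 * D) => [|t]; first exact: mulr_ge0.
split; first exact: mHk2.
  move=> z; rewrite !normc_sqrt !sqnM sqn_expi mul1r sqrtrM ?sqn_ge0// -!normc_sqrt normc_real.
  apply: ler_pM => //; [exact: nc_ge0|exact: (pft_bound (ftr_nice k) z)|].
  have [hx|hx] := pselect (inbox (2 * Nk k) z.2); last first.
    have [j hj] : exists j, 2 * Nk k < `|z.2 ord0 j|.
      apply: contrapT => /forallNP hn; apply: hx => j; rewrite leNgt; apply/negP; exact: hn.
    by rewrite (kapN0 (Nk1 k) (ltW hj)) mulr0 normr0.
  have /andP[k0 k1] := kapN_in (Nk1 k) z.2; have j0 := jp_gt0 (m - 1) z.2.
  rewrite ger0_norm; last by apply: mulr_ge0 => //; exact: ltW.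
  by rewrite -[leRHS]mulr1; apply: ler_pM => //; [exact: ltW|exact: hD].
move=> z hz; have [h1|h1] := leP `|z.1| (Nk k); last by rewrite /Hk (pft_out (ftr_nice k) h1) mulr0 mul0r.
have [j hj] : exists j, 2 * Nk k < `|z.2 ord0 j|.
  apply: contrapT => /forallNP hn; apply: hz; split; first by have := Nk0 k; lra.
  by move=> j; rewrite leNgt; apply/negP; exact: hn.
by rewrite /Hk (kapN0 (Nk1 k) (ltW hj)) !mulr0.
Qed.

Let mIH k : cmeas (fun p : (R * Rn) * R => (Iv p.1.1 p.2)%:C * Hk k p.1.1 (p.2, p.1.2)).
Proof.
have m11 : measT (fun p : (R * Rn) * R => p.1.1) by exact: (mcomp mfst mfst).
have m12 : measT (fun p : (R * Rn) * R => p.1.2) by exact: (mcomp msnd mfst).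
apply: cmeasM.
  apply: cmeas_real; exact (mcomp meas_Iv (mpair m11 msnd)).
exact (mHk2 k m11 (mpair msnd m12)).
Qed.

Lemma cmeas_Gk k : cmeas (fun p : R * Rn => Gk k p.1 p.2).
Proof.
apply: cmeasM; last exact: (cmeas_cint leb (mIH k)).
have met : measT (@et R).
  have -> : @et R = (fun t => 2 * \1_(`[0, +oo[%classic) t - 1).
    apply/funext => t; rewrite /et indicE; case: ifPn => h.
      by rewrite mem_set ?mulr1; [ring|rewrite /= in_itv /= h].
    by rewrite memNset ?mulr0 ?sub0r//= in_itv /= andbT; exact/negP.
  apply: mfunB => //; apply: mfunM => //; exact: mindic.
by apply: cmeas_real; exact: (mcomp met mfst).
Qed.

Lemma Gk_bound k : exists2 M, 0 <= M & forall t xi, normc (Gk k t xi) <= M /\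
  (~ inbox (2 * Nk k) xi -> Gk k t xi = 0).
Proof.
have [M M0 hM] := Hk_nice k; have T0 : 0 <= 2 * Nk k by apply: mulr_ge0.
exists (M * (2 * (2 * Nk k))) => [|t xi]; first by rewrite !mulr_ge0.
have [_ HM H0] := hM t.
have mI : cmeas (fun tau => (Iv t tau)%:C * Hk k t (tau, xi)).
  exact: (cmeas_comp (mIH k) (mpair1 (t, xi))).
split; last first.
  move=> hx; rewrite /Gk (_ : (fun tau => _) = fun=> 0) ?cint0 ?mulr0//; apply/funext => tau.
  by rewrite H0 ?mulr0// => -[_]; exact: hx.
rewrite /Gk Normc.normcM normc_real et_norm mul1r -lee_fin.
apply: le_trans (le_normc_cint_meas leb mI) _.
apply: (int_le_support M0 T0 mI) => [tau|tau h].
  have /andP[i0 i1] := Iv01 t tau; have h0 := nc_ge0 (Hk k t (tau, xi)).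
  rewrite Normc.normcM normc_real ger0_norm//.
  by apply: le_trans (HM (tau, xi)); rewrite ler_piMl.
by rewrite H0 ?mulr0// => -[h1 _]; move: h; rewrite ltNge h1.
Qed.

Let iGk k t : cintg Leb (Gk k t).
Proof.
have [M M0 hM] := Gk_bound k; apply: (@box_cintg _ _ _ M (2 * Nk k)).
- exact: (cmeas_comp (cmeas_Gk k) (mpair1 t)).
- by move=> x; have [] := hM t x.
- by move=> x; have [_] := hM t x.
Qed.

Lemma cmeas_gk k : cmeas (gk k).
Proof.
apply: cmeasM; first exact: cmeas_cst.
apply: (@cmeas_cint _ _ _ _ _ Leb (fun q : (R * Rn) * Rn => expi (phn 1 (q.1.2, q.2)) * Gk k q.1.1 q.2)).
have m11 : measT (fun p : (R * Rn) * Rn => p.1.1) by exact: (mcomp mfst mfst).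
have m12 : measT (fun p : (R * Rn) * Rn => p.1.2) by exact: (mcomp msnd mfst).
apply: cmeasM; last exact (cmeas_comp (cmeas_Gk k) (mpair m11 msnd)).
apply: cmeas_expi; exact (mcomp (meas_phn 1) (mpair m12 msnd)).
Qed.

Lemma gk_bound k : exists2 M, 0 <= M & forall z, normc (gk k z) <= M.
Proof.
have [M M0 hM] := Gk_bound k; pose V := boxvol (n := n.+1) (2 * Nk k).
have V0 : 0 <= V by exact: boxvol_ge0.
have ci : 0 <= c2^-1 by rewrite invr_ge0 ltW.
exists (c2^-1 * (M * V)) => [|z]; first by rewrite !mulr_ge0.
rewrite Normc.normcM normc_real ger0_norm//; apply: ler_wpM2l => //.
rewrite -lee_fin; have i1 := FT_integrable (meas_phn 1) z.2 (iGk k z.1).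
apply: le_trans (le_normc_cint i1) _.
apply: (@le_trans _ _ (\int[Leb]_x (normc (Gk k z.1 x))%:E)%E).
  by apply: eq_leE; apply: eqint => x _; rewrite !normc_sqrt sqnM sqn_expi mul1r.
apply: box_int_le.
- exact: (cmeas_comp (cmeas_Gk k) (mpair1 z.1)).
- by move=> x; have [] := hM z.1 x.
- by move=> x; have [_] := hM z.1 x.
Qed.

Let FTn_bounded u : cintg Leb u -> exists D, forall x, normc (FTn 1 u x) <= D.
Proof.
move=> iu; exists (fine (\int[Leb]_x (normc (u x))%:E)%E) => x.
have /cintgP[_ fu] := iu; rewrite -lee_fin fineK; last by rewrite ge0_fin_numE//; apply: int_ge0 => y; rewrite lee_fin nc_ge0.
apply: le_trans (le_normc_cint (FT_integrable (meas_phn 1) x iu)) _.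
by apply: eq_leE; apply: eqint => y _; rewrite !normc_sqrt sqnM sqn_expi mul1r.
Qed.

Let Hk_FTn_integrable k t tau u : cintg Leb u -> cintg Leb (fun xi => Hk k t (tau, xi) * FTn 1 u xi).
Proof.
move=> iu; have mFT : cmeas (FTn 1 u) := cmeas_FT Leb (meas_phn 1) (cintg_meas iu).
have [D hD] := FTn_bounded iu; have [M M0 hM] := Hk_nice k; have [mH HM H0] := hM t.
have mHt : cmeas (fun xi => Hk k t (tau, xi)) by exact: (cmeas_comp mH (mpair1 tau)).
have iHt : cintg Leb (fun xi => Hk k t (tau, xi)).
  by apply: (@box_cintg _ _ _ M (2 * Nk k)) => // x hx; apply: H0 => -[_].
have := cintgM mFT hD iHt; congr (cintg _ _); apply/funext => x; exact: mulrC.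
Qed.

Lemma gk_dual k t u : cintg Leb u ->
  cint Leb (fun x => gk k (t, x) * u x) =
  (et t)%:C * cint leb (fun tau => (Iv t tau)%:C * ((c2^-1)%:C * cint Leb (fun xi => Hk k t (tau, xi) * FTn 1 u xi))).
Proof.
move=> iu; have [M M0 hM] := Hk_nice k; have nH := hM t; have iH := nice_prod_integrable nH.
have mFT : cmeas (FTn 1 u) := cmeas_FT Leb (meas_phn 1) (cintg_meas iu).
have [D hD] := FTn_bounded iu.
have mFT2 : cmeas (fun z : R * Rn => FTn 1 u z.2) by exact: (cmeas_comp mFT msnd).
have mIz : measT (fun z : R * Rn => Iv t z.1).
  exact: (mcomp meas_Iv (mcomp (mpair1 t) mfst)).
have i1 : cintg (leb \x Leb)%E (fun z => (Iv t z.1)%:C * (FTn 1 u z.2 * Hk k t z)).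
  have i0 : cintg (leb \x Leb)%E (fun z => FTn 1 u z.2 * Hk k t z)
    := @cintgM R _ _ (leb \x Leb)%E (fun z => FTn 1 u z.2) (Hk k t) D mFT2 (fun z => hD z.2) iH.
  have hI (z : R * Rn) : normc ((Iv t z.1)%:C) <= 1.
    by rewrite normc_real; have /andP[h1 h2] := Iv01 t z.1; rewrite ger0_norm.
  exact (@cintgM R _ _ (leb \x Leb)%E (fun z => (Iv t z.1)%:C) _ 1 (cmeas_real mIz) hI i0).
have it xi : cintg leb (fun tau => (Iv t tau)%:C * Hk k t (tau, xi)).
  have [_ HM H0] := nH; have mI : cmeas (fun tau => (Iv t tau)%:C * Hk k t (tau, xi)).
    exact: (cmeas_comp (mIH k) (mpair1 (t, xi))).
  apply: (bsupp_cintg (M := M) (N := 2 * Nk k)) => // [tau|tau h].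
    have /andP[i0 i2] := Iv01 t tau; have h0 := nc_ge0 (Hk k t (tau, xi)).
    rewrite Normc.normcM normc_real ger0_norm//.
    by apply: le_trans (HM (tau, xi)); rewrite ler_piMl.
  by rewrite H0 ?mulr0// => -[h1 _]; move: h; rewrite ltNge h1.
have ix tau := Hk_FTn_integrable k t tau iu.
transitivity ((c2^-1)%:C * cint Leb (fun x => FTn 1 (Gk k t) x * u x)).
  rewrite -cintZl; first by apply: eq_cint => x; rewrite /gk mulrA.
  have [D2 hD2] := FTn_bounded (iGk k t).
  exact (cintgM (cmeas_FT Leb (meas_phn 1) (cintg_meas (iGk k t))) hD2 iu).
rewrite (FT_dual (iGk k t) iu).
have i2 : cintg leb (fun tau => (Iv t tau)%:C * cint Leb (fun xi => Hk k t (tau, xi) * FTn 1 u xi)).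
  have := cintg_cint1 i1; congr (cintg _ _); apply/funext => tau /=; rewrite -cintZl//.
  by apply: eq_cint => x; ring.
have e1 : cint Leb (fun xi => cint leb (fun tau => (Iv t tau)%:C * (FTn 1 u xi * Hk k t (tau, xi)))) =
    cint leb (fun tau => (Iv t tau)%:C * cint Leb (fun xi => Hk k t (tau, xi) * FTn 1 u xi)).
  rewrite -(cint_Fubini i1); apply: eq_cint => tau /=; rewrite -cintZl//.
  by apply: eq_cint => x; ring.
have -> : (fun xi => Gk k t xi * FTn 1 u xi) = (fun xi => (et t)%:C * cint leb (fun tau => (Iv t tau)%:C * (FTn 1 u xi * Hk k t (tau, xi)))).
  apply/funext => xi; rewrite /Gk -mulrA; congr (_ * _); rewrite -(cintZr (FTn 1 u xi) (it xi)).
  by apply: eq_cint => tau; ring.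
have i3 : cintg Leb (fun xi => cint leb (fun tau => (Iv t tau)%:C * (FTn 1 u xi * Hk k t (tau, xi)))).
  have [D2 D20 hD2] := Gk_bound k.
  have : cintg Leb (fun xi => (et t)%:C * (FTn 1 u xi * Gk k t xi)).
    by apply: cintgZl; exact: cintgM mFT hD (iGk k t).
  congr (cintg _ _); apply/funext => xi; rewrite /Gk mulrCA [X in _ * X]mulrA -creM.
  have -> : et t * et t = 1 by rewrite /et; case: ifP; rewrite ?mulr1 ?mulrNN ?mulr1.
  rewrite mul1r -(cintZl (FTn 1 u xi) (it xi)); by apply: eq_cint => tau; ring.
rewrite cintZl// e1 mulrCA; congr (_ * _); rewrite -cintZl//; apply: eq_cint => tau; ring.
Qed.

Lemma fourierE (phi : Rn -> R[i]) : fourier phi = FTn (-1) phi.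
Proof. by apply/funext => xi; apply: eq_cint => x; rewrite /phn /= mulN1r. Qed.

Lemma inv_fourierE (phi : Rn -> R[i]) : inv_fourier phi = fun xi => (c2^-1)%:C * FTn 1 phi xi.
Proof. by apply/funext => xi; congr (_ * _); apply: eq_cint => x; rewrite /phn /= mul1r dotpC. Qed.

(** The symbol of <D>^(m-1) moved to the test function, on the Fourier side. *)
Definition wsym (phi : Rn -> R[i]) (xi : Rn) : R[i] := (jp (m - 1) xi)%:C * inv_fourier phi xi.

Lemma rapidc_wsym phi : rapidc phi -> rapidc (wsym phi).
Proof.
move=> hp; apply: rapidc_jp; rewrite inv_fourierE; apply: rapidcZ; apply: rapidc_FTn => //; by left.
Qed.

(** The composition of the Bessel multiplier with the propagator leaves the inverse transform of a
    transform between the two symbols; here it is removed. *)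
Lemma inv_fourierK (w : Rn -> R[i]) : rapidc w -> inv_fourier (fourier w) = w.
Proof.
move=> hw; rewrite fourierE inv_fourierE; apply/funext => x; rewrite fourier_inversion// mulrA -creM mulVf ?gt_eqF//.
by rewrite mul1r.
Qed.

Let wsym_int phi : rapidc phi -> cintg Leb (wsym phi) /\ (\int[Leb]_x (sqn (wsym phi x))%:E < +oo)%E.
Proof.
move=> /rapidc_wsym hw; split; first exact: rapidc_integrable.
apply: le_lt_trans (rapidc_weight_sqr 0 hw); apply: eq_leE; apply: eqint => x _.
by rewrite /jp powRr0 mul1r.
Qed.

Let ftr_L2 k : (\int[leb \x Leb]_z (sqn (ftr k z))%:E < +oo)%E.
Proof.
apply: le_lt_trans f_L2.
exact (ge0_le_int (leb \x Leb)%E (msqn (cmeas_ftr k)) (msqn mf) (fun z => sqn_ge0 _) (ftr_le k)).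
Qed.

Let Iv_in t tau (z : R[i]) (F : Rn -> R[i]) : z = cint Leb F ->
  (Iv t tau)%:C * z = cint Leb (fun x => (Iv t tau)%:C * F x).
Proof.
move=> ->; have [->|->] := IvP t tau.
  by rewrite mul0r -(cint0 Leb); apply: eq_cint => x; rewrite mul0r.
by rewrite mul1r; apply: eq_cint => x; rewrite mul1r.
Qed.

Let one_le (x : Rn) : `|1 : R| <= 1. Proof. by rewrite normr1. Qed.
Let kap_le k (x : Rn) : `|kapN (Nk k) x| <= 1.
Proof. by have /andP[h1 h2] := kapN_in (Nk1 k) x; rewrite ger0_norm. Qed.

Lemma gk_test k t phi : rapidc phi ->
  cint Leb (fun x => gk k (t, x) * phi x) = (et t)%:C * TT a (wsym phi) (ftr k) (kapN (Nk k)) t.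
Proof.
move=> hp; have ip := rapidc_integrable hp; have [iw sw] := wsym_int hp.
have [i1 _] := TT_bound ma iw sw (meas_kapN (Nk k)) (kap_le k) t ltr01 (cmeas_ftr k) (ftr_L2 k).
rewrite gk_dual// /TT (cint_prod1 i1); congr (_ * _); apply: eq_cint => tau; apply: Iv_in.
rewrite -cintZl; last exact: Hk_FTn_integrable.
have iv := vt_integrable ma iw (meas_kapN (Nk k)) (kap_le k) t tau.
rewrite -(FT_dual (nice_integrable (ftr_nice k) tau) iv); apply: eq_cint => xi.
rewrite /Hk /wsym inv_fourierE /= creM /pft /=; ring.
Qed.

Lemma bessel_duhamelE t phi : rapidc phi ->
  bessel (m - 1) (duhamel a f t) phi = (et t)%:C * TT a (wsym phi) f (fun=> 1) t.
Proof.
move=> hp; have [iw sw] := wsym_int hp; have hw := rapidc_wsym hp.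
have [i1 _] := TT_bound ma iw sw (mcst (1 : R)) one_le t ltr01 mf f_L2.
rewrite /TT (cint_prod1 i1) /bessel /multiplier /dist_inv_fourier /dist_mul /dist_fourier /duhamel /dist_integral0.
rewrite cintegral0E; congr (_ * _); apply: eq_cint => tau; apply: Iv_in.
have e : (fun xi : Rn => expi ((t - tau) * a xi) * inv_fourier (fourier (wsym phi)) xi) =
    (fun xi => expi ((t - tau) * a xi) * (1%:C * wsym phi xi)).
  by apply/funext => xi; rewrite (inv_fourierK hw) mul1r.
have e2 : forall x, fourier (fun xi : Rn => expi ((t - tau) * a xi) * inv_fourier (fourier (wsym phi)) xi) x =
    vt a (wsym phi) (fun=> 1) t (tau, x).
  by move=> x; rewrite e fourierE.
by apply: eq_cint => x; exact: (congr1 (fun z => f (tau, x) * z) (e2 x)).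
Qed.

Lemma gk_test_cvg t phi (eps : R) : rapidc phi -> 0 < eps -> exists K, forall k, (K <= k)%N ->
  normc (cint Leb (fun x => gk k (t, x) * phi x) - bessel (m - 1) (duhamel a f t) phi) <= eps.
Proof.
move=> hp e0; have [iw sw] := wsym_int hp.
have k01 k (x : Rn) : 0 <= kapN (Nk k) x <= 1 by exact: kapN_in (Nk1 k) x.
have kc (d : R) : 0 < d -> exists K, forall k, (K <= k)%N ->
    (\int[Leb]_x ((1 - kapN (Nk k) x)%R ^+ 2 * sqn (wsym phi x))%:E <= d%:E)%E.
  move=> d0; have mw2 := msqn (cintg_meas iw).
  have h1 k : measT (fun x : Rn => (1 - kapN (Nk k) x)%R ^+ 2 * sqn (wsym phi x)).
    apply: mfunM => //; apply: mfunX; apply: mfunB => //; exact: meas_kapN.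
  have h2 k (x : Rn) : 0 <= (1 - kapN (Nk k) x)%R ^+ 2 * sqn (wsym phi x) <= sqn (wsym phi x).
    have /andP[c0 c1] := k01 k x; rewrite mulr_ge0 ?sqr_ge0 ?sqn_ge0//= ler_piMl ?sqn_ge0//.
    by apply: exprn_ile1; rewrite ?subr_ge0// gerBl.
  have h3 (x : Rn) : (1 - kapN (Nk k) x)%R ^+ 2 * sqn (wsym phi x) @[k --> \oo] --> (0 : R).
    (* At time 0, [indT_lim] says that [x] eventually lies in the cube on which [kapN] is 1. *)
    have [K hK] := indT_lim (0 : R, x); apply: cvg_near_cst; exists K => // k /= Kk.
    rewrite kapN1 ?subrr ?expr0n ?mul0r// => j; rewrite leNgt; apply/negP => hj.
    have := hK k Kk; rewrite indT0 => [/eqP|[_ /(_ j)]]; first by rewrite eq_sym oner_eq0.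
    by rewrite leNgt hj.
  exact (@dominated_small R _ _ Leb _ (fun x => sqn (wsym phi x)) d d0 h1 h2 mw2 sw h3).
have [K hK] := @TT_cvg R n a (wsym phi) ma iw sw f ftr (fun k => kapN (Nk k)) t eps e0 mf f_L2 cmeas_ftr ftr_le
  (fun k => meas_kapN (Nk k)) k01 ftr_cvg kc.
exists K => k Kk; rewrite gk_test// bessel_duhamelE// -mulrBr Normc.normcM normc_real et_norm mul1r; exact: hK.
Qed.

(** With conj(h) as test function the frequency integral is exactly [pairing]. Since the bilinear
    estimate controls the integral of its modulus over all [tau], the restriction to the interval
    between 0 and [t] costs nothing. *)
Lemma gk_pairing k (h : R * Rn -> R[i]) Mh Th t : nice Mh Th h ->
  ((normc (cint Leb (fun x => gk k (t, x) * conjc (h (t, x)))))%:E <=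
   (c2^-1)%:E * \int[leb]_tau (normc (pairing m a (Nk k) (ftr k) h t tau))%:E)%E.
Proof.
move=> nh; have iht := nice_integrable nh t; have ih := cintg_conj iht.
have E tau : cint Leb (fun xi => Hk k t (tau, xi) * FTn 1 (fun x => conjc (h (t, x))) xi) = pairing m a (Nk k) (ftr k) h t tau.
  apply: eq_cint => xi; have -> : FTn 1 (fun x => conjc (h (t, x))) xi = conjc (pft h (t, xi)).
    rewrite /pft /FTn /FT -cint_conj; last exact: (FT_integrable (meas_phn (-1)) xi iht).
    by apply: eq_cint => y; rewrite conjcM conj_expi /phn /= mul1r mulN1r opprK.
  by rewrite /Hk /=; ring.
have mFT : cmeas (FTn 1 (fun x => conjc (h (t, x)))) := cmeas_FT Leb (meas_phn 1) (cintg_meas ih).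
have [M M0 hM] := Hk_nice k; have [mH _ _] := hM t.
have mP : cmeas (fun tau => pairing m a (Nk k) (ftr k) h t tau).
  have -> : (fun tau => pairing m a (Nk k) (ftr k) h t tau) = (fun tau => cint Leb (fun xi => Hk k t (tau, xi) * FTn 1 (fun x => conjc (h (t, x))) xi)).
    by apply/funext => tau; rewrite E.
  apply: (cmeas_cint Leb (F := fun p : R * Rn => Hk k t p * FTn 1 (fun x => conjc (h (t, x))) p.2)).
  by apply: cmeasM => //; exact: (cmeas_comp mFT msnd).
rewrite gk_dual// Normc.normcM normc_real et_norm mul1r.
have mI : measT (Iv t) by exact: (mcomp meas_Iv (mpair1 t)).
under eq_cint do rewrite E.
have mF : cmeas (fun tau => (Iv t tau)%:C * ((c2^-1)%:C * pairing m a (Nk k) (ftr k) h t tau)).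
  by apply: cmeasM; [exact: cmeas_real|apply: cmeasM => //; exact: cmeas_cst].
have ci : 0 <= c2^-1 by rewrite invr_ge0 ltW.
apply: le_trans (le_normc_cint_meas leb mF) _.
rewrite -(ge0_intZl leb ci (mnormc mP) (fun x => nc_ge0 _)); apply: ge0_le_int.
- exact: mnormc.
- by apply: mfunM => //; exact: mnormc.
- by move=> x; exact: nc_ge0.
move=> tau; rewrite !Normc.normcM !normc_real (ger0_norm ci).
have /andP[i0 i1] := Iv01 t tau; rewrite ger0_norm// ler_piMl//; apply: mulr_ge0 => //; exact: nc_ge0.
Qed.

End approximants.

Lemma jp_mulN {R : realType} {n : nat} (r : R) (x : 'rV[R]_n) : japanese x `^ r * japanese x `^ (- r) = 1.
Proof. by rewrite -[LHS]/(jp r x * jp (- r) x) -jpD subrr /jp powRr0. Qed.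

(** The term in [Q] on the right of the hypothesis is half of the left side, so it can be absorbed;
    this requires [Q] to be finite. *)
Lemma absorb_scaled {R : realType} (c : R) (Q W : \bar R) : 0 < c -> (0 <= Q)%E -> (Q < +oo)%E -> (0 <= W)%E -> (W < +oo)%E ->
  ((2 * c)^-1%:E * Q <= c%:E * (W + ((2 * c)^-1 ^+ 2)%:E * Q))%E -> (Q <= ((2 * c) ^+ 2)%:E * W)%E.
Proof.
move=> c0; case: Q => [q| |]//; case: W => [w| |]// _ _ _ _; rewrite !lee_fin => key.
have h2 : 0 < 2 * c by exact: mulr_gt0.
have := ler_wpM2l (ltW (mulr_gt0 h2 h2)) key.
have -> : 2 * c * (2 * c) * ((2 * c)^-1 * q) = 2 * c * q by field; rewrite gt_eqF.
have -> : 2 * c * (2 * c) * (c * (w + (2 * c)^-1 ^+ 2 * q)) = c * ((2 * c) ^+ 2 * w + q).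
  by field; rewrite gt_eqF.
move=> k2; rewrite -(ler_pM2l c0); move: k2.
by rewrite mulrDr -mulrA mulr_natl mulr2n lerD2r.
Qed.

Lemma gk_slice_L2 {R : realType} n (m : R) (a : 'rV[R]_n.+1 -> R) (f : R * 'rV[R]_n.+1 -> R[i]) k t :
  continuous a -> cmeas f -> (\int[lebesgue_rV n.+1]_x (sqn (gk m a f k (t, x)))%:E < +oo)%E.
Proof.
move=> ca mf; have [M M0 hM] := Gk_bound m ca mf k; set G := Gk m a f k t.
have mG : cmeas G by exact: (cmeas_comp (cmeas_Gk m ca mf k) (mpair1 t)).
have iG : cintg (lebesgue_rV n.+1) G.
  by apply: (@box_cintg _ _ _ M (2 * (k%:R + 1))) => // x; have [] := hM t x.
have /cintgP[_ nG] := iG; have mn := mnormc mG.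
have sG : (\int[lebesgue_rV n.+1]_x (sqn (G x))%:E < +oo)%E.
  apply: (@le_lt_trans _ _ (\int[lebesgue_rV n.+1]_x (M * normc (G x))%:E)%E).
    apply: ge0_le_int.
    - exact: msqn.
    - exact: mfunM.
    - by move=> x; exact: sqn_ge0.
    move=> x; rewrite -normc_sqrE expr2; apply: ler_wpM2r; first exact: nc_ge0.
    by have [] := hM t x.
  rewrite (ge0_intZl (lebesgue_rV n.+1) M0 mn (fun x => nc_ge0 _)).
  by apply: lte_mul_pinfty; rewrite ?lee_fin.
have mF : cmeas (FTn 1 G) := cmeas_FT (lebesgue_rV n.+1) (meas_phn 1) mG.
have k0 : 0 <= ((2 * pi) ^+ n.+1)^-1 ^+ 2 :> R by exact: sqr_ge0.
have -> : (\int[lebesgue_rV n.+1]_x (sqn (gk m a f k (t, x)))%:E =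
    \int[lebesgue_rV n.+1]_x ((((2 * pi) ^+ n.+1)^-1 ^+ 2 : R) * sqn (FTn 1 G x))%:E)%E.
  by apply: eqint => x _; rewrite /gk sqnM sqn_real.
rewrite (ge0_intZl (lebesgue_rV n.+1) k0 (msqn mF) (fun x => sqn_ge0 _)).
apply: lte_mul_pinfty; rewrite ?lee_fin//.
apply: le_lt_trans (@bessel_rV R n.+1 1 (or_introl erefl) G iG sG) _.
apply: lte_mul_pinfty; rewrite ?lee_fin//; apply: exprn_ge0; apply: mulr_ge0 => //; exact: pi_ge0.
Qed.

(** * Uniform weighted bound by duality *)

Section weighted_bound.
Context {R : realType} (n : nat) (m s : R) (hs : 2^-1 < s) (a : 'rV[R]_n.+1 -> R).
Local Notation Rn := 'rV[R]_n.+1.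
Local Notation leb := (@lebesgue_measure R).
Local Notation Leb := (@lebesgue_rV R n.+1).
Local Open Scope complex_scope.
Variables (f : R * Rn -> R[i]) (C : R).
Hypotheses (ca : continuous a) (mf : cmeas f) (Wf : (wL2 s f < +oo)%E) (C0 : 0 <= C)
  (hC : forall N : R, 1 <= N -> forall f h Mf Tf Mh Th, nice Mf Tf f -> nice Mh Th h ->
  (\int[leb]_t \int[leb]_tau (normc (pairing m a N f h t tau))%:E <= C%:E * (wL2 s f + wL2 s h))%E).

Let c2 : R := (2 * pi) ^+ n.+1.
Let c20 : 0 < c2. Proof. by apply: exprn_gt0; apply: mulr_gt0 => //; exact: pi_gt0. Qed.

Definition Cdual : R := c2^-1 * C + 1.

Lemma Cdual_gt0 : 0 < Cdual.
Proof. by rewrite ltr_pwDr// mulr_ge0// invr_ge0 ltW. Qed.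

Variable k : nat.
Let g := gk m a f k.
Let mg : cmeas g. Proof. exact: cmeas_gk. Qed.
Let W := wL2 s f.
Let W0 : (0 <= W)%E.
Proof. by apply: int_ge0 => t; apply: int_ge0 => x; rewrite lee_fin mulr_ge0 ?powR_ge0 ?sqn_ge0. Qed.

Let p (z : R * Rn) : R := japanese z.2 `^ (- (2 * s)) * sqn (g z).
Let p0 z : 0 <= p z. Proof. by rewrite mulr_ge0 ?powR_ge0 ?sqn_ge0. Qed.
Let mp : measT p.
Proof.
apply: mfunM; last exact: msqn.
exact: (mcomp (meas_japanese _) msnd).
Qed.

Let jle1 (x : Rn) : japanese x `^ (- (2 * s)) <= 1.
Proof.
rewrite -[leRHS](powRr0 (japanese x)); apply: ler_powR; first exact: japanese_ge1.
by have := hs; lra.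
Qed.

Section box.
Variable T : R.
Let q (z : R * Rn) : R := p z * indT T z.
Let q0 z : 0 <= q z. Proof. by have /andP[h1 _] := indT_in T z; exact: mulr_ge0. Qed.
Let mq : measT q. Proof. by apply: mfunM => //; exact: meas_indT. Qed.
Let Q := (\int[leb]_t \int[Leb]_x (q (t, x))%:E)%E.

Let qnice : exists M, nice M T (fun z => (q z)%:C).
Proof.
have [M M0 hM] := gk_bound m ca mf k; exists (M ^+ 2); split; first exact: cmeas_real.
  move=> z; rewrite normc_real ger0_norm//; have /andP[h1 h2] := indT_in T z.
  have h3 : sqn (g z) <= M ^+ 2 by rewrite -normc_sqrE lerXn2r// ?nnegrE ?nc_ge0//; exact: hM.
  have h4 : p z <= M ^+ 2.
    by apply: le_trans h3; rewrite ler_piMl ?sqn_ge0//; exact: jle1.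
  by apply: le_trans h4; rewrite ler_piMr.
by move=> z h; rewrite /q indT0// mulr0.
Qed.

Let mqE : measT (fun z : R * Rn => (q (z.1, z.2))%:E).
Proof. by apply/mEFin; move: mq; apply: eq_measurable_fun => -[]. Qed.

Let Q_prod : Q = (\int[leb \x Leb]_z (q z)%:E)%E.
Proof.
rewrite /Q -(@ge0_prod_int _ _ _ _ _ leb Leb (fun t x => (q (t, x))%:E) mqE); first by apply: eqint => -[].
by move=> t x; rewrite lee_fin.
Qed.

Let Q0 : (0 <= Q)%E. Proof. by apply: int_ge0 => t; apply: int_ge0 => x; rewrite lee_fin. Qed.

Let Q_lty : (Q < +oo)%E.
Proof.
have [M nq] := qnice; have /cintgP[_] := nice_prod_integrable nq; apply: le_lt_trans.
by rewrite Q_prod; apply: eq_leE; apply: eqint => z _; rewrite normc_real ger0_norm.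
Qed.

(** The approximate solution is tested against itself, weighted by [lam] <x>^(-2s) and cut to a box.
    The pairing equals [lam] times the quantity [Q] to be bounded, while the weighted norm of the
    test function is at most [lam ^+ 2] times [Q]. The cut makes [Q] finite, and with [lam] = 1 / (2
    Cdual) the term in [Q] produced by the bilinear estimate is absorbed. *)
Lemma gk_weighted_box : (\int[leb \x Leb]_z (p z * indT T z)%:E <= ((2 * Cdual) ^+ 2)%:E * W)%E.
Proof.
rewrite -/q -Q_prod; have c'0 := Cdual_gt0; pose lam := (2 * Cdual)^-1.
have l0 : 0 < lam by rewrite invr_gt0 mulr_gt0.
have [M M0 hM] := gk_bound m ca mf k.
pose w (z : R * Rn) : R := lam * (japanese z.2 `^ (- (2 * s)) * indT T z).
have mw : measT w.
  apply: mfunM => //; apply: mfunM; last exact: meas_indT.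
  exact: (mcomp (meas_japanese _) msnd).
have w0 z : 0 <= w z.
  have /andP[h1 _] := indT_in T z; apply: mulr_ge0; [exact: ltW|]; apply: mulr_ge0 => //; exact: powR_ge0.
have wl z : w z <= lam.
  have /andP[h1 h2] := indT_in T z; rewrite -[leRHS]mulr1; apply: ler_wpM2l; first exact: ltW.
  by apply: mulr_ile1 => //; exact: powR_ge0.
pose h z : R[i] := (w z)%:C * g z.
have nh : nice (lam * M) T h.
  split; first by apply: cmeasM => //; exact: cmeas_real.
    move=> z; rewrite Normc.normcM normc_real ger0_norm//; apply: ler_pM => //; exact: nc_ge0.
  by move=> z hz; rewrite /h /w indT0// mulr0 mulr0 mul0r.
have mh : cmeas h by case: nh.
have jE (x : Rn) : japanese x `^ (2 * s) * japanese x `^ (- (2 * s)) = 1.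
  exact: jp_mulN.
have Wh : (wL2 s h <= (lam ^+ 2)%:E * Q)%E.
  rewrite Q_prod /wL2 -weight_prod// -(ge0_intZl (leb \x Leb)%E (sqr_ge0 lam) mq q0); apply: ge0_le_int.
  - apply: mfunM; last exact: msqn.
    exact: (mcomp (meas_japanese _) msnd).
  - exact: mfunM.
  - by move=> z; rewrite mulr_ge0 ?powR_ge0 ?sqn_ge0.
  move=> z; rewrite /h sqnM sqn_real /w /q /p.
  set J := japanese z.2 `^ (- (2 * s)); set I := indT T z.
  have /andP[i0 i1] : 0 <= I <= 1 by exact: indT_in.
  have -> : japanese z.2 `^ (2 * s) * ((lam * (J * I)) ^+ 2 * sqn (g z)) =
    (japanese z.2 `^ (2 * s) * J) * (lam ^+ 2 * (J * sqn (g z) * (I * I))) by ring.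
  rewrite jE mul1r; apply: ler_wpM2l; first exact: sqr_ge0.
  apply: ler_wpM2l; first by rewrite mulr_ge0 ?powR_ge0 ?sqn_ge0.
  by rewrite ler_piMl.
have mqt t : measT (fun x => q (t, x)) by exact: (mcomp mq (mpair1 t)).
have lq t : (lam%:E * \int[Leb]_x (q (t, x))%:E =
    (normc (cint Leb (fun x => g (t, x) * conjc (h (t, x)))))%:E)%E.
  have e : (fun x => g (t, x) * conjc (h (t, x))) = (fun x => (lam * q (t, x))%:C).
    apply/funext => x; rewrite /h conjcM mulrCA mulc_conj (_ : conjc (w (t, x))%:C = (w (t, x))%:C); last by rewrite /= oppr0.
    by rewrite -creM; congr (_%:C); rewrite /w /q /p /=; ring.
  have [Mq nq] := qnice; have [iq _] := cintgZl (lam%:C) (nice_integrable nq t).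
  have iq2 : Leb.-integrable setT (EFin \o (fun x => lam * q (t, x))).
    by move: iq; congr (integrable _ _ _); apply/funext => x /=; rewrite !mul0r subr0.
  have l0' := ltW l0.
  rewrite e cint_real normc_real ger0_norm; last by apply: Rintegral_ge0 => x _; exact: mulr_ge0.
  by rewrite -RintE// ge0_intZl.
have mL : measT (fun t => \int[Leb]_x (q (t, x))%:E)%E.
  exact: (@mintp _ _ _ _ _ Leb (fun t x => (q (t, x))%:E) mqE (fun t x => q0 (t, x))).
have nf := ftr_nice mf k; have [mftr _ _] := nf.
have N1 : 1 <= k%:R + 1 :> R by rewrite lerDr.
have ma := cont_mrV ca.
have mP : cmeas (fun p : R * R => pairing m a (k%:R + 1) (ftr f k) h p.1 p.2).
  apply: (@cmeas_cint _ _ _ _ _ Leb (fun y : (R * R) * Rn => expi ((y.1.1 - y.1.2) * a y.2) * pft (ftr f k) (y.1.2, y.2) *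
    conjc (pft h (y.1.1, y.2)) * (jp (m - 1) y.2 * kapN (k%:R + 1) y.2)%:C)).
  have m1 : measT (fun y : (R * R) * Rn => y.1.1) by exact: (mcomp mfst mfst).
  have m2 : measT (fun y : (R * R) * Rn => y.1.2) by exact: (mcomp msnd mfst).
  apply: cmeasM; last first.
    apply: cmeas_real; apply: mfunM; first exact: (mcomp (meas_japanese _) msnd).
    exact: (mcomp (meas_kapN _) msnd).
  apply: cmeasM; last by apply: cmeas_conj; exact (cmeas_comp (cmeas_pft nh) (mpair m1 msnd)).
  apply: cmeasM; last exact (cmeas_comp (cmeas_pft nf) (mpair m2 msnd)).
  by apply: cmeas_expi; apply: mfunM; [exact: mfunB|exact: (mcomp ma msnd)].
have mPI := @mintp _ _ _ _ _ leb (fun t tau => (normc (pairing m a (k%:R + 1) (ftr f k) h t tau))%:E)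
  ((mEFin _ _).2 (mnormc mP)) (fun t tau => nc_ge0 _).
have PI0 t : (0 <= \int[leb]_tau (normc (pairing m a (k%:R + 1) (ftr f k) h t tau))%:E)%E.
  by apply: int_ge0 => tau; rewrite lee_fin nc_ge0.
have ci : 0 <= c2^-1 by rewrite invr_ge0 ltW.
have qI0 t : (0 <= \int[Leb]_x (q (t, x))%:E)%E by apply: int_ge0 => x; rewrite lee_fin.
have key : (lam%:E * Q <= Cdual%:E * (W + (lam ^+ 2)%:E * Q))%E.
  rewrite /Q -(ge0_intZlE leb (ltW l0) mL qI0).
  apply: (@le_trans _ _ (\int[leb]_t ((c2^-1)%:E * \int[leb]_tau (normc (pairing m a (k%:R + 1) (ftr f k) h t tau))%:E))%E).
    apply: ge0_le_intE.
    - exact: mfuneM.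
    - exact: mfuneM.
    - by move=> t; rewrite lq lee_fin nc_ge0.
    by move=> t; rewrite lq; exact: gk_pairing nh.
  rewrite (ge0_intZlE leb ci mPI PI0) -/Q.
  apply: (@le_trans _ _ ((c2^-1)%:E * (C%:E * (wL2 s (ftr f k) + wL2 s h)))%E).
    by apply: lee_wpmul2l; [rewrite lee_fin|exact: hC N1 _ _ _ _ _ _ nf nh].
  rewrite muleA -EFinM; apply: (@le_trans _ _ ((c2^-1 * C)%:E * (W + (lam ^+ 2)%:E * Q))%E).
    apply: lee_wpmul2l; first by rewrite lee_fin mulr_ge0.
    by apply: leeD; [exact: ftr_wL2|exact: Wh].
  apply: lee_wpmul2r; last by rewrite lee_fin /Cdual lerDl.
  apply: (adde_ge0 W0); apply: mule_ge0 Q0; rewrite lee_fin; exact: sqr_ge0.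
exact: (absorb_scaled c'0 Q0 Q_lty W0 Wf key).
Qed.

End box.

(** Fatou's lemma as the box grows, the bound being the same for every box. *)
Lemma gk_weighted : (\int[leb \x Leb]_z (p z)%:E <= ((2 * Cdual) ^+ 2)%:E * W)%E.
Proof.
apply: (@fatou_le R _ _ (leb \x Leb)%E (fun i z => (p z * indT (i%:R + 1) z)%:E)).
- by move=> i; apply/mEFin; apply: mfunM => //; exact: meas_indT.
- by move=> i z; have /andP[h1 _] := indT_in (i%:R + 1) z; rewrite lee_fin mulr_ge0.
- move=> z; have [K hK] := indT_lim z; apply: cvg_near_cst; exists K => // i /= Ki.
  by rewrite hK// mulr1.
by move=> i; exact: gk_weighted_box.
Qed.

End weighted_bound.

(** * The norm of the statement and the final estimate *)

Section L2norm.
Context {R : realType} d (T : measurableType d) (mu : {measure set T -> \bar R}).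

Lemma L2normE (F : T -> R[i]) : L2norm mu F = ((\int[mu]_x (sqn (F x))%:E) `^ 2^-1)%E.
Proof.
rewrite /L2norm unlock; congr (_ `^ _)%E; apply: eqint => x _.
by rewrite /= ger0_norm ?nc_ge0// -normc_sqrE powR_mulrn ?nc_ge0.
Qed.

Lemma L2norm_lty (F : T -> R[i]) : (L2norm mu F < +oo)%E <-> (\int[mu]_x (sqn (F x))%:E < +oo)%E.
Proof.
have I0 : (0 <= \int[mu]_x (sqn (F x))%:E)%E by apply: int_ge0 => x; rewrite lee_fin sqn_ge0.
rewrite L2normE; move: I0; case: (\int[mu]_x _)%E => [r| |]//= _.
  by rewrite !ltry.
by rewrite invr_eq0 pnatr_eq0.
Qed.

Lemma L2norm_le (F G : T -> R[i]) (c : R) : 0 <= c ->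
  (\int[mu]_x (sqn (F x))%:E <= (c ^+ 2)%:E * \int[mu]_x (sqn (G x))%:E)%E ->
  (L2norm mu F <= c%:E * L2norm mu G)%E.
Proof.
move=> c0 h.
have I0 (H : T -> R[i]) : (0 <= \int[mu]_x (sqn (H x))%:E)%E by apply: int_ge0 => x; rewrite lee_fin sqn_ge0.
rewrite !L2normE (_ : c%:E = ((c ^+ 2)%:E `^ 2^-1)%E); last first.
  by rewrite poweR_EFin -[c ^+ 2]powR_mulrn// -powRrM mulfV// powRr1.
have c20 : (0 <= (c ^+ 2)%:E)%E by rewrite lee_fin sqr_ge0.
rewrite -poweRM//; apply: gt0_ler_poweR => //.
- by rewrite in_itv /= I0 leey.
- by rewrite in_itv /= mule_ge0// leey.
Qed.

End L2norm.

Theorem theorem5p2 (R : realType) (n : nat) (m s : R)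
  (hn : (1 <= n)%N) (hm : 0 < m) (hs : 2^-1 < s)
  (a am : 'rV[R]_n -> R)
  (a_smooth : smooth_on setT a)
  (am_smooth : smooth_on [set xi : 'rV[R]_n | xi != 0] am)
  (am_homog : forall (lam : R) (xi : 'rV[R]_n), 0 < lam -> xi != 0 ->
     am (lam *: xi) = lam `^ m * am xi)
  (a_grad : forall xi : 'rV[R]_n, gradient a xi != 0)
  (am_grad : forall xi : 'rV[R]_n, xi != 0 -> gradient am xi != 0)
  (a_am : forall al : @multi_index n, exists Cal : R,
     forall xi : 'rV[R]_n, 1 <= enorm xi ->
       `|mi_deriv al (fun eta => a eta - am eta) xi|
         <= Cal * enorm xi `^ (m - 1 - (mi_size al)%:R)) :
  exists C : R, 0 < C /\
    forall f : R * 'rV[R]_n -> R[i],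
      in_L2 spacetime_measure (weight s f) ->
      exists g : R * 'rV[R]_n -> R[i],
        [/\ {ae lebesgue_measure, forall t : R,
              dist_eq (bessel (m - 1) (duhamel a f t))
                (dist_of_fun (fun x => g (t, x)))},
            in_L2 spacetime_measure (weight (- s) g) &
            (L2norm spacetime_measure (weight (- s) g)
              <= C%:E * L2norm spacetime_measure (weight s f))%E].
Proof.
case: n hn a am a_smooth am_smooth am_homog a_grad am_grad a_am => [//|n] _ a am a_smooth am_smooth am_homog a_grad am_grad a_am.
have [C C0 hC] := pairing_bound hs a_smooth am_smooth am_homog a_grad am_grad a_am.
have ca := symbol_continuous a_smooth.
have c'0 := Cdual_gt0 n C0; set c' := Cdual n C in c'0.
(* The approximants satisfy the squared bound with constant (2 c')^2, the weak limit with twice that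
   constant, and 8 <= 3^2. *)
exists (3 * c'); split; first exact: mulr_gt0.
move=> f [mf1 mf2 lf].
have mj (r : R) : measT (fun z : R * 'rV[R]_n.+1 => japanese z.2 `^ r).
  exact: (mcomp (meas_japanese _) msnd).
have jV (x : 'rV[R]_n.+1) (r : R) : japanese x `^ (- r) * japanese x `^ r = 1.
  by rewrite mulrC jp_mulN.
have mf : cmeas f.
  have -> : f = fun z => (japanese z.2 `^ (- s))%:C%C * weight s f z.
    by apply/funext => z; rewrite /weight mulrA -creM jV mul1r.
  by apply: cmeasM; [apply: cmeas_real; exact: mj|split].
have wE (r : R) (F : R * 'rV[R]_n.+1 -> R[i]) z : sqn (weight r F z) = japanese z.2 `^ (2 * r) * sqn (F z).
  by rewrite /weight sqnM sqn_real mulrC [2 * r]mulrC powRrM powR_mulrn ?powR_ge0// mulrC.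
have fW : (\int[spacetime_measure]_z (sqn (weight s f z))%:E = wL2 s f)%E.
  by rewrite /wL2 -weight_prod//; apply: eqint => z _; rewrite wE.
have Wf : (wL2 s f < +oo)%E by rewrite -fW; apply/L2norm_lty.
have W0 : (0 <= wL2 s f)%E by rewrite -fW; apply: int_ge0 => z; rewrite lee_fin sqn_ge0.
have We : wL2 s f = (fine (wL2 s f))%:E by rewrite fineK// ge0_fin_numE.
set W := fine (wL2 s f) in We; have Wr0 : 0 <= W by exact: fine_ge0.
(* The weights are distributed so that the limit is taken in unweighted L2: <x>^(-s) is attached to
   the approximants and <x>^s to the test functions, leaving the pairings unchanged. *)
pose V_ k := weight (- s) (gk m a f k).
pose Phi (psi : 'rV[R]_n.+1 -> R[i]) := exists2 phi, rapidc phi & psi = fun x => (japanese x `^ s)%:C%C * phi x.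
pose L t (psi : 'rV[R]_n.+1 -> R[i]) := bessel (m - 1) (duhamel a f t) (fun x => (japanese x `^ (- s))%:C%C * psi x).
have PhiK (phi : 'rV[R]_n.+1 -> R[i]) : (fun x => (japanese x `^ (- s))%:C%C * ((japanese x `^ s)%:C%C * phi x)) = phi.
  by apply/funext => x; rewrite mulrA -creM jV mul1r.
have mV k : cmeas (V_ k) by apply: cmeasM; [apply: cmeas_real; exact: mj|exact: cmeas_gk].
have BV k : (\int[lebesgue_measure \x lebesgue_rV n.+1]_z (sqn (V_ k z))%:E <= ((2 * c') ^+ 2 * W)%:E)%E.
  rewrite EFinM -We; apply: le_trans (gk_weighted hs ca mf Wf C0 hC k).
  by apply: eq_leE; apply: eqint => z _; rewrite wE mulrN.
have sV k t : (\int[lebesgue_rV n.+1]_x (sqn (V_ k (t, x)))%:E < +oo)%E.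
  apply: le_lt_trans (gk_slice_L2 m k t ca mf); apply: ge0_le_int.
  - exact: msqn (cmeas_comp (mV k) (mpair1 t)).
  - exact: msqn (cmeas_comp (cmeas_gk m ca mf k) (mpair1 t)).
  - by move=> x; exact: sqn_ge0.
  move=> x; rewrite wE ler_piMl ?sqn_ge0//= -[leRHS](powRr0 (japanese x)).
  apply: ler_powR; [exact: japanese_ge1|lra].
have hPhi psi : Phi psi -> cmeas psi /\ (\int[lebesgue_rV n.+1]_x (sqn (psi x))%:E < +oo)%E.
  move=> [phi hp ->]; split.
    by apply: cmeasM; [apply: cmeas_real; exact: meas_japanese|exact: cintg_meas (rapidc_integrable hp)].
  apply: le_lt_trans (rapidc_weight_sqr (2 * s) hp); apply: eq_leE; apply: eqint => x _.
  by rewrite -(wE s (fun z => phi z.2) (0, x)).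
have cV t psi : Phi psi -> forall eps : R, 0 < eps ->
    exists K, forall k, (K <= k)%N -> normc (slice_pair (V_ k) t psi - L t psi) <= eps.
  move=> [phi hp ->] eps e0; have [K hK] := gk_test_cvg m hs ca mf Wf t hp e0; exists K => k Kk.
  rewrite /L PhiK (_ : slice_pair _ _ _ = cint (lebesgue_rV n.+1) (fun x => gk m a f k (t, x) * phi x)); first exact: hK.
  apply: eq_cint => x; rewrite /V_ /weight /= mulrACA -creM jV mul1r //.
have [G [mG GB Gae]] := weak_limit mV BV sV hPhi cV.
pose g (z : R * 'rV[R]_n.+1) := (japanese z.2 `^ s)%:C%C * G z.
have gG : weight (- s) g = G by apply/funext => z; rewrite /weight mulrA -creM jV mul1r.
have GL : (\int[spacetime_measure]_z (sqn (G z))%:E <= ((3 * c') ^+ 2)%:E * \int[spacetime_measure]_z (sqn (weight s f z))%:E)%E.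
  rewrite fW We; apply: le_trans GB _; rewrite -EFinM lee_fin mulrA; apply: ler_wpM2r => //.
  by rewrite !exprMn; have := sqr_ge0 c'; nra.
exists g; rewrite gG; split.
- apply: (ae_mono Gae) => t hG phi [h1 h2].
  have hp : rapidc phi by split; exact: rschwartz_rapid.
  have := hG (fun x => (japanese x `^ s)%:C%C * phi x) (ex_intro2 _ _ phi hp erefl).
  rewrite /L PhiK => <-; apply: eq_cint => x; rewrite /g /=; ring.
- have [G1 G2] := mG; split => //; apply/L2norm_lty; apply: le_lt_trans GL _.
  by rewrite fW We -EFinM ltry.
by apply: L2norm_le => //; apply: mulr_ge0 => //; exact: ltW.
Qed.
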